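(* Suppose the running cost $f$ is strictly convex (case (I) of the context) and $0<\sigma_1\le\sigma_2$. Let $\theta(y)=c-f'(y)/\rho$ for $y\in[0,1]$, $u(x,i;y)=\sup_{\tau\ge0}\mathbb{E}_{(x,i)}[e^{-\rho\tau}(X_\tau-\theta(y))]$, and $$F(x,y,i):=\int_0^yu(x,i;z)\,dz-\frac{f(y)}{\rho}.$$ Then $F(\cdot,\cdot,i)\in C^{2,1}(\mathbb{R}\times[0,1])$ for $i=1,2$. Moreover, for $i=1,2$ there exist constants $C_i>0$ and $\kappa_i>0$ such that $$|F(x,y,i)|+|F_y(x,y,i)|\le C_i(1+|x|),\qquad |F_x(x,y,i)|+|F_{xx}(x,y,i)|\le\kappa_i,$$ for all $(x,y)\in\mathbb{R}\times[0,1]$.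
   Context: Let $(\Omega,\mathcal{F},\mathbb{P})$ be a complete probability space carrying a one-dimensional Brownian motion $W$ and an independent continuous-time Markov chain $\varepsilon$ with state space $\{1,2\}$ and generator $\begin{pmatrix}-\lambda_1&\lambda_1\\ \lambda_2&-\lambda_2\end{pmatrix}$, $\lambda_1,\lambda_2>0$; $\mathbb{F}$ is the augmented filtration generated by $(W,\varepsilon)$. $dX_t=\sigma_{\varepsilon_t}dW_t$, $X_0=x$, with $\sigma_1,\sigma_2>0$; $\mathbb{E}_{(x,i)}$ is expectation given $X_0=x,\varepsilon_0=i$. Constants $\rho,c>0$. The supremum defining $u$ is over all $\mathbb{P}_{(x,i)}$-a.s. finite $\mathbb{F}$-stopping times. Case (I): $f:\mathbb{R}\to\mathbb{R}_+$ is increasing, $f(0)=0$, and $f$ is strictly convex and continuously differentiable on $[0,1]$. $C^{2,1}(\mathbb{R}\times[0,1])$: functions $F(x,y)$ with $F,F_x,F_{xx},F_y$ continuous on $\mathbb{R}\times[0,1]$ (one-sided $y$-derivatives at $y=0,1$). *)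

(* Defs.v *)
From HB Require Import structures.
From mathcomp Require Import all_boot all_order all_algebra.
From mathcomp Require Import all_classical all_reals all_analysis.

Set Implicit Arguments.
Unset Strict Implicit.
Unset Printing Implicit Defensive.

Import Order.TTheory GRing.Theory Num.Theory.
Import numFieldNormedType.Exports.

Local Open Scope classical_set_scope.
Local Open Scope ring_scope.

Section regularity.
Context {R : realType}.
Implicit Types (D : set R) (f : R -> R) (F : R -> R -> R).

(* Derivative relative to D: only points of D enter the difference quotient,
   so that it is one-sided at the end points when D is an interval. *)
Definition quot_within D f (y : R) : set_system R :=
  (f z - f y) / (z - y) @[z --> within D y^'].

Definition derivable_within D f (y : R) := cvg (quot_within D f y).

Definition derive_within D f (y : R) : R := lim (quot_within D f y).

Definition C1_on D f :=
  (forall y, D y -> derivable_within D f y) /\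
  {within D, continuous (derive_within D f)}.

Definition strictly_convex_on D f := forall a b t : R,
  D a -> D b -> a != b -> 0 < t < 1 ->
  f (t * a + (1 - t) * b) < t * f a + (1 - t) * f b.

(* "Increasing" is nondecreasing: with f >= 0 and f 0 = 0 the function f
   vanishes on the negative half-line. *)
Definition case_I f :=
  [/\ forall y, 0 <= f y,
      {homo f : y z / y <= z},
      f 0 = 0,
      strictly_convex_on `[0, 1] f
    & C1_on `[0, 1] f].

Definition dx F (x y : R) : R := derive1 (fun z => F z y) x.
Definition dxx F (x y : R) : R := dx (dx F) x y.
Definition dy F (x y : R) : R := derive_within `[0, 1] (F x) y.

Definition strip : set (R * R) := [set p | p.2 \in `[0, 1]].

Definition continuous_on_strip F :=
  {within strip, continuous (fun p : R * R => F p.1 p.2)}.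

Definition C21 F :=
  (forall x y, y \in `[0, 1] ->
     [/\ derivable (fun x' => F x' y) x 1,
         derivable (fun x' => dx F x' y) x 1
       & derivable_within `[0, 1] (F x) y]) /\
  [/\ continuous_on_strip F,
      continuous_on_strip (dx F),
      continuous_on_strip (dxx F)
    & continuous_on_strip (dy F)].

End regularity.

(* Processes R -> T -> S are indexed by [0, +oo[: their values at negative
   times are irrelevant. *)

Section processes.
Context {d : measure_display} {T : measurableType d} {R : realType}.
Variable P : probability T R.
Implicit Types (F : R -> set (set T)).

Definition events_of d' (S : measurableType d') (Z : R -> T -> S) (A : set R) :
    set (set T) :=
  [set E | exists s B, [/\ A s, measurable B & E = Z s @^-1` B]].

Definition sigma_of d' (S : measurableType d') (Z : R -> T -> S) (A : set R) :
    set (set T) :=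
  <<s events_of Z A >>.

Definition indep (G H : set (set T)) := forall A B, G A -> H B ->
  P (A `&` B) = (P A * P B)%E.

Definition measurable_wrt d' (S : measurableType d') (G : set (set T))
    (Y : T -> S) :=
  forall B, measurable B -> G (Y @^-1` B).

Definition brownian_motion (W : R -> T -> R) :=
  [/\ forall t, 0 <= t -> measurable_fun setT (W t),
      {ae P, forall w, W 0 w = 0},
      forall w, {within `[0, +oo[, continuous (fun t => W t w)},
      forall s t, 0 <= s -> s < t -> forall B, measurable B ->
        P ((W t \- W s) @^-1` B) = normal_prob 0 (Num.sqrt (t - s)) B
    & forall s t, 0 <= s -> s < t ->
        indep (sigma_of W `[0, s])
          (preimage_set_system setT (W t \- W s) measurable)].

(* Entrywise exponential series; expmx (t *: Q) is the transition matrix at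
   time t of the chain with generator Q. *)
Definition expmx m (A : 'M[R]_m.+1) : 'M[R]_m.+1 :=
  \matrix_(i, j) limn (series (fun k => (A ^+ k) i j / k`!%:R)).

Definition cadlag_chain m (e : R -> T -> 'I_m.+1) :=
  forall w t, 0 <= t ->
    (\forall s \near t^'+, e s w = e t w) /\
    (0 < t -> exists j, \forall s \near t^'-, e s w = j).

(* The initial distribution is arbitrary. *)
Definition markov_chain m (Q : 'M[R]_m.+1) (e : R -> T -> 'I_m.+1) :=
  [/\ forall t j, 0 <= t -> measurable [set w | e t w = j],
      cadlag_chain e
    & forall n (t : nat -> R) (j : nat -> 'I_m.+1),
        t 0%N = 0 -> (forall k, t k <= t k.+1) ->
        P [set w | forall k, (k <= n)%N -> e (t k) w = j k] =
        (P [set w | e 0%R w = j 0%N] *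
         (\prod_(k < n)
            expmx ((t k.+1 - t k) *: Q) (j k) (j k.+1))%:E)%E].

(* Stands for \sum_(k < n) xi_k 1_(t_k, t_(k+1)]. *)

Record simple_process := SimpleProcess {
  sp_size : nat;
  sp_time : nat -> R;
  sp_val : nat -> T -> R }.

Definition simple_adapted F (S : simple_process) :=
  0 <= sp_time S 0%N /\
  forall k, (k < sp_size S)%N ->
    [/\ sp_time S k <= sp_time S k.+1,
        measurable_wrt (F (sp_time S k)) (sp_val S k)
      & exists M : R, forall w, `|sp_val S k w| <= M].

Definition simple_fun (S : simple_process) (s : R) (w : T) : R :=
  \sum_(k < sp_size S)
    sp_val S k w * \1_(`]sp_time S k, sp_time S k.+1]) s.

Definition simple_integral (W : R -> T -> R) (S : simple_process)
    (t : R) (w : T) : R :=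
  \sum_(k < sp_size S) sp_val S k w *
    (W (Num.min (sp_time S k.+1) t) w - W (Num.min (sp_time S k) t) w).

(* I_t = \int_0^t H_s dW_s a.s. for every t, as an L^2 limit of integrals of
   simple processes approximating H in L^2(P x ds). *)
Definition is_ito_integral F (W H I : R -> T -> R) :=
  forall t, 0 <= t ->
    measurable_wrt (F t) (I t) /\
    exists S : nat -> simple_process,
    [/\ forall n, simple_adapted F (S n),
        (\int[P]_w \int[lebesgue_measure]_(s in `[0%R, t])
           ((simple_fun (S n) s w - H s w) ^+ 2)%:E)%E @[n --> \oo] --> 0%E
      & (\int[P]_w ((simple_integral W (S n) t w - I t w) ^+ 2)%:E)%E
          @[n --> \oo] --> 0%E].

Definition stopping_time F (tau : T -> \bar R) :=
  (forall w, (0 <= tau w)%E) /\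
  forall t, 0 <= t -> F t [set w | (tau w <= t%:E)%E].

(* P(. | A)-almost surely finite, for P A > 0 *)
Definition as_finite_given (A : set T) (tau : T -> \bar R) :=
  {ae P, forall w, A w -> (tau w < +oo)%E}.

(* E[Z | A] = E[Z 1_A] / P(A), for P A > 0 *)
Definition expect_given (A : set T) (Z : T -> R) : \bar R :=
  ((fine (P A))^-1%:E * \int[P]_(w in A) (Z w)%:E)%E.

End processes.

Definition by_regime (R : Type) (a1 a2 : R) (i : 'I_2) : R :=
  if i == ord0 then a1 else a2.

Section model.
Context {d : measure_display} {T : measurableType d} {R : realType}.
Variable P : probability T R.

Definition generator (lambda1 lambda2 : R) : 'M[R]_2 :=
  \matrix_(i, j) ((-1) ^+ (i == j) * by_regime lambda1 lambda2 i).

Definition augmented_filtration (W : R -> T -> R) (eps : R -> T -> 'I_2) (t : R) :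
    set (set T) :=
  <<s [set E | exists s B, [/\ 0 <= s <= t, measurable B & E = W s @^-1` B]]
      `|` [set E | exists s j, 0 <= s <= t /\ E = [set w | eps s w = j]]
      `|` [set E | P.-negligible E] >>.

(* X x is the solution of dX_t = sigma_(eps_t) dW_t, X_0 = x.  Regime 1 is
   ord0 and regime 2 is the other element of 'I_2. *)
Definition regime_model (lambda1 lambda2 sigma1 sigma2 : R)
    (W : R -> T -> R) (eps : R -> T -> 'I_2) (X : R -> R -> T -> R) :=
  [/\ measure_is_complete P,
      brownian_motion P W,
      markov_chain P (generator lambda1 lambda2) eps,
      indep P (sigma_of W `[0, +oo[)
        <<s [set E | exists s j, 0 <= s /\ E = [set w | eps s w = j]] >>
    & forall x,
        [/\ forall w, X x 0 w = x,
            forall w, {within `[0, +oo[, continuous (fun t => X x t w)}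
          & is_ito_integral P (augmented_filtration W eps) W
              (fun t w => by_regime sigma1 sigma2 (eps t w))
              (fun t w => X x t w - x)]].

Definition theta (rho c : R) (f : R -> R) (y : R) : R :=
  c - derive_within `[0, 1] f y / rho.

Definition value (rho c : R) (f : R -> R) (W : R -> T -> R)
    (eps : R -> T -> 'I_2) (X : R -> R -> T -> R) (x : R) (i : 'I_2) (y : R) :
    \bar R :=
  let start := [set w | eps 0 w = i] in
  ereal_sup [set expect_given P start
               (fun w => expR (- (rho * fine (tau w))) *
                         (X x (fine (tau w)) w - theta rho c f y))
            | tau in [set tau | stopping_time (augmented_filtration W eps) tau /\
                                as_finite_given P start tau]].

(* The value u is a supremum of extended-real expectations, so that bigF is a
   priori an extended real. *)
Definition bigF (rho c : R) (f : R -> R) (W : R -> T -> R)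
    (eps : R -> T -> 'I_2) (X : R -> R -> T -> R) (x y : R) (i : 'I_2) :
    \bar R :=
  (\int[lebesgue_measure]_(z in `[0%R, y]) value rho c f W eps X x i z
   - (f y / rho)%:E)%E.

End model.

(* Main.v *)
(* Up to the shift by theta(y), u(., i; y) is the value U_i of the stopping
   problem with payoff e^(-rho t) X_t: u(x, i; y) = U_i(x - theta(y)).  The pair
   (U_1, U_2) is built analytically: for a fixed continuation value of the other
   regime the obstacle problem is solved by exponential averages, and Tarski's
   fixed point theorem couples the two regimes.  It gives U_i in C^1 with U_i'
   Lipschitz, U_i = id beyond a threshold a_i and U_i in C^2 below it.
   Verification takes place on a time grid: over a step h, the conditional
   expectation of e^(-rho h) U at the end exceeds U at the start by at most
   O(h^(3/2)), and falls short of it by at most O(h^(3/2)) below the threshold,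
   so that the errors vanish in the limit over the whole grid.
   Finally theta is injective on [0,1] because f is strictly convex, so that for
   each x at most one z has x - theta(z) = a_i: the jump of U_i'' at a_i is lost
   in the integral over z, which is why F is C^2 in x. *)

Require Import Defs.
From HB Require Import structures.
From mathcomp Require Import all_boot all_order all_algebra.
From mathcomp Require Import all_classical all_reals all_analysis.
From mathcomp Require Import measurable_realfun ring lra.

Import Order.TTheory GRing.Theory Num.Theory.
Import numFieldNormedType.Exports.

Local Open Scope classical_set_scope.
Local Open Scope ring_scope.

Set Implicit Arguments.
Unset Strict Implicit.
Unset Printing Implicit Defensive.

(** * Exponential averages and the coupled obstacle problems *)

(** The obstacle is that U_i'' jumps at a_i and that the stochastic integral is given only through
    L^2 limits, so U_i(X_t) is expanded by hand. Over a step from s to t = s + h the state moves by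
    sigma_(eps_s) (W_t - W_s) + D, where D, caused by changes of regime inside the step, has mean
    zero against the past and E D^2 = O(h^2), while the regime changes with probability lambda_i h +
    O(h^2). A second order expansion of U_i leaves errors of mean O(h^(3/2)). With h = 1/m^2 a
    horizon N has N m^2 steps, hence a total error of order N/m. The expansion is one-sided. Off a_i
    one has U_i'' <= 2/sigma_i^2 ((rho + lambda_i) U_i - lambda_i U_j), which gives the upper bound
    everywhere. The reverse estimate is available only at a distance delta below a_i; the candidate
    rule therefore stops within delta of a_i, at a loss of at most delta. For a general stopping
    time integrability questions are avoided: the upper bound is proved for the positive part of the
    payoff, which is possible since U_i >= max(z, 0), and passes to the limit by Fatou's lemma. *)

Section averaging.
Context {R : realType}.
Implicit Types (b x y z : R) (phi psi : R -> R).
Notation mu := (@lebesgue_measure R).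

(** The class is stable under exponential averages, maxima, scaling by a factor in ]0, 1[ and infima
    of nonnegative members, as the fixed point argument requires; its linear growth makes the
    averages finite. *)
Definition slope01 phi := forall x y, x <= y -> 0 <= phi y - phi x <= y - x.

Lemma slope01_dist phi x y : slope01 phi -> `|phi x - phi y| <= `|x - y|.
Proof.
move=> h; wlog xy : x y / x <= y => [hw|].
  by case: (leP x y) => [/hw //|/ltW /hw]; rewrite distrC (distrC y).
have /andP[h1 h2] := h _ _ xy.
by rewrite distrC (ger0_norm h1) (distrC x) ger0_norm ?subr_ge0.
Qed.

Lemma dist_le_continuous (K : R) phi :
  (forall x y, `|phi x - phi y| <= K * `|x - y|) -> continuous phi.
Proof.
move=> h x; apply/cvgrPdist_lt => e e0.
have K1 : 0 < `|K| + 1 by rewrite ltr_wpDl.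
near=> y; rewrite (le_lt_trans (h _ _))//.
rewrite (@le_lt_trans _ _ ((`|K| + 1) * `|x - y|))//.
  by rewrite ler_wpM2r// (le_trans (ler_norm K))// lerDl.
rewrite -ltr_pdivlMl// mulrC; near: y.
by apply: cvgr_dist_lt => //; rewrite divr_gt0.
Unshelve. all: by end_near. Qed.

Lemma slope01_continuous phi : slope01 phi -> continuous phi.
Proof.
by move=> h; apply: (@dist_le_continuous 1) => x y; rewrite mul1r slope01_dist.
Qed.

Lemma is_derive_slope01 phi dphi :
  (forall x, is_derive x 1 phi (dphi x)) -> (forall x, 0 <= dphi x <= 1) ->
  slope01 phi.
Proof.
move=> hd hb x y; rewrite le_eqVlt => /predU1P[->|xy]; first by rewrite !subrr lexx.
have cf : {within `[x, y], continuous phi}.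
  by apply: derivable_within_continuous => z _; case: (hd z).
have [z _ ->] := @MVT R phi dphi x y xy (fun z _ => hd z) cf.
have /andP[h0 h1] := hb z.
by rewrite mulr_ge0 ?subr_ge0 ?(ltW xy)//= ler_piMl// subr_ge0 ltW.
Qed.

Lemma cvg_inv_pinfty : (fun x : R => x^-1) x @[x --> +oo] --> (0 : R).
Proof.
by apply/gtr0_cvgV0 => //; near=> x.
Unshelve. all: by end_near. Qed.

Lemma cvg_mulr_expRN : (fun x : R => x * expR (- x)) x @[x --> +oo] --> (0 : R).
Proof.
apply: (@squeeze_cvgr _ _ _ _ (cst 0) (fun x : R => 2 * x^-1)).
- near=> x; have x0 : 0 < x by [].
  rewrite mulr_ge0 ?expR_ge0 ?(ltW x0)//=.
  rewrite expRN ler_pdivrMr ?expR_gt0// mulrAC ler_pdivlMr// -expr2.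
  rewrite -ler_pdivrMl// mulrC.
  by have := expR_ge1Dxn 1 (ltW x0); rewrite (_ : 2`!%:R = 2 :> R)// => h; lra.
- exact: cvg_cst.
- rewrite -[X in _ --> X](mulr0 2); apply: cvgM; first exact: cvg_cst.
  exact: cvg_inv_pinfty.
Unshelve. all: by end_near. Qed.

Lemma cvg_expRNM b : 0 < b -> expR (- (b * x)) @[x --> +oo] --> (0 : R).
Proof.
move=> b0; apply: (@cvg_comp _ _ _ ( *%R b) (fun y => expR (- y)) _ +oo).
  by apply: gt0_cvgMry => //; exact: cvg_id.
exact: cvgr_expR.
Qed.

Lemma cvg_mulr_expRNM b : 0 < b -> x * expR (- (b * x)) @[x --> +oo] --> (0 : R).
Proof.
move=> b0.
have : b^-1 * ((b * x) * expR (- (b * x))) @[x --> +oo] --> b^-1 * (0 : R).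
  apply: cvgM; first exact: cvg_cst.
  apply: (@cvg_comp _ _ _ ( *%R b) (fun y => y * expR (- y)) _ +oo).
    by apply: gt0_cvgMry => //; exact: cvg_id.
  exact: cvg_mulr_expRN.
rewrite mulr0; apply: cvg_trans; apply: near_eq_cvg; near=> x => /=.
by rewrite !mulrA mulVf ?gt_eqF// mul1r.
Unshelve. all: by end_near. Qed.

Lemma is_derive_expRNM b x :
  is_derive x 1 (fun x => expR (- (b * x))) (- (b * expR (- (b * x)))).
Proof.
apply: is_derive_eq.
by rewrite !scaler1 mulrC mulNr.
Qed.

Lemma integral_expRN b z : 0 < b ->
  mu.-integrable `[z, +oo[ (EFin \o (fun s => expR (- (b * s)))) /\
  \int[mu]_(s in `[z, +oo[) expR (- (b * s)) = expR (- (b * z)) / b.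
Proof.
move=> b0.
have cf : continuous (fun s : R => expR (- (b * s))).
  move=> x; have [+ _] := is_derive_expRNM b x.
  by move/derivable1_diffP/differentiable_continuous.
have dF x : is_derive x 1 (fun x => - (expR (- (b * x)) / b)) (expR (- (b * x))).
  have h := is_derive_expRNM b x; apply: is_derive_eq.
  rewrite /GRing.scale/=; by field; rewrite gt_eqF.
have E : (\int[mu]_(s in `[z, +oo[) (expR (- (b * s)))%:E = (expR (- (b * z)) / b)%:E)%E.
  rewrite (@ge0_continuous_FTC2y _ _ (fun x => - (expR (- (b * x)) / b)) _ 0)//.
  - by rewrite -EFinB sub0r opprK.
  - by apply: continuous_subspaceT.
  - rewrite -oppr0 -[X in - X](mul0r b^-1); apply: cvgN; apply: cvgM; last exact: cvg_cst.
    exact: cvg_expRNM.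
  - apply: cvg_at_right_filter. have [+ _] := dF z.
    by move/derivable1_diffP/differentiable_continuous.
  - by move=> x _; rewrite derive1E; apply: derive_val.
split; last by rewrite /Rintegral E.
apply/integrableP; split.
  by apply/measurable_EFinP; apply: measurable_funTS; exact: continuous_measurable_fun.
under eq_integral do rewrite /= ger0_norm ?expR_ge0//.
by rewrite /= E ltry.
Qed.

Lemma integral_expRNM b z : 0 < b ->
  mu.-integrable `[z, +oo[ (EFin \o (fun s => expR (- (b * s)) * (s - z))) /\
  \int[mu]_(s in `[z, +oo[) (expR (- (b * s)) * (s - z)) = expR (- (b * z)) / b ^+ 2.
Proof.
move=> b0.
pose F x := - (expR (- (b * x)) / b) * (x - z) - expR (- (b * x)) / b ^+ 2.
have dF x : is_derive x 1 F (expR (- (b * x)) * (x - z)).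
  have h := is_derive_expRNM b x; apply: is_derive_eq.
  rewrite /GRing.scale/=. field; rewrite gt_eqF//.
have cf : continuous (fun s : R => expR (- (b * s)) * (s - z)).
  move=> x; apply: cvgM.
    have [+ _] := is_derive_expRNM b x.
    by move/derivable1_diffP/differentiable_continuous.
  by apply: cvgB; [exact: cvg_id|exact: cvg_cst].
have E : (\int[mu]_(s in `[z, +oo[) (expR (- (b * s)) * (s - z))%:E =
    (expR (- (b * z)) / b ^+ 2)%:E)%E.
  rewrite (@ge0_continuous_FTC2y _ _ F _ 0)//.
  - by rewrite -EFinB /F subrr mulr0 sub0r sub0r opprK.
  - by move=> x zx; rewrite mulr_ge0 ?expR_ge0// subr_ge0.
  - by apply: continuous_subspaceT.
  - rewrite (_ : F = fun x => (- b^-1) * (x * expR (- (b * x)))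
       + (z / b - (b ^+ 2)^-1) * expR (- (b * x))); last first.
      by apply/funext => x; rewrite /F; field; rewrite gt_eqF.
    rewrite [X in _ --> X](_ : 0 = - b^-1 * 0 + (z / b - (b ^+ 2)^-1) * 0); last by ring.
    apply: cvgD; (apply: cvgM; first exact: cvg_cst).
      exact: cvg_mulr_expRNM.
    exact: cvg_expRNM.
  - apply: cvg_at_right_filter. have [+ _] := dF z.
    by move/derivable1_diffP/differentiable_continuous.
  - by move=> x _; rewrite derive1E; apply: derive_val.
split; last by rewrite /Rintegral E.
apply/integrableP; split.
  by apply/measurable_EFinP; apply: measurable_funTS; exact: continuous_measurable_fun.
rewrite (@eq_integral _ _ _ mu _ (fun s => (expR (- (b * s)) * (s - z))%:E)) ?E ?ltry//.
move=> x; rewrite inE/= in_itv/= andbT => zx.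
by rewrite ger0_norm// mulr_ge0 ?expR_ge0// subr_ge0.
Qed.

Lemma cvg_is_derive phi dphi : is_derive (dphi.1 : R) 1 phi dphi.2 ->
  {for dphi.1, continuous phi}.
Proof. by case=> + _ => /derivable1_diffP/differentiable_continuous. Qed.

(** Expectation of phi(z + e) for an exponential variable e of rate b. It is a solution of v' = b (v
    - phi). *)
Definition avg b phi z : R :=
  b * expR (b * z) * \int[mu]_(s in `[z, +oo[) (expR (- (b * s)) * phi s).

Lemma continuous_avg_integrand b phi : slope01 phi ->
  continuous (fun s => expR (- (b * s)) * phi s).
Proof.
move=> hphi x; apply: cvgM; last exact: slope01_continuous.
exact: (@cvg_is_derive _ (x, _) (is_derive_expRNM b x)).
Qed.

Lemma integrable_avg b phi z : 0 < b -> slope01 phi ->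
  mu.-integrable `[z, +oo[ (EFin \o (fun s => expR (- (b * s)) * phi s)).
Proof.
move=> b0 hphi.
have [i1 _] := integral_expRN z b0.
have [i2 _] := integral_expRNM z b0.
have i3 : mu.-integrable `[z, +oo[ (fun s => `|phi z|%:E * (expR (- (b * s)))%:E +
   (expR (- (b * s)) * (s - z))%:E)%E.
  by apply: integrableD => //; apply: integrableZl.
apply: le_integrable i3 => //.
  apply/measurable_EFinP; apply: measurable_funTS.
  by apply: continuous_measurable_fun; exact: continuous_avg_integrand.
move=> s; rewrite /= in_itv/= andbT => zs.
rewrite lee_fin.
rewrite (_ : _ * _ + _ = expR (- (b * s)) * (`|phi z| + (s - z))); last by ring.
rewrite !normrM ler_wpM2l//.
rewrite [leRHS]ger0_norm; last by rewrite addr_ge0// subr_ge0.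
have /andP[h1 h2] := hphi _ _ zs.
rewrite -[X in `|X| <= _](subrKC (phi z)) (le_trans (ler_normD _ _))//.
by rewrite lerD2l ger0_norm.
Qed.

Lemma eq_avg b phi psi z : (forall s, z <= s -> phi s = psi s) ->
  avg b phi z = avg b psi z.
Proof.
move=> h; congr (_ * _); apply: eq_Rintegral => s.
by rewrite inE/= in_itv/= andbT => /h ->.
Qed.

Lemma le_avg b phi psi z : 0 < b -> slope01 phi -> slope01 psi ->
  (forall s, z <= s -> phi s <= psi s) -> avg b phi z <= avg b psi z.
Proof.
move=> b0 h1 h2 h; rewrite ler_wpM2l// ?mulr_ge0 ?expR_ge0 ?(ltW b0)//.
apply: le_Rintegral => //; try exact: integrable_avg.
by move=> s; rewrite /= in_itv/= andbT => /h; exact/ler_wpM2l/expR_ge0.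
Qed.

Lemma avg_cst b k z : 0 < b -> avg b (cst k) z = k.
Proof.
move=> b0; have [i1 E] := integral_expRN z b0.
rewrite /avg RintegralZr// E expRN.
by field; rewrite !gt_eqF ?expR_gt0.
Qed.

Lemma avg_affine b k z : 0 < b -> avg b (fun s => s + k) z = z + k + b^-1.
Proof.
move=> b0.
have [i1 E1] := integral_expRN z b0.
have [i2 E2] := integral_expRNM z b0.
rewrite /avg.
rewrite (@eq_Rintegral _ _ _ mu _
  (fun s => expR (- (b * s)) * (s - z) + expR (- (b * s)) * (z + k))); last first.
  by move=> s _; ring.
have i3 : mu.-integrable `[z, +oo[ (EFin \o (fun s => expR (- (b * s)) * (z + k))).
  by have := @integrableZr _ _ _ mu _ (measurable_itv `[z, +oo[) (z + k) _ i1.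
rewrite RintegralD//.
rewrite RintegralZr// E1 E2 expRN.
by field; rewrite !gt_eqF ?expR_gt0.
Qed.

Lemma slope01_cst k : slope01 (cst k).
Proof. by move=> x y xy; rewrite subrr lexx subr_ge0. Qed.

Lemma slope01_affine k : slope01 (fun s => s + k).
Proof. by move=> x y xy; rewrite opprD addrACA subrr addr0 lexx subr_ge0 xy. Qed.

(** To the right of z, phi lies between the constant phi(z) and the line phi(z) + s - z, and an
    exponential variable of rate b has mean 1/b. *)
Lemma avg_bounds b phi z : 0 < b -> slope01 phi ->
  0 <= avg b phi z - phi z <= b^-1.
Proof.
move=> b0 hphi; rewrite subr_ge0; apply/andP; split.
  rewrite -[leLHS](avg_cst (phi z) z b0); apply: le_avg => //.
    exact: slope01_cst.
  by move=> s /hphi/andP[]; rewrite subr_ge0.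
rewrite lerBlDl -[X in _ <= X + _](subrKC z (phi z)) -avg_affine//.
apply: le_avg => //; first exact: slope01_affine.
by move=> s /hphi/andP[_]; rewrite lerBlDr addrAC addrA.
Qed.

(** The variable is the lower end of an infinite integral. Near z this integral is a constant minus
    the integral from c = z - 1, to which the fundamental theorem applies as phi is continuous. *)
Lemma is_derive_avg b phi z : 0 < b -> slope01 phi ->
  is_derive z 1 (avg b phi) (b * (avg b phi z - phi z)).
Proof.
move=> b0 hphi.
pose g s := expR (- (b * s)) * phi s.
pose c := z - 1.
pose I := \int[mu]_(s in `[c, +oo[) g s.
pose J x := \int[mu]_(s in `[c, x]) g s.
have ig : mu.-integrable `[c, +oo[ (EFin \o g) by exact: integrable_avg.
have E x : c <= x -> \int[mu]_(s in `[x, +oo[) g s = I - J x.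
  move=> cx; rewrite /I /J Rintegral_itvB ?bnd_simp//.
  rewrite Rintegral_itv_obnd_cbnd//.
  by apply: integrableS ig => //; apply: subset_itvr; rewrite bnd_simp.
have dJ : is_derive z 1 J (g z).
  have [] := @continuous_FTC1_closed R g c z (z + 1).
  - by rewrite ltrDl.
  - apply: integrableS ig => //; exact: subset_itvl.
  - by rewrite /c ltrBlDr ltrDl.
  - by apply: continuous_avg_integrand.
  - by move=> h1 h2; apply: (DeriveDef h1); rewrite -derive1E; exact: h2.
have de : is_derive z 1 (fun x => b * expR (b * x)) (b * (b * expR (b * z))).
  by apply: is_derive_eq; rewrite /GRing.scale/=; ring.
apply: (@near_eq_is_derive _ _ _ (fun x => b * expR (b * x) * (I - J x))).
  near=> x; rewrite /avg E//.
  apply: ltW; near: x; apply: lt_nbhsr; by rewrite /c ltrBlDr ltrDl.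
have dIJ : is_derive z 1 (fun x => I - J x) (- g z).
  by rewrite -sub0r; apply: is_deriveB.
apply: is_derive_eq.
rewrite /GRing.scale/= /avg E; last by rewrite /c lerBlDr lerDl.
rewrite /g expRN; by field; rewrite !gt_eqF ?expR_gt0.
Unshelve. all: by end_near. Qed.

Lemma slope01_avg b phi : 0 < b -> slope01 phi -> slope01 (avg b phi).
Proof.
move=> b0 h; apply: (is_derive_slope01 (fun x => is_derive_avg x b0 h)) => x.
have /andP[h1 h2] := avg_bounds x b0 h.
by rewrite mulr_ge0 ?(ltW b0)//= -ler_pdivlMl// mulr1.
Qed.

Definition mirror phi s : R := - phi (- s).

Lemma slope01_mirror phi : slope01 phi -> slope01 (mirror phi).
Proof.
move=> h x y xy; rewrite /mirror.
have := h (- y) (- x); rewrite lerN2 => /(_ xy) /andP[h1 h2].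
by apply/andP; split; lra.
Qed.

(** Expectation of phi(z - e) for an exponential variable e of rate b; the reflection s -> - s
    carries over the facts about [avg]. *)
Definition lavg b phi z := - avg b (mirror phi) (- z).

Lemma slope01_lavg b phi : 0 < b -> slope01 phi -> slope01 (lavg b phi).
Proof. by move=> b0 h; apply: slope01_mirror; apply/slope01_avg/slope01_mirror. Qed.

Lemma le_lavg b phi psi z : 0 < b -> slope01 phi -> slope01 psi ->
  (forall s, phi s <= psi s) -> lavg b phi z <= lavg b psi z.
Proof.
move=> b0 h1 h2 h; rewrite lerN2; apply: le_avg => //; try exact: slope01_mirror.
by move=> s _; rewrite lerN2.
Qed.

Lemma lavg_ge0 b phi z : 0 < b -> slope01 phi -> (forall s, 0 <= phi s) ->
  0 <= lavg b phi z.
Proof.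
move=> b0 h h0; rewrite -oppr0 lerN2 -[leRHS](avg_cst 0 (- z) b0).
apply: le_avg => //; [exact: slope01_mirror|exact: slope01_cst|].
by move=> s _; rewrite oppr_le0.
Qed.

Lemma lavg_bounds b phi z : 0 < b -> slope01 phi ->
  0 <= phi z - lavg b phi z <= b^-1.
Proof.
move=> b0 h; have := avg_bounds (- z) b0 (slope01_mirror h).
by rewrite /lavg /mirror !opprK addrC.
Qed.

Lemma is_derive_lavg b phi z : 0 < b -> slope01 phi ->
  is_derive z 1 (lavg b phi) (b * (phi z - lavg b phi z)).
Proof.
move=> b0 h.
have d := is_derive_avg (- z) b0 (slope01_mirror h).
have d' := @is_derive1_comp R (avg b (mirror phi)) (fun x => - x) z _ _ d.
apply: is_derive_eq.
by rewrite /lavg /mirror /= (opprK z); ring.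
Qed.

(* The solution of the obstacle problem max(s^2/2 v'' - k v + m w, z - v) = 0,
   with b = sqrt(2 k) / s and l = m / k: since v'' - b^2 v factors as
   (D + b)(D - b) v, the function g = v - v'/b is l times the left exponential
   average of w where v > z, and z - 1/b where v = z. *)
Definition obst_gain b l phi s := Num.max (l * lavg b phi s) (s - b^-1).

Definition obst b l phi := avg b (obst_gain b l phi).

Section obstacle.
Variables (b l : R).
Hypotheses (b0 : 0 < b) (l0 : 0 < l) (l1 : l < 1).

Lemma slope01_max phi psi : slope01 phi -> slope01 psi ->
  slope01 (fun s => Num.max (phi s) (psi s)).
Proof.
move=> h1 h2 x y xy; have /andP[a1 a2] := h1 _ _ xy; have /andP[c1 c2] := h2 _ _ xy.
rewrite subr_ge0 ge_max !le_max; apply/andP; split.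
  by apply/andP; split; apply/orP; [left|right]; lra.
rewrite lerBlDr ge_max; apply/andP; split.
  by rewrite -lerBlDl le_max; apply/orP; left; lra.
by rewrite -lerBlDl le_max; apply/orP; right; lra.
Qed.

Lemma slope01_scale phi : slope01 phi -> slope01 (fun s => l * phi s).
Proof.
move=> h x y xy; have /andP[h1 h2] := h _ _ xy; rewrite -mulrBr.
rewrite mulr_ge0 ?(ltW l0)//= (le_trans _ h2)// ler_piMl// ltW//.
Qed.

Lemma slope01_obst_gain phi : slope01 phi -> slope01 (obst_gain b l phi).
Proof.
move=> h; apply: slope01_max; last exact: slope01_affine.
by apply/slope01_scale/slope01_lavg.
Qed.

Lemma slope01_obst phi : slope01 phi -> slope01 (obst b l phi).
Proof. by move=> h; apply: slope01_avg => //; exact: slope01_obst_gain. Qed.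

Lemma le_obst phi psi z : slope01 phi -> slope01 psi ->
  (forall s, phi s <= psi s) -> obst b l phi z <= obst b l psi z.
Proof.
move=> h1 h2 h; apply: le_avg => //; try exact: slope01_obst_gain.
move=> s _; rewrite /obst_gain ge_max !le_max lexx orbT andbT.
by rewrite ler_pM2l// le_lavg.
Qed.

(** The gain dominates both s - 1/b, whose average is z, and 0. *)
Lemma obst_ge phi z : slope01 phi -> (forall s, 0 <= phi s) ->
  Num.max z 0 <= obst b l phi z.
Proof.
move=> h h0; rewrite ge_max; apply/andP; split.
  rewrite -[leLHS](subrK b^-1) -avg_affine//; apply: le_avg => //.
  - exact: slope01_affine.
  - exact: slope01_obst_gain.
  - by move=> s _; rewrite le_max lexx orbT.
rewrite -(avg_cst 0 z b0); apply: le_avg => //.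
- exact: slope01_cst.
- exact: slope01_obst_gain.
- move=> s _; rewrite le_max; apply/orP; left.
  by rewrite mulr_ge0 ?(ltW l0)// lavg_ge0.
Qed.

(** The first branch of the maximum has slope at most l < 1 and the second has slope 1, so their
    difference is strictly decreasing and vanishes once. *)
Lemma obst_gain_crossing phi : slope01 phi -> (forall s, 0 <= phi s) ->
  exists a, (forall z, a <= z -> obst_gain b l phi z = z - b^-1) /\
            (forall z, z < a -> obst_gain b l phi z = l * lavg b phi z).
Proof.
move=> h h0.
pose D z := l * lavg b phi z - (z - b^-1).
have hl := slope01_lavg b0 h.
have cD : continuous D.
  move=> z; apply: cvgB.
    apply: cvgM; first exact: cvg_cst.
    exact: slope01_continuous.
  by apply: cvgB; [exact: cvg_id|exact: cvg_cst].
have dD x y : x < y -> D y < D x.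
  move=> xy; have /andP[h1 h2] := hl _ _ (ltW xy).
  have : l * (lavg b phi y - lavg b phi x) < y - x.
    rewrite (le_lt_trans (ler_wpM2l (ltW l0) h2))//.
    by rewrite gtr_pMl// subr_gt0.
  by rewrite /D; lra.
(* Since [lavg b phi] grows at most with slope 1, D M <= l lavg(0) + 1/b - (1 - l) M; the choice of
   [M] makes this negative, and the last summand puts [M] to the right of 1/b. *)
pose M := (l * lavg b phi 0 + b^-1 + 1) / (1 - l) + b^-1.
have A0 : 0 <= lavg b phi 0 by exact: lavg_ge0.
have bi0 : 0 < b^-1 by rewrite invr_gt0.
have q0 : 0 <= (l * lavg b phi 0 + b^-1 + 1) / (1 - l).
  by rewrite divr_ge0 ?subr_ge0 ?(ltW l1)// !addr_ge0 ?mulr_ge0 ?(ltW l0)// ltW.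
have bM : b^-1 <= M by rewrite lerDr.
have DM : D M <= 0.
  have /andP[_ h2] := hl 0 M (le_trans (ltW bi0) bM).
  have h3 : l * lavg b phi M <= l * lavg b phi 0 + l * M.
    by rewrite -mulrDr ler_pM2l//; lra.
  have h4 : M * (1 - l) = l * lavg b phi 0 + b^-1 + 1 + b^-1 * (1 - l).
    by rewrite mulrDl divfK// subr_eq0 gt_eqF.
  have h5 : 0 <= b^-1 * (1 - l) by rewrite mulr_ge0 ?(ltW bi0)// subr_ge0 ltW.
  by rewrite /D; lra.
have Db : 0 <= D b^-1.
  by rewrite /D subrr subr0 mulr_ge0 ?(ltW l0)// lavg_ge0.
have [|a _ Da] := @IVT R D b^-1 M 0 bM (continuous_subspaceT cD).
  by rewrite ge_min le_max DM Db orbT.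
exists a; split => z.
  rewrite le_eqVlt => /predU1P[<-|/dD].
    move: Da => /eqP; rewrite subr_eq0 => /eqP e.
    by rewrite /obst_gain e maxxx.
  by rewrite Da subr_lt0 => /ltW/max_r.
by move=> /dD; rewrite Da subr_gt0 => /ltW/max_l.
Qed.

(** The derivative is b times a difference of two functions with slopes in [0, 1], hence Lipschitz
    with constant b. Past the crossing the gain is affine, so its average is z; before it,
    differentiating the left average gives the second order equation. *)
Lemma obst_spec phi : slope01 phi -> (forall s, 0 <= phi s) ->
  exists (dv : R -> R) (a : R),
  [/\ forall z, is_derive z 1 (obst b l phi) (dv z),
      forall z, 0 <= dv z <= 1,
      forall x y, `|dv x - dv y| <= b * `|x - y|,
      forall z, a <= z -> obst b l phi z = z /\ l * phi z <= z
    & forall z, z < a ->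
      is_derive z 1 dv (b ^+ 2 * (obst b l phi z - l * phi z))].
Proof.
move=> h h0; have [a [ha1 ha2]] := obst_gain_crossing h h0.
have hN := slope01_obst_gain h; have hv := slope01_obst h.
exists (fun z => b * (obst b l phi z - obst_gain b l phi z)), a; split.
- by move=> z; exact: is_derive_avg.
- move=> z; have /andP[h1 h2] := avg_bounds z b0 hN.
  by rewrite mulr_ge0 ?(ltW b0)//= -ler_pdivlMl// mulr1.
- move=> x y; rewrite -mulrBr normrM gtr0_norm// ler_pM2l//.
  wlog xy : x y / x <= y => [hw|].
    by case: (leP x y) => [/hw //|/ltW /hw]; rewrite distrC (distrC y).
  have /andP[h1 h2] := hN _ _ xy; have /andP[h3 h4] := hv _ _ xy.
  rewrite (distrC x) (ger0_norm (_ : 0 <= y - x)) ?subr_ge0// ler_norml.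
  by apply/andP; split; lra.
- move=> z az; split.
    rewrite /obst (@eq_avg _ _ (fun s => s - b^-1)) ?avg_affine ?subrK//.
    by move=> s zs; apply: ha1; rewrite (le_trans az).
  have := ha1 _ az; rewrite /obst_gain => e.
  have : l * lavg b phi z <= z - b^-1 by rewrite -e le_max lexx.
  have /andP[_] := lavg_bounds z b0 h.
  rewrite lerBlDr -(ler_pM2l l0) mulrDr => e1 e2.
  have : l * b^-1 <= b^-1 by rewrite ler_piMl ?invr_ge0 ?ltW.
  by lra.
- move=> z za.
  have d1 := is_derive_avg z b0 hN; have d2 := is_derive_lavg z b0 h.
  apply: (@near_eq_is_derive _ _ _
      (fun z => b * (avg b (obst_gain b l phi) z - l * lavg b phi z))).
    near=> x; rewrite /obst ha2//.
    by near: x; exact: lt_nbhsl.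
  apply: is_derive_eq; rewrite /obst ha2// /GRing.scale/=; ring.
Unshelve. all: by end_near. Qed.

End obstacle.

End averaging.

(** * Least fixed point of the coupled obstacle problems *)

Section value_system.
Context {R : realType}.

(** Replacing phi by l phi gains (1 - l) C on the constant, while the average raises max(s, 0) by at
    most 1/b; the condition on C balances the two. *)
Lemma obst_le_shift (b l C : R) (phi : R -> R) z : 0 < b -> 0 < l -> l < 1 ->
  slope01 phi -> 0 <= C -> b^-1 / (1 - l) <= C ->
  (forall s, phi s <= Num.max s 0 + C) -> obst b l phi z <= Num.max z 0 + C.
Proof.
move=> b0 l0 l1 h C0 hC hphi.
have hl : slope01 (fun s : R => Num.max s 0 + l * C).
  move=> x y /(slope01_max (slope01_affine 0) (slope01_cst 0)).
  by rewrite !addr0 opprD addrACA subrr addr0.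
have /andP[_] := avg_bounds z b0 hl.
rewrite lerBlDr => hb.
have : obst b l phi z <= avg b (fun s => Num.max s 0 + l * C) z.
  apply: le_avg => //; first exact: slope01_obst_gain.
  move=> s _; rewrite ge_max; apply/andP; split.
    have /andP[h1 _] := lavg_bounds s b0 h.
    have h2 : lavg b phi s <= Num.max s 0 + C.
      by rewrite (le_trans _ (hphi s))// -subr_ge0.
    rewrite (le_trans (ler_wpM2l (ltW l0) h2))// mulrDr lerD2r.
    by rewrite ler_piMl ?(ltW l1)// le_max lexx orbT.
  have : s <= Num.max s 0 by rewrite le_max lexx.
  have : 0 < b^-1 by rewrite invr_gt0.
  have : 0 <= l * C by rewrite mulr_ge0// ltW.
  by lra.
move: hC; rewrite ler_pdivrMr ?subr_gt0// mulrBr mulr1.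
by lra.
Qed.

Lemma inf_slope01 (S : set (R -> R)) : S !=set0 ->
  (forall v, S v -> slope01 v) -> (forall v, S v -> forall s, 0 <= v s) ->
  slope01 (fun z => inf [set v z | v in S]).
Proof.
move=> [v0 Sv0] hs h0 x y xy.
have lb z : lbound [set v z | v in S] 0 by move=> _ [v Sv <-]; exact: h0.
have ne z : [set v z | v in S] !=set0 by exists (v0 z), v0.
rewrite subr_ge0 lerBlDr; apply/andP; split.
  apply: lb_le_inf => // _ [v Sv <-].
  rewrite (@le_trans _ _ (v x))//.
    by apply: ge_inf; [by exists 0|exists v].
  by have /andP[] := hs _ Sv _ _ xy; rewrite subr_ge0.
rewrite -lerBlDl; apply: lb_le_inf => // _ [v Sv <-].
rewrite lerBlDl (@le_trans _ _ (v y))//.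
  by apply: ge_inf; [by exists 0|exists v].
by have /andP[_] := hs _ Sv _ _ xy; rewrite lerBlDr.
Qed.

(** Let V be the pointwise infimum of all v with H v <= v. Monotonicity gives H V <= V; then H V
    belongs to the same set, so V <= H V. *)
Lemma obst_fixpoint (b1 l1 b2 l2 : R) :
  0 < b1 -> 0 < l1 -> l1 < 1 -> 0 < b2 -> 0 < l2 -> l2 < 1 ->
  exists v, [/\ slope01 v, forall s, 0 <= v s & v = obst b1 l1 (obst b2 l2 v)].
Proof.
move=> b10 l10 l11 b20 l20 l21.
pose H v := obst b1 l1 (obst b2 l2 v).
pose K (v : R -> R) := slope01 v /\ forall s, 0 <= v s.
have obst0 (b l : R) v : 0 < b -> 0 < l -> l < 1 -> K v -> K (obst b l v).
  move=> b0 l0 lt1 [k1 k2]; split; first exact: slope01_obst.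
  by move=> s; rewrite (le_trans _ (obst_ge b0 l0 lt1 s k1 k2))// le_max lexx orbT.
have KH v : K v -> K (H v) by move=> Kv; apply: (obst0) => //; exact: obst0.
have Hle v w : K v -> K w -> (forall s, v s <= w s) -> forall s, H v s <= H w s.
  move=> Kv Kw vw s.
  have [k1 _] := obst0 _ _ _ b20 l20 l21 Kv.
  have [k2 _] := obst0 _ _ _ b20 l20 l21 Kw.
  apply: (le_obst b10 l10 l11 _ k1 k2) => r.
  by have [v1 _] := Kv; have [w1 _] := Kw; exact: le_obst v1 w1 vw.
pose S := [set v | K v /\ forall z, H v z <= v z].
(* [C] exceeds both constants demanded by [obst_le_shift], so max(s, 0) + C is preserved from above
   by each of the two obstacle maps and the set [S] is inhabited. *)
pose C := b1^-1 / (1 - l1) + b2^-1 / (1 - l2).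
have C1 : 0 <= b1^-1 / (1 - l1) by rewrite divr_ge0 ?invr_ge0 ?subr_ge0 ?ltW.
have C2 : 0 <= b2^-1 / (1 - l2) by rewrite divr_ge0 ?invr_ge0 ?subr_ge0 ?ltW.
have C0 : 0 <= C by exact: addr_ge0.
have S0 : S !=set0.
  pose v0 (s : R) := Num.max s 0 + C.
  have K0 : K v0.
    split; last by move=> s; rewrite addr_ge0// le_max lexx orbT.
    move=> x y /(slope01_max (slope01_affine 0) (slope01_cst 0)).
    by rewrite /v0 !addr0 opprD addrACA subrr addr0.
  exists v0; split => // z.
  have [k1 _] := obst0 _ _ _ b20 l20 l21 K0.
  apply: obst_le_shift => //; first by rewrite lerDl.
  by move=> s; apply: obst_le_shift => //; [case: K0|rewrite lerDr].
pose V z := inf [set v z | v in S].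
have lb z : lbound [set v z | v in S] 0 by move=> _ [v [[_ h] _] <-]; exact: h.
have ne z : [set v z | v in S] !=set0 by have [v Sv] := S0; exists (v z), v.
have KV : K V.
  split; first by apply: inf_slope01 => // v [[]].
  by move=> s; exact: lb_le_inf.
have VS v z : S v -> V z <= v z by move=> Sv; apply: ge_inf; [by exists 0|exists v].
have HV z : H V z <= V z.
  apply: lb_le_inf => // _ [v Sv <-]; have [Kv Hv] := Sv.
  apply: le_trans (Hv z); apply: (Hle _ _ KV Kv) => s; exact: VS.
exists V; split; [by case: KV|by case: KV|].
apply/funext => z; apply/eqP; rewrite eq_le HV andbT.
by apply: VS; split; [exact: KH|move=> s; apply: Hle => //; exact: KH].
Qed.

(* [U i] is the candidate for the value of stopping [e^(-rho t) X_t] in regime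
   [i], [dU i] its derivative and [thr i] its stopping threshold; [j] is the
   regime other than [i]. *)
Record value_system (lam sg : 'I_2 -> R) (rho : R) (U dU : 'I_2 -> R -> R)
    (thr : 'I_2 -> R) : Prop := ValueSystem {
  vs_slope : forall i, slope01 (U i) ;
  vs_ge : forall i (z : R), Num.max z 0 <= U i z ;
  vs_derive : forall i (z : R), is_derive z 1 (U i) (dU i z) ;
  vs_derive01 : forall i (z : R), 0 <= dU i z <= 1 ;
  vs_lip : exists2 L, 0 < L & forall i (x y : R), `|dU i x - dU i y| <= L * `|x - y| ;
  vs_stop : forall i (z : R), thr i <= z -> U i z = z ;
  vs_super : forall i j (z : R), i != j -> thr i <= z ->
    lam i * U j z <= (rho + lam i) * z ;
  vs_ode : forall i j (z : R), i != j -> z < thr i -> is_derive z 1 (dU i)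
    (2 / sg i ^+ 2 * ((rho + lam i) * U i z - lam i * U j z)) }.

Lemma I2_cases (i : 'I_2) : i = ord0 \/ i = ord_max.
Proof. by case: i => -[|[|]]// ?; [left|right]; exact: val_inj. Qed.

Lemma value_system_exists (lam sg : 'I_2 -> R) (rho : R) :
  (forall i, 0 < lam i) -> (forall i, 0 < sg i) -> 0 < rho ->
  exists U dU thr, value_system lam sg rho U dU thr.
Proof.
move=> lam0 sg0 rho0.
(* Normal form of the equation: sg^2/2 v'' = (rho + lam) v - lam w becomes v'' = b^2 (v - l w). *)
pose b i := Num.sqrt (2 * (rho + lam i)) / sg i.
pose l i := lam i / (rho + lam i).
have k0 i : 0 < rho + lam i by rewrite addr_gt0.
have b0 i : 0 < b i by rewrite divr_gt0// sqrtr_gt0 mulr_gt0.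
have l0 i : 0 < l i by rewrite divr_gt0.
have l1 i : l i < 1 by rewrite ltr_pdivrMr// mul1r ltrDr.
have bE i : b i ^+ 2 = 2 / sg i ^+ 2 * (rho + lam i).
  by rewrite /b exprMn sqr_sqrtr ?mulr_ge0 ?ltW// exprVn; ring.
have [v [vs v0 vE]] :=
  obst_fixpoint (b0 ord0) (l0 ord0) (l1 ord0) (b0 ord_max) (l0 ord_max) (l1 ord_max).
pose v' := obst (b ord_max) (l ord_max) v.
have vs' : slope01 v' by exact: slope01_obst.
have v0' s : 0 <= v' s.
  rewrite (le_trans _ (obst_ge (b0 ord_max) (l0 ord_max) (l1 ord_max) s vs v0))//.
  by rewrite le_max lexx orbT.
pose U (i : 'I_2) := if i == ord0 then v else v'.
have Us i : slope01 (U i) by rewrite /U; case: ifP.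
have U0 i s : 0 <= U i s by rewrite /U; case: ifP.
have UE i j : i != j -> U i = obst (b i) (l i) (U j).
  have [->|->] := I2_cases i; have [->|->] := I2_cases j => ij.
  - by exfalso; rewrite eqxx in ij.
  - exact: vE.
  - exact: erefl.
  - by exfalso; rewrite eqxx in ij.
pose o (i : 'I_2) : 'I_2 := rev_ord i.
have io i : i != o i by have [->|->] := I2_cases i.
have oP i j : i != j -> j = o i.
  by have [->|->] := I2_cases i; have [->|->] := I2_cases j => // _; exact: val_inj.
have [dU hdU] := choice (fun i => obst_spec (b0 i) (l0 i) (l1 i) (Us (o i)) (U0 (o i))).
have [thr spec'] := choice hdU.
exists U, dU, thr; split => //.
- by move=> i z; rewrite (UE i _ (io i)); exact: obst_ge.
- by move=> i z; rewrite (UE i _ (io i)); have [] := spec' i.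
- by move=> i z; have [_ h _ _ _] := spec' i; exact: h.
- exists (b ord0 + b ord_max) => [|i x y]; first by rewrite addr_gt0.
  have [_ _ h _ _] := spec' i.
  rewrite (le_trans (h x y))// ler_wpM2r//.
  by have [->|->] := I2_cases i; rewrite ?lerDl ?lerDr ltW.
- by move=> i z tz; rewrite (UE i _ (io i)); have [_ _ _ /(_ z tz)[]] := spec' i.
- move=> i j z /oP -> tz; have [_ _ _ /(_ z tz)[_]] := spec' i.
  by rewrite /l mulrAC ler_pdivrMr// (mulrC z).
- move=> i j z ij zt; have [_ _ _ _ /(_ z zt)] := spec' i.
  rewrite -(UE i _ (io i)) bE -(oP _ _ ij) /l.
  by move/is_derive_eq; apply; field; rewrite !gt_eqF.
Qed.

End value_system.

(** * Gaussian moments and independence *)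

Section normal_moments.
Context {R : realType}.
Notation mu := (@lebesgue_measure R).
Variable s : R.
Hypothesis s0 : 0 < s.
Let p := normal_pdf 0 s : R -> R.

Let pE x : p x = normal_peak s * expR (- x ^+ 2 / (s ^+ 2 *+ 2)).
Proof. by rewrite /p normal_pdfE ?gt_eqF// /normal_fun subr0. Qed.

Let p0 x : 0 <= p x. Proof. exact: normal_pdf_ge0. Qed.

Let cp : continuous p. Proof. by apply: continuous_normal_pdf; rewrite gt_eqF. Qed.

Let mp : measurable_fun setT p. Proof. exact: measurable_normal_pdf. Qed.

(** The Radon-Nikodym derivative of the Gaussian law agrees almost everywhere with the density,
    because both have the same integral over every measurable set. *)
Lemma integral_normal_prob (f : R -> R) : measurable_fun setT f ->
  (forall x, 0 <= f x) ->
  (\int[normal_prob 0 s]_x (f x)%:E = \int[mu]_x (f x * p x)%:E)%E.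
Proof.
move=> mf f0.
have dom := @normal_prob_dominates R 0 s.
rewrite -(Radon_Nikodym_SigmaFinite.change_of_variables dom)//; last first.
  exact/measurable_EFinP.
have iRN := Radon_Nikodym_SigmaFinite.f_integrable dom.
have : ae_eq mu setT (Radon_Nikodym_SigmaFinite.f (normal_prob 0 s) mu) (EFin \o p).
  apply: integral_ae_eq => //; first exact/measurable_EFinP.
  by move=> E _ mE; rewrite -Radon_Nikodym_SigmaFinite.f_integral.
move=> [N [mN N0 sub]].
apply: ge0_ae_eq_integral => //.
- apply: emeasurable_funM; first exact/measurable_EFinP.
  exact: measurable_int iRN.
- by apply/measurable_EFinP; exact: measurable_funM.
- move=> x _; apply: mule_ge0; first by rewrite lee_fin.
  exact: Radon_Nikodym_SigmaFinite.f_ge0.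
- by move=> x _; rewrite lee_fin mulr_ge0.
- exists N; split => // x /= h; apply: sub => /= h1; apply: h => _.
  by rewrite h1// EFinM.
Qed.

Let dp (x : R) : is_derive x 1 p (- (x / s ^+ 2) * p x).
Proof.
have -> : p = fun x => normal_peak s * expR (- x ^+ 2 / (s ^+ 2 *+ 2)).
  by apply/funext => y; rewrite pE.
have dq : is_derive x 1 (fun x : R => - x ^+ 2 / (s ^+ 2 *+ 2)) (- (x / s ^+ 2)).
  apply: is_derive_eq; rewrite /GRing.scale/= -(mulr_natr (s ^+ 2)); field; rewrite gt_eqF//.
have de := @is_derive1_comp R expR (fun x : R => - x ^+ 2 / (s ^+ 2 *+ 2)) x _ _ (is_derive_expR _) dq.
apply: is_derive_eq (is_deriveZ (normal_peak s) de) _.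
by rewrite /GRing.scale/=; ring.
Qed.

Let cvgXp (n : nat) : (n <= 3)%N -> x ^+ n * p x @[x --> +oo] --> (0 : R).
Proof.
move=> n3.
apply: (@squeeze_cvgr _ _ _ _ (cst 0) (fun x : R => normal_peak s * (8 * s ^+ 4) * x^-1)).
- near=> x; have x1 : 1 <= x by [].
  have x0 : 0 < x by apply: lt_le_trans x1.
  rewrite mulr_ge0 ?exprn_ge0 ?(ltW x0)//= pE mulrCA -!mulrA ler_wpM2l ?normal_peak_ge0//.
  rewrite mulNr expRN ler_pdivrMr ?expR_gt0//.
  have y0 : 0 <= x ^+ 2 / (s ^+ 2 *+ 2) by rewrite divr_ge0 ?mulrn_wge0 ?sqr_ge0.
  (* With y = x^2 / (2 s^2) the bound e^y >= y^2 / 2 reads e^y >= x^4 / (8 s^4), one power more than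
     the cube to be killed. *)
  have := expR_ge1Dxn 1 y0; rewrite (_ : 2`!%:R = 2 :> R)//.
  set E := expR _ => hE.
  have {}hE : x ^+ 4 / (8 * s ^+ 4) <= E.
    apply: le_trans hE; rewrite ler_wpDl// le_eqVlt; apply/orP; left; apply/eqP.
    by rewrite -(mulr_natr (s ^+ 2)); field; rewrite gt_eqF.
  apply: (@le_trans _ _ (x ^+ 3)); first exact: ler_weXn2l.
  apply: (@le_trans _ _ (8 * s ^+ 4 * x^-1 * E)); last first.
    by rewrite le_eqVlt; apply/orP; left; apply/eqP; ring.
  rewrite (_ : x ^+ 3 = 8 * s ^+ 4 * x^-1 * (x ^+ 4 / (8 * s ^+ 4))); last first.
    by field; rewrite !gt_eqF.
  by apply: ler_wpM2l hE; rewrite !mulr_ge0 ?invr_ge0 ?exprn_ge0 ?(ltW x0) ?(ltW s0).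
- exact: cvg_cst.
- rewrite -[X in _ --> X](mulr0 (normal_peak s * (8 * s ^+ 4))).
  apply: cvgM; first exact: cvg_cst.
  exact: cvg_inv_pinfty.
Unshelve. all: by end_near. Qed.

Let deriv_of (F f : R -> R) := forall x : R, is_derive x 1 F (f x).

Let FTC (f F : R -> R) (a : R) : 0 <= a -> (forall x, a <= x -> 0 <= f x) ->
  deriv_of F f -> continuous f ->
  F x @[x --> +oo] --> (0 : R) ->
  (\int[mu]_(x in `[a, +oo[) (f x)%:E = (- F a)%:E)%E.
Proof.
move=> a0 f0 dF cf F0.
rewrite (@ge0_continuous_FTC2y _ _ F _ 0)// ?sub0e//.
- exact: continuous_subspaceT.
- by move=> x _; case: (dF x).
- apply: cvg_at_right_filter.
  exact: (@cvg_is_derive _ _ (a, f a) (dF a)).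
- by move=> x _; rewrite derive1E; have := dF x; case.
Qed.

Let even_half (f : R -> R) : (forall x, 0 <= f x) -> continuous f ->
  (forall x, f (- x) = f x) ->
  (\int[mu]_x (f x)%:E = 2%:E * \int[mu]_(x in `[0%R, +oo[) (f x)%:E)%E.
Proof.
move=> f0 cf fN; rewrite ge0_symfun_integralT//; last by move=> x; rewrite /= fN.
by rewrite set_itvcy.
Qed.

Let pN x : p (- x) = p x. Proof. by rewrite !pE sqrrN. Qed.

Let cXp (n : nat) : continuous (fun x : R => x ^+ n * p x).
Proof. by move=> x; apply: cvgM; [exact: exprn_continuous|exact: cp]. Qed.

Let m1 : (\int[mu]_(x in `[0%R, +oo[) (x ^+ 1 * p x)%:E = (s ^+ 2 * p 0)%:E)%E.
Proof.
rewrite (@FTC _ (fun x : R => - s ^+ 2 * p x)).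
- by rewrite mulNr opprK.
- by [].
- by move=> x x0; rewrite mulr_ge0.
- move=> x; have h := dp x; apply: is_derive_eq; rewrite /GRing.scale/=.
  by field; rewrite gt_eqF.
- exact: cXp.
- rewrite -[X in _ --> X](mulr0 (- s ^+ 2)); apply: cvgM; first exact: cvg_cst.
  have := @cvgXp 0 isT; by under eq_fun do rewrite expr0 mul1r.
Qed.

Let m3 : (\int[mu]_(x in `[0%R, +oo[) (x ^+ 3 * p x)%:E = (2 * s ^+ 4 * p 0)%:E)%E.
Proof.
rewrite (@FTC _ (fun x : R => - s ^+ 2 * (x ^+ 2 * p x) - 2 * s ^+ 4 * p x)).
- by rewrite expr0n/= mul0r mulr0 sub0r opprK.
- by [].
- by move=> x x0; rewrite mulr_ge0// exprn_ge0.
- move=> x; have h := dp x; apply: is_derive_eq; rewrite /GRing.scale/=.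
  by field; rewrite gt_eqF.
- exact: cXp.
- rewrite [X in _ --> X](_ : 0 = - s ^+ 2 * 0 - 2 * s ^+ 4 * 0); last by rewrite !mulr0 subr0.
  apply: cvgB; apply: cvgM; try exact: cvg_cst; first exact: cvgXp.
  have := @cvgXp 0 isT; by under eq_fun do rewrite expr0 mul1r.
Qed.

Let split_itv (f : R -> R) : (forall x, 0 <= f x) -> measurable_fun setT f ->
  (\int[mu]_(x in `[0%R, +oo[) (f x)%:E =
   \int[mu]_(x in `[0%R, s]) (f x)%:E + \int[mu]_(x in `[s, +oo[) (f x)%:E)%E.
Proof.
move=> f0 mf.
rewrite (@itv_bndbnd_setU _ _ _ (BRight s)); [|by rewrite bnd_simp ltW|by []].
rewrite ge0_integral_setU//=.
- congr (_ + _)%E; apply: integral_itv_obnd_cbnd.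
  by apply/measurable_EFinP; exact: measurable_funTS.
- by apply/measurable_EFinP; exact: measurable_funTS.
- by move=> x _; rewrite lee_fin.
- apply/disj_setPS => x [/=]; rewrite !in_itv/= andbT => /andP[_ h].
  by rewrite ltNge h.
Qed.

(** Integration by parts with the primitive x p(x), whose derivative (1 - x^2/s^2) p(x) changes sign
    at s. The fundamental theorem for nonnegative integrands is applied on [0, s] and on [s, +oo[
    separately; both boundary terms equal s p(s) and match. *)
Let m2 : (\int[mu]_(x in `[0%R, +oo[) (x ^+ 2 * p x)%:E =
  (s ^+ 2)%:E * \int[mu]_(x in `[0%R, +oo[) (p x)%:E)%E.
Proof.
have mX : measurable_fun setT (fun x : R => x ^+ 2 / s ^+ 2 * p x).
  by apply: measurable_funM => //; apply: measurable_funM.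
have X0 x : 0 <= x ^+ 2 / s ^+ 2 * p x by rewrite mulr_ge0 ?p0// divr_ge0 ?sqr_ge0.
transitivity ((s ^+ 2)%:E * \int[mu]_(x in `[0%R, +oo[) (x ^+ 2 / s ^+ 2 * p x)%:E)%E.
  rewrite -ge0_integralZl//.
  - by apply: eq_integral => x _; rewrite -EFinM; congr EFin; field; rewrite gt_eqF.
  - by apply/measurable_EFinP; exact: measurable_funTS.
  - by move=> x _; rewrite lee_fin.
  - by rewrite lee_fin sqr_ge0.
congr (_ * _)%E.
rewrite !split_itv//.
have dxp (x : R) : is_derive x 1 (fun x : R => x * p x) ((1 - x ^+ 2 / s ^+ 2) * p x).
  have h := dp x; apply: is_derive_eq; rewrite /GRing.scale/=.
  by field; rewrite gt_eqF.
have cq : continuous (fun x : R => (1 - x ^+ 2 / s ^+ 2) * p x).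
  move=> x; apply: cvgM; last exact: cp.
  apply: cvgB; first exact: cvg_cst.
  by apply: cvgM; [exact: exprn_continuous|exact: cvg_cst].
have hs (x : R) : 0 <= x -> (x ^+ 2 / s ^+ 2 <= 1) = (x <= s).
  by move=> x0; rewrite ler_pdivrMr ?exprn_gt0// mul1r ler_sqr ?nnegrE//; exact: ltW.
have hs' (x : R) : 0 <= x -> (1 <= x ^+ 2 / s ^+ 2) = (s <= x).
  by move=> x0; rewrite ler_pdivlMr ?exprn_gt0// mul1r ler_sqr ?nnegrE//; exact: ltW.
have H1 : (\int[mu]_(x in `[s, +oo[) ((x ^+ 2 / s ^+ 2 - 1) * p x)%:E = (s * p s)%:E)%E.
  rewrite (@FTC _ (fun x : R => - (x * p x))).
  - by rewrite opprK.
  - exact: ltW.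
  - by move=> x sx; rewrite mulr_ge0// subr_ge0 hs'// (le_trans (ltW s0)).
  - by move=> x; have h := dxp x; apply: is_derive_eq; ring.
  - rewrite (_ : (fun x => _) = - (fun x : R => (1 - x ^+ 2 / s ^+ 2) * p x)).
      by move=> x; apply: cvgN; exact: cq.
    by apply/funext => x; rewrite fctE; ring.
  - by rewrite -oppr0; apply: cvgN; apply: (@cvgXp 1).
have H2 : (\int[mu]_(x in `[0%R, s]) ((1 - x ^+ 2 / s ^+ 2) * p x)%:E = (s * p s)%:E)%E.
  rewrite (@continuous_FTC2 _ _ (fun x : R => x * p x))//.
  - by rewrite -EFinB mul0r subr0.
  - exact: continuous_subspaceT.
  - have c (x : R) : (fun y : R => y * p y) y @[y --> x] --> x * p x.
      by have := @cXp 1 x.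
    split; first by move=> x _; case: (dxp x).
    + by apply: cvg_at_right_filter; exact: c.
    + by apply: cvg_at_left_filter; exact: c.
  - by move=> x _; rewrite derive1E; apply: derive_val.
have mD A : measurable A -> measurable_fun A (fun x : R => (p x)%:E).
  by move=> mA; apply/measurable_EFinP; exact: measurable_funTS.
have mC (f : R -> R) A : measurable A -> continuous f -> measurable_fun A (fun x : R => (f x)%:E).
  move=> mA cf; apply/measurable_EFinP; apply: measurable_funTS.
  exact: continuous_measurable_fun.
have E1 : (\int[mu]_(x in `[s, +oo[) (x ^+ 2 / s ^+ 2 * p x)%:E =
    (s * p s)%:E + \int[mu]_(x in `[s, +oo[) (p x)%:E)%E.
  rewrite -H1 -ge0_integralD//.
  - by apply: eq_integral => x _; rewrite -EFinD; congr EFin; ring.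
  - move=> x; rewrite /= in_itv/= andbT => sx.
    by rewrite lee_fin mulr_ge0// subr_ge0 hs'// (le_trans (ltW s0)).
  - apply: mC => //.
    rewrite (_ : (fun x => _) = - (fun x : R => (1 - x ^+ 2 / s ^+ 2) * p x)).
      by move=> x; apply: cvgN; exact: cq.
    by apply/funext => x; rewrite fctE; ring.
  - by move=> x _; rewrite lee_fin.
  - exact: mD.
have E2 : (\int[mu]_(x in `[0%R, s]) (p x)%:E =
    (s * p s)%:E + \int[mu]_(x in `[0%R, s]) (x ^+ 2 / s ^+ 2 * p x)%:E)%E.
  rewrite -H2 -ge0_integralD//.
  - by apply: eq_integral => x _; rewrite -EFinD; congr EFin; ring.
  - move=> x; rewrite /= in_itv/= => /andP[x0 xs].
    by rewrite lee_fin mulr_ge0// subr_ge0 hs.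
  - exact: mC.
  - by move=> x _; rewrite lee_fin.
  - by apply/measurable_EFinP; exact: measurable_funTS.
by rewrite E1 E2 addeA [X in (X + _)%E]addeC.
Qed.

Lemma normal_second_moment : (\int[normal_prob 0%R s]_x (x ^+ 2)%:E = (s ^+ 2)%:E)%E.
Proof.
rewrite integral_normal_prob//; last by move=> x; exact: sqr_ge0.
rewrite even_half; [|by move=> x; rewrite mulr_ge0 ?sqr_ge0|exact: cXp
  |by move=> x; rewrite sqrrN pN].
by rewrite m2 muleCA -even_half// integral_normal_pdf mule1.
Qed.

Let p0_le : s * p 0 <= 1.
Proof.
rewrite pE expr0n/= oppr0 mul0r expR0 mulr1 /normal_peak.
rewrite ler_pdivrMr ?mul1r; last first.
  by rewrite sqrtr_gt0 mulrn_wgt0// mulr_gt0 ?pi_gt0// exprn_gt0.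
rewrite -[leLHS](gtr0_norm s0) -sqrtr_sqr; apply: ler_wsqrtr.
rewrite -(mulr_natr (_ * pi)) -mulrA ler_peMr ?sqr_ge0//.
by have := @pi_ge2 R; lra.
Qed.

(** Twice [m3] is 4 s^3 (s p(0)), and s p(0) <= 1 by [p0_le]. *)
Lemma normal_third_moment :
  (\int[normal_prob 0%R s]_x (`|x| ^+ 3)%:E <= (4 * s ^+ 3)%:E)%E.
Proof.
rewrite integral_normal_prob; [|by apply: measurable_funX; exact: normr_measurable
  |by move=> x; rewrite exprn_ge0].
have cn : continuous (fun x : R => `|x|).
  by apply: (@dist_le_continuous R 1) => x y; rewrite mul1r; exact: ler_dist_dist.
have c : continuous (fun x : R => `|x| ^+ 3 * p x).
  move=> x; apply: cvgM; last exact: cp.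
  apply: (@continuous_comp _ _ _ (fun x : R => `|x|) (fun x : R => x ^+ 3)); first exact: cn.
  exact: exprn_continuous.
rewrite even_half; [|by move=> x; rewrite mulr_ge0// exprn_ge0|exact: c
  |by move=> x; rewrite normrN pN].
rewrite (@eq_integral _ _ _ mu _ (fun x : R => (x ^+ 3 * p x)%:E)); last first.
  by move=> x; rewrite inE/= in_itv/= andbT => x0; rewrite ger0_norm.
rewrite m3 -EFinM lee_fin.
rewrite (_ : 2 * (2 * s ^+ 4 * p 0) = 4 * s ^+ 3 * (s * p 0)); last by ring.
by rewrite ler_piMr// mulr_ge0// exprn_ge0// ltW.
Qed.

(** The zero mean is stated through the two parts because the extended integrals at hand are those
    of nonnegative functions. The negative part is obtained as the first absolute moment minus the
    positive part. *)
Lemma normal_mean_parts :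
  (\int[normal_prob 0%R s]_x (Num.max x 0)%:E = (s ^+ 2 * p 0)%:E)%E /\
  (\int[normal_prob 0%R s]_x (Num.max (- x) 0)%:E = (s ^+ 2 * p 0)%:E)%E.
Proof.
have mid : measurable_fun [set: R] (@id R) by exact: measurable_id.
have pos0 (x : R) : 0 <= Num.max x 0 by rewrite le_max lexx orbT.
have mpos : measurable_fun setT (fun x : R => Num.max x 0).
  by apply: measurable_maxr.
have mneg : measurable_fun setT (fun x : R => Num.max (- x) 0).
  by apply: measurable_maxr => //; exact: oppr_measurable.
have A1 : (\int[normal_prob 0%R s]_x (Num.max x 0)%:E = (s ^+ 2 * p 0)%:E)%E.
  rewrite integral_normal_prob// -m1 [RHS]integral_mkcond.
  apply: eq_integral => x _; rewrite patchE.
  case: ifPn; rewrite ?inE /= ?notin_setE/= in_itv/= andbT.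
    by move=> x0; rewrite max_l.
  by move/negP; rewrite -ltNge => /ltW x0; rewrite max_r// mul0r.
split => //.
have cn : continuous (fun x : R => `|x|).
  by apply: (@dist_le_continuous R 1) => x y; rewrite mul1r; exact: ler_dist_dist.
have A2 : (\int[normal_prob 0%R s]_x (`|x|)%:E = 2%:E * (s ^+ 2 * p 0)%:E)%E.
  rewrite integral_normal_prob; [|exact: normr_measurable|by []].
  rewrite even_half; [|by move=> x; rewrite mulr_ge0|
    by move=> x; apply: cvgM; [exact: cn|exact: cp]
    |by move=> x; rewrite normrN pN].
  congr (_ * _)%E; rewrite -m1; apply: eq_integral => x.
  by rewrite inE/= in_itv/= andbT => x0; rewrite ger0_norm.
have A3 : (\int[normal_prob 0%R s]_x (`|x|)%:E =
    \int[normal_prob 0%R s]_x (Num.max x 0)%:E +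
    \int[normal_prob 0%R s]_x (Num.max (- x) 0)%:E)%E.
  rewrite -ge0_integralD//; [|by move=> x _; rewrite lee_fin|exact/measurable_EFinP
    |by move=> x _; rewrite lee_fin|exact/measurable_EFinP].
  apply: eq_integral => x _; rewrite -EFinD; congr EFin.
  case: (leP 0 x) => x0; first by rewrite ger0_norm// max_r ?oppr_le0// addr0.
  by rewrite ltr0_norm// max_l ?oppr_ge0 ?ltW// add0r.
move: A3; rewrite A1 A2.
have f1 : (0 <= \int[normal_prob 0%R s]_x (Num.max (- x) 0)%:E)%E.
  by apply: integral_ge0 => x _; rewrite lee_fin.
case: (\int[_]__ _)%E f1 => [r _|_|]//=.
by rewrite -!EFinM -EFinD => -[h]; congr EFin; lra.
Qed.

End normal_moments.

(** * Products of independent random variables *)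

Section independence.
Context {d : measure_display} {T : measurableType d} {R : realType}.
Variable P : probability T R.
Implicit Types X Y : T -> R.

Definition integrableR X := P.-integrable setT (EFin \o X).

Definition indepRV X Y := forall A B : set R, measurable A -> measurable B ->
  P (X @^-1` A `&` Y @^-1` B) = (P (X @^-1` A) * P (Y @^-1` B))%E.

Lemma indepRV_comp X Y (f g : R -> R) : measurable_fun setT f ->
  measurable_fun setT g -> indepRV X Y -> indepRV (f \o X) (g \o Y).
Proof.
move=> mf mg h A B mA mB; apply: (h (f @^-1` A) (g @^-1` B)).
  by have := mf measurableT A mA; rewrite setTI.
by have := mg measurableT B mB; rewrite setTI.
Qed.

(** The joint law agrees with the product law on rectangles, hence everywhere, and Tonelli's theorem
    factors the integral. The product is written with positive parts so that the integrand is
    nonnegative on the whole plane. *)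
Lemma integral_indep_ge0 X Y : measurable_fun setT X -> measurable_fun setT Y ->
  (forall w, 0 <= X w) -> (forall w, 0 <= Y w) -> indepRV X Y ->
  (\int[P]_w (X w * Y w)%:E = \int[P]_w (X w)%:E * \int[P]_w (Y w)%:E)%E.
Proof.
move=> mX mY X0 Y0 XY.
pose Xm : {mfun T >-> R} := HB.pack X (isMeasurableFun.Build _ _ _ _ _ mX).
pose Ym : {mfun T >-> R} := HB.pack Y (isMeasurableFun.Build _ _ _ _ _ mY).
have mZ : measurable_fun setT (fun w => (X w, Y w)) by exact: measurable_fun_pair.
pose Zm : {mfun T >-> (R * R)%type} := HB.pack (fun w => (X w, Y w)) (isMeasurableFun.Build _ _ _ _ _ mZ).
pose f (z : R * R) := (Num.max z.1 0 * Num.max z.2 0)%:E.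
have mpos : measurable_fun setT (fun x : R => Num.max x 0).
  by apply: measurable_maxr => //; exact: measurable_id.
have m1 : measurable_fun setT (fun z : R * R => Num.max z.1 0).
  by apply: measurableT_comp mpos _.
have m2 : measurable_fun setT (fun z : R * R => Num.max z.2 0).
  by apply: measurableT_comp mpos _.
have mf : measurable_fun setT f by apply/measurable_EFinP; exact: measurable_funM.
have pos0 (x : R) : 0 <= Num.max x 0 by rewrite le_max lexx orbT.
have f0 z : (0 <= f z)%E by rewrite lee_fin mulr_ge0.
have E1 : (\int[P]_w (X w * Y w)%:E = \int[distribution P Zm]_z f z)%E.
  rewrite ge0_integral_distribution//; apply: eq_integral => w _.
  by rewrite /f /= !max_l.
have E2 : (\int[distribution P Zm]_z f z =
    \int[distribution P Xm \x distribution P Ym]_z f z)%E.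
  apply: eq_measure_integral => A mA _; apply/esym.
  apply: product_measure_unique => //.
rewrite E1 E2 fubini_tonelli1//.
have E3 x : fubini_F (distribution P Ym) f x =
    ((Num.max x 0)%:E * \int[P]_w (Y w)%:E)%E.
  rewrite /fubini_F /f /=.
  under eq_integral do rewrite EFinM.
  rewrite ge0_integralZl_EFin//.
  - rewrite ge0_integral_distribution; [|exact/measurable_EFinP|by move=> y; rewrite lee_fin].
    congr (_ * _)%E; apply: eq_integral => w _ /=; by rewrite max_l.
  - by move=> y _; rewrite lee_fin.
  - exact/measurable_EFinP.
under eq_integral do rewrite E3.
rewrite ge0_integralZr//.
- rewrite ge0_integral_distribution; [|exact/measurable_EFinP|by move=> y; rewrite lee_fin].
  by congr (_ * _)%E; apply: eq_integral => w _ /=; rewrite max_l.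
- exact/measurable_EFinP.
- by move=> y _; rewrite lee_fin.
- by apply: integral_ge0 => w _; rewrite lee_fin.
Qed.

Lemma integrableR_measurable X : integrableR X -> measurable_fun setT X.
Proof. by move=> /measurable_int/measurable_EFinP. Qed.

Lemma integrableR_ge0P X : measurable_fun setT X -> (forall w, 0 <= X w) ->
  integrableR X <-> (\int[P]_w (X w)%:E < +oo)%E.
Proof.
move=> mX X0; split=> [/integrableP[_]|h].
  by under eq_integral do rewrite /= ger0_norm//.
apply/integrableP; split; first exact/measurable_EFinP.
by under eq_integral do rewrite /= ger0_norm//.
Qed.

Lemma integrableR_le X Y : measurable_fun setT X -> integrableR Y ->
  (forall w, `|X w| <= Y w) -> integrableR X.
Proof.
move=> mX iY h; apply: le_integrable iY => //; first exact/measurable_EFinP.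
by move=> w _; rewrite /= lee_fin (le_trans (h w))// ler_norm.
Qed.

Lemma integrableR_cst (k : R) : integrableR (cst k).
Proof. exact: finite_measure_integrable_cst. Qed.

Lemma integrableR_bounded X (M : R) : measurable_fun setT X ->
  (forall w, `|X w| <= M) -> integrableR X.
Proof. by move=> mX h; apply: (integrableR_le mX (integrableR_cst M)). Qed.

Lemma integrableR_norm X : integrableR X -> integrableR (fun w => `|X w|).
Proof. by move=> iX; exact: integrable_norm. Qed.

Lemma integrableRD X Y : integrableR X -> integrableR Y ->
  integrableR (fun w => X w + Y w).
Proof. by move=> iX iY; exact: (@integrableD _ _ _ P _ measurableT _ _ iX iY). Qed.

Lemma integrableRB X Y : integrableR X -> integrableR Y ->
  integrableR (fun w => X w - Y w).
Proof. by move=> iX iY; exact: (@integrableB _ _ _ P _ measurableT _ _ iX iY). Qed.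

Lemma integrableRZ (k : R) X : integrableR X -> integrableR (fun w => k * X w).
Proof. by move=> iX; exact: (@integrableZl _ _ _ P _ measurableT k _ iX). Qed.

Lemma integrableR_sum (I : Type) (r : seq I) (X : I -> T -> R) :
  (forall k, integrableR (X k)) -> integrableR (fun w => \sum_(k <- r) X k w).
Proof.
move=> iX; elim: r => [|k r IH].
  rewrite (_ : (fun w => _) = cst 0); first exact: integrableR_cst.
  by apply/funext => w; rewrite big_nil.
rewrite (_ : (fun w => _) = fun w => X k w + \sum_(k <- r) X k w).
  by apply: integrableRD => //; exact: IH.
by apply/funext => w; rewrite big_cons.
Qed.

Lemma Rintegral_sum (I : Type) (r : seq I) (X : I -> T -> R) :
  (forall k, integrableR (X k)) ->
  \int[P]_w (\sum_(k <- r) X k w) = \sum_(k <- r) \int[P]_w X k w.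
Proof.
move=> iX; elim: r => [|k r IH].
  rewrite big_nil (_ : (fun w => _) = cst 0); last by apply/funext => w; rewrite big_nil.
  by rewrite Rintegral_cst// mul0r.
under eq_Rintegral do rewrite big_cons.
rewrite big_cons -IH// -RintegralD//.
  exact: iX.
exact: integrableR_sum.
Qed.

Lemma Rintegral_ge0E X : integrableR X -> (\int[P]_w X w)%:E = (\int[P]_w (X w)%:E)%E.
Proof. by move=> iX; rewrite /Rintegral fineK//; exact: integrable_fin_num. Qed.

Lemma integrableR_indep X Y : integrableR X -> integrableR Y -> indepRV X Y ->
  integrableR (fun w => X w * Y w).
Proof.
move=> iX iY h.
have mX := integrableR_measurable iX; have mY := integrableR_measurable iY.
have inX := integrableR_norm iX; have inY := integrableR_norm iY.
apply: (@integrableR_le _ (fun w => `|X w| * `|Y w|)).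
- exact: measurable_funM.
- apply/integrableR_ge0P => //.
    by apply: measurable_funM; apply: measurableT_comp => //; exact: normr_measurable.
  rewrite integral_indep_ge0//; try exact: measurableT_comp.
  + by rewrite -!Rintegral_ge0E// -EFinM ltry.
  + by apply: (@indepRV_comp _ _ (fun x => `|x|) (fun x => `|x|)) => //; exact: normr_measurable.
- by move=> w; rewrite normrM.
Qed.

(** The positive and negative parts are functions of X and Y and inherit independence, so the
    nonnegative case applies to the four products. *)
Lemma Rintegral_indep X Y : integrableR X -> integrableR Y -> indepRV X Y ->
  \int[P]_w (X w * Y w) = \int[P]_w X w * \int[P]_w Y w.
Proof.
move=> iX iY h.
pose pos (x : R) := Num.max x 0; pose neg (x : R) := Num.max (- x) 0.
have mpos : measurable_fun setT pos.
  by apply: measurable_maxr => //; exact: measurable_id.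
have mneg : measurable_fun setT neg.
  by apply: measurable_maxr => //; exact: measurable_oppr.
have pos0 x : 0 <= pos x by rewrite le_max lexx orbT.
have neg0 x : 0 <= neg x by rewrite le_max lexx orbT.
have E x : x = pos x - neg x.
  rewrite /pos /neg; case: (leP 0 x) => x0; first by rewrite max_r ?oppr_le0// subr0.
  by rewrite max_l ?oppr_ge0 ?ltW// opprK add0r.
have lepos x : `|pos x| <= `|x|.
  rewrite ger0_norm// /pos; case: (leP 0 x) => // x0; exact: ler_norm.
have leneg x : `|neg x| <= `|x|.
  by rewrite ger0_norm// /neg ge_max normr_ge0 -normrN ler_norm.
have ip (f : R -> R) Z : measurable_fun setT f -> (forall x, `|f x| <= `|x|) -> integrableR Z ->
    integrableR (f \o Z).
  move=> mf lf iZ; apply: (@integrableR_le _ (fun w => `|Z w|)).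
  - by apply: measurableT_comp => //; exact: integrableR_measurable.
  - exact: integrableR_norm.
  - by move=> w; exact: lf.
have key (f g : R -> R) : measurable_fun setT f -> measurable_fun setT g ->
    (forall x, 0 <= f x) -> (forall x, 0 <= g x) ->
    (forall x, `|f x| <= `|x|) -> (forall x, `|g x| <= `|x|) ->
    integrableR (fun w => f (X w) * g (Y w)) /\
    \int[P]_w (f (X w) * g (Y w)) = \int[P]_w f (X w) * \int[P]_w g (Y w).
  move=> mf mg f0 g0 lf lg.
  have i1 := ip f X mf lf iX; have i2 := ip g Y mg lg iY.
  have h' := indepRV_comp mf mg h.
  split; first exact: (integrableR_indep i1 i2 h').
  rewrite {1}/Rintegral (integral_indep_ge0 _ _ _ _ h')//=; try exact: integrableR_measurable.
  by rewrite -!Rintegral_ge0E.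
have [i1 e1] := key _ _ mpos mpos pos0 pos0 lepos lepos.
have [i2 e2] := key _ _ mpos mneg pos0 neg0 lepos leneg.
have [i3 e3] := key _ _ mneg mpos neg0 pos0 leneg lepos.
have [i4 e4] := key _ _ mneg mneg neg0 neg0 leneg leneg.
have EX : \int[P]_w X w = \int[P]_w pos (X w) - \int[P]_w neg (X w).
  rewrite -RintegralB//; try exact: ip.
  by apply: eq_Rintegral => w _; exact: E.
have EY : \int[P]_w Y w = \int[P]_w pos (Y w) - \int[P]_w neg (Y w).
  rewrite -RintegralB//; try exact: ip.
  by apply: eq_Rintegral => w _; exact: E.
transitivity (\int[P]_w (pos (X w) * pos (Y w) - pos (X w) * neg (Y w)
   - (neg (X w) * pos (Y w) - neg (X w) * neg (Y w)))).
  by apply: eq_Rintegral => w _; rewrite [X w in LHS]E [Y w in LHS]E; ring.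
rewrite !RintegralB//; try exact: integrableRB.
by rewrite e1 e2 e3 e4 EX EY; ring.
Qed.

End independence.

(** * Transition probabilities of the two-state chain *)

Section expmx2.
Context {R : realType}.
Variables (lambda1 lambda2 : R).
Hypotheses (h1 : 0 < lambda1) (h2 : 0 < lambda2).
Let L := lambda1 + lambda2.
Let Q := generator lambda1 lambda2.

(** The rows of a generator sum to zero, so in dimension two Q has eigenvalues 0 and - L; this
    collapses the matrix exponential to a scalar one. *)
Let QQ : Q *m Q = (- L) *: Q.
Proof.
apply/matrixP => i j; rewrite !mxE !big_ord_recl big_ord0 addr0 !mxE.
case: i => -[|[|]]// ?; case: j => -[|[|]]// ?;
  rewrite /by_regime /= ?expr1 ?expr0 /L; ring.
Qed.

Lemma expmx_generator (h : R) (i j : 'I_2) : i != j ->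
  expmx (h *: Q) i j = by_regime lambda1 lambda2 i / L * (1 - expR (- (L * h))).
Proof.
move=> ij; have L0 : L != 0 by rewrite gt_eqF// addr_gt0.
rewrite mxE.
have pw k : (h *: Q) ^+ k.+1 = (- (L * h)) ^+ k *: (h *: Q).
  elim: k => [|k IH]; first by rewrite expr1 expr0 scale1r.
  rewrite exprS IH -[LHS]/(_ *m _) -scalemxAr -scalemxAl -scalemxAr QQ !scalerA.
  by congr (_ *: _); rewrite exprS; ring.
pose c := by_regime lambda1 lambda2 i / L.
(* The identity term k = 0 vanishes off the diagonal while the scalar exponential series starts with
   1; this explains the correction at k = 0. *)
have cf : (fun k => ((h *: Q) ^+ k) i j / k`!%:R) =
    (fun k => c * ((k == 0%N)%:R - exp_coeff (- (L * h)) k)).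
  apply/funext => -[|k].
    rewrite expr0 [in LHS]mxE (negbTE ij) mul0r /exp_coeff /= expr0 fact0 divr1.
    by rewrite subrr mulr0.
  rewrite pw !mxE (negbTE ij) expr0 mul1r /exp_coeff /= exprS /c.
  have f0 : (k.+1)`!%:R != 0 :> R by rewrite pnatr_eq0 -lt0n fact_gt0.
  by field; rewrite f0 L0.
rewrite cf; apply/cvg_lim => //.
have c1 : series (exp_coeff (- (L * h))) n @[n --> \oo] --> expR (- (L * h)).
  exact: is_cvg_series_exp_coeff.
have : c * (1 - series (exp_coeff (- (L * h))) n) @[n --> \oo] -->
    c * (1 - expR (- (L * h))).
  by apply: cvgM; [exact: cvg_cst|apply: cvgB; [exact: cvg_cst|exact: c1]].
apply: cvg_trans; apply: near_eq_cvg; near=> n.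
rewrite /series /= -mulr_sumr sumrB; congr (_ * (_ - _)).
have n0 : (0 < n)%N by near: n; exists 1%N.
by rewrite (bigD1_seq 0%N) ?mem_index_iota ?iota_uniq//= big1 ?addr0// => k /negbTE ->.
Unshelve. all: by end_near. Qed.

(** Both bounds come from x - x^2 <= 1 - e^(-x) <= x at x = L h. *)
Lemma expmx_generator_bounds (h : R) (i j : 'I_2) : i != j -> 0 <= h ->
  [/\ 0 <= expmx (h *: Q) i j, expmx (h *: Q) i j <= by_regime lambda1 lambda2 i * h
    & by_regime lambda1 lambda2 i * h - by_regime lambda1 lambda2 i * L * h ^+ 2 <= expmx (h *: Q) i j].
Proof.
move=> ij h0; rewrite expmx_generator//.
have L0 : 0 < L by rewrite addr_gt0.
have l0 : 0 < by_regime lambda1 lambda2 i by rewrite /by_regime; case: ifP.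
have x0 : 0 <= L * h by rewrite mulr_ge0// ltW.
have e1 : 1 - expR (- (L * h)) <= L * h.
  by have := expR_ge1Dx (- (L * h)); lra.
have e0 : 0 <= 1 - expR (- (L * h)) by rewrite subr_ge0 expR_le1 oppr_le0.
have e2 : L * h - (L * h) ^+ 2 <= 1 - expR (- (L * h)).
  rewrite expRN.
  have : (expR (L * h))^-1 <= (1 + L * h)^-1.
    by rewrite lef_pV2 ?posrE ?expR_gt0 ?expR_ge1Dx//; lra.
  have : (1 + L * h)^-1 <= 1 - L * h + (L * h) ^+ 2.
    rewrite invf_ple ?posrE; [|lra|nra].
    rewrite -[leLHS]mul1r ler_pdivrMr; last nra.
    have := exprn_ge0 3 x0; nra.
  by lra.
set l := by_regime _ _ _ in l0 *.
have lL : 0 < l / L by rewrite divr_gt0.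
split.
- by rewrite mulr_ge0// ltW.
- rewrite (le_trans (ler_wpM2l (ltW lL) e1))// le_eqVlt; apply/orP; left; apply/eqP.
  by field; rewrite gt_eqF.
- rewrite (le_trans _ (ler_wpM2l (ltW lL) e2))// le_eqVlt; apply/orP; left; apply/eqP.
  by field; rewrite gt_eqF.
Qed.

End expmx2.

(** * Identities on pi-systems, extended up to null sets *)

Section pi_systems.
Context {d : measure_display} {T : measurableType d} {R : realType}.
Variable P : probability T R.

Lemma sub_sigma (G H : set (set T)) : G `<=` <<s H >> -> <<s G >> `<=` <<s H >>.
Proof. by move=> h; apply: smallest_sub => //; exact: smallest_sigma_algebra. Qed.

Lemma sigma_measurable (G : set (set T)) : G `<=` measurable -> <<s G >> `<=` measurable.
Proof.
move=> h; apply: smallest_sub => //; split => //.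
- by move=> A mA; rewrite setTD; exact: measurableC.
- by move=> F mF; exact: bigcupT_measurable.
Qed.

Definition null_sym_diff (E A : set T) := P.-negligible ((E `\` A) `|` (A `\` E)).

Lemma null_sym_diff_measure (E A C : set T) : measurable E -> measurable A -> measurable C ->
  null_sym_diff E A -> P (E `&` C) = P (A `&` C).
Proof.
have half (B D : set T) : measurable B -> measurable D -> measurable C ->
    P.-negligible (B `\` D) -> P (B `&` C) = P (B `&` D `&` C).
  move=> mB mD mC nBD.
  have -> : B `&` C = (B `&` D `&` C) `|` ((B `\` D) `&` C).
    by apply/seteqP; split => w /=; [case: (pselect (D w)); tauto|tauto].
  rewrite measureU//; last first.
  - by apply/seteqP; split => w //= [[[_ ?] _] [[_ ?] _]].
  - by apply: measurableI => //; exact: measurableD.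
  - by apply: measurableI => //; exact: measurableI.
  rewrite (@measure_negligible _ _ _ P ((B `\` D) `&` C)) ?adde0//.
    by apply: measurableI => //; exact: measurableD.
  by apply: negligibleS nBD => w [].
move=> mE mA mC n.
rewrite (half E A)//; last by apply: negligibleS n => w ?; left.
rewrite (half A E)//; last by apply: negligibleS n => w ?; right.
by rewrite (setIC E).
Qed.

(** The augmented filtration contains all negligible events. Adding the measurable events which
    differ from [G] by a null set keeps a pi-system, so Dynkin's theorem still applies. *)
Definition null_completion (G : set (set T)) : set (set T) :=
  [set E | measurable E /\ exists2 A, G A & null_sym_diff E A].

Lemma sub_null_completion (G : set (set T)) : G `<=` measurable ->
  G `<=` null_completion G.
Proof.
move=> h A GA; split; first exact: h.
by exists A => //; rewrite /null_sym_diff setDv setU0; exact: negligible_set0.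
Qed.

Lemma null_completion_setI (G : set (set T)) : setI_closed G ->
  setI_closed (null_completion G).
Proof.
move=> GI E F [mE [A GA nA]] [mF [B GB nB]]; split; first exact: measurableI.
exists (A `&` B); first exact: GI.
apply: negligibleS (negligibleU nA nB) => w /=.
by case: (pselect (E w)); case: (pselect (F w)); case: (pselect (A w));
  case: (pselect (B w)); tauto.
Qed.

(* The identity P(E & C1) = c P(E & C2) covers both independence (C2 = setT,
   c = P(C1)) and the Markov property (C2 = {e_s = i}, C1 = {e_s = i, e_t = j}). *)
Lemma pi_lambda_ratio (G : set (set T)) (C1 C2 : set T) (c : R) :
  setI_closed G -> G `<=` measurable -> G setT ->
  measurable C1 -> measurable C2 ->
  (forall A, G A -> P (A `&` C1) = (c%:E * P (A `&` C2))%E) ->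
  forall A, <<s null_completion G >> A -> P (A `&` C1) = (c%:E * P (A `&` C2))%E.
Proof.
move=> GI Gm GT mC1 mC2 h.
have h' A : null_completion G A -> P (A `&` C1) = (c%:E * P (A `&` C2))%E.
  move=> [mA [B GB nAB]].
  have mB := Gm _ GB.
  by rewrite (null_sym_diff_measure mA mB mC1 nAB) (null_sym_diff_measure mA mB mC2 nAB) h.
rewrite -(setI_closed_g_dynkin_g_sigma_algebra (null_completion_setI GI)).
have mP A : measurable A -> P A = (fine (P A))%:E.
  by move=> mA; rewrite fineK// fin_num_measure.
suff : <<d null_completion G >> `<=`
    [set A | measurable A /\ P (A `&` C1) = (c%:E * P (A `&` C2))%E].
  by move=> sub A /sub[].
apply: smallest_sub; last by move=> A GA; split; [case: GA|exact: h'].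
split.
- by split => //; apply: h; exact: GT.
- move=> A [mA e]; split; first exact: measurableC.
  have eT : P C1 = (c%:E * P C2)%E by have := h _ GT; rewrite !setTI.
  have sp C : measurable C -> P (~` A `&` C) = (P C - P (A `&` C))%E.
    move=> mC; rewrite setIC -setDE measureD//; last by rewrite -ge0_fin_numE// fin_num_measure.
    by rewrite (setIC C).
  rewrite !sp// e eT muleBr// fin_num_adde_defl// fin_numN fin_num_measure//.
  exact: measurableI.
- move=> F tF hF; split; first by apply: bigcupT_measurable => k; case: (hF k).
  have bc C : measurable C -> P ((\bigcup_k F k) `&` C) = (\sum_(k <oo) P (F k `&` C))%E.
    move=> mC; rewrite setI_bigcupl measure_bigcup//=.
    - by apply: eq_eseriesl => k; rewrite in_setT.
    - by move=> k _; apply: measurableI => //; case: (hF k).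
    - exact: trivIset_setIr.
  rewrite !bc// -nneseriesZl//.
  by apply: eq_eseriesr => k _; case: (hF k).
Qed.

End pi_systems.

(** * The Markov chain, the filtration and the increments of W *)

Section regime_process.
Context {d : measure_display} {T : measurableType d} {R : realType}.
Variable P : probability T R.
Variables (lambda1 lambda2 : R) (W : R -> T -> R) (eps : R -> T -> 'I_2).
Hypotheses (hl1 : 0 < lambda1) (hl2 : 0 < lambda2).
Hypothesis hcompl : measure_is_complete P.
Hypothesis hBM : brownian_motion P W.
Hypothesis hMC : markov_chain P (generator lambda1 lambda2) eps.

Definition sigma_eps : set (set T) :=
  <<s [set E | exists s j, 0 <= s /\ E = [set w | eps s w = j]] >>.

Hypothesis hind : indep P (sigma_of W `[0, +oo[) sigma_eps.

Let sW s := sigma_of W `[0, s].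

Lemma sigma_setI (G : set (set T)) : setI_closed <<s G >>.
Proof. by move=> A B; exact: (@measurableI _ (g_sigma_algebraType G)). Qed.

Lemma sigma_setC (G : set (set T)) (A : set T) : <<s G >> A -> <<s G >> (~` A).
Proof. exact: (@measurableC _ (g_sigma_algebraType G)). Qed.

Lemma sigma_setT (G : set (set T)) : <<s G >> setT.
Proof. exact: (@measurableT _ (g_sigma_algebraType G)). Qed.

Lemma sigma_set0 (G : set (set T)) : <<s G >> set0.
Proof. exact: (@measurable0 _ (g_sigma_algebraType G)). Qed.

Lemma sigma_gen (G : set (set T)) : G `<=` <<s G >>.
Proof. exact: sub_gen_smallest. Qed.

Lemma measurable_W t : 0 <= t -> measurable_fun setT (W t).
Proof. by case: hBM => h _ _ _ _; exact: h. Qed.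

Lemma measurable_preimage (X : T -> R) (B : set R) :
  measurable_fun setT X -> measurable B -> measurable (X @^-1` B).
Proof. by move=> mX mB; rewrite -[X in measurable X]setTI; exact: mX. Qed.

Lemma measurable_eps t j : 0 <= t -> measurable [set w | eps t w = j].
Proof. by case: hMC => h _ _; exact: h. Qed.

Lemma sigma_W_measurable s : sigma_of W `[0, s] `<=` measurable.
Proof.
apply: sigma_measurable => _ [r [B [+ mB ->]]]; rewrite /= in_itv/= => /andP[r0 _].
by apply: measurable_preimage => //; exact: measurable_W.
Qed.

Lemma sigma_eps_measurable : sigma_eps `<=` measurable.
Proof. by apply: sigma_measurable => _ [s [j [s0 ->]]]; exact: measurable_eps. Qed.

Lemma sigma_W_all s : sigma_of W `[0, s] `<=` sigma_of W `[0, +oo[.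
Proof.
apply: sub_sigma => _ [r [B [+ mB ->]]]; rewrite /= in_itv/= => /andP[r0 _].
by apply: sigma_gen; exists r, B; split => //=; rewrite in_itv/= r0.
Qed.

(* The information of [F_s] together with the whole path of the chain: the
   increments of [W] after [s] are still independent of it. *)
Definition rich s : set (set T) :=
  <<s null_completion P [set D | exists A B, [/\ sW s A, sigma_eps B & D = A `&` B]] >>.

Let prod_setI s : setI_closed [set D | exists A B, [/\ sW s A, sigma_eps B & D = A `&` B]].
Proof.
move=> _ _ [A [B [hA hB ->]]] [A' [B' [hA' hB' ->]]].
exists (A `&` A'), (B `&` B'); split; [exact: sigma_setI|exact: sigma_setI|].
by rewrite setIACA.
Qed.

Let prod_measurable s :
  [set D | exists A B, [/\ sW s A, sigma_eps B & D = A `&` B]] `<=` measurable.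
Proof.
move=> _ [A [B [hA hB ->]]]; apply: measurableI.
  exact: sigma_W_measurable hA.
exact: sigma_eps_measurable.
Qed.

Lemma rich_measurable s : rich s `<=` measurable.
Proof. by apply: sigma_measurable => A []. Qed.

Lemma rich_eps s r j : 0 <= r -> rich s [set w | eps r w = j].
Proof.
move=> r0; apply: sigma_gen; apply: sub_null_completion; first exact: prod_measurable.
exists setT, [set w | eps r w = j]; split; rewrite ?setTI//; first exact: sigma_setT.
by apply: sigma_gen; exists r, j.
Qed.

Lemma aug_sub_rich s : 0 <= s -> augmented_filtration P W eps s `<=` rich s.
Proof.
move=> s0; apply: sub_sigma => E [[|]|].
- move=> [r [B [/andP[r0 rs] mB ->]]].
  apply: sigma_gen; apply: sub_null_completion; first exact: prod_measurable.
  exists (W r @^-1` B), setT; split; rewrite ?setIT//; last exact: sigma_setT.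
  by apply: sigma_gen; exists r, B; split => //=; rewrite in_itv/= r0.
- by move=> [r [j [/andP[r0 rs] ->]]]; exact: rich_eps.
- move=> nE; apply: sigma_gen; split; first exact: hcompl.
  exists set0; last by rewrite /null_sym_diff setD0 set0D setU0.
  by exists set0, set0; split; rewrite ?set0I//; exact: sigma_set0.
Qed.

Lemma aug_measurable s : 0 <= s -> augmented_filtration P W eps s `<=` measurable.
Proof. by move=> s0 A /(aug_sub_rich s0); exact: rich_measurable. Qed.

(** On a rectangle A & B the event A & {increment in C} still belongs to the sigma-field of W.
    Independence of W and the chain splits off B, then independence of increments splits off A. *)
Lemma rich_indep (s t : R) (E : set T) (C : set R) : 0 <= s -> s < t -> rich s E ->
  measurable C ->
  P (E `&` (W t \- W s)%R @^-1` C) = (P E * P ((W t \- W s)%R @^-1` C))%E.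
Proof.
move=> s0 st hE mC.
have t0 : 0 <= t by rewrite (le_trans s0)// ltW.
have mD : measurable_fun setT (W t \- W s)%R.
  by apply: measurable_funB; exact: measurable_W.
have mDC : measurable ((W t \- W s)%R @^-1` C) by exact: measurable_preimage.
pose c := fine (P ((W t \- W s)%R @^-1` C)).
have cE : P ((W t \- W s)%R @^-1` C) = c%:E by rewrite fineK// fin_num_measure.
have [_ _ _ _ hBMi] := hBM.
rewrite muleC cE -[X in (_ * P X)%E](setIT E).
apply: pi_lambda_ratio hE => //.
- by exists setT, setT; split; rewrite ?setIT//; exact: sigma_setT.
- move=> _ [A [B [hA hB ->]]].
  have hAC : sigma_of W `[0, +oo[ (A `&` (W t \- W s)%R @^-1` C).
    apply: sigma_setI; first exact: sigma_W_all hA.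
    pose G := events_of W `[0, +oo[.
    have mWG r : 0 <= r -> @measurable_fun _ _ (g_sigma_algebraType G) R setT (W r).
      move=> r0 _ D mDD; rewrite setTI; apply: sigma_gen.
      by exists r, D; split => //=; rewrite in_itv/= r0.
    have := @measurable_funB _ (g_sigma_algebraType G) R setT (W t) (W s) (mWG _ t0) (mWG _ s0).
    by move=> /(_ measurableT C mC); rewrite setTI.
  have e1 : P (A `&` (W t \- W s)%R @^-1` C) = (P A * c%:E)%E.
    rewrite -cE; apply: (hBMi s t s0 st) => //.
    by exists C; rewrite ?setTI.
  have e2 : P (A `&` B) = (P A * P B)%E by apply: hind => //; exact: sigma_W_all hA.
  rewrite setIT setIAC hind// e1 e2 -muleA muleCA.
  by rewrite muleA.
Qed.

Lemma measurable_wrt_measurable (G : set (set T)) (X : T -> R) :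
  G `<=` measurable -> measurable_wrt G X -> measurable_fun setT X.
Proof. by move=> h hX _ B mB; rewrite setTI; apply: h; exact: hX. Qed.

Lemma indepRV_incr (s t : R) (X : T -> R) : 0 <= s -> s < t -> measurable_wrt (rich s) X ->
  indepRV P X (W t \- W s)%R.
Proof. by move=> s0 st hX A B mA mB; apply: rich_indep => //; exact: hX. Qed.

Let C2 (s : R) (i : 'I_2) := [set w | eps s w = i].

Let path_event (S : seq (R * 'I_2)) : set T := [set w | forall p, p \in S -> eps p.1 w = p.2].

(** The finite-dimensional law of the chain is stated along a sorted sequence of times starting at
    0. The observations in [S] are therefore sorted and completed by an initial state [j0], and the
    two possible initial states are summed at the end. *)
Let markov_path (S : seq (R * 'I_2)) s t i j : 0 <= s -> s <= t ->
  (forall p, p \in S -> 0 <= p.1 <= s) ->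
  P (path_event S `&` (C2 s i `&` C2 t j)) =
  ((expmx ((t - s) *: generator lambda1 lambda2) i j)%:E * P (path_event S `&` C2 s i))%E.
Proof.
move=> s0 st hS.
have [_ _ hfd] := hMC.
pose le1 (p q : R * 'I_2) := p.1 <= q.1.
have le1_total : total le1 by move=> p q; exact: le_total.
have le1_trans : transitive le1 by move=> p q r; exact: le_trans.
pose L j0 := (0, j0) :: rcons (sort le1 S) (s, i).
have sL j0 : sorted le1 (L j0).
  rewrite sorted_pairwise// /L pairwise_cons pairwise_rcons -sorted_pairwise//.
  rewrite sort_sorted// andbT; apply/andP; split.
    by apply/allP => p; rewrite mem_rcons inE mem_sort => /predU1P[->//|/hS/andP[]].
  by apply/allP => p; rewrite mem_sort => /hS/andP[].
have LE j0 p : (p \in L j0) = [|| p == (0, j0), p == (s, i) | p \in S].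
  by rewrite inE mem_rcons inE mem_sort.
have lastL j0 : nth (t, j) (L j0) (size (sort le1 S)).+1 = (s, i).
  by rewrite /L /= nth_rcons ltnn eqxx.
(* The default value (t, j) of [nth] plays the role of the last observation: the index [n.+2] lies
   just past the list. *)
pose tt j0 k := (nth (t, j) (L j0) k).1.
pose jj j0 k := (nth (t, j) (L j0) k).2.
have szL j0 : size (L j0) = (size (sort le1 S)).+2 by rewrite /= size_rcons.
set n := size (sort le1 S) in lastL szL.
have ttle j0 k : tt j0 k <= t.
  rewrite /tt; case: (ltnP k (size (L j0))) => hk; last by rewrite nth_default.
  have := mem_nth (t, j) hk; rewrite LE => /or3P[/eqP->|/eqP->|/hS/andP[_ h]] //=.
    exact: le_trans st.
  exact: le_trans st.
have ttmono j0 k : tt j0 k <= tt j0 k.+1.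
  case: (ltnP k.+1 (size (L j0))) => hk.
    by move/sortedP : (sL j0); move=> /(_ (t, j)) /(_ k hk).
  by rewrite [leRHS]/tt nth_default.
have pathE j0 m : (n.+1 <= m <= n.+2)%N ->
    P [set w | forall k, (k <= m)%N -> eps (tt j0 k) w = jj j0 k] =
    P (path_event (L j0) `&` (if m == n.+2 then C2 t j else setT)).
  move=> /andP[m1 m2]; congr (P _); apply/seteqP; split => w /=.
    move=> h; split.
      move=> p /(nthP (t, j))[k]; rewrite szL ltnS => kn <-.
      by apply: h; exact: leq_trans m1.
    case: eqP => // mE; rewrite /C2 /=.
    by have := h n.+2; rewrite mE leqnn => /(_ isT); rewrite /tt /jj nth_default ?szL.
  move=> [h1 h2] k km; case: (ltnP k n.+2) => hk.
    by apply: h1; apply: mem_nth; rewrite szL.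
  have kE : k = n.+2 by apply/eqP; rewrite eqn_leq hk (leq_trans km m2).
  have mE : m = n.+2 by apply/eqP; rewrite eqn_leq m2 -kE km.
  by rewrite mE eqxx in h2; rewrite kE /tt /jj nth_default ?szL.
have key j0 : P (path_event (L j0) `&` C2 t j) =
   ((expmx ((t - s) *: generator lambda1 lambda2) i j)%:E * P (path_event (L j0)))%E.
  have := pathE j0 n.+2; rewrite leqnn leqnSn eqxx => /(_ isT) <-.
  have := pathE j0 n.+1; rewrite leqnn leqnSn (ltn_eqF (ltnSn _)) setIT => /(_ isT) <-.
  rewrite !hfd//; try by [].
  rewrite big_ord_recr/= EFinM muleA muleC; congr (_ * _)%E.
  by rewrite /tt /jj lastL nth_default ?szL.
have path_measurable S' : (forall p, p \in S' -> 0 <= p.1) -> measurable (path_event S').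
  elim: S' => [|p S' IH] h.
    by rewrite (_ : path_event _ = setT)//; apply/seteqP; split.
  rewrite (_ : path_event _ = [set w | eps p.1 w = p.2] `&` path_event S').
    apply: measurableI; first by apply: measurable_eps; apply: h; rewrite mem_head.
    by apply: IH => q qS; apply: h; rewrite inE qS orbT.
  apply/seteqP; split => w /=.
    by move=> hw; split=> [|q qS]; apply: hw; rewrite ?mem_head// inE qS orbT.
  by move=> [h1' h2'] q; rewrite inE => /predU1P[->//|]; exact: h2'.
have mL j0 : measurable (path_event (L j0)).
  apply: path_measurable => p; rewrite LE => /or3P[/eqP->|/eqP->|/hS/andP[]]//.
have dec (A : set T) : measurable A ->
    P (path_event S `&` C2 s i `&` A) =
    (P (path_event (L ord0) `&` A) + P (path_event (L ord_max) `&` A))%E.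
  move=> mA; rewrite -measureU//.
  - rewrite -setIUl; congr (P (_ `&` _)); apply/seteqP; split => w /=.
      move=> [hw hi].
      have [h0|h0] : eps 0 w = ord0 \/ eps 0 w = ord_max.
        by case: (eps 0 w) => -[|[|]]// q; [left|right]; exact: val_inj.
      + by left => p; rewrite LE => /or3P[/eqP->|/eqP->|/hw].
      + by right => p; rewrite LE => /or3P[/eqP->|/eqP->|/hw].
    by case=> hw; split => [p pS|]; [apply: hw; rewrite LE pS !orbT|
      apply: (hw (s, i)); rewrite LE eqxx orbT|apply: hw; rewrite LE pS !orbT|
      apply: (hw (s, i)); rewrite LE eqxx orbT].
  - exact: measurableI.
  - exact: measurableI.
  - apply/seteqP; split => w //= [[hw _] [hw' _]].
    have := hw (0, ord0); rewrite LE eqxx => /(_ isT) /= e1.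
    have := hw' (0, ord_max); rewrite LE eqxx => /(_ isT) /= e2.
    by move: e1; rewrite e2.
have t0 : 0 <= t by exact: le_trans st.
have mC : measurable (C2 t j) by exact: measurable_eps.
rewrite setIA dec//.
have := dec _ measurableT; rewrite !setIT => ->.
by rewrite !key -ge0_muleDr// measure_ge0.
Qed.

(** The events A & B, with A determined by W up to s and B a finite path event up to s, form a
    pi-system which generates F_s up to null sets. On them independence removes A, and [markov_path]
    treats B. *)
Lemma markov_aug (s t : R) i j (E : set T) : 0 <= s -> s <= t ->
  augmented_filtration P W eps s E ->
  P (E `&` ([set w | eps s w = i] `&` [set w | eps t w = j])) =
  ((expmx ((t - s) *: generator lambda1 lambda2) i j)%:E * P (E `&` [set w | eps s w = i]))%E.
Proof.
move=> s0 st hE.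
have t0 : 0 <= t by exact: le_trans st.
pose inS (S : seq (R * 'I_2)) := forall p : R * 'I_2, p \in S -> 0 <= p.1 <= s.
pose G := [set D | exists A B, [/\ sW s A, B = set0 \/ (exists2 S, inS S & B = path_event S)
   & D = A `&` B]].
have path_eps S : inS S -> sigma_eps (path_event S).
  elim: S => [|p S IH] h.
    by rewrite (_ : path_event _ = setT); [exact: sigma_setT|apply/seteqP; split].
  rewrite (_ : path_event _ = [set w | eps p.1 w = p.2] `&` path_event S).
    apply: sigma_setI.
      by apply: sigma_gen; exists p.1, p.2; split => //; have /andP[] := h p (mem_head _ _).
    by apply: IH => q qS; apply: h; rewrite inE qS orbT.
  apply/seteqP; split => w /=.
    by move=> hw; split=> [|q qS]; apply: hw; rewrite ?mem_head// inE qS orbT.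
  by move=> [h1' h2'] q; rewrite inE => /predU1P[->//|]; exact: h2'.
have Geps B : B = set0 \/ (exists2 S, inS S & B = path_event S) -> sigma_eps B.
  by move=> [->|[S hS ->]]; [exact: sigma_set0|exact: path_eps].
have GI : setI_closed G.
  move=> _ _ [A [B [hA hB ->]]] [A' [B' [hA' hB' ->]]].
  exists (A `&` A'), (B `&` B'); split; [exact: sigma_setI| |by rewrite setIACA].
  case: hB => [->|[S hS ->]]; first by left; rewrite set0I.
  case: hB' => [->|[S' hS' ->]]; first by left; rewrite setI0.
  right; exists (S ++ S').
    by move=> p; rewrite mem_cat => /orP[/hS|/hS'].
  apply/seteqP; split => w /=.
    by move=> [h1' h2'] p; rewrite mem_cat => /orP[/h1'|/h2'].
  by move=> h; split=> p pS; apply: h; rewrite mem_cat pS ?orbT.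
have Gm : G `<=` measurable.
  move=> _ [A [B [hA /Geps hB ->]]]; apply: measurableI.
    exact: sigma_W_measurable hA.
  exact: sigma_eps_measurable.
have nilE : path_event [::] = setT by apply/seteqP; split.
apply: (@pi_lambda_ratio _ _ _ P G) => //.
- by exists setT, setT; split; rewrite ?setIT//; [exact: sigma_setT|right; exists [::]].
- by apply: measurableI; exact: measurable_eps.
- exact: measurable_eps.
- move=> _ [A [B [hA hB ->]]].
  have ee r k : 0 <= r -> sigma_eps [set w | eps r w = k].
    by move=> r0; apply: sigma_gen; exists r, k.
  have hAll := sigma_W_all hA.
  have hBe := Geps _ hB.
  have h1' : sigma_eps (B `&` [set w | eps s w = i]) by apply: sigma_setI => //; exact: ee.
  have h2' : sigma_eps (B `&` ([set w | eps s w = i] `&` [set w | eps t w = j])).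
    by apply: sigma_setI => //; apply: sigma_setI; exact: ee.
  rewrite -!setIA (hind hAll h1') (hind hAll h2') muleCA; congr (_ * _)%E.
  case: hB => [->|[S hS ->]]; first by rewrite !set0I !measure0 mule0.
  exact: markov_path.
- apply: sub_sigma hE => D [[|]|].
  + move=> [r [B [/andP[r0 rs] mB ->]]].
    apply: sigma_gen; apply: sub_null_completion => //.
    exists (W r @^-1` B), setT; split; rewrite ?setIT//; last by right; exists [::].
    by apply: sigma_gen; exists r, B; split => //=; rewrite in_itv/= r0.
  + move=> [r [k [/andP[r0 rs] ->]]].
    apply: sigma_gen; apply: sub_null_completion => //.
    exists setT, [set w | eps r w = k]; split; rewrite ?setTI//; first exact: sigma_setT.
    right; exists [:: (r, k)].
      by move=> p; rewrite inE => /eqP ->; rewrite r0.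
    by apply/seteqP; split => w /= h; [move=> p; rewrite inE => /eqP ->|exact: (h (r, k) (mem_head _ _))].
  + move=> nE; apply: sigma_gen; split; first exact: hcompl.
    exists set0; last by rewrite /null_sym_diff setD0 set0D setU0.
    by exists set0, set0; split; rewrite ?set0I//; [exact: sigma_set0|left].
Qed.

End regime_process.

(** * Moments of Brownian increments against the past *)

Section increments.
Context {d : measure_display} {T : measurableType d} {R : realType}.
Variable P : probability T R.
Variables (lambda1 lambda2 : R) (W : R -> T -> R) (eps : R -> T -> 'I_2).
Hypotheses (hl1 : 0 < lambda1) (hl2 : 0 < lambda2).
Hypothesis hcompl : measure_is_complete P.
Hypothesis hBM : brownian_motion P W.
Hypothesis hMC : markov_chain P (generator lambda1 lambda2) eps.
Hypothesis hind : indep P (sigma_of W `[0, +oo[) (sigma_eps eps).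
Local Notation rich := (rich P W eps).

Lemma rich_mono (s t : R) : s <= t -> rich s `<=` rich t.
Proof.
move=> st; apply: sub_sigma => E [mE [D [A [B [hA hB ->]]] n]].
apply: sigma_gen; split => //; exists (A `&` B) => //.
exists A, B; split => //; apply: sub_sigma hA => _ [r [C [+ mC ->]]].
rewrite /= in_itv/= => /andP[r0 rs].
by apply: sigma_gen; exists r, C; split => //=; rewrite in_itv/= r0 (le_trans rs).
Qed.

Lemma measurable_wrtP (G : set (set T)) (X : T -> R) :
  measurable_wrt <<s G >> X <-> @measurable_fun _ _ (g_sigma_algebraType G) R setT X.
Proof.
split=> h; first by move=> _ B mB; rewrite setTI; exact: h.
by move=> B mB; have := h measurableT B mB; rewrite setTI.
Qed.

Lemma measurable_wrt_sub (G H : set (set T)) (X : T -> R) : G `<=` H ->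
  measurable_wrt G X -> measurable_wrt H X.
Proof. by move=> GH h B mB; apply: GH; exact: h. Qed.

Lemma rich_W (s t : R) : 0 <= s -> s <= t -> measurable_wrt (rich t) (W s).
Proof.
move=> s0 st B mB; apply: (aug_sub_rich hcompl hBM hMC (le_trans s0 st)).
by apply: sigma_gen; left; left; exists s, B; split => //; rewrite s0.
Qed.

Lemma measurable_wrtM (G : set (set T)) (X Y : T -> R) : measurable_wrt <<s G >> X ->
  measurable_wrt <<s G >> Y -> measurable_wrt <<s G >> (fun w => X w * Y w).
Proof. by move=> /measurable_wrtP hX /measurable_wrtP hY; apply/measurable_wrtP; exact: measurable_funM. Qed.

Lemma measurable_wrtB (G : set (set T)) (X Y : T -> R) : measurable_wrt <<s G >> X ->
  measurable_wrt <<s G >> Y -> measurable_wrt <<s G >> (fun w => X w - Y w).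
Proof. by move=> /measurable_wrtP hX /measurable_wrtP hY; apply/measurable_wrtP; exact: measurable_funB. Qed.

Lemma measurable_wrtD (G : set (set T)) (X Y : T -> R) : measurable_wrt <<s G >> X ->
  measurable_wrt <<s G >> Y -> measurable_wrt <<s G >> (fun w => X w + Y w).
Proof. by move=> /measurable_wrtP hX /measurable_wrtP hY; apply/measurable_wrtP; exact: measurable_funD. Qed.

Lemma measurable_wrt_cst (G : set (set T)) (k : R) : measurable_wrt <<s G >> (cst k).
Proof. by apply/measurable_wrtP; exact: measurable_cst. Qed.

Lemma measurable_wrt_comp (G : set (set T)) (X : T -> R) (f : R -> R) :
  measurable_fun setT f -> measurable_wrt <<s G >> X -> measurable_wrt <<s G >> (f \o X).
Proof.
by move=> mf hX B mB; have := mf measurableT B mB; rewrite setTI => /hX.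
Qed.

Lemma measurable_wrt_indic (G : set (set T)) (A : set T) : <<s G >> A ->
  measurable_wrt <<s G >> (\1_A : T -> R).
Proof.
by move=> hA; apply/measurable_wrtP; exact: (@measurable_indic _ (g_sigma_algebraType G)).
Qed.

Lemma measurable_wrt_regime (G : set (set T)) (a1 a2 : R) s :
  (forall j, <<s G >> [set w | eps s w = j]) ->
  measurable_wrt <<s G >> (fun w => by_regime a1 a2 (eps s w)).
Proof.
move=> h; rewrite (_ : (fun w => _) = fun w =>
   a1 * \1_[set w | eps s w = ord0] w + a2 * \1_[set w | eps s w = ord_max] w).
  by apply: measurable_wrtD; apply: measurable_wrtM;
    try exact: measurable_wrt_cst; exact: measurable_wrt_indic.
apply/funext => w; rewrite !indicE.
have [e|e] := I2_cases (eps s w); rewrite e /by_regime ?eqxx.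
- by rewrite mem_set// memNset /= ?e// mulr1 mulr0 addr0.
- by rewrite memNset /= ?e// mem_set//= mulr1 mulr0 add0r.
Qed.

Lemma rich_measurable_fun (s : R) (X : T -> R) : measurable_wrt (rich s) X -> measurable_fun setT X.
Proof. by apply: measurable_wrt_measurable; exact: rich_measurable. Qed.

Lemma integrableR_bddM (Y X : T -> R) (M : R) : measurable_fun setT Y ->
  (forall w, `|Y w| <= M) -> integrableR P X -> integrableR P (fun w => Y w * X w).
Proof.
move=> mY hM iX; apply: (@integrableR_le _ _ _ _ _ (fun w => M * `|X w|)).
- by apply: measurable_funM => //; exact: integrableR_measurable iX.
- by apply: integrableRZ; exact: integrableR_norm.
- by move=> w; rewrite normrM ler_wpM2r.
Qed.

Section one_increment.
Variables (s t : R).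
Hypotheses (s0 : 0 <= s) (st : s < t).

Let t0 : 0 <= t. Proof. by rewrite (le_trans s0)// ltW. Qed.
Let mD : measurable_fun setT (fun w => W t w - W s w).
Proof. by apply: measurable_funB; apply: (measurable_W hBM). Qed.
Let q : R := Num.sqrt (t - s).
Let q0 : 0 < q. Proof. by rewrite sqrtr_gt0 subr_gt0. Qed.

Lemma integral_incr (f : R -> R) : measurable_fun setT f -> (forall x, 0 <= f x) ->
  (\int[P]_w (f (W t w - W s w))%:E = \int[normal_prob 0%R q]_x (f x)%:E)%E.
Proof.
move=> mf f0.
have mD' : @measurable_fun _ _ T (measurableTypeR R) setT (fun w => W t w - W s w) by exact: mD.
have mf' : @measurable_fun _ _ (measurableTypeR R) R setT f by exact: mf.
pose Dm : {mfun T >-> measurableTypeR R} :=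
  HB.pack (fun w => W t w - W s w : measurableTypeR R) (isMeasurableFun.Build _ _ _ _ _ mD').
transitivity (\int[distribution P Dm]_x (f x)%:E)%E.
  by rewrite ge0_integral_distribution//; exact/measurable_EFinP.
apply: eq_measure_integral => A mA _.
by have [_ _ _ + _] := hBM; apply.
Qed.

Lemma incr_sq : (\int[P]_w ((W t w - W s w) ^+ 2)%:E = (t - s)%:E)%E.
Proof.
rewrite (@integral_incr (fun x => x ^+ 2)); last 2 first.
- exact: exprn_measurable.
- by move=> x; exact: sqr_ge0.
by rewrite normal_second_moment// sqr_sqrtr// subr_ge0 ltW.
Qed.

Lemma incr_cube : (\int[P]_w (`|W t w - W s w| ^+ 3)%:E <= (4 * q ^+ 3)%:E)%E.
Proof.
rewrite (@integral_incr (fun x => `|x| ^+ 3)).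
- exact: normal_third_moment.
- by apply: measurable_funX; exact: normr_measurable.
- by move=> x; rewrite exprn_ge0.
Qed.

Lemma integrable_incr_sq : integrableR P (fun w => (W t w - W s w) ^+ 2).
Proof.
apply/integrableR_ge0P => [|w|]; [exact: measurable_funX|exact: sqr_ge0|].
by rewrite incr_sq ltry.
Qed.

Lemma integrable_incr : integrableR P (fun w => W t w - W s w).
Proof.
apply: (@integrableR_le _ _ _ _ _ (fun w => 1 + (W t w - W s w) ^+ 2)) => //.
  by apply: integrableRD; [exact: integrableR_cst|exact: integrable_incr_sq].
move=> w; set x := W t w - W s w.
have := sqr_ge0 (`|x| - 1); rewrite sqrrB1 real_normK ?num_real//.
by have := normr_ge0 x; lra.
Qed.

Lemma mean_incr : \int[P]_w (W t w - W s w) = 0.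
Proof.
have mpos : measurable_fun setT (fun x : R => Num.max x 0).
  by apply: measurable_maxr => //; exact: measurable_id.
have mneg : measurable_fun setT (fun x : R => Num.max (- x) 0).
  by apply: measurable_maxr => //; exact: oppr_measurable.
have [e1 e2] := normal_mean_parts q0.
have {}e1 : (\int[P]_w (Num.max (W t w - W s w) 0)%:E =
    (q ^+ 2 * normal_pdf 0 q 0)%:E)%E.
  rewrite (@integral_incr (fun x => Num.max x 0))//.
  by move=> x; rewrite le_max lexx orbT.
have {}e2 : (\int[P]_w (Num.max (- (W t w - W s w)) 0)%:E =
    (q ^+ 2 * normal_pdf 0 q 0)%:E)%E.
  rewrite (@integral_incr (fun x => Num.max (- x) 0))//.
  by move=> x; rewrite le_max lexx orbT.
have i1 : integrableR P (fun w => Num.max (W t w - W s w) 0).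
  apply/integrableR_ge0P; [exact: (measurableT_comp mpos)| |by rewrite e1 ltry].
  by move=> x; rewrite le_max lexx orbT.
have i2 : integrableR P (fun w => Num.max (- (W t w - W s w)) 0).
  apply/integrableR_ge0P; [exact: (measurableT_comp mneg)| |by rewrite e2 ltry].
  by move=> x; rewrite le_max lexx orbT.
transitivity (\int[P]_w (Num.max (W t w - W s w) 0 - Num.max (- (W t w - W s w)) 0)).
  apply: eq_Rintegral => w _; case: (leP 0 (W t w - W s w)) => x0.
    by rewrite max_r ?oppr_le0// subr0.
  by rewrite max_l ?oppr_ge0 ?ltW// opprK add0r.
by rewrite RintegralB// /Rintegral e1 e2 subrr.
Qed.

Lemma indep_incr (Y : T -> R) (f : R -> R) : measurable_fun setT f ->
  measurable_wrt (rich s) Y -> integrableR P Y ->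
  integrableR P (fun w => f (W t w - W s w)) ->
  integrableR P (fun w => Y w * f (W t w - W s w)) /\
  \int[P]_w (Y w * f (W t w - W s w)) = \int[P]_w Y w * \int[P]_w f (W t w - W s w).
Proof.
move=> mf mY iY iX.
have h : indepRV P Y (fun w => f (W t w - W s w)).
  have := indepRV_incr hBM hMC hind s0 st mY.
  exact: (indepRV_comp (@measurable_id _ R setT) mf).
by split; [exact: integrableR_indep|exact: Rintegral_indep].
Qed.

End one_increment.

Lemma integrable_mean_incr (s t : R) (Y : T -> R) : 0 <= s -> s <= t ->
  measurable_wrt (rich s) Y -> integrableR P Y ->
  integrableR P (fun w => Y w * (W t w - W s w)) /\
  \int[P]_w (Y w * (W t w - W s w)) = 0.
Proof.
move=> s0; rewrite le_eqVlt => /predU1P[<-|st] mY iY.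
  rewrite (_ : (fun w => Y w * _) = cst 0); last by apply/funext => w; rewrite subrr mulr0.
  by split; [exact: integrableR_cst|rewrite Rintegral_cst// mul0r].
have [i e] := @indep_incr s t s0 st Y id (@measurable_id _ R setT) mY iY (integrable_incr s0 st).
by split => //; rewrite e mean_incr// mulr0.
Qed.

Lemma integrable_sq_incr (s t : R) : 0 <= s -> s <= t ->
  integrableR P (fun w => (W t w - W s w) ^+ 2).
Proof.
move=> s0; rewrite le_eqVlt => /predU1P[<-|st]; last exact: integrable_incr_sq.
rewrite (_ : (fun w => _) = cst 0); first exact: integrableR_cst.
by apply/funext => w; rewrite subrr expr0n.
Qed.

Lemma sq_incr (s t : R) (Y : T -> R) : 0 <= s -> s <= t ->
  measurable_wrt (rich s) Y -> integrableR P Y ->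
  integrableR P (fun w => Y w * (W t w - W s w) ^+ 2) /\
  \int[P]_w (Y w * (W t w - W s w) ^+ 2) = (t - s) * \int[P]_w Y w.
Proof.
move=> s0; rewrite le_eqVlt => /predU1P[<-|st] mY iY.
  rewrite (_ : (fun w => Y w * _) = cst 0); last by apply/funext => w; rewrite subrr expr0n mulr0.
  by split; [exact: integrableR_cst|rewrite Rintegral_cst// mul0r subrr mul0r].
have [i e] := @indep_incr s t s0 st Y (fun x => x ^+ 2) (@exprn_measurable R setT 2) mY iY
  (integrable_incr_sq s0 st).
by split => //; rewrite e [X in _ * X]/Rintegral incr_sq//= mulrC.
Qed.

Lemma integrable_incr_prod (Y : T -> R) (M a b c e : R) : measurable_fun setT Y ->
  (forall w, `|Y w| <= M) -> 0 <= a -> a <= b -> 0 <= c -> c <= e ->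
  integrableR P (fun w => Y w * ((W b w - W a w) * (W e w - W c w))).
Proof.
move=> mY hM a0 ab c0 ce; apply: (integrableR_bddM mY hM).
have mW u : 0 <= u -> measurable_fun setT (W u) by exact: (measurable_W hBM).
apply: (@integrableR_le _ _ _ _ _ (fun w => (W b w - W a w) ^+ 2 + (W e w - W c w) ^+ 2)).
- have b0 := le_trans a0 ab; have e0 := le_trans c0 ce.
  by apply: measurable_funM; apply: measurable_funB; exact: mW.
- by apply: integrableRD; exact: integrable_sq_incr.
- move=> w; set x := W b w - W a w; set y := W e w - W c w.
  have := sqr_ge0 (`|x| - `|y|); rewrite sqrrB !real_normK ?num_real// normrM.
  by have := mulr_ge0 (normr_ge0 x) (normr_ge0 y); rewrite -mulr_natr; lra.
Qed.

(** Length of the intersection of ]a, b] and ]c, e]. *)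
Definition overlap (a b c e : R) : R := Num.max 0 (Num.min b e - Num.max a c).

(** With a <= c both increments are cut at c and at the first of b and e. Only the square of the
    common piece has a mean; every other product contains an increment that lies after all its
    remaining factors. *)
Lemma incr_covariance (xi eta : T -> R) (M a b c e : R) :
  0 <= a -> a <= b -> 0 <= c -> c <= e ->
  measurable_wrt (rich a) xi -> measurable_wrt (rich c) eta ->
  (forall w, `|xi w| <= M) -> (forall w, `|eta w| <= M) ->
  \int[P]_w ((xi w * eta w) * ((W b w - W a w) * (W e w - W c w))) =
  overlap a b c e * \int[P]_w (xi w * eta w).
Proof.
wlog ac : xi eta a b c e / a <= c => [hw|] a0 ab c0 ce mxi meta hxi heta.
  case: (leP a c) => ac; first exact: hw.
  have := hw eta xi c e a b (ltW ac) c0 ce a0 ab meta mxi heta hxi.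
  have -> : overlap c e a b = overlap a b c e by rewrite /overlap (maxC c) (minC e).
  rewrite (_ : \int[P]_w (eta w * xi w) = \int[P]_w (xi w * eta w)) => [<-|].
    by apply: eq_Rintegral => w _; ring.
  by apply: eq_Rintegral => w _; rewrite mulrC.
have M0 : 0 <= M.
  have [w _] : [set: T] !=set0.
    apply/set0P; apply/eqP => T0; have := @probability_setT _ _ _ P.
    by rewrite T0 measure0 => /eqP; rewrite eq_sym onee_eq0.
  exact: le_trans (hxi w).
have mxc : measurable_wrt (rich c) xi by apply: measurable_wrt_sub mxi; exact: rich_mono.
have mxe := measurable_wrtM mxc meta.
have hxe w : `|xi w * eta w| <= M * M by rewrite normrM ler_pM.
have ixe : integrableR P (fun w => xi w * eta w).
  by apply: (@integrableR_bounded _ _ _ P _ (M * M)) => //; exact: rich_measurable_fun mxe.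
have mW u v : 0 <= u -> u <= v -> measurable_wrt (rich v) (W u) by exact: rich_W.
have iinc u v : 0 <= u -> u <= v -> integrableR P (fun w => W v w - W u w).
  move=> u0; rewrite le_eqVlt => /predU1P[<-|uv]; last exact: integrable_incr.
  rewrite (_ : (fun w => _) = cst 0); first exact: integrableR_cst.
  by apply/funext => w; rewrite subrr.
rewrite /overlap (max_r ac).
case: (leP b c) => bc.
  rewrite max_l; last by rewrite subr_le0 ge_min bc.
  rewrite mul0r.
  have [_ <-] := @integrable_mean_incr c e (fun w => xi w * eta w * (W b w - W a w)) c0 ce
    (measurable_wrtM mxe (measurable_wrtB (mW _ _ (le_trans a0 ab) bc) (mW _ _ a0 ac)))
    (integrableR_bddM (rich_measurable_fun mxe) hxe (iinc _ _ a0 ab)).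
  by apply: eq_Rintegral => w _; ring.
(* W at [m] and W at [K] are W at [b] and W at [e] in some order. The product (W_b - W_c)(W_e - W_c)
   is symmetric in b and e, so it can be rewritten in terms of [m] and [K] in both cases at once. *)
pose m := Num.min b e; pose K := Num.max b e.
have cm : c <= m by rewrite le_min ce ltW.
have mK : m <= K by rewrite /m /K; case: (leP b e) => // /ltW.
have m0 : 0 <= m by exact: le_trans cm.
rewrite (max_r _ : Num.max 0 (m - c) = m - c) ?subr_ge0//.
have mxm : measurable_wrt (rich m) (fun w => xi w * eta w).
  by apply: measurable_wrt_sub mxe; exact: rich_mono.
have [i1 e1] := @integrable_mean_incr c e (fun w => xi w * eta w * (W c w - W a w)) c0 ce
    (measurable_wrtM mxe (measurable_wrtB (mW _ _ c0 (lexx c)) (mW _ _ a0 ac)))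
    (integrableR_bddM (rich_measurable_fun mxe) hxe (iinc _ _ a0 ac)).
have [i2 e2] := @sq_incr c m (fun w => xi w * eta w) c0 cm mxe ixe.
have [i3 e3] := @integrable_mean_incr m K (fun w => xi w * eta w * (W m w - W c w)) m0 mK
    (measurable_wrtM mxm (measurable_wrtB (mW _ _ m0 (lexx m)) (mW _ _ c0 cm)))
    (integrableR_bddM (rich_measurable_fun mxm) hxe (iinc _ _ c0 cm)).
transitivity (\int[P]_w (xi w * eta w * (W c w - W a w) * (W e w - W c w) +
   (xi w * eta w * (W m w - W c w) ^+ 2 +
   xi w * eta w * (W m w - W c w) * (W K w - W m w)))).
  apply: eq_Rintegral => w _.
  have : W m w + W K w = W b w + W e w.
    by rewrite /m /K; case: (leP b e) => _; ring.
  have : W m w * W K w = W b w * W e w.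
    by rewrite /m /K; case: (leP b e) => _; ring.
  set p := W m w; set r := W K w => h1 h2.
  have -> : xi w * eta w * ((W b w - W a w) * (W e w - W c w)) = xi w * eta w *
    ((W c w - W a w) * (W e w - W c w) + (W b w * W e w - W c w * (W b w + W e w) + W c w ^+ 2)).
    by ring.
  by rewrite -h1 -h2; ring.
rewrite RintegralD//; last exact: integrableRD.
by rewrite RintegralD// e1 e2 e3 add0r addr0.
Qed.

End increments.

(** * The stochastic integral over a short interval *)

Section double_integral.
Context {d : measure_display} {T : measurableType d} {R : realType}.
Variable P : probability T R.
Notation mu := (@lebesgue_measure R).
Implicit Types f g : T * measurableTypeR R -> R.

Definition dint (A : set R) f : \bar R := (\int[P]_w \int[mu]_(r in A) (f (w, r))%:E)%E.

Lemma measurable_inner (A : set R) f : measurable A -> measurable_fun setT f ->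
  (forall z, 0 <= f z) -> measurable_fun setT (fun w => (\int[mu]_(r in A) (f (w, r))%:E)%E).
Proof.
move=> mA mf f0.
pose g (z : T * measurableTypeR R) := (f z * \1_A z.2)%:E.
have mg : measurable_fun setT g.
  apply/measurable_EFinP; apply: measurable_funM => //.
  by apply: measurableT_comp => //; exact: measurable_indic.
have g0 z : (0 <= g z)%E by rewrite lee_fin mulr_ge0// indicE.
have := @measurable_fun_fubini_tonelli_F _ _ T (measurableTypeR R) R mu g mg g0.
rewrite /fubini_F; apply: eq_measurable_fun => w _.
rewrite [RHS]integral_mkcond; apply: eq_integral => r _.
by rewrite patchE /g indicE /=; case: (r \in A); rewrite ?mulr1 ?mulr0.
Qed.

Lemma measurable_section f w : measurable_fun setT f ->
  measurable_fun setT (fun r : measurableTypeR R => f (w, r)).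
Proof. by move=> mf; apply: measurableT_comp mf _; exact: pair1_measurable. Qed.

Lemma measurable_section_in (A : set R) f w : measurable_fun setT f ->
  @measurable_fun _ _ (measurableTypeR R) _ A (fun r => (f (w, r))%:E).
Proof.
move=> mf; apply/measurable_EFinP; apply: measurable_funTS.
exact: measurable_section.
Qed.

Lemma dintD A f g : measurable A -> measurable_fun setT f -> measurable_fun setT g ->
  (forall z, 0 <= f z) -> (forall z, 0 <= g z) ->
  dint A (fun z => f z + g z) = (dint A f + dint A g)%E.
Proof.
move=> mA mf mg f0 g0; rewrite /dint -ge0_integralD//.
- apply: eq_integral => w _; rewrite -ge0_integralD//.
  + by move=> r _; rewrite lee_fin.
  + exact: measurable_section_in.
  + by move=> r _; rewrite lee_fin.
  + exact: measurable_section_in.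
- by move=> w _; apply: integral_ge0 => r _; rewrite lee_fin.
- exact: measurable_inner.
- by move=> w _; apply: integral_ge0 => r _; rewrite lee_fin.
- exact: measurable_inner.
Qed.

Lemma dintZ A f (k : R) : measurable A -> measurable_fun setT f -> (forall z, 0 <= f z) ->
  0 <= k -> dint A (fun z => k * f z) = (k%:E * dint A f)%E.
Proof.
move=> mA mf f0 k0; rewrite /dint -ge0_integralZl//.
- apply: eq_integral => w _; rewrite -ge0_integralZl//.
  + exact: measurable_section_in.
  + by move=> r _; rewrite lee_fin.
- exact: measurable_inner.
- by move=> w _; apply: integral_ge0 => r _; rewrite lee_fin.
Qed.

Lemma le_dint A f g : measurable A -> measurable_fun setT f -> measurable_fun setT g ->
  (forall z, 0 <= f z) -> (forall w r, A r -> f (w, r) <= g (w, r)) ->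
  (forall z, 0 <= g z) -> (dint A f <= dint A g)%E.
Proof.
move=> mA mf mg f0 fg g0; apply: ge0_le_integral => //.
- by move=> w _; apply: integral_ge0 => r _; rewrite lee_fin.
- exact: measurable_inner.
- exact: measurable_inner.
- move=> w _; apply: ge0_le_integral => //.
  + by move=> r _; rewrite lee_fin.
  + exact: measurable_section_in.
  + exact: measurable_section_in.
  + by move=> r Ar; rewrite lee_fin fg.
Qed.

Lemma dint_indic A B f : measurable A -> measurable B -> B `<=` A ->
  dint A (fun z => f z * \1_B z.2) = dint B f.
Proof.
move=> mA mB BA; apply: eq_integral => w _.
rewrite -[in RHS](setIidr BA) integral_mkcondr; apply: eq_integral => r _.
by rewrite patchE indicE /=; case: (r \in B); rewrite ?mulr1 ?mulr0.
Qed.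

Lemma dint_swap A f : measurable A -> measurable_fun setT f -> (forall z, 0 <= f z) ->
  dint A f = (\int[mu]_(r in A) \int[P]_w (f (w, r))%:E)%E.
Proof.
move=> mA mf f0.
pose g (z : T * measurableTypeR R) := (f z * \1_A z.2)%:E.
have mg : measurable_fun setT g.
  apply/measurable_EFinP; apply: measurable_funM => //.
  by apply: measurableT_comp => //; exact: measurable_indic.
have g0 z : (0 <= g z)%E by rewrite lee_fin mulr_ge0// indicE.
have := @fubini_tonelli _ _ T (measurableTypeR R) R P mu g mg g0.
have -> : (\int[P]_x \int[mu]_y g (x, y))%E = dint A f.
  apply: eq_integral => w _; rewrite [RHS]integral_mkcond; apply: eq_integral => r _.
  by rewrite patchE /g indicE /=; case: (r \in A); rewrite ?mulr1 ?mulr0.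
move=> ->; rewrite [RHS]integral_mkcond; apply: eq_integral => r _.
rewrite patchE /g /=; under eq_integral do rewrite indicE /=.
case: (r \in A); first by apply: eq_integral => w _; rewrite mulr1.
by apply: integral0_eq => w _; rewrite mulr0.
Qed.

Lemma Rintegral_cstP (k : R) : \int[P]_w k = k.
Proof.
have := @expectation_cst _ T R P k; rewrite unlock => e.
by rewrite /Rintegral (_ : (\int[P]_w k%:E)%E = k%:E).
Qed.

(** Young's inequality |Y| <= z/2 + Y^2/(2 z) takes the place of the Cauchy-Schwarz inequality and
    gives integrability at the same time. *)
Lemma L1_le_L2 (Y : T -> R) (z : R) : measurable_fun setT Y -> 0 < z ->
  (\int[P]_w ((Y w) ^+ 2)%:E <= (z ^+ 2)%:E)%E ->
  integrableR P Y /\ \int[P]_w `|Y w| <= z.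
Proof.
move=> mY z0 h.
have i2 : integrableR P (fun w => (Y w) ^+ 2).
  apply/integrableR_ge0P => [|w|]; [exact: measurable_funX|exact: sqr_ge0|].
  by apply: le_lt_trans h _; rewrite ltry.
have i3 : integrableR P (fun w => z / 2 + (2 * z)^-1 * (Y w) ^+ 2).
  by apply: integrableRD; [exact: integrableR_cst|exact: integrableRZ].
have le w : `|Y w| <= z / 2 + (2 * z)^-1 * (Y w) ^+ 2.
  rewrite -subr_ge0 (_ : _ - _ = (2 * z)^-1 * (`|Y w| - z) ^+ 2).
    by rewrite mulr_ge0 ?sqr_ge0// invr_ge0 mulr_ge0// ltW.
  by rewrite sqrrB real_normK ?num_real//; field; rewrite gt_eqF.
have i1 : integrableR P Y by exact: integrableR_le i3 le.
split => //.
apply: (@le_trans _ _ (\int[P]_w (z / 2 + (2 * z)^-1 * (Y w) ^+ 2))).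
  by apply: le_Rintegral => //; exact: integrableR_norm.
rewrite RintegralD//; [|exact: integrableR_cst|exact: integrableRZ].
rewrite Rintegral_cstP RintegralZl//.
have h2 : \int[P]_w (Y w) ^+ 2 <= z ^+ 2 by rewrite -lee_fin Rintegral_ge0E.
have : (2 * z)^-1 * \int[P]_w (Y w) ^+ 2 <= (2 * z)^-1 * z ^+ 2.
  by apply: ler_wpM2l h2; rewrite invr_ge0 mulr_ge0// ltW.
rewrite (_ : (2 * z)^-1 * z ^+ 2 = z / 2); last by field; rewrite gt_eqF.
by lra.
Qed.

End double_integral.

Section overlap_integral.
Context {R : realType}.
Notation mu := (@lebesgue_measure R).

Lemma overlap_integral (t a b c e : R) : 0 <= a -> 0 <= c -> b <= t -> e <= t ->
  mu.-integrable `[0, t] (EFin \o (fun r => \1_(`]a, b]%classic) r * \1_(`]c, e]%classic) r)) /\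
  \int[mu]_(r in `[0, t]) (\1_(`]a, b]%classic) r * \1_(`]c, e]%classic) r) = overlap a b c e.
Proof.
move=> a0 c0 bt et.
have E : (fun r : R => \1_(`]a, b]%classic) r * \1_(`]c, e]%classic) r) =
    \1_(`]Num.max a c, Num.min b e]%classic) :> (R -> R).
  apply/funext => r; rewrite !indicE !mem_setE !in_itv/= gt_max le_min.
  by case: (a < r); case: (c < r); case: (r <= b); case: (r <= e); rewrite ?mulr0 ?mulr1.
have mI : measurable `]Num.max a c, Num.min b e]%classic by exact: measurable_itv.
rewrite E; split.
  apply: (integrableS _ _ (subsetT _)) => //.
  exact: integrable_indic_itv.
have sub : `]Num.max a c, Num.min b e]%classic `<=` `[0, t]%classic.
  move=> r; rewrite /= !in_itv/= gt_max le_min => /andP[/andP[ar _] /andP[rb _]].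
  by rewrite (le_trans a0 (ltW ar)) (le_trans rb).
rewrite /Rintegral integral_indic// setIidl//.
have E2 := @lebesgue_measure_itv R (Interval (BRight (Num.max a c)) (BRight (Num.min b e))).
apply: etrans (congr1 fine E2) _; rewrite /= lte_fin.
rewrite /overlap /=; case: ltP => h /=.
  by apply/esym/max_r; rewrite subr_ge0 ltW.
by apply/esym/max_l; rewrite subr_le0.
Qed.

End overlap_integral.

(** * Isometry for elementary integrals *)

Section ito.
Context {d : measure_display} {T : measurableType d} {R : realType}.
Variable P : probability T R.
Variables (lambda1 lambda2 : R) (W : R -> T -> R) (eps : R -> T -> 'I_2).
Hypotheses (hl1 : 0 < lambda1) (hl2 : 0 < lambda2).
Hypothesis hcompl : measure_is_complete P.
Hypothesis hBM : brownian_motion P W.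
Hypothesis hMC : markov_chain P (generator lambda1 lambda2) eps.
Hypothesis hind : indep P (sigma_of W `[0, +oo[) (sigma_eps eps).
Notation mu := (@lebesgue_measure R).
Local Notation rich := (rich P W eps).
Local Notation F := (augmented_filtration P W eps).

(** The index set is an arbitrary finite type and the intervals may overlap, so that sums and
    differences of simple integrals, even with different end times, stay in the class. The
    coefficients may depend on the whole path of the chain. *)
Definition admissible (t : R) (J : finType) (a b : J -> R) (xi : J -> T -> R) :=
  forall p, [/\ 0 <= a p, a p <= b p, b p <= t, measurable_wrt (rich (a p)) (xi p)
    & exists M, forall w, `|xi p w| <= M].

Definition elem_int (J : finType) (a b : J -> R) (xi : J -> T -> R) (w : T) : R :=
  \sum_p xi p w * (W (b p) w - W (a p) w).

Definition elem_fun (J : finType) (a b : J -> R) (xi : J -> T -> R) (r : R) (w : T) : R :=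
  \sum_p xi p w * \1_(`]a p, b p]%classic) r.

(** Both sides expand into double sums over pairs of intervals, and for each pair both the
    covariance of the increments and the integral of the product of indicators produce the factor
    [overlap]. *)
Lemma elem_isometry (t : R) (J : finType) (a b : J -> R) (xi : J -> T -> R) :
  admissible t a b xi ->
  integrableR P (fun w => elem_int a b xi w ^+ 2) /\
  (\int[P]_w (elem_int a b xi w ^+ 2)%:E =
   \int[P]_w \int[mu]_(r in `[0%R, t]) (elem_fun a b xi r w ^+ 2)%:E)%E.
Proof.
move=> adm.
have [M hM] : exists M, forall p w, `|xi p w| <= M.
  have [Mf hMf] := choice (fun p => let: And5 _ _ _ _ h := adm p in h).
  exists (\sum_p `|Mf p|) => p w; rewrite (le_trans (hMf p w))//.
  rewrite (le_trans (ler_norm _))// (bigD1 p)//= lerDl.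
  by apply: sumr_ge0.
have mxi p : measurable_fun setT (xi p).
  by have [_ _ _ h _] := adm p; exact: rich_measurable_fun h.
have E1 w : elem_int a b xi w ^+ 2 = \sum_(pq : J * J)
    (xi pq.1 w * xi pq.2 w * ((W (b pq.1) w - W (a pq.1) w) * (W (b pq.2) w - W (a pq.2) w))).
  rewrite expr2 /elem_int big_distrlr /= pair_bigA /=.
  by apply: eq_bigr => pq _; ring.
have mxx (pq : J * J) : measurable_fun setT (fun w => xi pq.1 w * xi pq.2 w).
  exact: measurable_funM.
have hxx (pq : J * J) w : `|xi pq.1 w * xi pq.2 w| <= M * M by rewrite normrM ler_pM.
have ixx (pq : J * J) : integrableR P (fun w => xi pq.1 w * xi pq.2 w).
  exact: (integrableR_bounded P (mxx pq) (hxx pq)).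
have i1 (pq : J * J) : integrableR P (fun w =>
    xi pq.1 w * xi pq.2 w * ((W (b pq.1) w - W (a pq.1) w) * (W (b pq.2) w - W (a pq.2) w))).
  have [a0 ab _ _ _] := adm pq.1; have [c0 ce _ _ _] := adm pq.2.
  exact: (integrable_incr_prod hBM (mxx pq) (hxx pq)).
have isq : integrableR P (fun w => elem_int a b xi w ^+ 2).
  rewrite (_ : (fun w => _) = fun w => \sum_(pq : J * J)
    (xi pq.1 w * xi pq.2 w * ((W (b pq.1) w - W (a pq.1) w) * (W (b pq.2) w - W (a pq.2) w)))).
    exact: integrableR_sum.
  by apply/funext => w; exact: E1.
split => //.
pose ov (pq : J * J) := overlap (a pq.1) (b pq.1) (a pq.2) (b pq.2).
rewrite -Rintegral_ge0E//.
under eq_Rintegral do rewrite E1.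
rewrite Rintegral_sum//.
have E2 w : (\int[mu]_(r in `[0%R, t]) (elem_fun a b xi r w ^+ 2)%:E)%E =
    (\sum_(pq : J * J) ov pq * (xi pq.1 w * xi pq.2 w))%:E.
  pose g (pq : J * J) r := xi pq.1 w * xi pq.2 w *
    (\1_(`]a pq.1, b pq.1]%classic) r * \1_(`]a pq.2, b pq.2]%classic) r).
  have ig pq : mu.-integrable `[0, t] (EFin \o g pq).
    have [a0 ab bt _ _] := adm pq.1; have [c0 ce et _ _] := adm pq.2.
    have [i _] := overlap_integral a0 c0 bt et.
    exact: (@integrableZl _ _ _ mu _ (measurable_itv `[0, t]) (xi pq.1 w * xi pq.2 w) _ i).
  transitivity (\sum_(pq : J * J) \int[mu]_(r in `[0%R, t]) (g pq r)%:E)%E.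
    rewrite -integral_sum//; apply: eq_integral => r _.
    rewrite sumEFin; congr EFin; rewrite expr2 /elem_fun big_distrlr /= pair_bigA /=.
    by apply: eq_bigr => pq _; rewrite /g; ring.
  rewrite -sumEFin; apply: eq_bigr => pq _.
  have [a0 ab bt _ _] := adm pq.1; have [c0 ce et _ _] := adm pq.2.
  have [i e] := overlap_integral a0 c0 bt et.
  rewrite -[LHS]fineK; last exact: integrable_fin_num (ig pq).
  congr EFin; rewrite -[fine _]/(\int[mu]_(r in `[0, t]) g pq r).
  by rewrite /g RintegralZl// e mulrC.
under [RHS]eq_integral do rewrite E2.
have iov pq : integrableR P (fun w => ov pq * (xi pq.1 w * xi pq.2 w)).
  exact: integrableRZ.
rewrite -Rintegral_ge0E; last exact: integrableR_sum.
rewrite Rintegral_sum//; congr EFin; apply: eq_bigr => pq _.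
have [a0 ab _ mx hx] := adm pq.1; have [c0 ce _ my hy] := adm pq.2.
rewrite RintegralZl// /ov; last exact: ixx.
exact: (incr_covariance hcompl hBM hMC hind a0 ab c0 ce mx my (hM pq.1) (hM pq.2)).
Qed.

Section simple.
Variables (S : simple_process (T := T) (R := R)) (t : R).
Hypotheses (hS : simple_adapted F S) (t0 : 0 <= t).

Let n := sp_size S.

Lemma simple_time_ge0 k : (k <= n)%N -> 0 <= sp_time S k.
Proof.
have [h0 hk] := hS; elim: k => [//|k IH] kn.
by have [h _ _] := hk k kn; rewrite (le_trans (IH (ltnW kn))).
Qed.

Definition sp_left (k : 'I_n) : R := Num.min (sp_time S k) t.
Definition sp_right (k : 'I_n) : R := Num.min (sp_time S k.+1) t.
(** After clipping at t, an interval that starts later than t has left end t, where its coefficient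
    need not be measurable. Its increment is zero, so the coefficient is replaced by 0. *)
Definition sp_coef (k : 'I_n) (w : T) : R := if sp_time S k <= t then sp_val S k w else 0.

Lemma sp_admissible : admissible t sp_left sp_right sp_coef.
Proof.
move=> k; have [_ /(_ k (ltn_ord k))[hk mk [M hM]]] := hS.
have k0 := simple_time_ge0 (ltnW (ltn_ord k)).
rewrite /sp_left /sp_right /sp_coef; split.
- by rewrite le_min k0 t0.
- by rewrite le_min !ge_min lexx hk orbT.
- by rewrite ge_min lexx orbT.
- case: (boolP (sp_time S k <= t)) => h; last exact: measurable_wrt_cst.
  apply: measurable_wrt_sub mk; rewrite min_l//.
  exact: (aug_sub_rich hcompl hBM hMC k0).
- by exists `|M| => w; case: ifP => _; rewrite ?normr0// (le_trans (hM w))// ler_norm.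
Qed.

Lemma sp_elem_int w : elem_int sp_left sp_right sp_coef w = simple_integral W S t w.
Proof.
apply: eq_bigr => k _; rewrite /sp_coef /sp_left /sp_right; case: ifPn => // h.
have [_ /(_ k (ltn_ord k))[hk _ _]] := hS.
move: h; rewrite -ltNge => h; rewrite (min_r (ltW h)) min_r ?subrr ?mulr0//.
by rewrite (le_trans (ltW h)).
Qed.

Lemma sp_elem_fun r w : r <= t ->
  elem_fun sp_left sp_right sp_coef r w = simple_fun S r w.
Proof.
move=> rt; apply: eq_bigr => k _; rewrite /sp_coef /sp_left /sp_right !indicE !mem_setE !in_itv/=.
case: ifPn => h; first by rewrite (min_l h) le_min rt andbT.
move: h; rewrite -ltNge => h.
by rewrite mul0r (le_gtF (ltW (le_lt_trans rt h)))/= mulr0.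
Qed.

Lemma measurable_simple_fun :
  measurable_fun setT (fun z : T * measurableTypeR R => simple_fun S z.2 z.1).
Proof.
rewrite /simple_fun; apply: measurable_sum => k.
have [_ /(_ k (ltn_ord k))[hk mk _]] := hS.
have k0 := simple_time_ge0 (ltnW (ltn_ord k)).
apply: measurable_funM.
  apply: (@measurableT_comp _ _ _ _ _ _ (sp_val S k)) => //.
  apply: measurable_wrt_measurable mk.
  exact: (aug_measurable hcompl hBM hMC k0).
by apply: measurableT_comp => //; apply: measurable_indic; exact: measurable_itv.
Qed.

End simple.

End ito.

(** * Freezing the regime over a short interval *)

Section ito_increment.
Context {d : measure_display} {T : measurableType d} {R : realType}.
Variable P : probability T R.
Variables (lambda1 lambda2 sg1 sg2 : R) (W : R -> T -> R) (eps : R -> T -> 'I_2).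
Hypotheses (hl1 : 0 < lambda1) (hl2 : 0 < lambda2).
Hypothesis hcompl : measure_is_complete P.
Hypothesis hBM : brownian_motion P W.
Hypothesis hMC : markov_chain P (generator lambda1 lambda2) eps.
Hypothesis hind : indep P (sigma_of W `[0, +oo[) (sigma_eps eps).
Notation mu := (@lebesgue_measure R).
Local Notation rich := (rich P W eps).
Local Notation F := (augmented_filtration P W eps).
Local Notation H := (fun r w => by_regime sg1 sg2 (eps r w)).

(** Negative times are sent to 0, where the chain is defined, so that the integrand becomes a map on
    the whole product space. *)
Let Hp (z : T * measurableTypeR R) : R := H (Num.max z.2 0) z.1.

Lemma measurable_regime (a1 a2 s : R) : 0 <= s ->
  measurable_fun setT (fun w => by_regime a1 a2 (eps s w)).
Proof.
move=> s0; apply: (rich_measurable_fun (P := P) (W := W) (s := s)).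
apply: measurable_wrt_regime => j; exact: (rich_eps hBM hMC j s0).
Qed.

(** The chain is read at the first point of the grid of mesh 1/(n + 1) that lies strictly to the
    right of r. Each approximation takes countably many rectangles into account, and
    right-continuity of the paths gives pointwise convergence. *)
Lemma regime_jointly_measurable : measurable_fun setT Hp.
Proof.
pose k_ n (r : R) := Num.truncn (n.+1%:R * Num.max r 0).
pose d_ n (r : R) : R := (k_ n r).+1%:R / n.+1%:R.
have p0 n (r : R) : 0 <= n.+1%:R * Num.max r 0.
  by rewrite mulr_ge0// le_max lexx orbT.
have mpos n : measurable_fun setT (fun r : R => n.+1%:R * Num.max r 0).
  apply: measurable_funM => //; apply: measurable_maxr => //; exact: measurable_id.
have ttk n k : measurable [set r : measurableTypeR R | k_ n r = k].
  rewrite (_ : [set _ | _] = (fun r : R => n.+1%:R * Num.max r 0) @^-1` `[k%:R, k.+1%:R[).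
    by rewrite -[X in measurable X]setTI; apply: mpos.
  apply/seteqP; split => r /=; rewrite in_itv/= /k_.
    by move=> <-; rewrite truncn_itv.
  by move=> h; apply/truncn_def.
pose g_ n (z : T * measurableTypeR R) : R := H (d_ n z.2) z.1.
apply: (@measurable_fun_cvg _ _ _ _ g_).
- move=> n _ B mB; rewrite setTI.
  rewrite (_ : _ @^-1` _ = \bigcup_k ([set w | B (H (k.+1%:R / n.+1%:R) w)] `*`
      [set r : measurableTypeR R | k_ n r = k])).
    apply: bigcupT_measurable => k; apply: measurableX; last exact: ttk.
    have k0 : 0 <= k.+1%:R / n.+1%:R :> R by rewrite divr_ge0.
    by have := measurable_regime sg1 sg2 k0 measurableT mB; rewrite setTI.
  apply/seteqP; split => -[w r] /=.
    by move=> h; exists (k_ n r).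
  by move=> [k _ [/= h e]]; rewrite /g_ /d_ /= e.
- move=> [w r] _; apply: cvg_near_cst.
  have [_ hc _] := hMC.
  have t0 : 0 <= Num.max r 0 by rewrite le_max lexx orbT.
  have [/nbhs_ballP[e /= e0 he] _] := hc w _ t0.
  have /cvgrPdist_lt/(_ _ e0) := @cvg_harmonic R.
  apply: filterS => n; rewrite sub0r normrN gtr0_norm ?invr_gt0// => hn.
  rewrite /g_ /Hp /=; congr by_regime; apply: he.
    rewrite /ball /= distrC.
    have /andP[h1 h2] := truncn_itv (p0 n r).
    have q0 : 0 < n.+1%:R :> R by [].
    have E : d_ n r - Num.max r 0 = ((k_ n r).+1%:R - n.+1%:R * Num.max r 0) / n.+1%:R.
      by rewrite /d_; field; rewrite gt_eqF.
    rewrite E ger0_norm; last by rewrite divr_ge0// subr_ge0 ltW.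
    apply: le_lt_trans hn; rewrite -[leRHS]mul1r ler_wpM2r ?invr_ge0//.
    by rewrite lerBlDr -natr1 addrC lerD2l.
  have /andP[_ h2] := truncn_itv (p0 n r).
  by rewrite /d_ ltr_pdivlMr// mulrC.
Qed.

Definition jump (s r : R) : set T := [set w | eps r w <> eps s w].

Lemma rich_jump (u s r : R) : 0 <= s -> 0 <= r -> rich u (jump s r).
Proof.
move=> s0 r0.
rewrite (_ : jump s r = ([set w | eps s w = ord0] `&` [set w | eps r w = ord_max]) `|`
   ([set w | eps s w = ord_max] `&` [set w | eps r w = ord0])).
  apply: (@measurableU _ (g_sigma_algebraType _)); apply: sigma_setI;
    exact: (rich_eps hBM hMC).
apply/seteqP; split => w; rewrite /jump /=.
  by have [->|->] := I2_cases (eps s w); have [->|->] := I2_cases (eps r w) => //; [left|right].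
by case=> -[-> ->].
Qed.

Lemma prob_transition (s r : R) i j : 0 <= s -> s <= r -> i != j ->
  (P ([set w | eps s w = i] `&` [set w | eps r w = j]) <=
   (by_regime lambda1 lambda2 i * (r - s))%:E)%E.
Proof.
move=> s0 sr ij.
have FT : F s setT by exact: sigma_setT.
have := markov_aug hcompl hBM hMC hind i j s0 sr FT.
rewrite !setTI => E; rewrite E.
have rs0 : 0 <= r - s by rewrite subr_ge0.
have [q0 q1 _] := expmx_generator_bounds hl1 hl2 ij rs0.
have mi : measurable [set w | eps s w = i] by exact: (measurable_eps hMC).
rewrite -[leRHS]mule1; apply: lee_pmul => //.
exact: probability_le1.
Qed.

Lemma prob_jump (s r : R) : 0 <= s -> s <= r ->
  (P (jump s r) <= ((lambda1 + lambda2) * (r - s))%:E)%E.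
Proof.
move=> s0 sr; have r0 : 0 <= r by exact: le_trans sr.
have me u j : 0 <= u -> measurable [set w | eps u w = j] by move=> ?; exact: (measurable_eps hMC).
rewrite (_ : jump s r = ([set w | eps s w = ord0] `&` [set w | eps r w = ord_max]) `|`
   ([set w | eps s w = ord_max] `&` [set w | eps r w = ord0])).
  apply: (@le_trans _ _ (P ([set w | eps s w = ord0] `&` [set w | eps r w = ord_max]) +
   P ([set w | eps s w = ord_max] `&` [set w | eps r w = ord0]))%E).
    by apply: measureU2; apply: measurableI; exact: me.
  by rewrite mulrDl EFinD; apply: leeD; exact: (@prob_transition s r).
apply/seteqP; split => w; rewrite /jump /=.
  by have [->|->] := I2_cases (eps s w); have [->|->] := I2_cases (eps r w) => //; [left|right].
by case=> -[-> ->].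
Qed.

Let sq_meas (f : T * measurableTypeR R -> R) : measurable_fun setT f ->
  measurable_fun setT (fun z => f z ^+ 2).
Proof. exact: measurable_funX. Qed.

Let regime_dist (i j : 'I_2) : (by_regime sg1 sg2 i - by_regime sg1 sg2 j) ^+ 2 =
  (sg1 - sg2) ^+ 2 * (i != j)%:R.
Proof.
by have [->|->] := I2_cases i; have [->|->] := I2_cases j;
  rewrite /by_regime /= ?subrr ?expr0n ?mulr0 ?mulr1// -sqrrN opprB.
Qed.

(** The squared difference is (sg1 - sg2)^2 on the event that the two regimes differ. That event has
    probability of order r - s <= t - s, and the time integral supplies the second factor t - s. *)
Lemma regime_dint (s t : R) : 0 <= s -> s <= t ->
  (dint P `]s, t] (fun z => ((Hp z - H s z.1) ^+ 2)%R) <=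
   ((sg1 - sg2) ^+ 2 * (lambda1 + lambda2) * (t - s) ^+ 2)%:E)%E.
Proof.
move=> s0 st.
have mHs : measurable_fun setT (fun z : T * measurableTypeR R => H s z.1).
  by apply: (measurableT_comp (measurable_regime sg1 sg2 s0)).
rewrite dint_swap//; last 2 first.
- by apply: sq_meas; apply: measurable_funB => //; exact: regime_jointly_measurable.
- by move=> z; exact: sqr_ge0.
set K := (sg1 - sg2) ^+ 2 * (lambda1 + lambda2) * (t - s).
have L0 : 0 <= (sg1 - sg2) ^+ 2 * (lambda1 + lambda2).
  by apply: mulr_ge0; [exact: sqr_ge0|rewrite addr_ge0// ltW].
have K0 : 0 <= K by apply: mulr_ge0 => //; rewrite subr_ge0.
apply: (@le_trans _ _ (\int[mu]_(r in `]s, t]) K%:E)%E).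
  apply: ge0_le_integral => //.
  - by move=> r _; apply: integral_ge0 => w _; rewrite lee_fin sqr_ge0.
  - have mG : measurable_fun setT (fun z : T * measurableTypeR R => ((Hp z - H s z.1) ^+ 2)%:E).
      apply/measurable_EFinP; apply: sq_meas; apply: measurable_funB => //.
      exact: regime_jointly_measurable.
    apply: measurable_funTS.
    apply: (@measurable_fun_fubini_tonelli_G _ _ T (measurableTypeR R) R P
      (fun z => ((Hp z - H s z.1) ^+ 2)%:E) mG).
    by move=> z; rewrite lee_fin sqr_ge0.
  - move=> r; rewrite /= in_itv/= => /andP[sr rt].
    have r0 : 0 <= r by rewrite (le_trans s0)// ltW.
    have rj : rich 0 (jump s r) by exact: rich_jump.
    have mj : measurable (jump s r) by apply: (@rich_measurable _ _ _ P W eps 0).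
    rewrite (@eq_integral _ _ _ P _ (fun w => ((sg1 - sg2) ^+ 2 * \1_(jump s r) w)%:E)).
      under eq_integral do rewrite EFinM.
      rewrite ge0_integralZl_EFin ?sqr_ge0//; last first.
        by apply/measurable_EFinP; exact: measurable_indic.
      rewrite integral_indic// setIT.
      apply: (@le_trans _ _ (((sg1 - sg2) ^+ 2)%:E * ((lambda1 + lambda2) * (r - s))%:E)%E).
        by apply: lee_wpmul2l; [rewrite lee_fin sqr_ge0|exact: prob_jump s0 (ltW sr)].
      rewrite -EFinM lee_fin /K mulrA; apply: ler_wpM2l => //.
      by rewrite lerB.
    move=> w _; congr EFin; rewrite /Hp /= max_l// regime_dist; congr (_ * _).
    rewrite indicE; congr (_%:R); congr nat_of_bool; apply/idP/idP.
      by move=> h; rewrite mem_set// => e; rewrite e eqxx in h.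
    by rewrite inE => h; apply/eqP.
rewrite integral_cst//; have := @lebesgue_measure_itv R (Interval (BRight s) (BRight t)).
move=> /= e; rewrite [X in (_ * X)%E](etrans e _ : _ = (t - s)%:E).
  by rewrite -EFinM lee_fin /K (expr2 (t - s)) mulrA.
rewrite /= lte_fin; case: ltP => h; first by rewrite EFinB.
by have -> : t - s = 0 by apply/eqP; rewrite subr_eq0 eq_le h st.
Qed.

Lemma le_dint2 (t : R) (f g1 g2 g3 : T * measurableTypeR R -> R) :
  measurable_fun setT f -> (forall z, 0 <= f z) ->
  measurable_fun setT g1 -> (forall z, 0 <= g1 z) ->
  measurable_fun setT g2 -> (forall z, 0 <= g2 z) ->
  measurable_fun setT g3 -> (forall z, 0 <= g3 z) ->
  (forall w r, 0 <= r -> r <= t -> f (w, r) <= 3 * (g1 (w, r) + g2 (w, r) + g3 (w, r))) ->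
  (dint P `[0%R, t] f <= 3%:E * (dint P `[0%R, t] g1 + dint P `[0%R, t] g2 +
     dint P `[0%R, t] g3))%E.
Proof.
move=> mf f0 m1 p1 m2 p2 m3 p3 h.
have m12 : measurable_fun setT (fun z => g1 z + g2 z) by exact: measurable_funD.
have p12 z : 0 <= g1 z + g2 z by exact: addr_ge0.
have m123 : measurable_fun setT (fun z => g1 z + g2 z + g3 z) by exact: measurable_funD.
have p123 z : 0 <= g1 z + g2 z + g3 z by exact: addr_ge0.
rewrite -dintD// -dintD// -dintZ//; apply: le_dint => //.
- exact: measurable_funM.
- by move=> w r /=; rewrite in_itv/= => /andP[]; exact: h.
- by move=> z; rewrite mulr_ge0.
Qed.

Variable I : R -> T -> R.
Hypothesis hI : is_ito_integral P F W H I.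

Lemma ito_measurable_wrt t : 0 <= t -> measurable_wrt (F t) (I t).
Proof. by move=> t0; have [] := hI t0. Qed.

Lemma ito_measurable t : 0 <= t -> measurable_fun setT (I t).
Proof.
move=> t0; apply: measurable_wrt_measurable (ito_measurable_wrt t0).
exact: (aug_measurable hcompl hBM hMC t0).
Qed.

Lemma ito_approx (t z : R) : 0 <= t -> 0 < z -> exists S, [/\ simple_adapted F S,
  (\int[P]_w ((simple_integral W S t w - I t w) ^+ 2)%:E <= z%:E)%E &
  (dint P `[0%R, t] (fun v => ((simple_fun S v.2 v.1 - Hp v) ^+ 2)%R) <= z%:E)%E].
Proof.
move=> t0 z0; have [_ [S [hS h1 h2]]] := hI t0.
have nz : nbhs 0%E (fun u : \bar R => (u < z%:E)%E).
  by apply: open_ereal_lt'; rewrite lte_fin.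
have [N1 _ hN1] := h1 _ nz; have [N2 _ hN2] := h2 _ nz.
pose N := maxn N1 N2.
have a1 := hN1 N (leq_maxl _ _); have a2 := hN2 N (leq_maxr _ _).
exists (S N); split; [exact: hS|exact: ltW|].
apply: le_trans (ltW a1); rewrite le_eqVlt; apply/orP; left; apply/eqP.
apply: eq_integral => w _; apply: eq_integral => r; rewrite inE/= in_itv/= => /andP[r0 _].
by rewrite /Hp /= max_l.
Qed.

(** The integral of H_r - H_s over ]s, t], that is, the error made by keeping the regime of time
    s. *)
Definition ito_error (s t : R) (w : T) : R := I t w - I s w - H s w * (W t w - W s w).

(** The factor 9 = 3 * 3 comes from two successive uses of (a + b + c)^2 <= 3 (a^2 + b^2 + c^2):
    once below the time integral, once when passing to the L^2 limit. *)
Let C := 9 * ((sg1 - sg2) ^+ 2 * (lambda1 + lambda2)).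

Lemma measurable_ito_error s t : 0 <= s -> s <= t -> measurable_fun setT (ito_error s t).
Proof.
move=> s0 st; have t0 : 0 <= t by exact: le_trans st.
apply: measurable_funB; first by apply: measurable_funB; exact: ito_measurable.
apply: measurable_funM; first exact: measurable_regime.
by apply: measurable_funB; apply: (measurable_W hBM).
Qed.

(* [ito_error s t] is approximated in L^2 by the integral of
   S 1_(0,t] - S' 1_(0,s] - H_s 1_(s,t], where S and S' approximate H on [0, t]
   and on [0, s]. *)
Lemma ito_error_approx (s t z : R) : 0 <= s -> s <= t -> 0 < z ->
  exists S S', [/\ simple_adapted F S, simple_adapted F S',
   (\int[P]_w ((simple_integral W S t w - I t w) ^+ 2)%:E <= z%:E)%E,
   (\int[P]_w ((simple_integral W S' s w - I s w) ^+ 2)%:E <= z%:E)%E &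
   (\int[P]_w ((simple_integral W S t w - simple_integral W S' s w -
       H s w * (W t w - W s w)) ^+ 2)%:E <= (6 * z + C / 3 * (t - s) ^+ 2)%:E)%E /\
   (\int[P]_w ((simple_integral W S s w - simple_integral W S' s w) ^+ 2)%:E
      <= (6 * z)%:E)%E].
Proof.
move=> s0 st z0; have t0 : 0 <= t by exact: le_trans st.
have [S [hS S1 S2]] := ito_approx t0 z0.
have [S' [hS' S1' S2']] := ito_approx s0 z0.
exists S, S'; split => //.
have mS := measurable_simple_fun hcompl hBM hMC hS.
have mS' := measurable_simple_fun hcompl hBM hMC hS'.
have mH := regime_jointly_measurable.
have mHs : measurable_fun setT (fun z : T * measurableTypeR R => H s z.1).
  by apply: (measurableT_comp (measurable_regime sg1 sg2 s0)).
have mind (A : set R) : measurable A ->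
    measurable_fun setT (fun z : T * measurableTypeR R => \1_A z.2 : R).
  by move=> mA; apply: measurableT_comp => //; exact: measurable_indic.
have ind0 (A : set R) r : 0 <= (\1_A r : R) by rewrite indicE.
pose g1 (v : T * measurableTypeR R) := (simple_fun S v.2 v.1 - Hp v) ^+ 2.
pose g2 (v : T * measurableTypeR R) := (simple_fun S' v.2 v.1 - Hp v) ^+ 2 * \1_(`[0, s]%classic) v.2.
pose g3 (v : T * measurableTypeR R) := (Hp v - H s v.1) ^+ 2 * \1_(`]s, t]%classic) v.2.
have m1 : measurable_fun setT g1 by apply: sq_meas; exact: measurable_funB.
have m2 : measurable_fun setT g2.
  apply: measurable_funM; last by apply: mind; exact: measurable_itv.
  by apply: sq_meas; exact: measurable_funB.
have m3 : measurable_fun setT g3.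
  apply: measurable_funM; last by apply: mind; exact: measurable_itv.
  by apply: sq_meas; exact: measurable_funB.
have p1 v : 0 <= g1 v by exact: sqr_ge0.
have p2 v : 0 <= g2 v by rewrite mulr_ge0// sqr_ge0.
have p3 v : 0 <= g3 v by rewrite mulr_ge0// sqr_ge0.
have d2 : (dint P `[0%R, t] g2 <= z%:E)%E.
  rewrite (@dint_indic _ _ _ P `[0%R, t]%classic `[0%R, s]%classic
    (fun v => (simple_fun S' v.2 v.1 - Hp v) ^+ 2))//.
  by move=> r; rewrite /= !in_itv/= => /andP[-> rs]; rewrite (le_trans rs).
have d3 : (dint P `[0%R, t] g3 <= (C / 9 * (t - s) ^+ 2)%:E)%E.
  rewrite (@dint_indic _ _ _ P `[0%R, t]%classic `]s, t]%classic
    (fun v => (Hp v - H s v.1) ^+ 2))//.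
    apply: le_trans (regime_dint s0 st) _; rewrite lee_fin /C.
    by rewrite le_eqVlt; apply/orP; left; apply/eqP; field.
  by move=> r; rewrite /= !in_itv/= => /andP[sr ->]; rewrite (le_trans s0)// ltW.
split.
- pose J := ('I_(sp_size S) + ('I_(sp_size S') + unit))%type.
  pose a (p : J) := match p with inl k => sp_left t k | inr (inl k) => sp_left s k
     | inr (inr _) => s end.
  pose b (p : J) := match p with inl k => sp_right t k | inr (inl k) => sp_right s k
     | inr (inr _) => t end.
  pose xi (p : J) w := match p with inl k => sp_coef t k w
     | inr (inl k) => - sp_coef s k w | inr (inr _) => - H s w end.
  have adm : admissible P W eps t a b xi.
    case=> [k|[k|u]].
    + exact: (sp_admissible hcompl hBM hMC hS t0).
    + have [h1 h2 h3 h4 [M hM]] := sp_admissible hcompl hBM hMC hS' s0 k.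
      split => //; first exact: le_trans st.
        rewrite /xi (_ : (fun w => _) = (fun x => - x) \o sp_coef s k)//.
        exact: (measurable_wrt_comp (@oppr_measurable R setT)).
      by exists M => w; rewrite /xi normrN.
    + split => //.
        rewrite /xi (_ : (fun w => _) = (fun x => - x) \o (fun w => H s w))//.
        apply: (measurable_wrt_comp (@oppr_measurable R setT)).
        by apply: measurable_wrt_regime => j; exact: (rich_eps hBM hMC).
      exists (`|sg1| + `|sg2|) => w; rewrite /xi normrN /by_regime.
      by case: ifP => _; rewrite ?lerDl ?lerDr.
  have sumJ (f : J -> R) : \sum_p f p = \sum_k f (inl k) + \sum_k f (inr (inl k)) + f (inr (inr tt)).
    by rewrite !big_sumType /= (big_pred1 tt) ?addrA//; case.
  have Ei w : elem_int W a b xi w = simple_integral W S t w - simple_integral W S' s w -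
       H s w * (W t w - W s w).
    rewrite -(sp_elem_int t hS) -(sp_elem_int s hS') /elem_int sumJ /=; congr (_ + _ + _).
      by rewrite -sumrN; apply: eq_bigr => k _; rewrite mulNr.
    by rewrite mulNr.
  have Ef w r : 0 <= r -> r <= t -> elem_fun a b xi r w =
      simple_fun S r w - simple_fun S' r w * \1_(`[0, s]%classic) r - H s w * \1_(`]s, t]%classic) r.
    move=> r0 rt; rewrite /elem_fun sumJ /=; congr (_ + _ + _).
    + by rewrite -(sp_elem_fun S _ rt).
    + rewrite indicE mem_setE in_itv/= r0 /=; case: (leP r s) => rs.
        rewrite mulr1 -(sp_elem_fun S' _ rs) -sumrN.
        by apply: eq_bigr => k _; rewrite mulNr.
      rewrite mulr0 oppr0; apply: big1 => k _.
      rewrite indicE mem_setE in_itv/= (_ : r <= sp_right s k = false) ?andbF ?mulr0//.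
      by apply/negbTE; rewrite -ltNge /sp_right (le_lt_trans _ rs)// ge_min lexx orbT.
    + by rewrite mulNr.
  have [_ iso] := elem_isometry hcompl hBM hMC hind adm.
  rewrite (_ : (\int[P]_w _)%E = (\int[P]_w (elem_int W a b xi w ^+ 2)%:E)%E); last first.
    by apply: eq_integral => w _; rewrite Ei.
  rewrite iso.
  pose f (v : T * measurableTypeR R) := (simple_fun S v.2 v.1 -
     simple_fun S' v.2 v.1 * \1_(`[0, s]%classic) v.2 - H s v.1 * \1_(`]s, t]%classic) v.2) ^+ 2.
  have mf : measurable_fun setT f.
    apply: sq_meas; apply: measurable_funB; first apply: measurable_funB => //.
      by apply: measurable_funM => //; apply: mind; exact: measurable_itv.
    by apply: measurable_funM => //; apply: mind; exact: measurable_itv.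
  have -> : (\int[P]_w \int[mu]_(r in `[0%R, t]) (elem_fun a b xi r w ^+ 2)%:E)%E =
      dint P `[0%R, t] f.
    apply: eq_integral => w _; apply: eq_integral => r; rewrite inE/= in_itv/= => /andP[r0 rt].
    by rewrite Ef.
  have fle w r : 0 <= r -> r <= t -> f (w, r) <= 3 * (g1 (w, r) + g2 (w, r) + g3 (w, r)).
    move=> r0 rt; rewrite /f /g1 /g2 /g3 !indicE !mem_setE !in_itv/= r0 rt /= andbT.
    set x := simple_fun S r w; set y := simple_fun S' r w; set h := Hp (w, r); set q := H s w.
    case: (leP r s) => rs; rewrite ?mulr1 ?mulr0 ?subr0.
      have := sqr_ge0 (x - h + (y - h)); have := sqr_ge0 (x - h); have := sqr_ge0 (y - h).
      by nra.
    have := sqr_ge0 (x - h - (h - q)); have := sqr_ge0 (x - h); have := sqr_ge0 (h - q).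
    by nra.
  apply: le_trans (le_dint2 mf (fun v => sqr_ge0 _) m1 p1 m2 p2 m3 p3 fle) _.
  apply: (@le_trans _ _ (3%:E * (z%:E + z%:E + (C / 9 * (t - s) ^+ 2)%:E))%E).
    apply: lee_wpmul2l; first by rewrite lee_fin.
    by apply: leeD d3; exact: leeD S2 d2.
  rewrite -!EFinD -EFinM lee_fin le_eqVlt; apply/orP; left; apply/eqP; by field.
(* S and S' both approximate H on [0, s], so their integrals up to s are close. The mean of the
   error can then be read off from the part of S after s. *)
- pose J := ('I_(sp_size S) + 'I_(sp_size S'))%type.
  pose a (p : J) := match p with inl k => sp_left s k | inr k => sp_left s k end.
  pose b (p : J) := match p with inl k => sp_right s k | inr k => sp_right s k end.
  pose xi (p : J) w := match p with inl k => sp_coef s k w | inr k => - sp_coef s k w end.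
  have adm : admissible P W eps s a b xi.
    case=> [k|k].
    + exact: (sp_admissible hcompl hBM hMC hS s0).
    + have [h1 h2 h3 h4 [M hM]] := sp_admissible hcompl hBM hMC hS' s0 k.
      split => //.
        rewrite /xi (_ : (fun w => _) = (fun x => - x) \o sp_coef s k)//.
        exact: (measurable_wrt_comp (@oppr_measurable R setT)).
      by exists M => w; rewrite /xi normrN.
  have sumJ (f : J -> R) : \sum_p f p = \sum_k f (inl k) + \sum_k f (inr k).
    by rewrite !big_sumType.
  have Ei w : elem_int W a b xi w = simple_integral W S s w - simple_integral W S' s w.
    rewrite -(sp_elem_int s hS) -(sp_elem_int s hS') /elem_int sumJ /=; congr (_ + _).
    by rewrite -sumrN; apply: eq_bigr => k _; rewrite mulNr.
  have Ef w r : 0 <= r -> r <= s -> elem_fun a b xi r w = simple_fun S r w - simple_fun S' r w.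
    move=> r0 rs; rewrite /elem_fun sumJ /=; congr (_ + _).
    + by rewrite -(sp_elem_fun S _ rs).
    + rewrite -(sp_elem_fun S' _ rs) -sumrN.
      by apply: eq_bigr => k _; rewrite mulNr.
  have [_ iso] := elem_isometry hcompl hBM hMC hind adm.
  rewrite (_ : (\int[P]_w _)%E = (\int[P]_w (elem_int W a b xi w ^+ 2)%:E)%E); last first.
    by apply: eq_integral => w _; rewrite Ei.
  rewrite iso.
  pose f (v : T * measurableTypeR R) := (simple_fun S v.2 v.1 - simple_fun S' v.2 v.1) ^+ 2.
  have mf : measurable_fun setT f by apply: sq_meas; exact: measurable_funB.
  have ss : `[0, s]%classic `<=` `[0, t]%classic.
    by move=> r; rewrite /= !in_itv/= => /andP[-> rs]; rewrite (le_trans rs).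
  have -> : (\int[P]_w \int[mu]_(r in `[0%R, s]) (elem_fun a b xi r w ^+ 2)%:E)%E =
      dint P `[0%R, t] (fun v => f v * \1_(`[0, s]%classic) v.2).
    rewrite (@dint_indic _ _ _ P _ _ f (measurable_itv _) (measurable_itv _) ss).
    apply: eq_integral => w _; apply: eq_integral => r; rewrite inE/= in_itv/= => /andP[r0 rt].
    by rewrite Ef.
  have mf' : measurable_fun setT (fun v => f v * \1_(`[0, s]%classic) v.2).
    by apply: measurable_funM => //; apply: mind; exact: measurable_itv.
  have fle w r : 0 <= r -> r <= t -> f (w, r) * \1_(`[0, s]%classic) r <=
      3 * (g1 (w, r) + g2 (w, r) + 0).
    move=> r0 rt; rewrite /f /g1 /g2 !indicE !mem_setE !in_itv/= r0 /=.
    set x := simple_fun S r w; set y := simple_fun S' r w; set h := Hp (w, r).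
    case: (leP r s) => rs; rewrite ?mulr1 ?mulr0 ?addr0; last by rewrite mulr_ge0// sqr_ge0.
    have := sqr_ge0 (x - h + (y - h)); have := sqr_ge0 (x - h); have := sqr_ge0 (y - h).
    by nra.
  have f0 v : 0 <= f v * \1_(`[0, s]%classic) v.2 by rewrite mulr_ge0// sqr_ge0.
  have m0 : measurable_fun setT (fun _ : T * measurableTypeR R => 0 : R) by exact: measurable_cst.
  have p0 (v : T * measurableTypeR R) : (0 : R) <= 0 by [].
  apply: le_trans (le_dint2 mf' f0 m1 p1 m2 p2 m0 p0 fle) _.
  rewrite [X in (_ + X)%E](_ : _ = 0%E); last first.
    by apply: integral0_eq => w _; apply: integral0_eq.
  rewrite adde0.
  apply: (@le_trans _ _ (3%:E * (z%:E + z%:E))%E).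
    apply: lee_wpmul2l; first by rewrite lee_fin.
    exact: leeD S2 d2.
  by rewrite -!EFinD -EFinM lee_fin le_eqVlt; apply/orP; left; apply/eqP; field.
Qed.

End ito_increment.

(** * Mean and second moment of the freezing error *)

Section ito_error.
Context {d : measure_display} {T : measurableType d} {R : realType}.
Variable P : probability T R.
Variables (lambda1 lambda2 sg1 sg2 : R) (W : R -> T -> R) (eps : R -> T -> 'I_2).
Hypotheses (hl1 : 0 < lambda1) (hl2 : 0 < lambda2).
Hypothesis hcompl : measure_is_complete P.
Hypothesis hBM : brownian_motion P W.
Hypothesis hMC : markov_chain P (generator lambda1 lambda2) eps.
Hypothesis hind : indep P (sigma_of W `[0, +oo[) (sigma_eps eps).
Local Notation rich := (rich P W eps).
Local Notation F := (augmented_filtration P W eps).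
Local Notation H := (fun r w => by_regime sg1 sg2 (eps r w)).
Variable I : R -> T -> R.
Hypothesis hI : is_ito_integral P F W H I.
Local Notation D := (ito_error sg1 sg2 W eps I).

Definition ito_error_cst : R := 9 * ((sg1 - sg2) ^+ 2 * (lambda1 + lambda2)).

Lemma le_sq3 (X a b c : T -> R) : measurable_fun setT X -> measurable_fun setT a ->
  measurable_fun setT b -> measurable_fun setT c ->
  (forall w, X w = a w - b w + c w) ->
  (\int[P]_w ((X w) ^+ 2)%:E <= 3%:E * (\int[P]_w ((a w) ^+ 2)%:E +
    \int[P]_w ((b w) ^+ 2)%:E + \int[P]_w ((c w) ^+ 2)%:E))%E.
Proof.
move=> mX ma mb mc XE.
have mm (Y : T -> R) : measurable_fun setT Y -> measurable_fun setT (fun w => ((Y w) ^+ 2)%:E).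
  by move=> mY; apply/measurable_EFinP; exact: measurable_funX.
have s0 (Y : T -> R) w : setT w -> (0 <= ((Y w) ^+ 2)%:E)%E by move=> _; rewrite lee_fin sqr_ge0.
have mab : measurable_fun setT (fun w => ((a w) ^+ 2)%:E + ((b w) ^+ 2)%:E)%E.
  by apply: emeasurable_funD; exact: mm.
have mabc : measurable_fun setT (fun w => ((a w) ^+ 2)%:E + ((b w) ^+ 2)%:E + ((c w) ^+ 2)%:E)%E.
  by apply: emeasurable_funD => //; exact: mm.
rewrite -(ge0_integralD P measurableT (s0 a) (mm _ ma) (s0 b) (mm _ mb)).
rewrite -(ge0_integralD P measurableT _ mab (s0 c) (mm _ mc)); last first.
  by move=> w _; rewrite -EFinD lee_fin addr_ge0 ?sqr_ge0.
rewrite -(ge0_integralZl_EFin P measurableT _ mabc); last 2 first.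
- by move=> w _; rewrite -!EFinD lee_fin !addr_ge0 ?sqr_ge0.
- by [].
apply: ge0_le_integral => //.
- exact: s0.
- exact: mm.
- by apply: measurable_funeM.
- move=> w _; rewrite -!EFinD -EFinM lee_fin XE.
  have := sqr_ge0 (a w + b w); have := sqr_ge0 (a w - c w); have := sqr_ge0 (b w + c w).
  by nra.
Qed.

Lemma measurable_simple_integral S t : simple_adapted F S -> 0 <= t ->
  measurable_fun setT (simple_integral W S t).
Proof.
move=> hS t0; apply: measurable_sum => k.
have [_ /(_ k (ltn_ord k))[hk mk _]] := hS.
have k0 := simple_time_ge0 hS (ltnW (ltn_ord k)).
apply: measurable_funM.
  by apply: measurable_wrt_measurable mk; exact: (aug_measurable hcompl hBM hMC k0).
by apply: measurable_funB; apply: (measurable_W hBM); rewrite le_min t0 ?andbT// (le_trans k0).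
Qed.

Lemma ito_error_sq s t : 0 <= s -> s <= t ->
  integrableR P (fun w => D s t w ^+ 2) /\
  (\int[P]_w (D s t w ^+ 2)%:E <= (ito_error_cst * (t - s) ^+ 2)%:E)%E.
Proof.
move=> s0 st; have t0 : 0 <= t by exact: le_trans st.
have mD := measurable_ito_error hcompl hBM hMC hI s0 st.
have mI u : 0 <= u -> measurable_fun setT (I u) by exact: (ito_measurable hcompl hBM hMC hI).
have mW u : 0 <= u -> measurable_fun setT (W u) by exact: (measurable_W hBM).
have bound : (\int[P]_w (D s t w ^+ 2)%:E <= (ito_error_cst * (t - s) ^+ 2)%:E)%E.
  apply/lee_addgt0Pr => z z0.
  (* The three squares contribute 6, 1 and 1 times the tolerance, and the split multiplies by 3:
     altogether 24. *)
  have z24 : 0 < z / 24 by rewrite divr_gt0.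
  have [S [S' [hS hS' e1 e2 [e3 _]]]] := ito_error_approx hl1 hl2 hcompl hBM hMC hind hI s0 st z24.
  have mS := measurable_simple_integral hS t0.
  have mS' := measurable_simple_integral hS' s0.
  apply: le_trans (@le_sq3 _ (fun w => simple_integral W S t w - simple_integral W S' s w -
       H s w * (W t w - W s w)) (fun w => simple_integral W S t w - I t w)
       (fun w => simple_integral W S' s w - I s w) mD _ _ _ _) _.
  - apply: measurable_funB; first exact: measurable_funB.
    apply: measurable_funM; first exact: (measurable_regime hBM hMC sg1 sg2 s0).
    by apply: measurable_funB; exact: mW.
  - by apply: measurable_funB => //; exact: mI.
  - by apply: measurable_funB => //; exact: mI.
  - by move=> w; rewrite /ito_error; ring.
  apply: (@le_trans _ _ (3%:E * ((6 * (z / 24) + ito_error_cst / 3 * (t - s) ^+ 2)%:E +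
     (z / 24)%:E + (z / 24)%:E))%E).
    apply: lee_wpmul2l; first by rewrite lee_fin.
    by apply: leeD e2; exact: leeD e3 e1.
  by rewrite -!EFinD -EFinM lee_fin le_eqVlt; apply/orP; left; apply/eqP; field.
split => //; apply/integrableR_ge0P.
- exact: measurable_funX.
- by move=> w; exact: sqr_ge0.
- by apply: le_lt_trans bound _; rewrite ltry.
Qed.

Lemma simple_after_mean S s t (G : T -> R) (M : R) : simple_adapted F S ->
  0 <= s -> s <= t -> measurable_wrt (rich s) G -> (forall w, `|G w| <= M) ->
  integrableR P (fun w => G w * (simple_integral W S t w - simple_integral W S s w)) /\
  \int[P]_w (G w * (simple_integral W S t w - simple_integral W S s w)) = 0.
Proof.
move=> hS s0 st mG hG; have t0 : 0 <= t by exact: le_trans st.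
(* The partition clipped to [s, t]: the difference of the simple integrals at t and at s is the sum
   of the increments of W over the clipped intervals. Each clipped interval of nonzero length starts
   no earlier than s and than its own left end. *)
pose a (k : nat) := Num.max (Num.min (sp_time S k) t) s.
pose X (k : 'I_(sp_size S)) w := G w * sp_val S k w * (W (a k.+1) w - W (a k) w).
have Wa (k : nat) w : W (Num.min (sp_time S k) t) w - W (Num.min (sp_time S k) s) w =
    W (a k) w - W s w.
  rewrite /a; case: (leP (sp_time S k) s) => ks.
    by rewrite min_l ?(le_trans ks)// max_r// !subrr.
  by rewrite max_l// le_min ltW.
have XE w : G w * (simple_integral W S t w - simple_integral W S s w) = \sum_k X k w.
  rewrite /simple_integral -sumrB mulr_sumr; apply: eq_bigr => k _.
  have := Wa k w; have := Wa k.+1 w; rewrite /X.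
  set x1 := W (Num.min (sp_time S k.+1) t) w; set x2 := W (Num.min (sp_time S k.+1) s) w.
  set x3 := W (Num.min (sp_time S k) t) w; set x4 := W (Num.min (sp_time S k) s) w.
  move=> h1 h2.
  have -> : W (a k.+1) w = x1 - x2 + W s w by rewrite h1 subrK.
  have -> : W (a k) w = x3 - x4 + W s w by rewrite h2 subrK.
  by ring.
have key k : integrableR P (X k) /\ \int[P]_w X k w = 0.
  have [_ /(_ k (ltn_ord k))[hk mk [N hN]]] := hS.
  have k0 := simple_time_ge0 hS (ltnW (ltn_ord k)).
  case: (leP (sp_time S k) t) => kt.
    have ka : sp_time S k <= a k by rewrite /a min_l// le_max lexx.
    have sa : s <= a k by rewrite le_max lexx orbT.
    have aa : a k <= a k.+1.
      have mm : Num.min (sp_time S k) t <= Num.min (sp_time S k.+1) t.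
        by rewrite le_min !ge_min hk lexx orbT.
      by rewrite /a ge_max !le_max mm lexx orbT.
    have mGv : measurable_wrt (rich (a k)) (fun w => G w * sp_val S k w).
      apply: measurable_wrtM; first by apply: measurable_wrt_sub mG; exact: rich_mono.
      apply: measurable_wrt_sub (measurable_wrt_sub (aug_sub_rich hcompl hBM hMC k0) mk).
      exact: rich_mono.
    apply: (integrable_mean_incr hBM hMC hind (le_trans s0 sa) aa mGv).
    apply: (@integrableR_bounded _ _ _ P _ (M * N)).
      exact: rich_measurable_fun mGv.
    by move=> w; rewrite normrM ler_pM.
  have E : X k = cst 0.
    apply/funext => w; rewrite /X /a (min_r (ltW kt)) (min_r (ltW (lt_le_trans kt hk))).
    by rewrite subrr mulr0.
  rewrite E; split; first exact: integrableR_cst.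
  by rewrite Rintegral_cst// mul0r.
have -> : (fun w => G w * (simple_integral W S t w - simple_integral W S s w)) =
    (fun w => \sum_k X k w) by apply/funext.
split; first by apply: integrableR_sum => k; case: (key k).
rewrite Rintegral_sum; last by move=> k; case: (key k).
by apply: big1 => k _; case: (key k).
Qed.

Lemma ito_error_mean s t (G : T -> R) (M : R) : 0 <= s -> s <= t ->
  measurable_wrt (rich s) G -> (forall w, `|G w| <= M) ->
  \int[P]_w (G w * D s t w) = 0.
Proof.
move=> s0 st mG hG; have t0 : 0 <= t by exact: le_trans st.
have mD := measurable_ito_error hcompl hBM hMC hI s0 st.
have mI u : 0 <= u -> measurable_fun setT (I u) by exact: (ito_measurable hcompl hBM hMC hI).
have mGm : measurable_fun setT G by exact: rich_measurable_fun mG.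
have M0 : 0 <= `|M| by [].
have hGM w : `|G w| <= `|M| by rewrite (le_trans (hG w))// ler_norm.
apply/eqP; rewrite -normr_le0; apply/ler_addgt0Pr => z z0; rewrite add0r.
(* Three remainders of size at most |M| e have to fit into z; the summand 3 keeps the denominator
   positive. The tolerance e^2/6 below compensates the factor 6 of [ito_error_approx]. *)
pose e := z / (3 * `|M| + 3).
have e0 : 0 < e by rewrite divr_gt0// ltr_wpDl// mulr_ge0.
have q0 : 0 < e ^+ 2 / 6 by rewrite divr_gt0// exprn_gt0.
have [S [S' [hS hS' e1 e2 [_ e3]]]] := ito_error_approx hl1 hl2 hcompl hBM hMC hind hI s0 st q0.
have mS u : 0 <= u -> measurable_fun setT (simple_integral W S u) by exact: measurable_simple_integral.
have mS' := measurable_simple_integral hS' s0.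
have q1 : e ^+ 2 / 6 <= e ^+ 2 by have := sqr_ge0 e; lra.
have q2 : 6 * (e ^+ 2 / 6) = e ^+ 2 by field.
have q1E : ((e ^+ 2 / 6)%:E <= (e ^+ 2)%:E)%E by rewrite lee_fin.
have [i1 l1] := @L1_le_L2 _ _ _ P (fun w => simple_integral W S t w - I t w) e
  (measurable_funB (mS _ t0) (mI _ t0)) e0 (le_trans e1 q1E).
have [i2 l2] := @L1_le_L2 _ _ _ P (fun w => simple_integral W S' s w - I s w) e
  (measurable_funB mS' (mI _ s0)) e0 (le_trans e2 q1E).
rewrite q2 in e3.
have [i3 l3] := @L1_le_L2 _ _ _ P (fun w => simple_integral W S s w - simple_integral W S' s w) e
  (measurable_funB (mS _ s0) mS') e0 e3.
have [i4 e4] := simple_after_mean hS s0 st mG hG.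
have mGH : measurable_wrt (rich s) (fun w => G w * H s w).
  apply: measurable_wrtM => //; apply: measurable_wrt_regime => j.
  exact: (rich_eps hBM hMC).
have hGH w : `|G w * H s w| <= `|M| * (`|sg1| + `|sg2|).
  rewrite normrM ler_pM// /by_regime.
  by case: ifP => _; rewrite ?lerDl ?lerDr.
have [i5 e5] := integrable_mean_incr hBM hMC hind s0 st mGH
  (integrableR_bounded P (rich_measurable_fun mGH) hGH).
have bnd Y : integrableR P Y -> \int[P]_w `|Y w| <= e ->
    integrableR P (fun w => G w * Y w) /\ `|\int[P]_w (G w * Y w)| <= `|M| * e.
  move=> iY hY; have iGY := integrableR_bddM mGm hGM iY; split => //.
  apply: (@le_trans _ _ (\int[P]_w `|G w * Y w|)); first exact: le_normr_Rintegral.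
  apply: (@le_trans _ _ (\int[P]_w (`|M| * `|Y w|))).
    apply: le_Rintegral => //; first exact: integrableR_norm.
      by apply: integrableRZ; exact: integrableR_norm.
    by move=> w _; rewrite normrM ler_wpM2r.
  by rewrite RintegralZl ?ler_wpM2l//; exact: integrableR_norm.
have [j1 b1] := bnd _ i1 l1; have [j2 b2] := bnd _ i2 l2; have [j3 b3] := bnd _ i3 l3.
have E : \int[P]_w (G w * D s t w) = \int[P]_w (G w * (simple_integral W S s w - simple_integral W S' s w))
   - \int[P]_w (G w * (simple_integral W S t w - I t w))
   + \int[P]_w (G w * (simple_integral W S' s w - I s w)).
  transitivity (\int[P]_w (G w * (simple_integral W S s w - simple_integral W S' s w)
    - G w * (simple_integral W S t w - I t w) + G w * (simple_integral W S' s w - I s w)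
    + (G w * (simple_integral W S t w - simple_integral W S s w)
       - G w * H s w * (W t w - W s w)))).
    by apply: eq_Rintegral => w _; rewrite /ito_error; ring.
  have k1 := integrableRB j3 j1; have k2 := integrableRD k1 j2; have k3 := integrableRB i4 i5.
  rewrite RintegralD// [X in _ + X = _]RintegralB// e4 e5 subrr addr0.
  by rewrite RintegralD// RintegralB.
rewrite E.
have : `|M| * e * 3 <= z.
  rewrite /e mulrC !mulrA ler_pdivrMr; last by rewrite ltr_wpDl// mulr_ge0.
  by nra.
move=> hz; apply: le_trans (ler_normD _ _) _.
apply: le_trans (lerD (ler_normB _ _) b2) _.
by lra.
Qed.

End ito_error.

(** * Taylor estimates for the value functions *)

Section taylor.
Context {R : realType}.
Implicit Types (f df : R -> R).

(** Cutting at c reduces to the mean value theorem on each side. The exceptional point is where the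
    second derivative of a value function may fail to exist. *)
Lemma nonincr_except_one (c : R) f df (p q : R) : p <= q -> continuous f ->
  (forall x : R, p < x < q -> x != c -> is_derive x 1 f (df x) /\ df x <= 0) ->
  f q <= f p.
Proof.
move=> pq cf h.
have base (a b : R) : a <= b -> (forall x : R, a < x < b -> is_derive x 1 f (df x) /\ df x <= 0) ->
    f b <= f a.
  move=> ab h'.
  have dfx x : x \in `]a, b[ -> is_derive x 1 f (df x).
    by rewrite in_itv/= => /h'[].
  move: ab; rewrite le_eqVlt => /predU1P[->//|ab].
  have [x xab E] := MVT ab dfx (@continuous_subspaceT _ _ _ f cf).
  rewrite -subr_le0 E; apply: mulr_le0_ge0; last by rewrite subr_ge0 ltW.
  by move: xab; rewrite in_itv/= => /h'[].
case: (boolP (p < c < q)) => [/andP[pc cq]|npq].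
  apply: (@le_trans _ _ (f c)); apply: base; rewrite ?ltW// => x /andP[x1 x2]; apply: h.
  - by rewrite (lt_trans pc).
  - by rewrite gt_eqF.
  - by rewrite x1 (lt_trans x2).
  - by rewrite lt_eqF.
apply: base => // x xpq; apply: h => //.
by apply: contraNneq npq => <-.
Qed.

(** Monotonicity is used twice: first for df minus the primitive of A + B (x - z), then for f minus
    its cubic comparison polynomial. *)
Lemma taylor2_right (c A B : R) f df (d2 : R -> R) (z y : R) : z <= y -> continuous df ->
  (forall x : R, is_derive x 1 f (df x)) ->
  (forall x : R, z < x < y -> x != c -> is_derive x 1 df (d2 x) /\ d2 x <= A + B * (x - z)) ->
  f y - f z - df z * (y - z) <= A / 2 * (y - z) ^+ 2 + B / 6 * (y - z) ^+ 3.
Proof.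
move=> zy cdf hf h.
pose psi x := df x - A * (x - z) - B / 2 * (x - z) ^+ 2.
pose Phi x := f x - df z * (x - z) - A / 2 * (x - z) ^+ 2 - B / 6 * (x - z) ^+ 3.
have cl : continuous (fun x : R => x - z).
  by move=> x; apply: (@cvgB _ _ _ _ _ id (cst z)); [exact: cvg_id|exact: cvg_cst].
have cX n : continuous (fun x : R => (x - z) ^+ n).
  move=> x; apply: (@continuous_comp _ _ _ (fun x : R => x - z) (fun x : R => x ^+ n)).
    exact: cl.
  exact: exprn_continuous.
have cpsi : continuous psi.
  have c1 : continuous (fun x : R => A * (x - z)).
    by move=> x; apply: (@cvgM _ _ _ _ (cst A)); [exact: cvg_cst|exact: cl].
  have c2 : continuous (fun x : R => B / 2 * (x - z) ^+ 2).
    by move=> x; apply: (@cvgM _ _ _ _ (cst (B / 2))); [exact: cvg_cst|exact: cX].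
  move=> x; apply: (@cvgB _ _ _ _ _ (fun x => df x - A * (x - z))); last exact: c2.
  by apply: (@cvgB _ _ _ _ _ df); [exact: cdf|exact: c1].
have hpsi x : z <= x -> x <= y -> psi x <= df z.
  move=> zx xy; have -> : df z = psi z by rewrite /psi subrr expr0n/= !mulr0 !subr0.
  apply: (@nonincr_except_one c psi (fun x => d2 x - A - B * (x - z))) => // u /andP[zu ux] uc.
  have uzy : z < u < y by rewrite zu (lt_le_trans ux).
  have [du d2u] := h u uzy uc.
  split; last by lra.
  by apply: is_derive_eq; rewrite /GRing.scale/=; field.
have hPhi (x : R) : is_derive x 1 Phi (psi x - df z).
  by have hx := hf x; apply: is_derive_eq; rewrite /GRing.scale/= /psi; field.
have cPhi : continuous Phi.
  by move=> x; exact: (@cvg_is_derive _ _ (x, _) (hPhi x)).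
have : Phi y <= Phi z.
  apply: (@nonincr_except_one c Phi (fun x => psi x - df z)) => // u /andP[zu uy] _.
  by split => //; rewrite subr_le0 hpsi// ltW.
by rewrite /Phi subrr !expr0n/= !mulr0 !subr0; lra.
Qed.

Lemma taylor2_left (c A B : R) f df (d2 : R -> R) (z y : R) : y <= z -> continuous df ->
  (forall x : R, is_derive x 1 f (df x)) ->
  (forall x : R, y < x < z -> x != c -> is_derive x 1 df (d2 x) /\ d2 x <= A + B * (z - x)) ->
  f y - f z - df z * (y - z) <= A / 2 * (y - z) ^+ 2 + B / 6 * (z - y) ^+ 3.
Proof.
move=> yz cdf hf h.
have opp (x : R) : is_derive x 1 (fun x : R => - x) (-1) by apply: is_derive_eq.
have := @taylor2_right (- c) A B (fun x => f (- x)) (fun x => - df (- x)) (fun x => d2 (- x))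
  (- z) (- y).
rewrite lerN2 !opprK => /(_ yz).
have cN : continuous (fun x : R => - df (- x)).
  move=> x; apply: (@cvgN _ _ _ _ _ (fun x => df (- x))).
  apply: (@continuous_comp _ _ _ (fun x : R => - x) df); last exact: cdf.
  exact: (@cvgN _ _ _ _ _ id).
move=> /(_ cN).
have d1 (x : R) : is_derive x 1 (fun x => f (- x)) (- df (- x)).
  have := @is_derive1_comp R f (fun x => - x) x _ _ (hf (- x)) (opp x).
  by rewrite mulrN1.
move=> /(_ d1); have -> : - y + z = z - y by ring.
have -> : - df z * (z - y) = df z * (y - z) by ring.
have -> : (z - y) ^+ 2 = (y - z) ^+ 2 by ring.
apply => x /andP[zx xy] xc.
have xyz : y < - x < z by rewrite ltrNr xy ltrNl zx.
have xc' : - x != c by rewrite eqr_oppLR.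
have [dd le2] := h (- x) xyz xc'.
split; last by move: le2; rewrite !opprK (addrC z).
have := is_deriveN (@is_derive1_comp R df (fun x => - x) x _ _ dd (opp x)).
by rewrite mulrN1 opprK.
Qed.

Lemma taylor2_abs (c A B : R) f df (d2 : R -> R) (z y : R) : continuous df ->
  (forall x : R, is_derive x 1 f (df x)) -> 0 <= B ->
  (forall x : R, Num.min y z < x < Num.max y z -> x != c ->
     is_derive x 1 df (d2 x) /\ d2 x <= A + B * `|x - z|) ->
  f y - f z - df z * (y - z) <= A / 2 * (y - z) ^+ 2 + B * `|y - z| ^+ 3.
Proof.
move=> cdf hf B0 h; have q0 : 0 <= `|y - z| ^+ 3 by rewrite exprn_ge0.
have hB : B / 6 * `|y - z| ^+ 3 <= B * `|y - z| ^+ 3.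
  by rewrite ler_wpM2r//; lra.
apply: le_trans (lerD (lexx _) hB).
case: (leP z y) => zy.
  rewrite ger0_norm ?subr_ge0//; apply: (@taylor2_right c _ _ _ _ d2) => // x xzy xc.
  have := h x; rewrite min_r// max_l// => /(_ xzy xc)[? le2]; split => //.
  have xz0 : 0 <= x - z by case/andP: xzy => + _; rewrite subr_ge0 => /ltW.
  by rewrite (ger0_norm xz0) in le2.
have yz0 : y - z <= 0 by rewrite subr_le0 ltW.
rewrite (ler0_norm yz0) opprB; apply: (@taylor2_left c A B f df d2 z y (ltW zy)) => // x xzy xc.
have := h x; rewrite (min_l (ltW zy)) (max_r (ltW zy)) => /(_ xzy xc)[? le2]; split => //.
have xz0 : x - z <= 0 by case/andP: xzy => _; rewrite subr_le0 => /ltW.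
by rewrite (ler0_norm xz0) opprB in le2.
Qed.

End taylor.

(** * One-sided expansions of the value functions *)

Section value_system_calculus.
Context {R : realType}.
Variables (lam sg : 'I_2 -> R) (rho : R) (U dU : 'I_2 -> R -> R) (thr : 'I_2 -> R).
Hypotheses (lam0 : forall i, 0 < lam i) (sg0 : forall i, 0 < sg i) (rho0 : 0 < rho).
Hypothesis VS : value_system lam sg rho U dU thr.

(** Below the threshold this is sg_i^2 / 2 times U_i''. From the threshold on it is nonnegative by
    [vs_super], whereas U_i'' = 0 beyond it. *)
Definition vs_gen i j (z : R) : R := (rho + lam i) * U i z - lam i * U j z.

Let Lg i := rho + lam i + lam i.

Lemma vs_gen_lip i j x y : `|vs_gen i j x - vs_gen i j y| <= Lg i * `|x - y|.
Proof.
rewrite /vs_gen (_ : _ - _ = (rho + lam i) * (U i x - U i y) - lam i * (U j x - U j y)); last by ring.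
rewrite (le_trans (ler_normB _ _))// !normrM /Lg [leRHS]mulrDl.
rewrite (gtr0_norm (lam0 i)) (gtr0_norm (addr_gt0 rho0 (lam0 i))).
by apply: lerD; rewrite ler_pM2l ?addr_gt0//; apply/slope01_dist/(vs_slope VS).
Qed.

Lemma vs_dU_continuous i : continuous (dU i).
Proof.
have [L _ h] := vs_lip VS; apply: (@dist_le_continuous R L) => x y; exact: h.
Qed.

(** The inequality is an equality below the threshold. Beyond it U_i is the identity and the
    right-hand side is nonnegative, which is the supersolution property. *)
Lemma vs_second i j (x : R) : i != j -> x != thr i ->
  is_derive x 1 (dU i) (if x < thr i then 2 / sg i ^+ 2 * vs_gen i j x else 0) /\
  (if x < thr i then 2 / sg i ^+ 2 * vs_gen i j x else 0) <= 2 / sg i ^+ 2 * vs_gen i j x.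
Proof.
move=> ij xt; case: ifPn => [xl|]; first by split => //; exact: (vs_ode VS).
rewrite -leNgt le_eqVlt eq_sym (negbTE xt) /= => tx.
split.
  have dU1 y : thr i < y -> dU i y = 1.
    move=> ty; have hy : is_derive y 1 (U i) 1.
      have hid : is_derive (y : R) 1 (fun x : R => x) 1 by apply: is_derive_eq.
      apply: near_eq_is_derive hid.
      by near=> u; rewrite (vs_stop VS)//; apply: ltW; near: u; exact: lt_nbhsr.
    by rewrite -(@derive_val _ _ _ _ _ _ _ (vs_derive VS i y)) (@derive_val _ _ _ _ _ _ _ hy).
  have hid : is_derive (x : R) 1 (fun x : R => (1 : R)) 0 by apply: is_derive_eq.
  apply: near_eq_is_derive hid.
  by near=> u; rewrite dU1//; near: u; exact: lt_nbhsr.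
apply: mulr_ge0; first by rewrite divr_ge0// sqr_ge0.
rewrite /vs_gen subr_ge0 (vs_stop VS (ltW tx)); exact: (vs_super VS ij (ltW tx)).
Unshelve. all: by end_near. Qed.

Lemma vs_taylor_ub i j : i != j -> exists2 K, 0 <= K & forall z m,
  U i (z + m) - U i z - dU i z * m <= vs_gen i j z / sg i ^+ 2 * m ^+ 2 + K * `|m| ^+ 3.
Proof.
move=> ij; have s2 : 0 < 2 / sg i ^+ 2 by rewrite divr_gt0// exprn_gt0.
have L0 : 0 <= Lg i by rewrite !addr_ge0 ?ltW.
exists (2 / sg i ^+ 2 * Lg i) => [|z m]; first by rewrite mulr_ge0// ltW.
have := @taylor2_abs R (thr i) (2 / sg i ^+ 2 * vs_gen i j z) (2 / sg i ^+ 2 * Lg i)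
  (U i) (dU i) _ z (z + m) (@vs_dU_continuous i) (vs_derive VS i) (mulr_ge0 (ltW s2) L0).
rewrite !(addrC z) !addrK => h.
apply: le_trans (h _ _) _ => [x _ xt|].
  have [d1 d2] := vs_second ij xt; split; first exact: d1.
  apply: (le_trans d2); rewrite -(mulrA (2 / sg i ^+ 2) (Lg i)) -mulrDr ler_pM2l//.
  by rewrite -lerBlDl (le_trans (ler_norm _))// vs_gen_lip.
rewrite lerD2r le_eqVlt; apply/orP; left; apply/eqP; field.
by rewrite gt_eqF.
Qed.

(** If z + m stays below the threshold, the upper expansion is applied to - U_i. If it passes the
    threshold then |m| >= del, so quadratic terms are at most |m|^3 / del and are absorbed by the
    cubic error; this is why K depends on del. *)
Lemma vs_taylor_lb i j (del : R) : i != j -> 0 < del -> exists2 K, 0 <= K & forall z m,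
  z <= thr i - del ->
  vs_gen i j z / sg i ^+ 2 * m ^+ 2 - K * `|m| ^+ 3 <= U i (z + m) - U i z - dU i z * m.
Proof.
move=> ij del0; have s2 : 0 < 2 / sg i ^+ 2 by rewrite divr_gt0// exprn_gt0.
have L0 : 0 <= Lg i by rewrite !addr_ge0 ?ltW.
have [L Lpos hL] := vs_lip VS.
pose K1 := 2 / sg i ^+ 2 * Lg i.
have K10 : 0 <= K1 by rewrite mulr_ge0// ltW.
pose M := `|vs_gen i j (thr i)| / sg i ^+ 2 + Lg i * 0 + 2 * L.
exists (K1 + 2 * L / del) => [|z m zd].
  by rewrite addr_ge0// divr_ge0 ?mulr_ge0 ?ltW.
have m3 : 0 <= `|m| ^+ 3 by rewrite exprn_ge0.
case: (leP (z + m) (thr i)) => zm.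
  have := @taylor2_abs R (thr i) (- (2 / sg i ^+ 2 * vs_gen i j z)) K1
    (fun x => - U i x) (fun x => - dU i x) (fun x => - (2 / sg i ^+ 2 * vs_gen i j x)) z (z + m).
  rewrite !(addrC z) !addrK => h.
  have {}h := h _ _ K10 _.
  have : - U i (m + z) - - U i z - - dU i z * m <=
      - (2 / sg i ^+ 2 * vs_gen i j z) / 2 * m ^+ 2 + K1 * `|m| ^+ 3.
    apply: h.
    - by move=> x; apply: cvgN; exact: vs_dU_continuous.
    - by move=> x; apply: is_deriveN; exact: (vs_derive VS).
    - move=> x /andP[_ xmax] xt.
      have xt' : x < thr i.
        apply: lt_le_trans xmax _; rewrite ge_max addrC zm/=.
        by rewrite (le_trans zd)// lerBlDr lerDl ltW.
      split; first by apply: is_deriveN; exact: (vs_ode VS ij xt').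
      rewrite /K1 -!mulrN -(mulrA (2 / sg i ^+ 2) (Lg i)) -mulrDr ler_pM2l// lerNl opprD opprK.
      rewrite lerBlDr -lerBlDl distrC.
      by rewrite (le_trans (ler_norm _))// vs_gen_lip.
  have e1 : - (2 / sg i ^+ 2 * vs_gen i j z) / 2 * m ^+ 2 = - (vs_gen i j z / sg i ^+ 2 * m ^+ 2).
    by field; rewrite gt_eqF.
  rewrite e1 (addrC m).
  have : 0 <= 2 * L / del * `|m| ^+ 3 by rewrite mulr_ge0// divr_ge0 ?mulr_ge0 ?ltW.
  by rewrite mulrDl; lra.
have zt : z < thr i by move: zd; lra.
have dm : del <= `|m|.
  by rewrite (le_trans _ (ler_norm m))//; move: zm zd; lra.
(* U'' <= L bounds the quadratic term; the increment itself is >= - L m^2. *)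
have g_le : vs_gen i j z / sg i ^+ 2 <= L.
  have [dz d1z] := vs_ode VS ij zt.
  have : 2 / sg i ^+ 2 * vs_gen i j z <= L.
    rewrite -d1z.
    have cv : (fun h : R => h^-1 *: (dU i (h + z) - dU i z)) h @[h --> 0^'+] --> 'D_1 (dU i) z.
      have := dz; rewrite /derivable => /cvg_ex[l hl].
      have -> : 'D_1 (dU i) z = l.
        by apply/cvg_lim => //.
      have hl' : (fun h : R => h^-1 *: (dU i (h + z) - dU i z)) h @[h --> 0^'] --> l.
        by move: hl; under eq_fun do rewrite scaler1.
      apply: cvg_trans hl'; apply: cvg_app; apply: within_subset.
      by move=> h /= h0; rewrite gt_eqF.
    have cvl := cvg_lim (@Rhausdorff R) cv; rewrite -cvl.
    apply: limr_le; first by apply/cvg_ex; eexists; exact: cv.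
    near=> h.
    have h0 : 0 < h by [].
    rewrite /GRing.scale/= ler_pdivrMl// mulrC.
    apply: le_trans (ler_norm _) _; apply: le_trans (hL _ _ _) _.
    by rewrite addrK gtr0_norm.
  have -> : vs_gen i j z / sg i ^+ 2 = (2 / sg i ^+ 2 * vs_gen i j z) / 2.
    by field; rewrite gt_eqF.
  by lra.
have T1 : - (L * m ^+ 2) <= U i (z + m) - U i z - dU i z * m.
  have m0 : 0 < m by move: zm zt; lra.
  have cU : continuous (U i) by apply: slope01_continuous; exact: (vs_slope VS).
  have zzm : z < z + m by rewrite ltrDl.
  have [x] := @MVT R (U i) (dU i) z (z + m) zzm (fun x _ => vs_derive VS i x) (@continuous_subspaceT _ _ _ _ cU).
  rewrite in_itv/= => /andP[zx xm] ->; rewrite (addrC z) addrK -mulrBl.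
  have : `|dU i x - dU i z| <= L * m.
    apply: le_trans (hL _ _ _) _; rewrite ler_pM2l// ger0_norm ?subr_ge0 ?ltW//.
    by move: xm; lra.
  rewrite ler_norml => /andP[hl _].
  by rewrite expr2 mulrA -mulNr ler_pM2r.
have m2 : m ^+ 2 <= `|m| ^+ 3 / del.
  rewrite ler_pdivlMr// -real_normK ?num_real// [leRHS]exprS mulrC.
  by rewrite ler_wpM2r// sqr_ge0.
have q1 : vs_gen i j z / sg i ^+ 2 * m ^+ 2 <= L * m ^+ 2 by rewrite ler_wpM2r// sqr_ge0.
have q2 : L * m ^+ 2 <= L / del * `|m| ^+ 3.
  by rewrite -mulrA ler_pM2l// mulrC.
have q3 : 0 <= K1 * `|m| ^+ 3 by rewrite mulr_ge0.
have -> : (K1 + 2 * L / del) * `|m| ^+ 3 = K1 * `|m| ^+ 3 + 2 * (L / del * `|m| ^+ 3) by ring.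
by lra.
Unshelve. all: by end_near. Qed.

(** Beyond both thresholds the two functions coincide; before the larger threshold c, monotonicity
    keeps both between 0 and |c|. *)
Lemma vs_diff_bounded i j : exists2 B, 0 <= B & forall z, `|U i z - U j z| <= B.
Proof.
pose c := Num.max (thr i) (thr j).
have stop z : c <= z -> U i z - U j z = 0.
  by rewrite ge_max => /andP[h1 h2]; rewrite !(vs_stop VS)// subrr.
have U0 k z : 0 <= U k z by rewrite (le_trans _ (vs_ge VS k z))// le_max lexx orbT.
exists `|c| => // z; case: (leP c z) => cz; first by rewrite stop// normr0.
have Uc k : (k == i) || (k == j) -> U k z <= `|c|.
  move=> hk; have tk : thr k <= c by case/orP: hk => /eqP ->; rewrite le_max lexx ?orbT.
  have /andP[h _] := vs_slope VS k (ltW cz).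
  rewrite (le_trans _ (ler_norm c))// -[leRHS](vs_stop VS tk).
  by rewrite -subr_ge0.
have := Uc i; have := Uc j; rewrite !eqxx orbT => /(_ isT) h1 /(_ isT) h2.
have := U0 i z; have := U0 j z.
by rewrite ler_norml; lra.
Qed.

End value_system_calculus.

(** * One-step estimates in expectation *)

Section markov_bounded.
Context {d : measure_display} {T : measurableType d} {R : realType}.
Variable P : probability T R.

(** The laws of Y 1_C1 and Y 1_C2 are proportional on ]0, +oo[. The value 0, at which the
    complements of C1 and C2 interfere, does not contribute to the integrals. *)
Lemma ge0_integral_proportional (p : R) (C1 C2 : set T) (Y : T -> R) :
  0 <= p -> measurable C1 -> measurable C2 -> measurable_fun setT Y -> (forall w, 0 <= Y w) ->
  (forall B, measurable B -> P (Y @^-1` B `&` C1) = (p%:E * P (Y @^-1` B `&` C2))%E) ->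
  (\int[P]_w (Y w * \1_C1 w)%:E = p%:E * \int[P]_w (Y w * \1_C2 w)%:E)%E.
Proof.
move=> p0 mC1 mC2 mY Y0 h.
pose phi (C : set T) (w : T) : R := Y w * \1_C w.
have mphi C : measurable C -> measurable_fun setT (phi C).
  by move=> mC; apply: measurable_funM => //; exact: measurable_indic.
have phi0 C w : 0 <= phi C w by rewrite /phi mulr_ge0.
pose D : set R := `]0, +oo[%classic.
have mD : measurable D by exact: measurable_itv.
have mE : measurable_fun D (fun x : R => x%:E) by apply: measurable_funTS; exact/measurable_EFinP.
have D0 : {in D, forall y : R, (0 <= y%:E)%E}.
  by move=> y; rewrite inE /D/= in_itv/= andbT lee_fin => /ltW.
have push C : measurable C ->
    (\int[pushforward P (phi C)]_(y in D) y%:E = \int[P]_w (phi C w)%:E)%E.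
  move=> mC; rewrite (ge0_integral_pushforward (mphi _ mC) P mD mE D0).
  rewrite integral_mkcond; apply: eq_integral => w _; rewrite patchE.
  case: ifPn => //; rewrite notin_setE /D/= in_itv/= andbT => /negP; rewrite -leNgt => hle.
  by congr (_%:E); apply/eqP; rewrite eq_le hle phi0.
rewrite -[X in X = _]push// -[X in _ = (_ * X)%E]push//.
have pushm C : measurable C -> exists m : {measure set R -> \bar R},
    m = pushforward P (phi C) :> (set R -> \bar R).
  move=> mC.
  by exists (measure_function_pushforward__canonical__measure_function_Measure P (mphi _ mC)).
have [m1 m1E] := pushm _ mC1; have [m2 m2E] := pushm _ mC2; rewrite -m1E -m2E.
rewrite -(ge0_integral_mscale m2 mD (NngNum p0) mE); last first.
  by move=> x; rewrite /D/= in_itv/= andbT lee_fin => /ltW.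
apply: eq_measure_integral => A mA AD.
have E C : phi C @^-1` A = Y @^-1` A `&` C.
  apply/seteqP; split => w /=; rewrite /phi indicE.
    case: (boolP (w \in C)) => [wC|_]; first by rewrite mulr1 => ?; split => //; exact: set_mem.
    by rewrite mulr0 => /AD; rewrite /D/= in_itv/= ltxx.
  by move=> [hA wC]; rewrite (mem_set wC) mulr1.
transitivity (p%:E * m2 A)%E; last by [].
by rewrite m1E m2E /pushforward !E h.
Qed.

Variables (lambda1 lambda2 : R) (W : R -> T -> R) (eps : R -> T -> 'I_2).
Hypotheses (hl1 : 0 < lambda1) (hl2 : 0 < lambda2).
Hypothesis hcompl : measure_is_complete P.
Hypothesis hBM : brownian_motion P W.
Hypothesis hMC : markov_chain P (generator lambda1 lambda2) eps.
Hypothesis hind : indep P (sigma_of W `[0, +oo[) (sigma_eps eps).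
Local Notation F := (augmented_filtration P W eps).

Lemma markov_bounded (s t M : R) (i j : 'I_2) (Y : T -> R) : 0 <= s -> s <= t ->
  i != j ->
  measurable_wrt (F s) Y -> (forall w, `|Y w| <= M) ->
  \int[P]_w (Y w * \1_([set w | eps s w = i] `&` [set w | eps t w = j]) w) =
  expmx ((t - s) *: generator lambda1 lambda2) i j * \int[P]_w (Y w * \1_[set w | eps s w = i] w).
Proof.
move=> s0 st ij mY hY; have t0 : 0 <= t by exact: le_trans st.
set C1 := _ `&` _; set C2 := [set w | eps s w = i]; set p := expmx _ _ _.
have p0 : 0 <= p.
  by have [] := expmx_generator_bounds hl1 hl2 ij (_ : 0 <= t - s); rewrite ?subr_ge0.
have mC2 : measurable C2 by exact: (measurable_eps hMC).
have mC1 : measurable C1 by apply: measurableI => //; exact: (measurable_eps hMC).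
have mYm : measurable_fun setT Y.
  by apply: measurable_wrt_measurable mY; exact: (aug_measurable hcompl hBM hMC).
(* Shifting by the bound makes the variable nonnegative; the constant is treated by the Markov
   property of the whole space. *)
pose Z w := Y w + M.
have Z0 w : 0 <= Z w by have := hY w; rewrite ler_norml => /andP[+ _]; rewrite /Z; lra.
have mZ : measurable_wrt (F s) Z.
  apply: measurable_wrtD => //; exact: measurable_wrt_cst.
have mZm : measurable_fun setT Z by apply: measurable_funD.
have ind_le1 C (w : T) : `|\1_C w : R| <= 1 by rewrite indicE; case: (_ \in _); rewrite ?normr1 ?normr0.
have iC C : measurable C -> integrableR P (fun w => \1_C w : R).
  move=> mC; by apply: (@integrableR_bounded _ _ _ P _ 1); [exact: measurable_indic|exact: ind_le1].
have iYC C : measurable C -> integrableR P (fun w => Y w * \1_C w).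
  by move=> mC; apply: (integrableR_bddM mYm hY); exact: iC.
have iZC C : measurable C -> integrableR P (fun w => Z w * \1_C w).
  move=> mC; apply: (@integrableR_bddM _ _ _ P _ _ (M + M)) => //; last exact: iC.
  by move=> w; rewrite (le_trans (ler_normD _ _))// lerD// ger0_norm// (le_trans _ (hY w)).
have key : \int[P]_w (Z w * \1_C1 w) = p * \int[P]_w (Z w * \1_C2 w).
  rewrite /Rintegral (@ge0_integral_proportional p C1 C2 Z) => //.
    by rewrite -(Rintegral_ge0E (iZC _ mC2)) -EFinM.
  by move=> B mB; apply: (markov_aug hcompl hBM hMC hind) => //; exact: mZ.
have cst1 : \int[P]_w (\1_C1 w : R) = p * \int[P]_w (\1_C2 w : R).
  rewrite /Rintegral !integral_indic// !setIT.
  have hT : F s setT by exact: sigma_setT.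
  have := markov_aug hcompl hBM hMC hind i j s0 st hT.
  rewrite !setTI -/C1 -/C2 -/p => E.
  transitivity (fine (p%:E * P C2)%E); first by congr fine; exact: E.
  by rewrite fineM// fin_num_measure.
have dec C : measurable C -> \int[P]_w (Y w * \1_C w) =
    \int[P]_w (Z w * \1_C w) - M * \int[P]_w (\1_C w : R).
  move=> mC; rewrite -RintegralZl//; last exact: iC.
  rewrite -RintegralB//; [|exact: iZC|by apply: integrableRZ; exact: iC].
  by apply: eq_Rintegral => w _; rewrite /Z; ring.
by rewrite !dec// key cst1; ring.
Qed.

End markov_bounded.

Lemma MVT_dist {R : realType} (f df : R -> R) (x y : R) :
  (forall u : R, is_derive u 1 f (df u)) ->
  exists2 xi, `|xi - x| <= `|y - x| & f y - f x = df xi * (y - x).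
Proof.
move=> hf; have cf : continuous f by move=> u; exact: (@cvg_is_derive _ _ (u, _) (hf u)).
case: (leP x y) => xy.
  have [xi xiI E] := MVT_segment xy (fun u _ => hf u) (@continuous_subspaceT _ _ _ f cf).
  exists xi => //; move: xiI; rewrite in_itv/= => /andP[h1 h2].
  by rewrite !ger0_norm ?subr_ge0//; lra.
have [xi xiI E] := MVT_segment (ltW xy) (fun u _ => hf u) (@continuous_subspaceT _ _ _ f cf).
exists xi; last by rewrite -opprB E; ring.
move: xiI; rewrite in_itv/= => /andP[h1 h2].
have xi0 : xi - x <= 0 by lra.
have yx0 : y - x <= 0 by lra.
by rewrite (ler0_norm xi0) (ler0_norm yx0); lra.
Qed.

(** * Pathwise expansion over one step *)

Section pathwise_step.
Context {R : realType}.
Variables (lam sg : 'I_2 -> R) (rho : R) (U dU : 'I_2 -> R -> R) (thr : 'I_2 -> R).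
Hypotheses (lam0 : forall i, 0 < lam i) (sg0 : forall i, 0 < sg i) (rho0 : 0 < rho).
Hypothesis VS : value_system lam sg rho U dU thr.
Local Notation gen := (vs_gen lam rho U).

Definition step_main i j (z m D J : R) : R :=
  gen i j z / sg i ^+ 2 * m ^+ 2 + dU i z * m + dU i z * D + J * (U j z - U i z).

(** Here q is the square root of the step. As m^2 and J have mean O(q^2) and D^2 has mean O(q^4),
    the weights by q make every term of mean O(q^3). *)
Definition step_err (q m D J : R) : R :=
  `|m| ^+ 3 + D ^+ 2 / q + q * m ^+ 2 + q * J + J * m ^+ 2 / q.

(** What is left over are mixed products of D with m and of J with m and D. Young's inequality with
    weight q turns each into squares of the right order. *)
Lemma step_remainder : exists2 L, 0 <= L & forall i j z m D J q, 0 < q -> q <= 1 ->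
  J = 0 \/ J = 1 ->
  `|(U i (z + m + D) + J * (U j (z + m + D) - U i (z + m + D)))
   - (U i (z + m) + dU i z * D + J * (U j z - U i z))| <=
  L * (D ^+ 2 / q + q * m ^+ 2 + q * J + J * m ^+ 2 / q).
Proof.
have [L L0 hL] := vs_lip VS.
exists (2 * L + 2) => [|i j z m D J q q0 q1 hJ]; first by rewrite addr_ge0// mulr_ge0// ltW.
have qi : 1 <= q^-1 by rewrite invf_ge1.
have qi0 : 0 < q^-1 by rewrite invr_gt0.
have [xi hxi Exi] := MVT_dist (z + m) (z + m + D) (vs_derive VS i).
have rem1 : `|U i (z + m + D) - U i (z + m) - dU i z * D| <= L * (`|D| * (`|m| + `|D|)).
  rewrite Exi (_ : z + m + D - (z + m) = D); last by ring.
  rewrite -mulrBl normrM mulrCA mulrC ler_wpM2l//.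
  apply: le_trans (hL _ _ _) _; rewrite ler_pM2l//.
  rewrite (_ : xi - z = m + (xi - (z + m))); last by ring.
  apply: le_trans (ler_normD _ _) _; rewrite lerD2l (le_trans hxi)//.
  by rewrite (_ : z + m + D - (z + m) = D)//; ring.
have rem2 : `|(U j (z + m + D) - U i (z + m + D)) - (U j z - U i z)| <= 2 * (`|m| + `|D|).
  have s k : `|U k (z + m + D) - U k z| <= `|m| + `|D|.
    apply: le_trans (slope01_dist _ _ (vs_slope VS k)) _.
    by rewrite (_ : z + m + D - z = m + D) ?ler_normD//; ring.
  rewrite (_ : _ - _ = (U j (z + m + D) - U j z) - (U i (z + m + D) - U i z)); last by ring.
  by apply: le_trans (ler_normB _ _) _; have := s i; have := s j; lra.
have J0 : 0 <= J by case: hJ => ->.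
have J1 : J <= 1 by case: hJ => ->; rewrite ?ler01.
set a := `|m| in rem1 rem2; set b := `|D| in rem1 rem2.
have a2 : m ^+ 2 = a ^+ 2 by rewrite /a real_normK// num_real.
have b2 : D ^+ 2 = b ^+ 2 by rewrite /b real_normK// num_real.
have a0 : 0 <= a by exact: normr_ge0.
have b0 : 0 <= b by exact: normr_ge0.
have young x y : 2 * (x * y) <= q * x ^+ 2 + y ^+ 2 / q.
  rewrite -subr_ge0 (_ : _ - _ = q * (x - y / q) ^+ 2); first by rewrite mulr_ge0 ?sqr_ge0// ltW.
  by field; rewrite gt_eqF.
apply: (@le_trans _ _ (L * (b * (a + b)) + J * (2 * (a + b)))).
  rewrite (_ : _ - _ = (U i (z + m + D) - U i (z + m) - dU i z * D) +
    J * ((U j (z + m + D) - U i (z + m + D)) - (U j z - U i z))); last by ring.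
  apply: le_trans (ler_normD _ _) _; apply: lerD => //.
  by rewrite normrM (ger0_norm J0) ler_wpM2l.
rewrite a2 b2; set Db := b ^+ 2 / q.
have bb : b * b <= Db by rewrite /Db -expr2 -[leLHS]mulr1 ler_wpM2l// sqr_ge0.
have Db0 : 0 <= Db by rewrite /Db divr_ge0// ?sqr_ge0// ltW.
have qa0 : 0 <= q * a ^+ 2 by rewrite mulr_ge0 ?sqr_ge0// ltW.
have y1 := young a b; rewrite -/Db in y1.
have y2 : J * (2 * a) <= q * J + J * a ^+ 2 / q.
  rewrite (_ : q * J + _ = J * (q + a ^+ 2 / q)); last by ring.
  by rewrite ler_wpM2l//; have := young 1 a; rewrite mul1r expr1n mulr1.
have y3 : J * (2 * b) <= q * J + Db.
  apply: (@le_trans _ _ (J * (q + Db))).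
    by rewrite ler_wpM2l//; have := young 1 b; rewrite mul1r expr1n mulr1.
  by rewrite mulrDr mulrC lerD2l -[leRHS]mul1r ler_wpM2r.
have t0 : 0 <= q * J by rewrite mulr_ge0// ltW.
have t1 : 0 <= J * a ^+ 2 / q by rewrite divr_ge0 ?mulr_ge0 ?sqr_ge0// ltW.
have l1 : L * (b * a) <= L * (q * a ^+ 2 + Db).
  by rewrite ler_pM2l//; move: y1; rewrite mulrC; lra.
have l2 : L * (b * b) <= L * Db by rewrite ler_pM2l.
have l3 : 0 <= L * (q * J) by rewrite mulr_ge0// ltW.
have l4 : 0 <= L * (J * a ^+ 2 / q) by rewrite mulr_ge0// ltW.
have l5 : 0 <= L * (q * a ^+ 2) by rewrite mulr_ge0// ltW.
have l6 : 0 <= L * Db by rewrite mulr_ge0// ltW.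
rewrite mulrDr in l1.
rewrite (_ : L * (b * (a + b)) + _ = L * (b * a) + L * (b * b) + J * (2 * a) + J * (2 * b)); last first.
  by ring.
set X1 := q * a ^+ 2 in l1 l5 qa0 *; set X2 := q * J in y2 y3 t0 l3 *.
set X3 := J * a ^+ 2 / q in y2 t1 l4 *.
rewrite (_ : (2 * L + 2) * _ = 2 * (L * Db) + 2 * (L * X1) + 2 * (L * X2) + 2 * (L * X3)
  + 2 * Db + 2 * X1 + 2 * X2 + 2 * X3); last by ring.
by lra.
Qed.

Lemma step_upper i j : i != j -> exists2 K, 0 <= K & forall z m D J q, 0 < q -> q <= 1 ->
  J = 0 \/ J = 1 ->
  U i (z + m + D) + J * (U j (z + m + D) - U i (z + m + D)) - U i z <=
  step_main i j z m D J + K * step_err q m D J.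
Proof.
move=> ij; have [L L0 hL] := step_remainder.
have [K K0 hK] := vs_taylor_ub lam0 sg0 rho0 VS ij.
exists (K + L) => [|z m D J q q0 q1 hJ]; first exact: addr_ge0.
have := hL i j z m D J q q0 q1 hJ; rewrite ler_norml => /andP[_].
have := hK z m.
rewrite /step_main /step_err; set X := D ^+ 2 / q + _ + _ + _; set Y := `|m| ^+ 3.
rewrite (_ : Y + D ^+ 2 / q + _ + _ + _ = Y + X); last by rewrite /X; ring.
have X0 : 0 <= X.
  have J0 : 0 <= J by case: hJ => ->.
  have q0' := ltW q0; have m2 := sqr_ge0 m; have D2 := sqr_ge0 D.
  rewrite /X; move: m2 D2; move: (m ^+ 2) (D ^+ 2) => m2 D2 hm hD.
  by rewrite !(addr_ge0, divr_ge0, mulr_ge0).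
have Y0 : 0 <= Y by rewrite exprn_ge0.
have := mulr_ge0 K0 X0; have := mulr_ge0 L0 Y0.
by rewrite mulrDl !mulrDr; lra.
Qed.

Lemma step_lower i j (del : R) : i != j -> 0 < del ->
  exists2 K, 0 <= K & forall z m D J q, 0 < q -> q <= 1 -> J = 0 \/ J = 1 ->
  z <= thr i - del ->
  step_main i j z m D J - K * step_err q m D J <=
  U i (z + m + D) + J * (U j (z + m + D) - U i (z + m + D)) - U i z.
Proof.
move=> ij del0; have [L L0 hL] := step_remainder.
have [K K0 hK] := vs_taylor_lb lam0 sg0 rho0 VS ij del0.
exists (K + L) => [|z m D J q q0 q1 hJ hz]; first exact: addr_ge0.
have := hL i j z m D J q q0 q1 hJ; rewrite ler_norml => /andP[+ _].
have := hK z m hz.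
rewrite /step_main /step_err; set X := D ^+ 2 / q + _ + _ + _; set Y := `|m| ^+ 3.
rewrite (_ : Y + D ^+ 2 / q + _ + _ + _ = Y + X); last by rewrite /X; ring.
have X0 : 0 <= X.
  have J0 : 0 <= J by case: hJ => ->.
  have q0' := ltW q0; have m2 := sqr_ge0 m; have D2 := sqr_ge0 D.
  rewrite /X; move: m2 D2; move: (m ^+ 2) (D ^+ 2) => m2 D2 hm hD.
  by rewrite !(addr_ge0, divr_ge0, mulr_ge0).
have Y0 : 0 <= Y by rewrite exprn_ge0.
have := mulr_ge0 K0 X0; have := mulr_ge0 L0 Y0.
by rewrite mulrDl !mulrDr; lra.
Qed.

End pathwise_step.

Section one_step.
Context {d : measure_display} {T : measurableType d} {R : realType}.
Variable P : probability T R.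
Variables (lambda1 lambda2 sg1 sg2 rho z0 : R) (W : R -> T -> R) (eps : R -> T -> 'I_2).
Hypotheses (hl1 : 0 < lambda1) (hl2 : 0 < lambda2) (hs1 : 0 < sg1) (hs2 : 0 < sg2).
Hypothesis rho0 : 0 < rho.
Hypothesis hcompl : measure_is_complete P.
Hypothesis hBM : brownian_motion P W.
Hypothesis hMC : markov_chain P (generator lambda1 lambda2) eps.
Hypothesis hind : indep P (sigma_of W `[0, +oo[) (sigma_eps eps).
Local Notation rich := (rich P W eps).
Local Notation F := (augmented_filtration P W eps).
Local Notation H := (fun r w => by_regime sg1 sg2 (eps r w)).
Variable Z : R -> T -> R.
Hypothesis hZ0 : forall w, Z 0 w = z0.
Hypothesis hI : is_ito_integral P F W H (fun t w => Z t w - z0).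
Local Notation D := (ito_error sg1 sg2 W eps (fun t w => Z t w - z0)).
Local Notation lam := (by_regime lambda1 lambda2).
Local Notation sg := (by_regime sg1 sg2).
Variables (U dU : 'I_2 -> R -> R) (thr : 'I_2 -> R).
Hypothesis VS : value_system lam sg rho U dU thr.

Lemma by_regime_gt0 (a b : R) i : 0 < a -> 0 < b -> 0 < by_regime a b i.
Proof. by rewrite /by_regime; case: ifP. Qed.

Let lam0 i : 0 < lam i. Proof. exact: by_regime_gt0. Qed.
Let sg0 i : 0 < sg i. Proof. exact: by_regime_gt0. Qed.

Lemma state_measurable_wrt t : 0 <= t -> measurable_wrt (F t) (Z t).
Proof.
move=> t0; have := ito_measurable_wrt hI t0.
move=> h; rewrite (_ : Z t = fun w => (Z t w - z0) + z0); last by apply/funext => w; rewrite subrK.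
by apply: measurable_wrtD => //; exact: measurable_wrt_cst.
Qed.

Lemma state_measurable t : 0 <= t -> measurable_fun setT (Z t).
Proof.
move=> t0; apply: measurable_wrt_measurable (state_measurable_wrt t0).
exact: (aug_measurable hcompl hBM hMC).
Qed.

Let C := ito_error_cst lambda1 lambda2 sg1 sg2.

Let C0 : 0 <= C.
Proof. by rewrite /C /ito_error_cst mulr_ge0// mulr_ge0 ?sqr_ge0// addr_ge0// ltW. Qed.

Lemma ito_error_L1 (s t : R) : 0 <= s -> s <= t ->
  integrableR P (D s t) /\ \int[P]_w `|D s t w| <= (1 + C) * (1 + t).
Proof.
move=> s0 st; have t0 : 0 <= t by exact: le_trans st.
have [iD2 D2] := ito_error_sq hl1 hl2 hcompl hBM hMC hind hI s0 st.
apply: L1_le_L2; first exact: (measurable_ito_error hcompl hBM hMC hI).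
  by apply: mulr_gt0; rewrite ltr_pwDl.
apply: le_trans D2 _; rewrite lee_fin -/C exprMn.
apply: ler_pM => //; first exact: sqr_ge0.
  by rewrite sqrrD expr1n mul1r; have := sqr_ge0 C; have := C0; lra.
by rewrite lerXn2r ?nnegrE ?subr_ge0 ?addr_ge0//; lra.
Qed.

Lemma state_decomposition t w : Z t w = z0 + H 0 w * (W t w - W 0 w) + D 0 t w.
Proof. by rewrite /ito_error hZ0; ring. Qed.

Let absH r w : `|H r w| <= sg1 + sg2.
Proof. by rewrite /by_regime; case: ifP => _; rewrite gtr0_norm// ?lerDl ?lerDr ltW. Qed.

(** This crude growth in t suffices: the discount e^(-rho t) beats it when the horizon is chosen in
    [value_lower]. *)
Lemma state_mean : exists2 a, 0 <= a & forall t, 0 <= t ->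
  integrableR P (Z t) /\ \int[P]_w `|Z t w| <= a * (1 + t).
Proof.
exists (`|z0| + (sg1 + sg2) + (1 + C)).
  by rewrite !addr_ge0// ltW.
move=> t t0.
have [iD D1] := ito_error_L1 (lexx 0) t0.
have mW : measurable_fun setT (fun w => W t w - W 0 w).
  by apply: measurable_funB; exact: (measurable_W hBM).
have [iW W1] : integrableR P (fun w => W t w - W 0 w) /\ \int[P]_w `|W t w - W 0 w| <= 1 + t.
  have m1 : measurable_wrt (rich 0) (cst (1 : R) : T -> R) by exact: measurable_wrt_cst.
  have [i2 e2] := sq_incr hBM hMC hind (lexx 0) t0 m1 (integrableR_cst P 1).
  apply: L1_le_L2 => //; first by rewrite ltr_pwDl.
  have i2' : integrableR P (fun w => (W t w - W 0 w) ^+ 2) by exact: (integrable_sq_incr hBM).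
  rewrite -(Rintegral_ge0E i2') lee_fin.
  rewrite (_ : \int[P]_w _ = \int[P]_w (1 * (W t w - W 0 w) ^+ 2)); last first.
    by apply: eq_Rintegral => w _; rewrite mul1r.
  rewrite e2 Rintegral_cstP subr0 mulr1 sqrrD expr1n mul1r; have := sqr_ge0 t; lra.
have iHW : integrableR P (fun w => H 0 w * (W t w - W 0 w)).
  exact: (integrableR_bddM (measurable_regime hBM hMC sg1 sg2 (lexx 0)) (absH 0)).
have iz : integrableR P (fun w => z0 + H 0 w * (W t w - W 0 w)).
  by apply: integrableRD => //; exact: integrableR_cst.
have iZ : integrableR P (Z t).
  rewrite (_ : Z t = fun w => z0 + H 0 w * (W t w - W 0 w) + D 0 t w).
    exact: integrableRD.
  by apply/funext => w; exact: state_decomposition.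
split => //.
pose bnd w := `|z0| + (sg1 + sg2) * `|W t w - W 0 w| + `|D 0 t w|.
have i1 := integrableR_norm iW; have i3 := integrableR_norm iD.
have i4 := integrableRZ (sg1 + sg2) i1.
have i5 := integrableRD (integrableR_cst P `|z0|) i4.
apply: (@le_trans _ _ (\int[P]_w bnd w)).
  apply: le_Rintegral => //; first exact: integrableR_norm.
    exact: integrableRD.
  move=> w _; rewrite (state_decomposition t w) /bnd.
  apply: le_trans (ler_normD _ _) _; rewrite lerD2r.
  apply: le_trans (ler_normD _ _) _; rewrite lerD2l normrM.
  by rewrite ler_wpM2r.
rewrite /bnd RintegralD// RintegralD//; last exact: integrableR_cst.
rewrite Rintegral_cstP RintegralZl//.
have s12 : 0 <= sg1 + sg2 by rewrite addr_ge0// ltW.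
have hW := ler_wpM2l s12 W1; have hz : 0 <= `|z0| * t by rewrite mulr_ge0.
rewrite [leRHS](_ : _ = `|z0| + `|z0| * t + (sg1 + sg2) * (1 + t) + (1 + C) * (1 + t)); last by ring.
by move: D1 hW hz; lra.
Qed.

Definition state_value t w : R := U (eps t w) (Z t w).
Local Notation V := state_value.

Lemma U_continuous i : continuous (U i).
Proof. exact: slope01_continuous (vs_slope VS i). Qed.

Lemma U_ge0 i z : 0 <= U i z.
Proof. by rewrite (le_trans _ (vs_ge VS i z))// le_max lexx orbT. Qed.

Lemma U_le i z : U i z <= U i 0 + `|z|.
Proof.
have := slope01_dist z 0 (vs_slope VS i); rewrite subr0 => h.
by have := le_trans (ler_norm _) h; lra.
Qed.

Lemma state_value_ge0 t w : 0 <= V t w.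
Proof. exact: U_ge0. Qed.

Lemma state_value_split t w : V t w =
  U ord0 (Z t w) * \1_[set w | eps t w = ord0] w +
  U ord_max (Z t w) * \1_[set w | eps t w = ord_max] w.
Proof.
rewrite /V !indicE; have [e|e] := I2_cases (eps t w); rewrite e.
- by rewrite mem_set// memNset /= ?e// mulr1 mulr0 addr0.
- by rewrite memNset /= ?e// mem_set//= mulr1 mulr0 add0r.
Qed.

Lemma aug_eps s r j : 0 <= r <= s -> F s [set w | eps r w = j].
Proof. by move=> rs; apply: sigma_gen; left; right; exists r, j. Qed.

Lemma state_value_measurable_wrt t : 0 <= t -> measurable_wrt (F t) (V t).
Proof.
move=> t0; rewrite (_ : V t = fun w => U ord0 (Z t w) * \1_[set w | eps t w = ord0] w +
  U ord_max (Z t w) * \1_[set w | eps t w = ord_max] w); last first.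
  by apply/funext => w; exact: state_value_split.
have mU i : measurable_fun setT (U i) by apply: continuous_measurable_fun; exact: U_continuous.
by apply: measurable_wrtD; (apply: measurable_wrtM; last first;
  [apply: measurable_wrt_indic; apply: aug_eps; rewrite t0 lexx
  |apply: (measurable_wrt_comp (mU _)); exact: state_measurable_wrt]).
Qed.

Lemma state_value_integrable t : 0 <= t -> integrableR P (V t).
Proof.
move=> t0; have [a _ /(_ t t0)[iZ _]] := state_mean.
apply: (@integrableR_le _ _ _ P _ (fun w => U ord0 0 + U ord_max 0 + `|Z t w|)).
- apply: measurable_wrt_measurable (state_value_measurable_wrt t0).
  exact: (aug_measurable hcompl hBM hMC).
- by apply: integrableRD; [exact: integrableR_cst|exact: integrableR_norm].
- move=> w; rewrite ger0_norm ?state_value_ge0// /V.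
  apply: le_trans (U_le _ _) _; rewrite lerD2r.
  by have [->|->] := I2_cases (eps t w); rewrite ?lerDl ?lerDr U_ge0.
Qed.

End one_step.

(** * Means of the main term and of the error of one step *)

Section one_step_expectation.
Context {d : measure_display} {T : measurableType d} {R : realType}.
Variable P : probability T R.
Variables (lambda1 lambda2 sg1 sg2 rho z0 : R) (W : R -> T -> R) (eps : R -> T -> 'I_2).
Hypotheses (hl1 : 0 < lambda1) (hl2 : 0 < lambda2) (hs1 : 0 < sg1) (hs2 : 0 < sg2).
Hypothesis rho0 : 0 < rho.
Hypothesis hcompl : measure_is_complete P.
Hypothesis hBM : brownian_motion P W.
Hypothesis hMC : markov_chain P (generator lambda1 lambda2) eps.
Hypothesis hind : indep P (sigma_of W `[0, +oo[) (sigma_eps eps).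
Local Notation rich := (rich P W eps).
Local Notation F := (augmented_filtration P W eps).
Local Notation H := (fun r w => by_regime sg1 sg2 (eps r w)).
Variable Z : R -> T -> R.
Hypothesis hZ0 : forall w, Z 0 w = z0.
Hypothesis hI : is_ito_integral P F W H (fun t w => Z t w - z0).
Local Notation D := (ito_error sg1 sg2 W eps (fun t w => Z t w - z0)).
Local Notation lam := (by_regime lambda1 lambda2).
Local Notation sg := (by_regime sg1 sg2).
Variables (U dU : 'I_2 -> R -> R) (thr : 'I_2 -> R).
Hypothesis VS : value_system lam sg rho U dU thr.
Local Notation V := (state_value eps Z U).
Local Notation gen := (vs_gen lam rho U).
Local Notation jumpI i j s t := ([set w | eps s w = i] `&` [set w | eps t w = j]).

Let lam0 i : 0 < lam i. Proof. exact: by_regime_gt0. Qed.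
Let sg0 i : 0 < sg i. Proof. exact: by_regime_gt0. Qed.

Let C := ito_error_cst lambda1 lambda2 sg1 sg2.

(** Coefficients of q^3 in the means of the five terms of [step_err], in the same order. *)
Definition step_cst i : R := 4 * sg i ^+ 3 + C + sg i ^+ 2 + lam i + sg i ^+ 2 * lam i.

Lemma indic01 (A : set T) w : (\1_A w = 0 :> R) \/ (\1_A w = 1 :> R).
Proof. by rewrite indicE; case: (_ \in _); [right|left]. Qed.

Lemma indic_norm_le1 (A : set T) w : `|\1_A w : R| <= 1.
Proof. by case: (indic01 A w) => ->; rewrite ?normr0 ?normr1. Qed.

Lemma integrableR_indic (A : set T) : measurable A -> integrableR P (\1_A : T -> R).
Proof.
by move=> mA; apply: (@integrableR_bounded _ _ _ P _ 1); [exact: measurable_indic|exact: indic_norm_le1].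
Qed.

Lemma Rintegral_indicE (A : set T) : measurable A -> \int[P]_w (\1_A w : R) = fine (P A).
Proof. by move=> mA; rewrite /Rintegral integral_indic// setIT. Qed.

Lemma step_err_mean (s t : R) i j : 0 <= s -> s < t -> i != j ->
  let q := Num.sqrt (t - s) in
  let err w := step_err q (sg i * (W t w - W s w)) (D s t w) (\1_(jumpI i j s t) w) in
  integrableR P err /\ \int[P]_w err w <= step_cst i * q ^+ 3.
Proof.
move=> s0 st ij q err; have t0 : 0 <= t by rewrite (le_trans s0)// ltW.
have st' := ltW st.
have q0 : 0 < q by rewrite sqrtr_gt0 subr_gt0.
have q2 : t - s = q ^+ 2 by rewrite sqr_sqrtr// subr_ge0.
pose J w : R := \1_(jumpI i j s t) w.
pose dW w := W t w - W s w.
have mdW : measurable_fun setT dW by apply: measurable_funB; exact: (measurable_W hBM).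
have mC : measurable (jumpI i j s t) by apply: measurableI; exact: (measurable_eps hMC).
have iJ : integrableR P J by exact: integrableR_indic.
have J1 : \int[P]_w J w <= lam i * q ^+ 2.
  rewrite /J Rintegral_indicE// -q2 -lee_fin fineK ?fin_num_measure//.
  exact: (prob_transition hl1 hl2 hcompl hBM hMC hind).
(* The indicator looks at the chain at time t, but [rich s] contains the whole path of the chain, so
   J is still independent of the increment of W. *)
have mJ : measurable_wrt (rich s) J.
  by apply: measurable_wrt_indic; apply: sigma_setI; apply: (rich_eps hBM hMC).
have [iJW eJW] := sq_incr hBM hMC hind s0 st' mJ iJ.
have iW2 : integrableR P (fun w => dW w ^+ 2) by exact: (integrable_sq_incr hBM).
have m1 : measurable_wrt (rich s) (cst (1 : R) : T -> R) by exact: measurable_wrt_cst.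
have [_ eW2'] := sq_incr hBM hMC hind s0 st' m1 (integrableR_cst P 1).
have eW2 : \int[P]_w (dW w ^+ 2) = q ^+ 2.
  rewrite (_ : \int[P]_w _ = \int[P]_w (cst 1 w * (W t w - W s w) ^+ 2)); last first.
    by apply: eq_Rintegral => w _; rewrite mul1r.
  by rewrite eW2' Rintegral_cstP mulr1.
have W3 := incr_cube hBM s0 st; rewrite -/q in W3.
have iW3 : integrableR P (fun w => `|dW w| ^+ 3).
  apply/integrableR_ge0P => [|w|].
  - by apply: measurable_funX; apply: measurableT_comp => //; exact: normr_measurable.
  - by rewrite exprn_ge0.
  - by apply: le_lt_trans W3 _; rewrite ltry.
have eW3 : \int[P]_w (`|dW w| ^+ 3) <= 4 * q ^+ 3 by rewrite -lee_fin Rintegral_ge0E.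
have [iD2 D2] := ito_error_sq hl1 hl2 hcompl hBM hMC hind hI s0 st'.
have eD2 : \int[P]_w (D s t w ^+ 2) <= C * q ^+ 4.
  by rewrite -lee_fin Rintegral_ge0E//; apply: le_trans D2 _; rewrite q2 -exprM.
have errE w : err w = sg i ^+ 3 * `|dW w| ^+ 3 + q^-1 * D s t w ^+ 2 +
    (q * sg i ^+ 2) * dW w ^+ 2 + q * J w + (sg i ^+ 2 / q) * (J w * dW w ^+ 2).
  rewrite /err /step_err -/(dW w) -/(J w) normrM exprMn (gtr0_norm (sg0 i)).
  by rewrite exprMn; ring.
have i1 := integrableRZ (sg i ^+ 3) iW3.
have i2 := integrableRZ q^-1 iD2.
have i3 := integrableRZ (q * sg i ^+ 2) iW2.
have i4 := integrableRZ q iJ.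
have i5 := integrableRZ (sg i ^+ 2 / q) iJW.
have i12 := integrableRD i1 i2; have i123 := integrableRD i12 i3.
have i1234 := integrableRD i123 i4; have i12345 := integrableRD i1234 i5.
have -> : err = fun w => sg i ^+ 3 * `|dW w| ^+ 3 + q^-1 * D s t w ^+ 2 +
    (q * sg i ^+ 2) * dW w ^+ 2 + q * J w + (sg i ^+ 2 / q) * (J w * dW w ^+ 2).
  by apply/funext.
split => //.
rewrite RintegralD// RintegralD// RintegralD// RintegralD// !RintegralZl//.
rewrite eW2 eJW q2 /step_cst.
have s3 : 0 <= sg i ^+ 3 by rewrite exprn_ge0// ltW.
have h1 := ler_wpM2l s3 eW3.
have qi : 0 <= q^-1 by rewrite invr_ge0 ltW.
have h2 := ler_wpM2l qi eD2.
have h3 := ler_wpM2l (ltW q0) J1.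
have s2q : 0 <= sg i ^+ 2 / q * q ^+ 2 by rewrite mulr_ge0// ?divr_ge0// ?sqr_ge0// ltW.
have h4 := ler_wpM2l s2q J1.
have e2 : q^-1 * (C * q ^+ 4) = C * q ^+ 3 by field; rewrite gt_eqF.
have e4 : sg i ^+ 2 / q * q ^+ 2 * (lam i * q ^+ 2) = sg i ^+ 2 * lam i * q ^+ 3.
  by field; rewrite gt_eqF.
rewrite e2 in h2; rewrite e4 -(mulrA (sg i ^+ 2 / q)) in h4.
rewrite [leRHS](_ : _ = sg i ^+ 3 * (4 * q ^+ 3) + C * q ^+ 3 + q * sg i ^+ 2 * q ^+ 2 +
  q * (lam i * q ^+ 2) + sg i ^+ 2 * lam i * q ^+ 3); last by ring.
by rewrite !lerD.
Qed.

(** The first order terms have mean zero. The quadratic one gives (t - s) times rho U_i - lam_i (U_j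
    - U_i), and the jump term gives p (U_j - U_i) with p = lam_i (t - s) + O((t - s)^2); the two
    contributions of the jumps cancel up to second order. *)
Lemma step_main_mean : exists2 K, 0 <= K & forall (s t : R) i j (A : set T),
  0 <= s -> s <= t -> i != j -> F s A -> A `<=` [set w | eps s w = i] ->
  let main w := \1_A w * step_main lam sg rho U dU i j (Z s w) (sg i * (W t w - W s w)) (D s t w)
    (\1_(jumpI i j s t) w) in
  integrableR P main /\
  `|\int[P]_w main w - rho * (t - s) * \int[P]_w (\1_A w * V s w)| <= K * (t - s) ^+ 2.
Proof.
have [B B0 hB] : exists2 B, 0 <= B & forall i j z, `|U j z - U i z| <= B.
  have [B1 B10 h1] := vs_diff_bounded VS ord0 ord_max.
  exists B1 => // i j z.
  have [->|->] := I2_cases i; have [->|->] := I2_cases j; rewrite ?subrr ?normr0//.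
  by rewrite distrC.
pose L := lambda1 + lambda2.
have L0 : 0 <= L by rewrite addr_ge0// ltW.
have lamL i : lam i <= L by rewrite /by_regime /L; case: ifP => _; rewrite ?lerDl ?lerDr ltW.
exists (L * L * B) => [|s t i j A s0 st ij FA AC main]; first by rewrite !mulr_ge0.
have t0 : 0 <= t by exact: le_trans st.
have Fr : F s `<=` rich s by exact: (aug_sub_rich hcompl hBM hMC s0).
have mA : measurable A by exact: (aug_measurable hcompl hBM hMC s0).
have mu i' : measurable_fun setT (U i') by apply: continuous_measurable_fun; exact: U_continuous VS _.
have mdU : measurable_fun setT (dU i).
  by apply: continuous_measurable_fun; exact: vs_dU_continuous VS i.
have FZ := state_measurable_wrt hI s0.
have FI : measurable_wrt (F s) (\1_A : T -> R) by exact: measurable_wrt_indic.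
have [a _ /(_ s s0)[iZ _]] := state_mean hl1 hl2 hs1 hs2 hcompl hBM hMC hind hZ0 hI.
have iUZ i' : integrableR P (fun w => U i' (Z s w)).
  apply: (@integrableR_le _ _ _ P _ (fun w => U i' 0 + `|Z s w|)).
  - exact: (measurableT_comp (mu i') (state_measurable hcompl hBM hMC hI s0)).
  - by apply: integrableRD; [exact: integrableR_cst|exact: integrableR_norm].
  - by move=> w; rewrite ger0_norm; [exact: U_le VS _ _|exact: U_ge0 VS _ _].
have iAY (Y : T -> R) : integrableR P Y -> integrableR P (fun w => \1_A w * Y w).
  move=> iY; apply: (integrableR_bddM _ (@indic_norm_le1 A) iY).
  exact: measurable_indic.
have mAY (f : R -> R) : measurable_fun setT f -> measurable_wrt (F s) (fun w => \1_A w * f (Z s w)).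
  by move=> mf; apply: measurable_wrtM => //; exact: (measurable_wrt_comp mf).
pose gZ w := gen i j (Z s w).
have igZ : integrableR P gZ by apply: integrableRB; apply: integrableRZ; exact: iUZ.
have mgen : measurable_fun setT (gen i j).
  by apply: measurable_funB; apply: measurable_funM => //; exact: measurable_cst.
pose J w : R := \1_(jumpI i j s t) w.
pose dW w := W t w - W s w.
pose Y4 w := \1_A w * (U j (Z s w) - U i (Z s w)).
have mY4 : measurable_wrt (F s) Y4.
  by apply: (mAY (fun z => U j z - U i z)); exact: measurable_funB.
have bY4 w : `|Y4 w| <= B.
  rewrite /Y4 normrM -[leRHS]mul1r; apply: ler_pM => //; exact: indic_norm_le1.
have iY4 : integrableR P Y4 by apply: iAY; exact: integrableRB.
have mC : measurable (jumpI i j s t) by apply: measurableI; exact: (measurable_eps hMC).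
have bdU w : `|\1_A w * dU i (Z s w)| <= 1.
  rewrite normrM -[leRHS]mul1r; apply: ler_pM => //; first exact: indic_norm_le1.
  by have /andP[d0 d1] := vs_derive01 VS i (Z s w); rewrite ger0_norm.
have mdUA : measurable_wrt (rich s) (fun w => \1_A w * dU i (Z s w)).
  by apply: measurable_wrt_sub Fr _; exact: mAY.
have idU : integrableR P (fun w => \1_A w * dU i (Z s w)).
  by apply: (@integrableR_bounded _ _ _ P _ 1) => //; exact: rich_measurable_fun mdUA.
have [i1 e1] := sq_incr hBM hMC hind s0 st (measurable_wrt_sub Fr (mAY _ mgen)) (iAY _ igZ).
have [i2 e2] := integrable_mean_incr hBM hMC hind s0 st mdUA idU.
have e3 := ito_error_mean hl1 hl2 hcompl hBM hMC hind hI s0 st mdUA bdU.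
have [iD _] := ito_error_L1 hl1 hl2 hcompl hBM hMC hind hI s0 st.
have i3 : integrableR P (fun w => \1_A w * dU i (Z s w) * D s t w).
  by apply: (integrableR_bddM _ bdU iD); exact: rich_measurable_fun mdUA.
have e4 := markov_bounded hl1 hl2 hcompl hBM hMC hind s0 st ij mY4 bY4.
have mY4m : measurable_fun setT Y4 by exact: integrableR_measurable iY4.
have i4 : integrableR P (fun w => Y4 w * J w).
  by apply: (integrableR_bddM mY4m bY4); exact: integrableR_indic.
have e4' : \int[P]_w (Y4 w * \1_[set w | eps s w = i] w) = \int[P]_w Y4 w.
  apply: eq_Rintegral => w _; rewrite /Y4 !indicE.
  case: (boolP (w \in A)) => [wA|_]; last by rewrite !mul0r.
  by rewrite (mem_set (AC _ (set_mem wA))) mulr1.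
rewrite e4' in e4.
have mainE : main = fun w => \1_A w * gen i j (Z s w) * (W t w - W s w) ^+ 2 +
    sg i * (\1_A w * dU i (Z s w) * (W t w - W s w)) +
    \1_A w * dU i (Z s w) * D s t w + Y4 w * J w.
  apply/funext => w; rewrite /main /step_main /Y4 /J; field.
  by rewrite gt_eqF.
have i2' := integrableRZ (sg i) i2.
have i12 := integrableRD i1 i2'; have i123 := integrableRD i12 i3.
rewrite mainE; split; first exact: integrableRD.
rewrite RintegralD// RintegralD// RintegralD// RintegralZl// e1 e2 e3 e4 mulr0 !addr0.
set p := expmx _ _ _.
have ts0 : 0 <= t - s by rewrite subr_ge0.
have [p0 p1 p2] := expmx_generator_bounds hl1 hl2 ij ts0; rewrite -/p in p0 p1 p2.
have genE : \int[P]_w (\1_A w * gen i j (Z s w)) =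
    rho * \int[P]_w (\1_A w * V s w) - lam i * \int[P]_w Y4 w.
  rewrite -RintegralZl//; last by apply: iAY; exact: (state_value_integrable hl1 hl2 hs1 hs2 hcompl hBM hMC hind hZ0 hI VS).
  rewrite -RintegralZl// -RintegralB//; last 2 first.
  - by apply: integrableRZ; apply: iAY; exact: (state_value_integrable hl1 hl2 hs1 hs2 hcompl hBM hMC hind hZ0 hI VS).
  - exact: integrableRZ.
  apply: eq_Rintegral => w _; rewrite /Y4 /vs_gen indicE.
  case: (boolP (w \in A)) => [wA|_]; last by rewrite !mul0r !mulr0 subr0.
  by rewrite /state_value (AC _ (set_mem wA)) !mul1r; ring.
rewrite genE (_ : _ - _ = (p - lam i * (t - s)) * \int[P]_w Y4 w); last by ring.
rewrite normrM.
have Yb : `|\int[P]_w Y4 w| <= B.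
  apply: le_trans (le_normr_Rintegral _ _) _ => //.
  rewrite -[leRHS](Rintegral_cstP P); apply: le_Rintegral => //.
  - exact: integrableR_norm.
  - exact: integrableR_cst.
have pb : `|p - lam i * (t - s)| <= L * L * (t - s) ^+ 2.
  have hL : lam i * L * (t - s) ^+ 2 <= L * L * (t - s) ^+ 2.
    by rewrite ler_wpM2r ?sqr_ge0// ler_wpM2r.
  rewrite ler_norml; apply/andP; split.
    by move: p2 hL; rewrite -/L; lra.
  by apply: (@le_trans _ _ 0); [rewrite subr_le0|rewrite mulr_ge0 ?sqr_ge0// mulr_ge0].
by rewrite [leRHS]mulrAC; apply: ler_pM.
Qed.

End one_step_expectation.

(** * One-step inequalities for the discounted value *)

Section one_step_bounds.
Context {d : measure_display} {T : measurableType d} {R : realType}.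
Variable P : probability T R.
Variables (lambda1 lambda2 sg1 sg2 rho z0 : R) (W : R -> T -> R) (eps : R -> T -> 'I_2).
Hypotheses (hl1 : 0 < lambda1) (hl2 : 0 < lambda2) (hs1 : 0 < sg1) (hs2 : 0 < sg2).
Hypothesis rho0 : 0 < rho.
Hypothesis hcompl : measure_is_complete P.
Hypothesis hBM : brownian_motion P W.
Hypothesis hMC : markov_chain P (generator lambda1 lambda2) eps.
Hypothesis hind : indep P (sigma_of W `[0, +oo[) (sigma_eps eps).
Local Notation rich := (rich P W eps).
Local Notation F := (augmented_filtration P W eps).
Local Notation H := (fun r w => by_regime sg1 sg2 (eps r w)).
Variable Z : R -> T -> R.
Hypothesis hZ0 : forall w, Z 0 w = z0.
Hypothesis hI : is_ito_integral P F W H (fun t w => Z t w - z0).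
Local Notation D := (ito_error sg1 sg2 W eps (fun t w => Z t w - z0)).
Local Notation lam := (by_regime lambda1 lambda2).
Local Notation sg := (by_regime sg1 sg2).
Variables (U dU : 'I_2 -> R -> R) (thr : 'I_2 -> R).
Hypothesis VS : value_system lam sg rho U dU thr.
Local Notation V := (state_value eps Z U).
Local Notation jumpI i j s t := ([set w | eps s w = i] `&` [set w | eps t w = j]).

Let lam0 i : 0 < lam i. Proof. exact: by_regime_gt0. Qed.
Let sg0 i : 0 < sg i. Proof. exact: by_regime_gt0. Qed.
Let iV t (t0 : 0 <= t) :=
  state_value_integrable hl1 hl2 hs1 hs2 hcompl hBM hMC hind hZ0 hI VS t0.

Let iAV (A : set T) t : measurable A -> 0 <= t -> integrableR P (fun w => \1_A w * V t w).
Proof.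
move=> mA t0; apply: (integrableR_bddM _ (@indic_norm_le1 _ T R A) (iV t0)).
exact: measurable_indic.
Qed.

Lemma indic1_mem (A : set T) w : (\1_A w = 1 :> R) -> A w.
Proof.
rewrite indicE; case: (boolP (w \in A)) => [/set_mem //|_ /eqP].
by rewrite eq_sym oner_eq0.
Qed.

Lemma step_err_ge0 (q m x J : R) : 0 < q -> 0 <= J -> 0 <= step_err q m x J.
Proof.
move=> /ltW q0 J0; rewrite /step_err; have := sqr_ge0 m; have := sqr_ge0 x.
have := exprn_ge0 3 (normr_ge0 m); move: (m ^+ 2) (x ^+ 2) (`|m| ^+ 3) => a b c ? ? ?.
by rewrite !(addr_ge0, divr_ge0, mulr_ge0).
Qed.

Lemma state_value_step s t i j w : i != j -> eps s w = i ->
  V t w = U i (Z s w + sg i * (W t w - W s w) + D s t w) +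
    \1_(jumpI i j s t) w * (U j (Z s w + sg i * (W t w - W s w) + D s t w) -
      U i (Z s w + sg i * (W t w - W s w) + D s t w)).
Proof.
move=> ij es; rewrite /state_value.
have -> : Z s w + sg i * (W t w - W s w) + D s t w = Z t w.
  by rewrite /ito_error es; ring.
rewrite indicE; have [ej|ei] : eps t w = j \/ eps t w = i.
- by move: ij; have [->|->] := I2_cases i; have [->|->] := I2_cases j;
    have [->|->] := I2_cases (eps t w) => //; by [left|right].
- by rewrite mem_set//= mul1r subrKC ej.
- rewrite memNset/= ?mul0r ?addr0 ?ei// => -[_ e].
  by move: ij; rewrite e eqxx.
Qed.

Lemma one_step_upper_at i j : i != j -> exists2 K, 0 <= K &
  forall (s t : R) (A : set T), 0 <= s -> s < t -> t - s <= 1 -> F s A ->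
  A `<=` [set w | eps s w = i] ->
  \int[P]_w (\1_A w * V t w) <=
  (1 + rho * (t - s)) * \int[P]_w (\1_A w * V s w) + K * Num.sqrt (t - s) ^+ 3.
Proof.
move=> ij.
have [K1 K10 h1] := step_upper lam0 sg0 rho0 VS ij.
have [K2 K20 h2] := step_main_mean hl1 hl2 hs1 hs2 hcompl hBM hMC hind hZ0 hI VS.
exists (K1 * `|step_cst lambda1 lambda2 sg1 sg2 i| + K2) => [|s t A s0 st ts1 FA AC].
  by rewrite addr_ge0// mulr_ge0.
have t0 : 0 <= t by rewrite (le_trans s0)// ltW.
have mA : measurable A by exact: (aug_measurable hcompl hBM hMC s0).
set q := Num.sqrt (t - s).
have q0 : 0 < q by rewrite sqrtr_gt0 subr_gt0.
have q2 : t - s = q ^+ 2 by rewrite sqr_sqrtr// subr_ge0 ltW.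
have q1 : q <= 1 by rewrite -[leRHS]sqrtr1 ler_wsqrtr.
have [ie ee] := step_err_mean hl1 hl2 hs1 hs2 hcompl hBM hMC hind hI s0 st ij.
have [im em] := h2 s t i j A s0 (ltW st) ij FA AC.
set err := (fun w => step_err _ _ _ _) in ie ee.
set main := (fun w => \1_A w * step_main _ _ _ _ _ _ _ _ _ _ _) in im em.
have iK := integrableRZ K1 ie.
have pw w : \1_A w * V t w <= \1_A w * V s w + (main w + K1 * err w).
  rewrite /main /err; set J : R := \1_(jumpI i j s t) w.
  have J01 : J = 0 \/ J = 1 by exact: indic01.
  have J0 : 0 <= J by case: J01 => ->.
  have e0 := step_err_ge0 (sg i * (W t w - W s w)) (D s t w) q0 J0.
  have [a0|a1] := indic01 A w (R := R).
    by rewrite a0 !mul0r !add0r mulr_ge0.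
  have es : eps s w = i.
    by apply: AC; exact: indic1_mem.
  rewrite a1 !mul1r (state_value_step t ij es) -lerBlDl.
  rewrite /state_value es; exact: h1.
have iR : integrableR P (fun w => \1_A w * V s w + (main w + K1 * err w)).
  by apply: integrableRD; [exact: iAV|exact: integrableRD].
have : \int[P]_w (\1_A w * V t w) <= \int[P]_w (\1_A w * V s w + (main w + K1 * err w)).
  by apply: le_Rintegral => //; exact: iAV.
rewrite RintegralD//; [|exact: iAV|exact: integrableRD].
rewrite RintegralD// RintegralZl// => h.
have ee' : K1 * \int[P]_w err w <= K1 * `|step_cst lambda1 lambda2 sg1 sg2 i| * q ^+ 3.
  rewrite -mulrA; apply: ler_wpM2l => //; apply: le_trans ee _.
  by rewrite ler_wpM2r ?ler_norm// exprn_ge0// ltW.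
have em' : \int[P]_w main w <= rho * (t - s) * \int[P]_w (\1_A w * V s w) + K2 * q ^+ 3.
  rewrite -lerBlDl; apply: le_trans (ler_norm _) _; apply: le_trans em _.
  rewrite q2 -exprM ler_wpM2l//; apply: ler_wiXn2l => //; exact: ltW.
rewrite mulrDl mul1r mulrDl; lra.
Qed.

Lemma one_step_lower_at i j (del : R) : i != j -> 0 < del -> exists2 K, 0 <= K &
  forall (s t : R) (A : set T), 0 <= s -> s < t -> t - s <= 1 -> F s A ->
  A `<=` [set w | eps s w = i] -> (forall w, A w -> Z s w <= thr i - del) ->
  (1 + rho * (t - s)) * \int[P]_w (\1_A w * V s w) - K * Num.sqrt (t - s) ^+ 3 <=
  \int[P]_w (\1_A w * V t w).
Proof.
move=> ij del0.
have [K1 K10 h1] := step_lower lam0 sg0 rho0 VS ij del0.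
have [K2 K20 h2] := step_main_mean hl1 hl2 hs1 hs2 hcompl hBM hMC hind hZ0 hI VS.
exists (K1 * `|step_cst lambda1 lambda2 sg1 sg2 i| + K2) => [|s t A s0 st ts1 FA AC Az].
  by rewrite addr_ge0// mulr_ge0.
have t0 : 0 <= t by rewrite (le_trans s0)// ltW.
have mA : measurable A by exact: (aug_measurable hcompl hBM hMC s0).
set q := Num.sqrt (t - s).
have q0 : 0 < q by rewrite sqrtr_gt0 subr_gt0.
have q2 : t - s = q ^+ 2 by rewrite sqr_sqrtr// subr_ge0 ltW.
have q1 : q <= 1 by rewrite -[leRHS]sqrtr1 ler_wsqrtr.
have [ie ee] := step_err_mean hl1 hl2 hs1 hs2 hcompl hBM hMC hind hI s0 st ij.
have [im em] := h2 s t i j A s0 (ltW st) ij FA AC.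
set err := (fun w => step_err _ _ _ _) in ie ee.
set main := (fun w => \1_A w * step_main _ _ _ _ _ _ _ _ _ _ _) in im em.
have iK := integrableRZ K1 ie.
have pw w : \1_A w * V s w + (main w - K1 * err w) <= \1_A w * V t w.
  rewrite /main /err; set J : R := \1_(jumpI i j s t) w.
  have J01 : J = 0 \/ J = 1 by exact: indic01.
  have J0 : 0 <= J by case: J01 => ->.
  have e0 := step_err_ge0 (sg i * (W t w - W s w)) (D s t w) q0 J0.
  have [a0|a1] := indic01 A w (R := R).
    by rewrite a0 !mul0r !add0r oppr_le0 mulr_ge0.
  have Aw : A w by exact: indic1_mem.
  have es := AC w Aw.
  rewrite a1 !mul1r (state_value_step t ij es) -lerBrDl.
  rewrite /state_value es; apply: h1 => //; exact: Az.
have iR : integrableR P (fun w => \1_A w * V s w + (main w - K1 * err w)).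
  by apply: integrableRD; [exact: iAV|exact: integrableRB].
have : \int[P]_w (\1_A w * V s w + (main w - K1 * err w)) <= \int[P]_w (\1_A w * V t w).
  by apply: le_Rintegral => //; exact: iAV.
rewrite RintegralD//; [|exact: iAV|exact: integrableRB].
rewrite RintegralB// RintegralZl// => h.
have ee' : K1 * \int[P]_w err w <= K1 * `|step_cst lambda1 lambda2 sg1 sg2 i| * q ^+ 3.
  rewrite -mulrA; apply: ler_wpM2l => //; apply: le_trans ee _.
  by rewrite ler_wpM2r ?ler_norm// exprn_ge0// ltW.
have em' : rho * (t - s) * \int[P]_w (\1_A w * V s w) - \int[P]_w main w <= K2 * q ^+ 3.
  rewrite -opprB; apply: le_trans (ler_norm _) _; rewrite normrN; apply: le_trans em _.
  rewrite q2 -exprM ler_wpM2l//; apply: ler_wiXn2l => //; exact: ltW.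
rewrite mulrDl mul1r mulrDl; lra.
Qed.

Let regime_split (A : set T) (X : T -> R) s : measurable A -> 0 <= s -> integrableR P X ->
  \int[P]_w (\1_A w * X w) =
  \int[P]_w (\1_(A `&` [set w | eps s w = ord0]) w * X w) +
  \int[P]_w (\1_(A `&` [set w | eps s w = ord_max]) w * X w).
Proof.
move=> mA s0 iX.
have mAi i : measurable (A `&` [set w | eps s w = i]).
  by apply: measurableI => //; exact: (measurable_eps hMC).
have iAi i : integrableR P (fun w => \1_(A `&` [set w | eps s w = i]) w * X w).
  apply: (integrableR_bddM _ (@indic_norm_le1 _ T R _) iX); exact: measurable_indic.
rewrite -RintegralD; [|by []|exact: iAi|exact: iAi].
apply: eq_Rintegral => w _.
rewrite !indicI /=; have [e|e] := I2_cases (eps s w).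
- rewrite [\1_[set w | eps s w = ord0] w]indicE mem_set//.
  by rewrite [\1_[set w | eps s w = ord_max] w]indicE memNset /= ?e// mulr1 mulr0 mul0r addr0.
- rewrite [\1_[set w | eps s w = ord_max] w]indicE mem_set//.
  by rewrite [\1_[set w | eps s w = ord0] w]indicE memNset /= ?e// mulr1 mulr0 mul0r add0r.
Qed.

Let o01 : (ord0 : 'I_2) != ord_max. Proof. by []. Qed.
Let o10 : (ord_max : 'I_2) != ord0. Proof. by []. Qed.

(** The growth factor 1 + rho h of [one_step_upper_at] is compensated by the discount, since e^x >=
    1 + x. *)
Lemma one_step_upper : exists2 K, 0 <= K &
  forall (s t : R) (A : set T), 0 <= s -> s < t -> t - s <= 1 -> F s A ->
  expR (- (rho * (t - s))) * \int[P]_w (\1_A w * V t w) <=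
  \int[P]_w (\1_A w * V s w) + K * Num.sqrt (t - s) ^+ 3.
Proof.
have [K0 K00 h0] := one_step_upper_at o01; have [K1 K10 h1] := one_step_upper_at o10.
exists (K0 + K1) => [|s t A s0 st ts FA]; first exact: addr_ge0.
have t0 : 0 <= t by rewrite (le_trans s0)// ltW.
have mA : measurable A by exact: (aug_measurable hcompl hBM hMC s0).
have FAi i : F s (A `&` [set w | eps s w = i]).
  by apply: sigma_setI => //; apply: aug_eps; rewrite s0 lexx.
have E0 := h0 s t _ s0 st ts (FAi ord0) (@subIsetr _ _ _).
have E1 := h1 s t _ s0 st ts (FAi ord_max) (@subIsetr _ _ _).
rewrite (regime_split mA s0 (iV t0)).
have := lerD E0 E1.
set x0 := \int[P]_w (_ * V t w); set x1 := \int[P]_w (_ * V t w).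
rewrite addrACA -mulrDr -(regime_split mA s0 (iV s0)) -mulrDl => {E0 E1} E.
set v := \int[P]_w (_ * V s w) in E *; set e := expR _.
have v0 : 0 <= v.
  apply: Rintegral_ge0 => w _; rewrite mulr_ge0//; exact: (state_value_ge0 _ _ VS).
have ts0 : 0 <= rho * (t - s) by rewrite mulr_ge0 ?subr_ge0 ?ltW.
have e0 : 0 <= e by exact: expR_ge0.
have e1 : e <= 1 by rewrite -[leRHS]expR0 ler_expR oppr_le0.
have e2 : e * (1 + rho * (t - s)) <= 1.
  rewrite /e expRN -ler_pdivlMl ?invr_gt0 ?expR_gt0// invrK mulr1.
  exact: expR_ge1Dx.
have KK : 0 <= (K0 + K1) * Num.sqrt (t - s) ^+ 3.
  by rewrite mulr_ge0 ?addr_ge0 ?exprn_ge0 ?sqrtr_ge0.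
apply: le_trans (ler_wpM2l e0 E) _; rewrite mulrDr mulrA; apply: lerD.
  by rewrite -[leRHS]mul1r ler_wpM2r.
by rewrite -[leRHS]mul1r ler_wpM2r.
Qed.

(** Here e^(-x) (1 + x) >= 1 - x^2 with x = rho h. The defect x^2 is harmless because on A the state
    is below the threshold, where the value is at most the threshold itself. *)
Lemma one_step_lower (del : R) : 0 < del -> exists2 K, 0 <= K &
  forall (s t : R) (A : set T), 0 <= s -> s < t -> t - s <= 1 -> F s A ->
  (forall w, A w -> Z s w <= thr (eps s w) - del) ->
  \int[P]_w (\1_A w * V s w) - K * Num.sqrt (t - s) ^+ 3 <=
  expR (- (rho * (t - s))) * \int[P]_w (\1_A w * V t w).
Proof.
move=> del0.
have [K0 K00 h0] := one_step_lower_at o01 del0; have [K1 K10 h1] := one_step_lower_at o10 del0.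
pose M := `|thr ord0| + `|thr ord_max|.
exists (K0 + K1 + rho ^+ 2 * M) => [|s t A s0 st ts FA Az].
  by rewrite !addr_ge0// mulr_ge0 ?sqr_ge0// addr_ge0.
have t0 : 0 <= t by rewrite (le_trans s0)// ltW.
have mA : measurable A by exact: (aug_measurable hcompl hBM hMC s0).
have FAi i : F s (A `&` [set w | eps s w = i]).
  by apply: sigma_setI => //; apply: aug_eps; rewrite s0 lexx.
have Azi i w : (A `&` [set w | eps s w = i]) w -> Z s w <= thr i - del.
  by move=> [/Az + /= e]; rewrite e.
have E0 := h0 s t _ s0 st ts (FAi ord0) (@subIsetr _ _ _) (Azi ord0).
have E1 := h1 s t _ s0 st ts (FAi ord_max) (@subIsetr _ _ _) (Azi ord_max).
rewrite (regime_split mA s0 (iV t0)).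
have := lerD E0 E1.
set x0 := \int[P]_w (_ * V t w); set x1 := \int[P]_w (_ * V t w).
rewrite addrACA -mulrDr -(regime_split mA s0 (iV s0)) -opprD -mulrDl => {E0 E1} E.
set v := \int[P]_w (_ * V s w) in E *; set e := expR _.
have v0 : 0 <= v.
  apply: Rintegral_ge0 => w _; rewrite mulr_ge0//; exact: (state_value_ge0 _ _ VS).
have vM : v <= M.
  rewrite /v -[leRHS](Rintegral_cstP P); apply: le_Rintegral => //; first exact: iAV.
    exact: integrableR_cst.
  move=> w _; have [a0|a1] := indic01 A w (R := R).
    by rewrite a0 mul0r addr_ge0.
  have Aw : A w by exact: indic1_mem.
  have zt : Z s w <= thr (eps s w) by have := Az w Aw; lra.
  rewrite a1 mul1r /state_value.
  have /andP[u0 _] := vs_slope VS (eps s w) zt.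
  have := vs_stop VS (lexx (thr (eps s w))); have := ler_norm (thr (eps s w)).
  have : `|thr (eps s w)| <= M.
    by rewrite /M; have [->|->] := I2_cases (eps s w); rewrite ?lerDl ?lerDr.
  lra.
set x := rho * (t - s) in E e *.
have x0' : 0 <= x by rewrite mulr_ge0 ?subr_ge0 ?ltW.
have e0 : 0 <= e by exact: expR_ge0.
have e1 : e <= 1 by rewrite -[leRHS]expR0 ler_expR oppr_le0.
have e2 : 1 - x ^+ 2 <= e * (1 + x).
  have := expR_ge1Dx (- x); rewrite -/e => h.
  apply: (@le_trans _ _ ((1 - x) * (1 + x))); last by rewrite ler_wpM2r// addr_ge0.
  by rewrite le_eqVlt; apply/orP; left; apply/eqP; ring.
set q := Num.sqrt (t - s) in E *.
have q0 : 0 <= q by exact: sqrtr_ge0.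
have q1 : q <= 1 by rewrite -[leRHS]sqrtr1 ler_wsqrtr.
have q2 : t - s = q ^+ 2 by rewrite sqr_sqrtr// subr_ge0 ltW.
have xq : x ^+ 2 <= rho ^+ 2 * q ^+ 3.
  rewrite /x q2 exprMn -exprM ler_wpM2l ?sqr_ge0//; exact: ler_wiXn2l.
have KK : 0 <= (K0 + K1) * q ^+ 3 by rewrite mulr_ge0 ?addr_ge0 ?exprn_ge0.
have h3 : e * ((1 + x) * v - (K0 + K1) * q ^+ 3) <= e * (x0 + x1) by exact: ler_wpM2l.
apply: le_trans h3; rewrite mulrBr (mulrA e).
have h4 : (1 - x ^+ 2) * v <= e * (1 + x) * v by exact: ler_wpM2r.
have h5 : e * ((K0 + K1) * q ^+ 3) <= (K0 + K1) * q ^+ 3 by rewrite -[leRHS]mul1r ler_wpM2r.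
have h6 : x ^+ 2 * v <= rho ^+ 2 * M * q ^+ 3.
  by rewrite [leRHS]mulrAC; apply: ler_pM => //; exact: sqr_ge0.
rewrite mulrBl mul1r in h4; rewrite (mulrDl (K0 + K1) (rho ^+ 2 * M) (q ^+ 3)); lra.
Qed.

End one_step_bounds.

(** * Verification on a time grid *)

(** The mesh is 1/m^2 so that the square root of a step is 1/m; N m^2 steps with error K/m^3 each
    then cost N K / m. *)
Definition grid {R : realType} (m k : nat) : R := k%:R / m%:R ^+ 2.

Section grid.
Context {R : realType}.
Local Notation grid := (@grid R).

Lemma grid0 m : grid m 0 = 0. Proof. by rewrite /grid mul0r. Qed.

Lemma grid_ge0 m k : 0 <= grid m k. Proof. by rewrite divr_ge0. Qed.

Lemma gridS m k : grid m k.+1 - grid m k = m%:R^-1 ^+ 2.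
Proof. by rewrite /grid -mulrBl -natr1 addrAC subrr add0r mul1r exprVn. Qed.

Lemma grid_lt m k : (0 < m)%N -> grid m k < grid m k.+1.
Proof. by move=> m0; rewrite -subr_gt0 gridS exprn_gt0// invr_gt0 ltr0n. Qed.

Lemma grid_le m k l : (k <= l)%N -> grid m k <= grid m l.
Proof. by move=> kl; rewrite /grid ler_wpM2r ?ler_nat// invr_ge0 sqr_ge0. Qed.

Lemma grid_step m k : (0 < m)%N ->
  grid m k.+1 - grid m k <= 1 /\ Num.sqrt (grid m k.+1 - grid m k) = m%:R^-1.
Proof.
move=> m0; rewrite gridS sqrtr_sqr ger0_norm ?invr_ge0//; split => //.
by rewrite exprn_ile1 ?invr_ge0// invf_le1 ?ltr0n// ler1n.
Qed.

Lemma grid_end m N : (0 < m)%N -> grid m (N * m ^ 2) = N%:R.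
Proof. by move=> m0; rewrite /grid natrM natrX mulfK// expf_neq0// pnatr_eq0 -lt0n. Qed.

End grid.

Section grid_sums.
Context {d : measure_display} {T : measurableType d} {R : realType}.
Variable P : probability T R.
Variables (lambda1 lambda2 sg1 sg2 rho z0 : R) (W : R -> T -> R) (eps : R -> T -> 'I_2).
Hypotheses (hl1 : 0 < lambda1) (hl2 : 0 < lambda2) (hs1 : 0 < sg1) (hs2 : 0 < sg2).
Hypothesis rho0 : 0 < rho.
Hypothesis hcompl : measure_is_complete P.
Hypothesis hBM : brownian_motion P W.
Hypothesis hMC : markov_chain P (generator lambda1 lambda2) eps.
Hypothesis hind : indep P (sigma_of W `[0, +oo[) (sigma_eps eps).
Local Notation rich := (rich P W eps).
Local Notation F := (augmented_filtration P W eps).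
Local Notation H := (fun r w => by_regime sg1 sg2 (eps r w)).
Variable Z : R -> T -> R.
Hypothesis hZ0 : forall w, Z 0 w = z0.
Hypothesis hI : is_ito_integral P F W H (fun t w => Z t w - z0).
Local Notation D := (ito_error sg1 sg2 W eps (fun t w => Z t w - z0)).
Local Notation lam := (by_regime lambda1 lambda2).
Local Notation sg := (by_regime sg1 sg2).
Variables (U dU : 'I_2 -> R -> R) (thr : 'I_2 -> R).
Hypothesis VS : value_system lam sg rho U dU thr.
Local Notation V := (state_value eps Z U).
Let iV t (t0 : 0 <= t) :=
  state_value_integrable hl1 hl2 hs1 hs2 hcompl hBM hMC hind hZ0 hI VS t0.

Let iAV (A : set T) t : measurable A -> 0 <= t -> integrableR P (fun w => \1_A w * V t w).
Proof.
move=> mA t0; apply: (integrableR_bddM _ (@indic_norm_le1 _ T R A) (iV t0)).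
exact: measurable_indic.
Qed.

Lemma aug_mono s t : s <= t -> F s `<=` F t.
Proof.
move=> st; apply: sub_sigma => E [[|]|hE].
- move=> [r [B [/andP[r0 rs] mB ->]]]; apply: sigma_gen; left; left; exists r, B; split => //.
  by rewrite r0 (le_trans rs).
- move=> [r [j [/andP[r0 rs] ->]]]; apply: sigma_gen; left; right; exists r, j; split => //.
  by rewrite r0 (le_trans rs).
- by apply: sigma_gen; right.
Qed.

Let split_indic (A B : set T) t : measurable A -> measurable B -> B `<=` A -> 0 <= t ->
  \int[P]_w (\1_A w * V t w) = \int[P]_w (\1_(A `\` B) w * V t w) + \int[P]_w (\1_B w * V t w).
Proof.
move=> mA mB BA t0; have mD : measurable (A `\` B) by exact: measurableD.
rewrite -RintegralD; [|by []|exact: iAV|exact: iAV].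
apply: eq_Rintegral => w _; rewrite -mulrDl; congr (_ * _).
rewrite !indicE in_setD; case: (boolP (w \in B)) => [wB|_].
  by rewrite (mem_set (BA _ (set_mem wB))) add0r.
by rewrite andbT addr0.
Qed.

(** [A k] stands for not having stopped by time k of the grid. A stop inside a step is rounded up:
    it is paid at the right end, where it is already known. *)
Lemma grid_upper : exists2 K, 0 <= K & forall m M (A : nat -> set T), (0 < m)%N ->
  (forall k, F (grid m k) (A k)) -> (forall k, A k.+1 `<=` A k) ->
  \sum_(k < M) expR (- (rho * grid m k.+1)) * \int[P]_w (\1_(A k `\` A k.+1) w * V (grid m k.+1) w)
  <= \int[P]_w (\1_(A 0%N) w * V 0 w) + M%:R * (K * m%:R^-1 ^+ 3).
Proof.
have [K K0 h] := one_step_upper hl1 hl2 hs1 hs2 rho0 hcompl hBM hMC hind hZ0 hI VS.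
exists K => // m M A m0 FA AS.
have mA k : measurable (A k) by exact: (aug_measurable hcompl hBM hMC (grid_ge0 m k)).
have E0 (t : R) : 0 <= t -> 0 <= expR (- (rho * t)) <= 1.
  by move=> t0; rewrite expR_ge0 -[leRHS]expR0 ler_expR oppr_le0 mulr_ge0// ltW.
suff : \sum_(k < M) expR (- (rho * grid m k.+1)) *
    \int[P]_w (\1_(A k `\` A k.+1) w * V (grid m k.+1) w) +
    expR (- (rho * grid m M)) * \int[P]_w (\1_(A M) w * V (grid m M) w)
  <= \int[P]_w (\1_(A 0%N) w * V 0 w) + M%:R * (K * m%:R^-1 ^+ 3).
  apply: le_trans; rewrite lerDl mulr_ge0 ?expR_ge0//.
  by apply: Rintegral_ge0 => w _; rewrite mulr_ge0//; exact: (state_value_ge0 _ _ VS).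
elim: M => [|M IH].
  by rewrite big_ord0 add0r mul0r addr0 grid0 mulr0 oppr0 expR0 mul1r.
rewrite big_ord_recr /= -addrA -mulrDr.
rewrite -(split_indic (mA M) (mA M.+1) (AS M) (grid_ge0 m M.+1)).
have [g1 gq] := grid_step (R := R) M m0.
have := h _ _ _ (grid_ge0 m M) (grid_lt M m0) g1 (FA M); rewrite gq.
set x := \int[P]_w (_ * V (grid m M.+1) w); set y := \int[P]_w (_ * V (grid m M) w).
move=> hs; set S := \sum_(_ < M) _.
have -> : expR (- (rho * grid m M.+1)) = expR (- (rho * grid m M)) * expR (- (rho * (grid m M.+1 - grid m M))).
  by rewrite -expRD; congr expR; ring.
have /andP[e0 e1] := E0 _ (grid_ge0 m M).
have c0 : 0 <= K * m%:R^-1 ^+ 3 by rewrite mulr_ge0// exprn_ge0// invr_ge0.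
rewrite -/S -/y in IH.
have h1 := ler_wpM2l e0 hs; rewrite [leRHS]mulrDr in h1.
have h2 : expR (- (rho * grid m M)) * (K * m%:R^-1 ^+ 3) <= K * m%:R^-1 ^+ 3.
  by rewrite -[leRHS]mul1r ler_wpM2r.
have -> : M.+1%:R * (K * m%:R^-1 ^+ 3) = M%:R * (K * m%:R^-1 ^+ 3) + K * m%:R^-1 ^+ 3.
  by rewrite -natr1 mulrDl mul1r.
rewrite -(mulrA (expR _) (expR _)); move: IH h1 h2 c0.
set MC := M%:R * _; set c1 := K * _; set e1' := expR (- (rho * grid m M)).
by lra.
Qed.

(** Compared with [grid_upper] the index is shifted: [A k.+1] means going on at time k of the grid,
    is decided at that time, and a stop is paid there. Going on is allowed only at distance del
    below the threshold, where the reverse one-step estimate holds. *)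
Lemma grid_lower (del : R) : 0 < del -> exists2 K, 0 <= K &
  forall m M (A : nat -> set T), (0 < m)%N -> F 0 (A 0%N) ->
  (forall k, (k < M)%N -> F (grid m k) (A k.+1)) -> (forall k, A k.+1 `<=` A k) ->
  (forall k w, (k < M)%N -> A k.+1 w -> Z (grid m k) w <= thr (eps (grid m k) w) - del) ->
  \int[P]_w (\1_(A 0%N) w * V 0 w) <=
  \sum_(k < M) expR (- (rho * grid m k)) * \int[P]_w (\1_(A k `\` A k.+1) w * V (grid m k) w) +
  expR (- (rho * grid m M)) * \int[P]_w (\1_(A M) w * V (grid m M) w) + M%:R * (K * m%:R^-1 ^+ 3).
Proof.
move=> del0.
have [K K0 h] := one_step_lower hl1 hl2 hs1 hs2 rho0 hcompl hBM hMC hind hZ0 hI VS del0.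
exists K => // m M A m0 FA0 FA AS hA.
have E0 (t : R) : 0 <= t -> 0 <= expR (- (rho * t)) <= 1.
  by move=> t0; rewrite expR_ge0 -[leRHS]expR0 ler_expR oppr_le0 mulr_ge0// ltW.
elim: M FA hA => [|M IH] FA hA.
  by rewrite big_ord0 add0r mul0r addr0 grid0 mulr0 oppr0 expR0 mul1r.
have {}IH := IH (fun k kM => FA k (ltnW kM)) (fun k w kM => hA k w (ltnW kM)).
have mA k : (k <= M.+1)%N -> measurable (A k).
  case: k => [_|k kM]; first exact: (aug_measurable hcompl hBM hMC (lexx 0)).
  exact: (aug_measurable hcompl hBM hMC (grid_ge0 m k) (FA k kM)).
rewrite big_ord_recr /=.
have [g1 gq] := grid_step (R := R) M m0.
have := h _ _ _ (grid_ge0 m M) (grid_lt M m0) g1 (FA M (ltnSn M)) (fun w => hA M w (ltnSn M)); rewrite gq.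
have := split_indic (mA M (leqnSn M)) (mA M.+1 (leqnn _)) (AS M) (grid_ge0 m M).
move: IH; set S := \sum_(_ < M) _; set v0 := \int[P]_w (_ * V 0 w).
set a := \int[P]_w (\1_(A M) w * _); set b := \int[P]_w (\1_(A M `\` A M.+1) w * _).
set c := \int[P]_w (\1_(A M.+1) w * V (grid m M) w); set e := \int[P]_w (_ * V (grid m M.+1) w).
move=> IH ab hs.
have -> : expR (- (rho * grid m M.+1)) = expR (- (rho * grid m M)) * expR (- (rho * (grid m M.+1 - grid m M))).
  by rewrite -expRD; congr expR; ring.
have /andP[e0 e1] := E0 _ (grid_ge0 m M).
have c0 : 0 <= K * m%:R^-1 ^+ 3 by rewrite mulr_ge0// exprn_ge0// invr_ge0.
have h1 := ler_wpM2l e0 hs; rewrite [leLHS]mulrBr in h1.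
have h2 : expR (- (rho * grid m M)) * (K * m%:R^-1 ^+ 3) <= K * m%:R^-1 ^+ 3.
  by rewrite -[leRHS]mul1r ler_wpM2r.
rewrite ab mulrDr in IH.
have -> : M.+1%:R * (K * m%:R^-1 ^+ 3) = M%:R * (K * m%:R^-1 ^+ 3) + K * m%:R^-1 ^+ 3.
  by rewrite -natr1 mulrDl mul1r.
rewrite -(mulrA (expR _) (expR _)); move: IH h1 h2 c0.
set MC := M%:R * _; set c1 := K * _; set e1' := expR (- (rho * grid m M)).
by lra.
Qed.

End grid_sums.

Lemma limn_einf_le {R : realType} (u v : (\bar R)^nat) (c : \bar R) :
  (forall n, (u n <= v n)%E) -> v @ \oo --> c -> (limn_einf u <= c)%E.
Proof.
move=> uv vc; rewrite limn_einf_lim -(cvg_lim (@ereal_hausdorff R) vc).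
apply: lee_lim; first exact: is_cvg_einfs.
  by apply/cvg_ex; exists c.
near=> n; apply: le_trans (uv n); apply: ereal_inf_lbound => /=.
by exists n => //=.
Unshelve. all: by end_near. Qed.

(** * No stopping time does better than the candidate value *)

Section value_upper_bound.
Context {d : measure_display} {T : measurableType d} {R : realType}.
Variable P : probability T R.
Variables (lambda1 lambda2 sg1 sg2 rho z0 : R) (W : R -> T -> R) (eps : R -> T -> 'I_2).
Hypotheses (hl1 : 0 < lambda1) (hl2 : 0 < lambda2) (hs1 : 0 < sg1) (hs2 : 0 < sg2).
Hypothesis rho0 : 0 < rho.
Hypothesis hcompl : measure_is_complete P.
Hypothesis hBM : brownian_motion P W.
Hypothesis hMC : markov_chain P (generator lambda1 lambda2) eps.
Hypothesis hind : indep P (sigma_of W `[0, +oo[) (sigma_eps eps).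
Local Notation rich := (rich P W eps).
Local Notation F := (augmented_filtration P W eps).
Local Notation H := (fun r w => by_regime sg1 sg2 (eps r w)).
Variable Z : R -> T -> R.
Hypothesis hZ0 : forall w, Z 0 w = z0.
Hypothesis hI : is_ito_integral P F W H (fun t w => Z t w - z0).
Local Notation D := (ito_error sg1 sg2 W eps (fun t w => Z t w - z0)).
Local Notation lam := (by_regime lambda1 lambda2).
Local Notation sg := (by_regime sg1 sg2).
Variables (U dU : 'I_2 -> R -> R) (thr : 'I_2 -> R).
Hypothesis VS : value_system lam sg rho U dU thr.
Local Notation V := (state_value eps Z U).
Let iV t (t0 : 0 <= t) :=
  state_value_integrable hl1 hl2 hs1 hs2 hcompl hBM hMC hind hZ0 hI VS t0.

Let iAV (A : set T) t : measurable A -> 0 <= t -> integrableR P (fun w => \1_A w * V t w).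
Proof.
move=> mA t0; apply: (integrableR_bddM _ (@indic_norm_le1 _ T R A) (iV t0)).
exact: measurable_indic.
Qed.

Hypothesis hZc : forall w, {within `[0, +oo[, continuous (fun t => Z t w)}.
Variable i : 'I_2.
Local Notation S := [set w | eps 0 w = i].

Definition payoff (tau : T -> \bar R) w : R := expR (- (rho * fine (tau w))) * Z (fine (tau w)) w.

(** Fatou's lemma asks for nonnegative functions. Discarding the negative part costs nothing in an
    upper bound, since the value functions dominate max(z, 0). *)
Definition pos_payoff (s : R) w : R := expR (- (rho * s)) * Num.max (Z s w) 0.

Lemma pos_payoff_ge0 s w : 0 <= pos_payoff s w.
Proof. by rewrite mulr_ge0 ?expR_ge0// le_max lexx orbT. Qed.

Lemma pos_payoff_le s w : pos_payoff s w <= expR (- (rho * s)) * V s w.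
Proof. by rewrite ler_pM2l ?expR_gt0//; exact: (vs_ge VS). Qed.

Lemma max0_continuous : continuous (fun x : R => Num.max x 0).
Proof.
apply: (@dist_le_continuous R 1) => x y; rewrite mul1r.
case: (leP x 0) => hx; case: (leP y 0) => hy; rewrite ?subrr ?normr0// ?sub0r ?subr0 ?normrN.
- by rewrite gtr0_norm//; have := ler_norm (y - x); rewrite distrC; lra.
- by rewrite gtr0_norm//; have := ler_norm (x - y); lra.
Qed.

Lemma pos_payoff_measurable s : 0 <= s -> measurable_fun setT (pos_payoff s).
Proof.
move=> s0; apply: measurable_funM; first exact: measurable_cst.
apply: (measurableT_comp (continuous_measurable_fun max0_continuous)).
exact: (state_measurable hcompl hBM hMC hI).
Qed.

Lemma pos_payoff_near w (t e : R) : 0 <= t -> 0 < e -> exists2 del, 0 < del &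
  forall s, 0 <= s -> `|s - t| < del -> `|pos_payoff s w - pos_payoff t w| < e.
Proof.
move=> t0 e0; have tI : (`[0, +oo[%classic : set R) t by rewrite /= in_itv/= t0.
have hZ : (fun s => Z s w) @ within `[0, +oo[ (nbhs t) --> Z t w.
  by have /subspace_continuousP := @hZc w; exact.
have cE : (fun s : R => expR (- (rho * s))) @ within `[0, +oo[ (nbhs t) --> expR (- (rho * t)).
  apply: cvg_within_filter.
  apply: (@continuous_comp _ _ _ (fun s : R => - (rho * s)) expR); last exact: continuous_expR.
  apply: (@cvgN _ _ _ _ _ (fun s : R => rho * s)).
  by apply: (@cvgM _ _ _ _ (cst rho) id); [exact: cvg_cst|exact: cvg_id].
have cM : (fun s : R => Num.max (Z s w) 0) @ within `[0, +oo[ (nbhs t) --> Num.max (Z t w) 0.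
  apply: (@cvg_comp _ _ _ (fun s => Z s w) (fun x : R => Num.max x 0) _ (nbhs (Z t w)) _ hZ).
  exact: max0_continuous.
have FF : Filter (within (`[0, +oo[%classic : set R) (nbhs t)) by exact: within_filter.
have := (@cvgrPdist_lt _ _ _ _ FF _ _).1 (@cvgM _ _ _ FF _ _ _ _ cE cM) e e0.
rewrite near_withinE => hn; have [del del0 hdel] := (nbhs_ballP _ _).1 hn.
exists del => // s s0 st; rewrite distrC; apply: hdel; last by rewrite /= in_itv/= s0.
by rewrite /ball/= distrC.
Qed.

Section stopped.
Variable tau : T -> \bar R.
Hypotheses (hst : stopping_time F tau) (hfin : as_finite_given P S tau).

Let tau0 w : (0 <= tau w)%E. Proof. by have [h _] := hst. Qed.

Let mS : measurable S. Proof. exact: (measurable_eps hMC). Qed.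

Let A m k := S `&` ~` [set w | (tau w <= (grid m k)%:E)%E].

Let FA m k : F (grid m k) (A m k).
Proof.
apply: sigma_setI; first by apply: aug_eps; rewrite lexx grid_ge0.
by apply: sigma_setC; have [_ h] := hst; apply: h; exact: grid_ge0.
Qed.

Let AS m k : A m k.+1 `<=` A m k.
Proof.
move=> w [Sw /= h]; split => //= h'; apply: h; apply: le_trans h' _.
by rewrite lee_fin grid_le.
Qed.

Let mA m k : measurable (A m k).
Proof. exact: (aug_measurable hcompl hBM hMC (grid_ge0 m k)). Qed.

Let mB m k : measurable (A m k `\` A m k.+1). Proof. exact: measurableD. Qed.

(** [fine] sends +oo to 0, so [E1] contains, besides the paths stopped at once, the null event [N0]
    on which tau is infinite. *)
Let E1 := S `&` [set w | fine (tau w) = 0].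
Let N0 := S `&` [set w | tau w = +oo%E].
Let S0 := S `&` [set w | (tau w <= 0%:E)%E].

Let negN0 : P.-negligible N0.
Proof.
apply: negligibleS hfin => w [Sw /= tw] /=.
by move=> /(_ Sw); rewrite tw ltxx.
Qed.

Let mN0 : measurable N0. Proof. exact: hcompl. Qed.
Let PN0 : P N0 = 0%E. Proof. exact: measure_negligible. Qed.

Let mS0 : measurable S0.
Proof.
apply: measurableI => //; have [_ h] := hst.
exact: (aug_measurable hcompl hBM hMC (lexx 0) (h 0 (lexx 0))).
Qed.

Let E1E : E1 = S0 `|` N0.
Proof.
apply/seteqP; split => w.
  move=> [Sw /=]; case E: (tau w) => [r| |] /=.
  - by move=> r0; left; split; rewrite //= E r0.
  - by move=> _; right.
  - by move: (tau0 w); rewrite E.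
case=> -[Sw /= tw]; split => //=; last by rewrite tw.
have -> : tau w = 0%:E by apply/eqP; rewrite eq_le tw tau0.
by [].
Qed.

Let mE1 : measurable E1. Proof. by rewrite E1E; exact: measurableU. Qed.

Let PE1 : P E1 = P S0.
Proof.
apply/eqP; rewrite eq_le; apply/andP; split; last first.
  by apply: le_measure; rewrite ?inE//; rewrite E1E; exact: subsetUl.
rewrite E1E; apply: le_trans (measureU2 P mS0 mN0) _.
rewrite -[leRHS]adde0; apply: leeD => //.
by rewrite le_eqVlt; apply/orP; left; apply/eqP; exact: PN0.
Qed.

(** The horizon n and the mesh 1/m^2 with m = (n + 1)^2 grow together: the accumulated error K n / m
    is at most K / (n + 1). *)
Let m_ n := (n.+1 ^ 2)%N.
Let M_ n := (n * m_ n ^ 2)%N.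

Let m_gt0 n : (0 < m_ n)%N. Proof. by rewrite expn_gt0. Qed.

(** Positive payoff at tau rounded up to the grid; paths with a finite tau beyond the horizon n
    contribute 0. *)
Let G n w : R := \1_E1 w * pos_payoff 0 w +
  \sum_(k < M_ n) \1_(A (m_ n) k `\` A (m_ n) k.+1) w * pos_payoff (grid (m_ n) k.+1) w.

Let G_ge0 n w : 0 <= G n w.
Proof.
apply: addr_ge0; first by rewrite mulr_ge0// pos_payoff_ge0.
by apply: sumr_ge0 => k _; rewrite mulr_ge0// pos_payoff_ge0.
Qed.

Let iterm (B : set T) s : measurable B -> 0 <= s ->
  integrableR P (fun w => \1_B w * pos_payoff s w).
Proof.
move=> mB' s0; apply: (@integrableR_le _ _ _ P _ (fun w => \1_B w * V s w)).
- by apply: measurable_funM; [exact: measurable_indic|exact: pos_payoff_measurable].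
- exact: iAV.
- move=> w; rewrite normrM (ger0_norm (pos_payoff_ge0 _ _)) ger0_norm//.
  rewrite ler_wpM2l// (le_trans (pos_payoff_le _ _))// -[leRHS]mul1r ler_wpM2r//.
    exact: (state_value_ge0 _ _ VS).
  by rewrite -[leRHS]expR0 ler_expR oppr_le0 mulr_ge0// ltW.
Qed.

Let iG n : integrableR P (G n).
Proof.
apply: integrableRD; first exact: iterm.
by apply: integrableR_sum => k; apply: iterm => //; exact: grid_ge0.
Qed.

Let V0 w : S w -> V 0 w = U i z0.
Proof. by move=> /= e; rewrite /state_value e hZ0. Qed.

Let intV0 (B : set T) : measurable B -> B `<=` S ->
  \int[P]_w (\1_B w * V 0 w) = U i z0 * fine (P B).
Proof.
move=> mB' BS; rewrite -Rintegral_indicE// -RintegralZl//; last exact: integrableR_indic.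
apply: eq_Rintegral => w _; rewrite mulrC.
have [->|e] := indic01 B w (R := R); first by rewrite !mulr0.
by rewrite V0//; apply: BS; exact: (indic1_mem e).
Qed.

Let intG : exists2 K, 0 <= K & forall n, \int[P]_w G n w <= U i z0 * fine (P S) + K / n.+1%:R.
Proof.
have [K K0 h] := grid_upper hl1 hl2 hs1 hs2 rho0 hcompl hBM hMC hind hZ0 hI VS.
exists K => // n; rewrite /G RintegralD//; last 2 first.
- exact: iterm.
- by apply: integrableR_sum => k; apply: iterm => //; exact: grid_ge0.
rewrite Rintegral_sum; last by move=> k; apply: iterm => //; exact: grid_ge0.
have A0 : A (m_ n) 0 = S `\` S0.
  rewrite /A grid0; apply/seteqP; split => w [Sw /= hw]; split => //=; first by case.
  by move=> h'; apply: hw.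
have PS : fine (P S) = fine (P S0) + fine (P (A (m_ n) 0)).
  rewrite -fineD ?fin_num_measure//; congr fine.
  rewrite -measureU//.
  - by rewrite A0 setDUK//; exact: subIsetl.
  - by rewrite A0 setDIK.
have h1 : \int[P]_w (\1_E1 w * pos_payoff 0 w) <= U i z0 * fine (P S0).
  rewrite -[P S0]PE1 -intV0//; last exact: subIsetl.
  apply: le_Rintegral => //; [exact: iterm|exact: iAV|].
  move=> w _; rewrite ler_wpM2l//; apply: le_trans (pos_payoff_le _ _) _.
  by rewrite mulr0 oppr0 expR0 mul1r.
have h2 := h (m_ n) (M_ n) (A (m_ n)) (m_gt0 n) (fun k => @FA (m_ n) k) (fun k => @AS (m_ n) k).
rewrite intV0// in h2; last by move=> w [].
have h3 : \sum_(k < M_ n) \int[P]_w (\1_(A (m_ n) k `\` A (m_ n) k.+1) w *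
    pos_payoff (grid (m_ n) k.+1) w) <=
  \sum_(k < M_ n) expR (- (rho * grid (m_ n) k.+1)) *
    \int[P]_w (\1_(A (m_ n) k `\` A (m_ n) k.+1) w * V (grid (m_ n) k.+1) w).
  apply: ler_sum => k _; rewrite -RintegralZl//; last by apply: iAV => //; exact: grid_ge0.
  apply: le_Rintegral => //.
  - by apply: iterm => //; exact: grid_ge0.
  - by apply: integrableRZ; apply: iAV => //; exact: grid_ge0.
  - by move=> w _; rewrite [leRHS]mulrCA ler_wpM2l// pos_payoff_le.
have h4 : (M_ n)%:R * (K * (m_ n)%:R^-1 ^+ 3) <= K / n.+1%:R.
  have n1 : 0 < n.+1%:R :> R by rewrite ltr0n.
  have -> : (M_ n)%:R * (K * (m_ n)%:R^-1 ^+ 3) = K / n.+1%:R * (n%:R / n.+1%:R).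
    rewrite /M_ /m_ natrM !natrX; field.
    by rewrite gt_eqF.
  rewrite -[leRHS]mulr1 ler_wpM2l// ?divr_ge0//.
  by rewrite ler_pdivrMr// mul1r ler_nat.
have PS' : U i z0 * fine (P S) = U i z0 * fine (P S0) + U i z0 * fine (P (A (m_ n) 0)).
  by rewrite PS mulrDr.
rewrite PS'; move: h1 h2 h3 h4.
set a := fine (P S0); set b := fine (P (A (m_ n) 0%N)); set c := \int[P]_w (\1_E1 w * _).
set x1 := \sum_(k < M_ n) _; set x2 := \sum_(k < M_ n) _.
set e1 := _%:R * _; set e2 := K / _; set u1 := U i z0 * a; set u2 := U i z0 * b.
by move: e1 e2 u1 u2 c x1 x2 => e1 e2 u1 u2 c x1 x2; lra.
Qed.

Let lim_payoff w : R := \1_S w * pos_payoff (fine (tau w)) w.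

(** Once the horizon exceeds tau, a single summand survives; its time is within one mesh of tau, and
    the path is continuous. *)
Let G_cvg w : G n w @[n --> \oo] --> lim_payoff w.
Proof.
case: (boolP (w \in S)) => [/set_mem Sw|nS]; last first.
  have nSw : ~ S w by move=> /mem_set; rewrite (negbTE nS).
  rewrite /lim_payoff indicE (negbTE nS) mul0r.
  rewrite (_ : (fun n => G n w) = cst 0); first exact: cvg_cst.
  apply/funext => n; rewrite /G indicE memNset ?mul0r ?add0r; last by case.
  by apply: big1 => k _; rewrite indicE memNset ?mul0r// => -[[]].
rewrite /lim_payoff indicE (mem_set Sw) mul1r.
have [t0|t0] := eqVneq (fine (tau w)) 0.
  rewrite t0; rewrite (_ : (fun n => G n w) = cst (pos_payoff 0 w)); first exact: cvg_cst.
  apply/funext => n; rewrite /G indicE mem_set//= mul1r big1 ?addr0// => k _.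
  have [h|h] : (tau w <= 0)%E \/ tau w = +oo%E.
  - have : E1 w by split.
    by rewrite E1E => -[] []; [left|right].
  - rewrite indicE memNset ?mul0r// => -[[_ /= hw] _]; apply: hw.
    by rewrite (le_trans h)// lee_fin grid_ge0.
  - rewrite indicE memNset ?mul0r// => -[_ hw]; apply: hw; split => //=.
    by rewrite h.
have [t tE] : exists t, tau w = t%:E.
  move: t0 (tau0 w); case: (tau w) => [r| |] //=; last by rewrite eqxx.
  by exists r.
rewrite tE /= in t0 *.
have t_gt0 : 0 < t by rewrite lt_neqAle eq_sym t0 -lee_fin -tE tau0.
(* The least grid index whose time reaches t is not 0 because t > 0; the step just before it
   contains t. *)
have locate n : t <= n%:R -> exists2 k, (k < M_ n)%N & grid (m_ n) k < t <= grid (m_ n) k.+1.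
  move=> tn; have ex : exists k, t <= grid (m_ n) k.
    by exists (M_ n); rewrite grid_end.
  case: (ex_minnP ex) => -[|k] hk hmin.
    by move: hk; rewrite grid0 leNgt t_gt0.
  exists k; first by apply: hmin; rewrite grid_end.
  by rewrite hk andbT ltNge; apply/negP => /hmin; rewrite ltnn.
apply/cvgrPdist_lt => e e0.
have [del del0 hdel] := pos_payoff_near w (ltW t_gt0) e0.
have cn1 : (n.+1%:R^-1 : R) @[n --> \oo] --> (0 : R) by exact: cvg_harmonic.
have hn1 : \forall n \near \oo, (n.+1%:R^-1 : R) < del.
  by have := cvgr_lt (0 : R) cn1; apply.
near=> n.
have tn : t <= n%:R by near: n; exact: nbhs_infty_ger.
have [k kM /andP[tk tk1]] := locate n tn.
have -> : G n w = pos_payoff (grid (m_ n) k.+1) w.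
  rewrite /G indicE memNset ?mul0r ?add0r; last by case=> _ /=; rewrite tE /=; apply/eqP.
  rewrite (bigD1 (Ordinal kM)) //= [\1__ w]indicE mem_set; last first.
    split; first by split => //=; rewrite tE lee_fin; apply/negP; rewrite -ltNge.
    by case=> _ /=; rewrite tE lee_fin.
  rewrite mul1r big1 ?addr0// => j /eqP jk.
  rewrite indicE memNset ?mul0r//= => -[[_ /= h1] h2].
  have {}h1 : grid (m_ n) j < t by rewrite ltNge; apply/negP => h; apply: h1; rewrite tE lee_fin.
  have {}h2 : t <= grid (m_ n) j.+1.
    by rewrite leNgt; apply/negP => h; apply: h2; split => //=; rewrite tE lee_fin; apply/negP; rewrite -ltNge.
  apply: jk; apply: val_inj => /=; apply/eqP; rewrite eqn_leq.
  apply/andP; split; rewrite leqNgt; apply/negP => lt.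
  - by have := lt_le_trans h1 (le_trans tk1 (grid_le _ lt)); rewrite ltxx.
  - by have := lt_le_trans tk (le_trans h2 (grid_le _ lt)); rewrite ltxx.
rewrite distrC; apply: hdel; first exact: grid_ge0.
rewrite ger0_norm ?subr_ge0//.
have hh : grid (m_ n) k.+1 - grid (m_ n) k <= n.+1%:R^-1 :> R.
  rewrite gridS /m_ natrX -!exprVn -exprM.
  rewrite -[leRHS]expr1; apply: ler_wiXn2l => //.
  by rewrite invf_le1// ?ler1n ?ltr0n.
have : n.+1%:R^-1 < del :> R.
  by near: n; exact: hn1.
move=> hdl; apply: le_lt_trans hdl; apply: le_trans hh.
by rewrite lerD2l lerN2; exact: ltW.
Unshelve. all: by end_near. Qed.

(** Only the positive part of the payoff is estimated, by Fatou's lemma along [G]; removing the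
    negative part can only increase the integral, whether or not it is finite. *)
Lemma value_upper : (\int[P]_(w in S) (payoff tau w)%:E <= (U i z0 * fine (P S))%:E)%E.
Proof.
have [K K0 hK] := intG.
rewrite integralE.
have hm : (0 <= \int[P]_(w in S) (fun w => (payoff tau w)%:E)^\- w)%E by exact: integral_ge0.
apply: (@le_trans _ _ (\int[P]_(w in S) (fun w => (payoff tau w)%:E)^\+ w)%E).
  by apply: geeDl; rewrite oppe_le0.
have -> : (\int[P]_(w in S) (fun w => (payoff tau w)%:E)^\+ w = \int[P]_w (lim_payoff w)%:E)%E.
  rewrite integral_mkcond; apply: eq_integral => w _; rewrite patchE /lim_payoff indicE.
  case: ifPn => wS; last by rewrite mul0r.
  rewrite funeposE -EFin_max mul1r /pos_payoff /payoff maxr_pMr ?expR_ge0// mulr0.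
  by [].
have -> : (\int[P]_w (lim_payoff w)%:E = \int[P]_w limn_einf (fun n => (G n w)%:E))%E.
  apply: eq_integral => w _; have h : (fun n => (G n w)%:E) @ \oo --> (lim_payoff w)%:E.
    by apply: cvg_EFin; [exact: nearW|exact: G_cvg].
  by rewrite (cvg_limn_einf_sup (u := fun n => (G n w)%:E) (l := (lim_payoff w)%:E)).
apply: le_trans (fatou P measurableT _ _) _.
- by move=> n; apply/measurable_EFinP; exact: integrableR_measurable (iG n).
- by move=> n w _; rewrite lee_fin G_ge0.
apply: (@limn_einf_le _ _ (fun n => (U i z0 * fine (P S) + K / n.+1%:R)%:E)).
  by move=> n; rewrite -(Rintegral_ge0E (iG n)) lee_fin.
apply: cvg_EFin; first exact: nearW.
rewrite -[X in _ --> X]addr0 -[X in _ + X](mulr0 K).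
by apply: cvgD; [exact: cvg_cst|apply: cvgM; [exact: cvg_cst|exact: cvg_harmonic]].
Qed.

End stopped.
End value_upper_bound.

(** * A nearly optimal stopping time on the grid *)

Section value_lower_bound.
Context {d : measure_display} {T : measurableType d} {R : realType}.
Variable P : probability T R.
Variables (lambda1 lambda2 sg1 sg2 rho z0 : R) (W : R -> T -> R) (eps : R -> T -> 'I_2).
Hypotheses (hl1 : 0 < lambda1) (hl2 : 0 < lambda2) (hs1 : 0 < sg1) (hs2 : 0 < sg2).
Hypothesis rho0 : 0 < rho.
Hypothesis hcompl : measure_is_complete P.
Hypothesis hBM : brownian_motion P W.
Hypothesis hMC : markov_chain P (generator lambda1 lambda2) eps.
Hypothesis hind : indep P (sigma_of W `[0, +oo[) (sigma_eps eps).
Local Notation rich := (rich P W eps).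
Local Notation F := (augmented_filtration P W eps).
Local Notation H := (fun r w => by_regime sg1 sg2 (eps r w)).
Variable Z : R -> T -> R.
Hypothesis hZ0 : forall w, Z 0 w = z0.
Hypothesis hI : is_ito_integral P F W H (fun t w => Z t w - z0).
Local Notation D := (ito_error sg1 sg2 W eps (fun t w => Z t w - z0)).
Local Notation lam := (by_regime lambda1 lambda2).
Local Notation sg := (by_regime sg1 sg2).
Variables (U dU : 'I_2 -> R -> R) (thr : 'I_2 -> R).
Hypothesis VS : value_system lam sg rho U dU thr.
Local Notation V := (state_value eps Z U).
Let iV t (t0 : 0 <= t) :=
  state_value_integrable hl1 hl2 hs1 hs2 hcompl hBM hMC hind hZ0 hI VS t0.

Let iAV (A : set T) t : measurable A -> 0 <= t -> integrableR P (fun w => \1_A w * V t w).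
Proof.
move=> mA t0; apply: (integrableR_bddM _ (@indic_norm_le1 _ T R A) (iV t0)).
exact: measurable_indic.
Qed.

Variable i : 'I_2.
Local Notation S := [set w | eps 0 w = i].

Let mS : measurable S. Proof. exact: (measurable_eps hMC). Qed.

Lemma sigma_setU (G : set (set T)) (A B : set T) : <<s G >> A -> <<s G >> B -> <<s G >> (A `|` B).
Proof. exact: (@measurableU _ (g_sigma_algebraType G)). Qed.

Lemma sigma_bigcup (G : set (set T)) (A : nat -> set T) : (forall k, <<s G >> (A k)) ->
  <<s G >> (\bigcup_k A k).
Proof. exact: (@bigcupT_measurable _ (g_sigma_algebraType G)). Qed.

Section stopped.
Variables (m M : nat) (del : R).
Hypotheses (m0 : (0 < m)%N) (del0 : 0 < del).

(** Stopping already within del of the threshold keeps every continuing state in the region where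
    [one_step_lower] applies. *)
Let stop k w : bool := ~~ (Z (grid m k) w <= thr (eps (grid m k) w) - del).

(** If no index below M stops, [find] returns the length M of the list, so the horizon acts as
    forced stopping. *)
Let kap w : nat := find (stop^~ w) (iota 0 M).

Definition grid_hit w : \bar R := (grid m (kap w))%:E.

Let kap_le w : (kap w <= M)%N.
Proof. by rewrite /kap -[leqRHS](size_iota 0 M) find_size. Qed.

Let F_stop k : F (grid m k) [set w | stop k w].
Proof.
have FZ := state_measurable_wrt hI (grid_ge0 m k).
have h j : F (grid m k) ([set w | eps (grid m k) w = j] `&` Z (grid m k) @^-1` `]thr j - del, +oo[).
  apply: sigma_setI; first by apply: aug_eps; rewrite grid_ge0 lexx.
  by apply: FZ; exact: measurable_itv.
rewrite (_ : [set w | stop k w] = ([set w | eps (grid m k) w = ord0] `&`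
    Z (grid m k) @^-1` `]thr ord0 - del, +oo[) `|` ([set w | eps (grid m k) w = ord_max] `&`
    Z (grid m k) @^-1` `]thr ord_max - del, +oo[)); first by apply: sigma_setU; exact: h.
apply/seteqP; split => w; rewrite /stop /= !in_itv/= !andbT -ltNge.
  move=> h'; have [e|e] := I2_cases (eps (grid m k) w); rewrite e in h'; [left|right];
    by split; rewrite //= in_itv/= andbT.
by case=> -[->].
Qed.

Let F_has (l : seq nat) (t : R) : (forall k, k \in l -> grid m k <= t) ->
  F t [set w | has (stop^~ w) l].
Proof.
elim: l => [|k l IH] h.
  by rewrite (_ : [set w | _] = set0); [exact: sigma_set0|apply/seteqP; split].
rewrite (_ : [set w | has (stop^~ w) (k :: l)] = [set w | stop k w] `|` [set w | has (stop^~ w) l]).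
  apply: sigma_setU; first by apply: (aug_mono (h k (mem_head _ _))); exact: F_stop.
  by apply: IH => j jl; apply: h; rewrite inE jl orbT.
by apply/seteqP; split => w /=; [move=> /orP|move=> h'; apply/orP].
Qed.

Let kap_ltE k w : (k < M)%N -> (kap w <= k)%N = has (stop^~ w) (iota 0 k.+1).
Proof.
move=> kM; rewrite -ltnS /kap -has_take_leq ?size_iota//.
by rewrite take_iota (minn_idPl kM).
Qed.

Let F_kap k : F (grid m k) [set w | (kap w <= k)%N].
Proof.
case: (ltnP k M) => kM; last first.
  rewrite (_ : [set w | _] = setT); first exact: sigma_setT.
  by apply/seteqP; split => // w _ /=; exact: leq_trans (kap_le w) kM.
rewrite (_ : [set w | _] = [set w | has (stop^~ w) (iota 0 k.+1)]); last first.
  by apply/seteqP; split => w /=; rewrite kap_ltE.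
by apply: F_has => j; rewrite mem_iota /= ltnS => jk; exact: grid_le.
Qed.

Lemma grid_hit_stopping : stopping_time F grid_hit.
Proof.
split=> [w|t t0]; first by rewrite lee_fin grid_ge0.
rewrite (_ : [set w | _] =
    \bigcup_k (if grid m k <= t then [set w | (kap w <= k)%N] else set0)).
  apply: sigma_bigcup => k; case: ifPn => kt; last exact: sigma_set0.
  by apply: (aug_mono kt); exact: F_kap.
apply/seteqP; split => w /=.
  by rewrite lee_fin => h; exists (kap w) => //; rewrite h /=.
move=> [k _]; case: ifPn => // kt /= h; rewrite lee_fin.
exact: le_trans (grid_le _ h) kt.
Qed.

Let E k := S `&` [set w | (k <= kap w)%N].

Let stopped_sum (X : nat -> T -> R) w :
  \sum_(k < M) \1_(E k `\` E k.+1) w * X k w + \1_(E M) w * X M w = \1_S w * X (kap w) w.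
Proof.
case: (boolP (w \in S)) => wS; last first.
  have nS : ~ S w by move=> /mem_set; rewrite (negbTE wS).
  rewrite !indicE (negbTE wS) (memNset (A := E M)); last by case.
  rewrite !mul0r addr0 big1// => k _; rewrite indicE memNset ?mul0r//.
  by case=> -[].
have Sw := set_mem wS.
have EE k : (\1_(E k `\` E k.+1) w : R) = (kap w == k)%:R.
  rewrite indicE in_setD !in_setI wS !mem_setE /=.
  by rewrite -ltnNge eqn_leq andbC.
have EM : (\1_(E M) w : R) = (kap w == M)%:R.
  by rewrite indicE in_setI wS mem_setE /= eqn_leq kap_le.
rewrite EM [\1_S w]indicE wS mul1r.
under eq_bigr do rewrite EE.
case: (ltnP (kap w) M) => kM; last first.
  have kE : kap w = M by apply/eqP; rewrite eqn_leq kap_le.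
  rewrite kE eqxx mul1r big1 ?add0r// => k _.
  by rewrite gtn_eqF ?ltn_ord// mul0r.
rewrite (ltn_eqF kM) mul0r addr0 (bigD1 (Ordinal kM))//= eqxx mul1r big1 ?addr0//.
move=> k /eqP hk; case: eqP => [e|_]; last by rewrite mul0r.
by exfalso; apply: hk; apply: val_inj.
Qed.

Let mE k : measurable (E k).
Proof.
case: k => [|k].
  rewrite (_ : E 0 = S)//; apply/seteqP; split => w; [by case|by split].
rewrite (_ : E k.+1 = S `\` [set w | (kap w <= k)%N]); last first.
  by apply/seteqP; split => w [Sw /= h]; split => //=; move: h; rewrite ltnNge => /negP.
apply: measurableD; first exact: mS.
exact: (aug_measurable hcompl hBM hMC (grid_ge0 m k) (@F_kap k)).
Qed.

Let mED k : measurable (E k `\` E k.+1). Proof. exact: measurableD. Qed.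

Let iterm (B : set T) (X : T -> R) : measurable B -> integrableR P X ->
  integrableR P (fun w => \1_B w * X w).
Proof.
move=> mB iX; apply: (integrableR_bddM _ (@indic_norm_le1 _ T R B) iX).
exact: measurable_indic.
Qed.

Let stopped_mean (X : nat -> T -> R) : (forall k, integrableR P (X k)) ->
  integrableR P (fun w => \1_S w * X (kap w) w) /\
  \int[P]_w (\1_S w * X (kap w) w) =
  \sum_(k < M) \int[P]_w (\1_(E k `\` E k.+1) w * X k w) + \int[P]_w (\1_(E M) w * X M w).
Proof.
move=> iX.
have i1 : integrableR P (fun w => \sum_(k < M) \1_(E k `\` E k.+1) w * X k w).
  by apply: integrableR_sum => k; exact: iterm.
have i2 : integrableR P (fun w => \1_(E M) w * X M w) by exact: iterm.
have -> : (fun w => \1_S w * X (kap w) w) =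
    (fun w => \sum_(k < M) \1_(E k `\` E k.+1) w * X k w + \1_(E M) w * X M w).
  by apply/funext => w; rewrite stopped_sum.
split; first exact: integrableRD.
by rewrite RintegralD// Rintegral_sum// => k; exact: iterm.
Qed.

(** At a genuine stop the value exceeds the state by at most del, because it is nondecreasing and
    equals the identity from the threshold on. At the forced stop the excess has linear growth and
    is controlled by the discount at the horizon. *)
Lemma grid_hit_gap (a : R) : (forall t, 0 <= t ->
    integrableR P (Z t) /\ \int[P]_w `|Z t w| <= a * (1 + t)) ->
  integrableR P (fun w => \1_S w * payoff rho Z grid_hit w) /\
  \int[P]_w (\1_S w * (expR (- (rho * grid m (kap w))) * V (grid m (kap w)) w)) <=
  \int[P]_w (\1_S w * payoff rho Z grid_hit w) + del +
  expR (- (rho * grid m M)) * (U ord0 0 + U ord_max 0 + 2 * (a * (1 + grid m M))).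
Proof.
move=> ha.
pose c0 := U ord0 0 + U ord_max 0.
have g0 k : 0 <= grid m k :> R by exact: grid_ge0.
have iVk k : integrableR P (fun w => expR (- (rho * grid m k)) * V (grid m k) w).
  by apply: integrableRZ; exact: iV.
have iZk k : integrableR P (fun w => expR (- (rho * grid m k)) * Z (grid m k) w).
  by apply: integrableRZ; case: (ha _ (g0 k)).
have [j1 _] := stopped_mean iVk; have [j2 _] := stopped_mean iZk.
split; first exact: j2.
pose tail w := expR (- (rho * grid m M)) * (c0 + 2 * `|Z (grid m M) w|).
have [iZM ZM] := ha _ (g0 M).
have i3 : integrableR P (fun w => c0 + 2 * `|Z (grid m M) w|).
  apply: integrableRD; first exact: integrableR_cst.
  by apply: integrableRZ; exact: integrableR_norm.
have i4 : integrableR P tail by exact: integrableRZ.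
have j5 : integrableR P (fun w => \1_S w * payoff rho Z grid_hit w + del).
  by apply: integrableRD => //; exact: integrableR_cst.
have tail_mean : \int[P]_w tail w <= expR (- (rho * grid m M)) * (c0 + 2 * (a * (1 + grid m M))).
  rewrite /tail RintegralZl// ler_wpM2l ?expR_ge0//.
  rewrite RintegralD//; last 2 first.
  - exact: integrableR_cst.
  - by apply: integrableRZ; exact: integrableR_norm.
  by rewrite Rintegral_cstP RintegralZl ?lerD2l ?ler_pM2l//; exact: integrableR_norm.
apply: le_trans (lerD (lexx _) tail_mean).
have -> : \int[P]_w (\1_S w * payoff rho Z grid_hit w) + del =
    \int[P]_w (\1_S w * payoff rho Z grid_hit w + del).
  by rewrite RintegralD// ?Rintegral_cstP//; exact: integrableR_cst.
rewrite -RintegralD//; apply: le_Rintegral => //; first exact: integrableRD.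
move=> w _.
have c00 : 0 <= c0 by rewrite addr_ge0//; exact: (U_ge0 VS).
have tail0 w' : 0 <= tail w' by rewrite mulr_ge0 ?expR_ge0// addr_ge0// mulr_ge0.
have [->|->] := indic01 S w (R := R).
  by rewrite !mul0r add0r addr_ge0// ltW.
rewrite !mul1r /payoff /grid_hit /=.
set k := kap w; set e := expR _.
have e0 : 0 <= e by exact: expR_ge0.
have e1 : e <= 1 by rewrite -[leRHS]expR0 ler_expR oppr_le0 mulr_ge0// ltW.
have : (k <= M)%N by exact: kap_le.
rewrite leq_eqVlt => /predU1P[kM|kM].
  have tE : tail w = e * (c0 + 2 * `|Z (grid m k) w|) by rewrite /tail /e -kM.
  have hV : V (grid m k) w <= Z (grid m k) w + (c0 + 2 * `|Z (grid m k) w|).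
    have h1 := U_le VS (eps (grid m k) w) (Z (grid m k) w).
    have h2 : U (eps (grid m k) w) 0 <= c0.
      by rewrite /c0; have [->|->] := I2_cases (eps (grid m k) w);
        rewrite ?lerDl ?lerDr; exact: (U_ge0 VS).
    have := ler_norm (- Z (grid m k) w); rewrite normrN /state_value; lra.
  have := ler_wpM2l e0 hV; rewrite mulrDr -tE; have := ltW del0; lra.
have st : stop k w.
  have hk : has (stop^~ w) (iota 0 M) by rewrite has_find size_iota.
  by have := nth_find 0%N hk; rewrite nth_iota.
have hV : V (grid m k) w <= Z (grid m k) w + del.
  move: st; rewrite /stop -ltNge /state_value; set j := eps _ w; set z := Z _ w => hz.
  case: (leP (thr j) z) => tz; first by rewrite (vs_stop VS tz) lerDl ltW.
  have /andP[u0 _] := vs_slope VS j (ltW tz).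
  have := vs_stop VS (lexx (thr j)); lra.
have := ler_wpM2l e0 hV; rewrite mulrDr.
have : e * del <= del by rewrite -[leRHS]mul1r ler_wpM2r// ltW.
have := tail0 w; lra.
Qed.

Lemma grid_hit_sum :
  \int[P]_w (\1_S w * (expR (- (rho * grid m (kap w))) * V (grid m (kap w)) w)) =
  \sum_(k < M) expR (- (rho * grid m k)) * \int[P]_w (\1_(E k `\` E k.+1) w * V (grid m k) w) +
  expR (- (rho * grid m M)) * \int[P]_w (\1_(E M) w * V (grid m M) w).
Proof.
have g0 k : 0 <= grid m k :> R by exact: grid_ge0.
have iVk k : integrableR P (fun w => expR (- (rho * grid m k)) * V (grid m k) w).
  by apply: integrableRZ; exact: iV.
have [_ ->] := stopped_mean iVk.
have out (B : set T) k : measurable B ->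
    \int[P]_w (\1_B w * (expR (- (rho * grid m k)) * V (grid m k) w)) =
    expR (- (rho * grid m k)) * \int[P]_w (\1_B w * V (grid m k) w).
  move=> mB; rewrite -RintegralZl//; last exact: iAV.
  by apply: eq_Rintegral => w _; rewrite mulrCA.
by congr (_ + _); [apply: eq_bigr => k _|]; exact: out.
Qed.

Lemma grid_hit_lower (K : R) : 0 <= K ->
  (forall m M (A : nat -> set T), (0 < m)%N -> F 0 (A 0%N) ->
  (forall k, (k < M)%N -> F (grid m k) (A k.+1)) -> (forall k, A k.+1 `<=` A k) ->
  (forall k w, (k < M)%N -> A k.+1 w -> Z (grid m k) w <= thr (eps (grid m k) w) - del) ->
  \int[P]_w (\1_(A 0%N) w * V 0 w) <=
  \sum_(k < M) expR (- (rho * grid m k)) * \int[P]_w (\1_(A k `\` A k.+1) w * V (grid m k) w) +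
  expR (- (rho * grid m M)) * \int[P]_w (\1_(A M) w * V (grid m M) w) + M%:R * (K * m%:R^-1 ^+ 3)) ->
  U i z0 * fine (P S) <=
  \int[P]_w (\1_S w * (expR (- (rho * grid m (kap w))) * V (grid m (kap w)) w)) +
  M%:R * (K * m%:R^-1 ^+ 3).
Proof.
move=> K0 h.
have -> : U i z0 * fine (P S) = \int[P]_w (\1_(E 0) w * V 0 w).
  have -> : E 0 = S by apply/seteqP; split => w; [by case|by split].
  rewrite -Rintegral_indicE// -RintegralZl//; last exact: integrableR_indic.
  apply: eq_Rintegral => w _; rewrite mulrC.
  have [->|e] := indic01 S w (R := R); first by rewrite !mul0r.
  by rewrite /state_value (indic1_mem e) hZ0.
rewrite grid_hit_sum; apply: h => //.
- rewrite (_ : E 0 = S); first by apply: aug_eps; rewrite lexx.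
  by apply/seteqP; split => w; [case|split].
- move=> k kM; rewrite (_ : E k.+1 = S `&` ~` [set w | (kap w <= k)%N]).
    apply: sigma_setI; first by apply: aug_eps; rewrite lexx grid_ge0.
    by apply: sigma_setC; exact: F_kap.
  by apply/seteqP; split => w [Sw /= hw]; split => //=; move: hw; rewrite ltnNge => /negP.
- by move=> k w [Sw /= kw]; split => //=; exact: ltnW.
(* Indices before the first stopping index do not satisfy [stop], so the state is at distance del
   below its threshold. *)
- move=> k w kM [Sw /= kw]; have := before_find 0%N kw.
  by rewrite nth_iota// add0n /stop => /negbFE.
Qed.

End stopped.

(** Three errors share eta: the margin del = eta/3, the tail at the horizon N, and the error
    accumulated on the grid. N is fixed before m, since the last one is N K / m. *)
Lemma value_lower (eta : R) : 0 < eta -> exists tau, [/\ stopping_time F tau,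
  forall w, (tau w < +oo)%E &
  ((U i z0 * fine (P S) - eta)%:E <= \int[P]_(w in S) (payoff rho Z tau w)%:E)%E].
Proof.
move=> eta0; have eta3 : 0 < eta / 3 by rewrite divr_gt0.
have [a a0 ha] := state_mean hl1 hl2 hs1 hs2 hcompl hBM hMC hind hZ0 hI.
have [K K0 hK] := grid_lower hl1 hl2 hs1 hs2 rho0 hcompl hBM hMC hind hZ0 hI VS eta3.
pose c0 := U ord0 0 + U ord_max 0.
have c00 : 0 <= c0 by rewrite addr_ge0//; exact: (U_ge0 VS).
have [N N0 hN] : exists2 N : nat, (0 < N)%N &
    expR (- (rho * N%:R)) * (c0 + 2 * (a * (1 + N%:R))) <= eta / 3.
  (* From e^(-y) <= 4/y^2 at y = rho N the tail is at most 4 (c0 + 4 a) / (rho^2 N), and N >= [Q]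
     makes it at most eta/3. *)
  pose Q := 12 * (c0 + 4 * a) / (rho ^+ 2 * eta).
  have Q0 : 0 <= Q.
    have c4 : 0 <= c0 + 4 * a by lra.
    have r2 : 0 < rho ^+ 2 * eta by rewrite mulr_gt0// exprn_gt0.
    by apply: divr_ge0; [exact: mulr_ge0|exact: ltW].
  exists (Num.Def.archi_bound Q).+1 => //.
  have := archi_boundP Q0 => hQ.
  set N := (_.+1%:R : R).
  have QN : Q <= N by rewrite (le_trans (ltW hQ))// ler_nat.
  have N1 : 1 <= N by rewrite /N ler1n.
  have N0 : 0 < N by exact: lt_le_trans N1.
  have rN : 0 < rho * N by rewrite mulr_gt0.
  have ex : expR (- (rho * N)) <= 4 / (rho ^+ 2 * N ^+ 2).
    have h1 : rho * N / 2 <= expR (rho * N / 2).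
      by have := expR_ge1Dx (rho * N / 2); lra.
    have h2 : (rho * N / 2) ^+ 2 <= expR (rho * N).
      have y0 : 0 <= rho * N / 2 by rewrite divr_ge0// ltW.
      have E2 : expR (rho * N) = expR (rho * N / 2) * expR (rho * N / 2).
        by rewrite -expRD; congr expR; field.
      by rewrite E2 expr2; apply: ler_pM.
    rewrite expRN -[leRHS]invrK lef_pV2 ?posrE ?expR_gt0//; last first.
      by rewrite invr_gt0 divr_gt0// mulr_gt0 ?exprn_gt0.
    apply: le_trans h2; rewrite le_eqVlt; apply/orP; left; apply/eqP; field.
    by rewrite !gt_eqF.
  have b1 : c0 + 2 * (a * (1 + N)) <= (c0 + 4 * a) * N.
    have := ler_wpM2l c00 N1; have := ler_wpM2l a0 N1; lra.
  apply: (@le_trans _ _ (4 / (rho ^+ 2 * N ^+ 2) * ((c0 + 4 * a) * N))).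
    apply: ler_pM => //.
    by rewrite addr_ge0// mulr_ge0// mulr_ge0// addr_ge0// ltW.
  rewrite [leLHS](_ : _ = Q / N * (eta / 3)); last first.
    rewrite /Q; move: (c0 + 4 * a) => c4; clearbody N.
    by field; rewrite !gt_eqF.
  by rewrite -[leRHS]mul1r ler_pM2r// ler_pdivrMr// mul1r.
have [m m0 hm] : exists2 m, (0 < m)%N & (N * m ^ 2)%:R * (K * m%:R^-1 ^+ 3) <= eta / 3.
  (* The accumulated error is N K / m, so m >= [Q] is what is required. *)
  pose Q := N%:R * K / (eta / 3).
  have Q0 : 0 <= Q by rewrite divr_ge0 ?mulr_ge0// ltW.
  exists (Num.Def.archi_bound Q).+1 => //.
  have := archi_boundP Q0 => hQ.
  set m := (_.+1 : nat).
  have mpos : 0 < m%:R :> R by rewrite ltr0n.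
  have Qm : Q <= m%:R by rewrite (le_trans (ltW hQ))// ler_nat.
  rewrite [leLHS](_ : _ = N%:R * K / m%:R); last first.
    rewrite natrM natrX; move: (m%:R : R) mpos => m' mpos.
    by field; rewrite gt_eqF.
  by rewrite ler_pdivrMr// -ler_pdivrMl// mulrC.
have [iS gap] := grid_hit_gap m (N * m ^ 2) eta3 ha.
exists (grid_hit m (N * m ^ 2) (eta / 3)); split.
- exact: grid_hit_stopping.
- by move=> w; rewrite ltry.
- have -> : (\int[P]_(w in S) (payoff rho Z (grid_hit m (N * m ^ 2) (eta / 3)) w)%:E)%E =
      (\int[P]_w (\1_S w * payoff rho Z (grid_hit m (N * m ^ 2) (eta / 3)) w))%:E.
    rewrite (Rintegral_ge0E iS) integral_mkcond; apply: eq_integral => w _.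
    by rewrite patchE indicE; case: ifPn => _; rewrite ?mul1r ?mul0r.
  rewrite lee_fin.
  have := @grid_hit_lower m (N * m ^ 2) (eta / 3) m0 K K0 hK.
  move: gap; rewrite (grid_end (R := R) N m0) -/c0.
  set x := \int[P]_w _; set y := \int[P]_w _ => gap hl.
  by move: gap hl hN hm; lra.
Qed.

End value_lower_bound.

(** Subtracting theta(y) from the state turns the payoff into the discounted state of a process with
    the same increments started at x - theta(y). The factor P(S) of the two bounds cancels against
    the conditioning on S. *)
Lemma value_eq {d : measure_display} {T : measurableType d} {R : realType}
    (P : probability T R) (lambda1 lambda2 sigma1 sigma2 rho c : R)
    (W : R -> T -> R) (eps : R -> T -> 'I_2) (X : R -> R -> T -> R) (f : R -> R)
    (U dU : 'I_2 -> R -> R) (thr : 'I_2 -> R) (i : 'I_2) (x y : R) :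
  0 < lambda1 -> 0 < lambda2 -> 0 < sigma1 -> 0 < sigma2 -> 0 < rho ->
  regime_model P lambda1 lambda2 sigma1 sigma2 W eps X ->
  value_system (by_regime lambda1 lambda2) (by_regime sigma1 sigma2) rho U dU thr ->
  (0 < P [set w | eps 0%R w = i])%E ->
  value P rho c f W eps X x i y = (U i (x - theta rho c f y))%:E.
Proof.
move=> l1 l2 s1 s2 r0 [hcompl hBM hMC hind hX] VS hi.
set th := theta rho c f y.
pose Z t w := X x t w - th.
have [X0 Xc XI] := hX x.
have hZ0 w : Z 0 w = x - th by rewrite /Z X0.
have hZc w : {within `[0, +oo[, continuous (fun t => Z t w)}.
  move=> t; apply: (@cvgB _ _ _ _ _ _ (cst th)); last exact: cvg_cst.
  exact: Xc.
have hI : is_ito_integral P (augmented_filtration P W eps) W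
    (fun t w => by_regime sigma1 sigma2 (eps t w)) (fun t w => Z t w - (x - th)).
  rewrite (_ : (fun t w => Z t w - (x - th)) = fun t w => X x t w - x)//.
  by apply/funext => t; apply/funext => w; rewrite /Z; ring.
set S := [set w | eps 0 w = i].
have mS : measurable S by exact: (measurable_eps hMC).
have PS : 0 < fine (P S) by rewrite fine_gt0// hi/= ltey_eq fin_num_measure.
have PSi : 0 < (fine (P S))^-1 by rewrite invr_gt0.
have up := value_upper l1 l2 s1 s2 r0 hcompl hBM hMC hind hZ0 hI VS hZc (i := i).
have lo := value_lower l1 l2 s1 s2 r0 hcompl hBM hMC hind hZ0 hI VS i.
have UE : (U i (x - th))%:E = ((fine (P S))^-1%:E * (U i (x - th) * fine (P S))%:E)%E.
  by rewrite -EFinM; congr EFin; field; rewrite gt_eqF.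
apply/eqP; rewrite eq_le; apply/andP; split.
  apply: ge_ereal_sup => _ [tau [hst hfin] <-].
  rewrite UE /expect_given; apply: lee_wpmul2l; first by rewrite lee_fin ltW.
  exact: (up tau hst hfin).
apply/lee_addgt0Pr => e e0.
have [tau [hst hfin htau]] := lo (e * fine (P S)) (mulr_gt0 e0 PS).
rewrite -leeBlDr//.
apply: (@le_trans _ _ (expect_given P S (fun w => expR (- (rho * fine (tau w))) *
                         (X x (fine (tau w)) w - th)))); last first.
  apply: ereal_sup_ubound; exists tau => //; split => //.
  by apply: nearW => w _; exact: hfin.
rewrite /expect_given; apply: le_trans (lee_wpmul2l _ htau); last by rewrite lee_fin ltW.
rewrite -EFinB -EFinM lee_fin le_eqVlt; apply/orP; left; apply/eqP.
by field; rewrite gt_eqF.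
Qed.

(** * Regularity of F *)

Lemma EFin_Rintegral {d : measure_display} {T : measurableType d} {R : realType}
    (mu : {measure set T -> \bar R}) (D : set T) (f : T -> R) : measurable D ->
  mu.-integrable D (EFin \o f) ->
  ((\int[mu]_(x in D) f x)%:E = \int[mu]_(x in D) (EFin \o f) x)%E.
Proof. by move=> mD i; rewrite /Rintegral fineK//; exact: integrable_fin_num i. Qed.

Section integral_on_interval.
Context {R : realType}.
Local Notation mu := (@lebesgue_measure R).
Implicit Types (phi psi : R -> R).

Definition J phi (y : R) : R := \int[mu]_(z in `[0, y]) phi z.

Lemma bounded_integrable_itv (b0 b1 : bool) (a b B : R) phi : measurable_fun setT phi ->
  (forall z, `|phi z| <= B) ->
  mu.-integrable [set` Interval (BSide b0 a) (BSide b1 b)] (EFin \o phi).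
Proof.
move=> mphi hB; set D := [set` _].
have mD : measurable D by exact: measurable_itv.
have muD : (mu D < +oo)%E.
  by rewrite /D lebesgue_measure_itv; case: ifP => _; rewrite ?ltry.
apply: (@le_integrable _ _ _ _ _ _ _ (EFin \o cst B)) => //.
- by apply/measurable_EFinP; exact: measurable_funTS.
- by move=> z _ /=; rewrite lee_fin (le_trans (hB z))// ler_norm.
- apply/integrableP; split; first by apply/measurable_EFinP; exact: measurable_cst.
  rewrite (_ : (\int[mu]_(x in D) _)%E = (\int[mu]_(x in D) (cst `|B|%:E) x)%E); last by apply: eq_integral.
  by rewrite integral_cst// lte_mul_pinfty.
Qed.

Lemma Rintegral_cst_itv (b0 b1 : bool) (a b k : R) : a <= b ->
  \int[mu]_(_ in [set` Interval (BSide b0 a) (BSide b1 b)]) k = k * (b - a).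
Proof.
move=> ab.
have mD : measurable ([set` Interval (BSide b0 a) (BSide b1 b)] : set R) by exact: measurable_itv.
rewrite Rintegral_cst //.
congr (_ * _).
transitivity (fine (lebesgue_measure ([set` Interval (BSide b0 a) (BSide b1 b)] : set R))) => //.
rewrite lebesgue_measure_itv /= lte_fin.
by move: ab; rewrite le_eqVlt => /predU1P[->|->] //; rewrite ltxx /= subrr.
Qed.

Lemma Rintegral_itv_bound (b0 b1 : bool) (a b B : R) phi : a <= b -> measurable_fun setT phi ->
  (exists C, forall z, `|phi z| <= C) ->
  (forall z, z \in Interval (BSide b0 a) (BSide b1 b) -> `|phi z| <= B) ->
  `|\int[mu]_(z in [set` Interval (BSide b0 a) (BSide b1 b)]) phi z| <= B * (b - a).
Proof.
move=> ab mphi [C hC] hB.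
have iphi := @bounded_integrable_itv b0 b1 a b C phi mphi hC.
have mD : measurable ([set` Interval (BSide b0 a) (BSide b1 b)] : set R) by exact: measurable_itv.
have h := @le_normr_Rintegral _ _ _ mu _ phi mD iphi.
apply: (le_trans h) => {h}.
have icst : mu.-integrable [set` Interval (BSide b0 a) (BSide b1 b)] (EFin \o (fun=> B)).
  by apply: (@bounded_integrable_itv _ _ _ _ `|B|).
apply: (@le_trans _ _ (\int[mu]_(z in [set` Interval (BSide b0 a) (BSide b1 b)]) B)).
  have inorm := @bounded_integrable_itv b0 b1 a b C (fun z => `|phi z|)
    (measurableT_comp (@normr_measurable R setT) mphi)
    (fun z => eq_ind_r (fun x => x <= C) (hC z) (normr_id (phi z))).
  by apply: (@le_Rintegral _ _ _ mu _ (fun z => `|phi z|) (fun=> B) mD inorm icst) => z hz; exact: hB.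
by rewrite Rintegral_cst_itv.
Qed.

Lemma J_increment phi (y y' k e : R) : 0 <= y -> y <= y' -> measurable_fun setT phi ->
  (exists C, forall z, `|phi z| <= C) ->
  (forall z, y < z <= y' -> `|phi z - k| <= e) ->
  `|J phi y' - J phi y - k * (y' - y)| <= e * (y' - y).
Proof.
move=> y0 yy' mphi [C hC] hk.
have i1 := @bounded_integrable_itv true false 0 y' C phi mphi hC.
rewrite /J Rintegral_itvB ?bnd_simp//.
have i2 := @bounded_integrable_itv false false y y' C phi mphi hC.
have ik := @bounded_integrable_itv false false y y' `|k| (cst k) (measurable_cst _) (fun=> lexx _).
have -> : k * (y' - y) = \int[mu]_(z in `]y, y']) k.
  by rewrite (@Rintegral_cst_itv false false).
rewrite -RintegralB//.
apply: (@Rintegral_itv_bound false false _ _ _ (fun z => phi z - k) yy').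
- by apply: measurable_funB => //; exact: measurable_cst.
- by exists (C + `|k|) => z; rewrite (le_trans (ler_normB _ _))// lerD2r.
- by move=> z; rewrite in_itv/= => /hk.
Qed.

Lemma J_dist phi (y y' B : R) : 0 <= y -> 0 <= y' -> measurable_fun setT phi ->
  (forall z, `|phi z| <= B) -> `|J phi y' - J phi y| <= B * `|y' - y|.
Proof.
move=> y0 y0' mphi hB.
wlog yy' : y y' y0 y0' / y <= y'.
  by move=> h; case: (leP y y') => yy'; [exact: h|rewrite distrC (distrC y')]; apply: h => //; exact: ltW.
rewrite (ger0_norm (_ : 0 <= y' - y)) ?subr_ge0//.
have := @J_increment phi y y' 0 B y0 yy' mphi; rewrite mul0r subr0; apply; first by exists B.
by move=> z _; rewrite subr0.
Qed.

Lemma J_diff phi psi (y e : R) : 0 <= y -> y <= 1 -> measurable_fun setT phi -> measurable_fun setT psi ->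
  (exists C, forall z, `|phi z| <= C) -> (exists C, forall z, `|psi z| <= C) ->
  (forall z, `|phi z - psi z| <= e) -> `|J phi y - J psi y| <= e.
Proof.
move=> y0 y1 mphi mpsi [C hC] [C' hC'] he.
have i1 := @bounded_integrable_itv true false 0 y C phi mphi hC.
have i2 := @bounded_integrable_itv true false 0 y C' psi mpsi hC'.
rewrite /J -RintegralB//.
apply: (@le_trans _ _ (e * (y - 0))).
  apply: (@Rintegral_itv_bound true false) => //; first exact: measurable_funB.
  by exists e.
have e0 : 0 <= e by rewrite (le_trans _ (he 0)).
by rewrite subr0 -[leRHS]mulr1 ler_wpM2l.
Qed.

Lemma J_bound phi (y B : R) : 0 <= y -> y <= 1 -> measurable_fun setT phi ->
  (forall z, `|phi z| <= B) -> `|J phi y| <= B.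
Proof.
move=> y0 y1 mphi hB; apply: (@le_trans _ _ (B * (y - 0))).
  by apply: (@Rintegral_itv_bound true false) => //; exists B.
have B0 : 0 <= B by rewrite (le_trans _ (hB 0)).
by rewrite subr0 -[leRHS]mulr1 ler_wpM2l.
Qed.

(** Dominated convergence. The exceptional point [zs], a null set, is where the argument meets the
    threshold and the second derivative jumps. *)
Lemma J_cvg (phi_ : nat -> R -> R) phi (y B zs : R) :
  (forall n, measurable_fun setT (phi_ n)) -> measurable_fun setT phi ->
  (forall n z, `|phi_ n z| <= B) ->
  (forall z, 0 <= z <= y -> z != zs -> phi_ n z @[n --> \oo] --> phi z) ->
  J (phi_ n) y @[n --> \oo] --> J phi y.
Proof.
move=> mphi_ mphi hB hcvg.
have mD : measurable (`[0, y]%classic : set R) by exact: measurable_itv.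
have iB := @bounded_integrable_itv true false 0 y `|B| (cst B) (measurable_cst _) (fun=> lexx _).
have [] := @dominated_convergence _ _ _ mu `[0, y] mD (fun n z => (phi_ n z)%:E) (EFin \o phi) (EFin \o cst B).
- by move=> n; apply: measurable_funTS; apply/measurable_EFinP; exact: mphi_.
- by apply: measurable_funTS; exact/measurable_EFinP.
- exists [set zs]; split; [exact: measurable_set1|exact: lebesgue_measure_set1|].
  move=> z /= h; apply: contrapT => zzs; apply: h => hz.
  apply: cvg_EFin; first exact: nearW.
  apply: hcvg; first by move: hz; rewrite /= in_itv/=.
  by apply/eqP => e; apply: zzs.
- exact: iB.
- by apply: aeW => z n _ /=; rewrite lee_fin.
move=> iphi _ h.
have hE := @EFin_Rintegral _ _ _ mu _ _ mD iphi.
have h' : (\int[mu]_(z in `[0%R, y]) (phi_ n z)%:E)%E @[n --> \oo] --> (J phi y)%:E.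
  by rewrite /J hE; exact: h.
by have := fine_cvg h'; exact.
Qed.

End integral_on_interval.

(** * Derivatives relative to the unit interval *)

Section derive_within01.
Context {R : realType}.
Implicit Types (f : R -> R) (y v : R).
Local Notation I := (`[0, 1]%classic : set R).

Lemma quot_withinP f y v : quot_within `[0, 1] f y --> v <->
  forall e, 0 < e -> exists2 del, 0 < del & forall z, 0 <= z <= 1 -> z != y -> `|z - y| < del ->
    `|(f z - f y) / (z - y) - v| < e.
Proof.
have FF : Filter (within I y^') by exact: within_filter.
split=> [h e e0|h].
  have hn := (@cvgrPdist_lt _ _ _ _ FF (fun z => (f z - f y) / (z - y)) v).1 h e e0.
  have [del del0 hdel] := (nbhs_ballP _ _).1 hn.
  exists del => // z z01 zy zd; rewrite distrC; apply: hdel; [|exact: zy|].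
    by rewrite /ball/= distrC.
  by rewrite /= in_itv/=.
apply/(@cvgrPdist_lt _ _ _ _ FF) => e e0.
have [del del0 hdel] := h e e0.
apply/nbhs_ballP; exists del => // z; rewrite /ball/= => hz zy z01.
by rewrite distrC; apply: hdel; [move: z01; rewrite /= in_itv|exact: zy|rewrite distrC].
Qed.

(** Every point of [0, 1] is a limit of other points of [0, 1]; this makes the filter of
    [quot_within] proper and its limit unique. *)
Lemma near_point y del : 0 <= y <= 1 -> 0 < del ->
  exists z, [/\ 0 <= z <= 1, z != y & `|z - y| < del].
Proof.
move=> /andP[y0 y1] del0; case: (leP y (1 / 2)) => hy.
  pose s := Num.min (del / 2) (1 / 2).
  have s0 : 0 < s by rewrite lt_min divr_gt0//= divr_gt0.
  have sd : s <= del / 2 by rewrite ge_min lexx.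
  have s2 : s <= 1 / 2 by rewrite ge_min lexx orbT.
  exists (y + s); split; [lra|by rewrite -subr_eq0 addrC addKr gt_eqF|].
  by rewrite addrC addKr gtr0_norm//; lra.
pose s := Num.min (del / 2) (1 / 2).
have s0 : 0 < s by rewrite lt_min divr_gt0//= divr_gt0.
have sd : s <= del / 2 by rewrite ge_min lexx.
have s2 : s <= 1 / 2 by rewrite ge_min lexx orbT.
exists (y - s); split; [lra|by rewrite -subr_eq0 addrC addKr oppr_eq0 gt_eqF|].
by rewrite addrC addKr normrN gtr0_norm//; lra.
Qed.

Lemma derive_withinE f y v : 0 <= y <= 1 -> quot_within `[0, 1] f y --> v ->
  derivable_within `[0, 1] f y /\ derive_within `[0, 1] f y = v.
Proof.
move=> y01 h.
have PF : ProperFilter (within I y^').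
  split; last exact: within_filter.
  move=> /nbhs_ballP[del del0 hdel].
  have [z [z01 zy zd]] := near_point y01 del0.
  by apply: (hdel z); [rewrite /ball/= distrC|exact: zy|rewrite /= in_itv/=].
split; first by apply/cvg_ex; exists v.
exact: (@cvg_lim _ (@Rhausdorff R) _ _ PF (fun z => (f z - f y) / (z - y)) v h).
Qed.

Lemma derivable_within_continuous01 f y : derivable_within `[0, 1] f y ->
  forall e, 0 < e -> exists2 del, 0 < del & forall z, 0 <= z <= 1 -> `|z - y| < del ->
    `|f z - f y| < e.
Proof.
move=> /quot_withinP h e e0; set v := lim _ in h.
have [del del0 hdel] := h 1 ltr01.
have v1 : 0 < `|v| + 1 by rewrite ltr_wpDl.
exists (Num.min del (e / (`|v| + 1))); first by rewrite lt_min del0 divr_gt0.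
move=> z z01; rewrite lt_min => /andP[zd ze].
have [->|zy] := eqVneq z y; first by rewrite subrr normr0.
have := hdel z z01 zy zd; set q := _ / _ => hq.
have -> : f z - f y = q * (z - y) by rewrite /q divfK// subr_eq0.
have qv : `|q| <= `|v| + 1.
  rewrite (_ : q = v + (q - v)); last by ring.
  by apply: le_trans (ler_normD _ _) _; rewrite lerD2l ltW.
rewrite normrM; apply: (@le_lt_trans _ _ ((`|v| + 1) * `|z - y|)); first by rewrite ler_wpM2r.
by rewrite mulrC -ltr_pdivlMr.
Qed.

Lemma derive_within_lt f a b : strictly_convex_on `[0, 1] f -> 0 <= a -> a < b -> b <= 1 ->
  derivable_within `[0, 1] f a -> derivable_within `[0, 1] f b ->
  derive_within `[0, 1] f a < derive_within `[0, 1] f b.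
Proof.
move=> hconv a0 ab b1 /quot_withinP ha /quot_withinP hb.
rewrite -/(derive_within `[0, 1] f a) in ha; rewrite -/(derive_within `[0, 1] f b) in hb.
pose s := (f b - f a) / (b - a).
have ba0 : 0 < b - a by rewrite subr_gt0.
have chord t : 0 < t < 1 -> f (t * a + (1 - t) * b) < t * f a + (1 - t) * f b.
  move=> t01; apply: hconv => //=; last by rewrite lt_eqF.
  - by rewrite in_itv/=; lra.
  - by rewrite in_itv/=; lra.
have fs : f b - f a = s * (b - a) by rewrite /s divfK// gt_eqF.
(* Strict inequalities between slopes become weak in the limit: split at the midpoint. *)
pose m := 2^-1 * a + (1 - 2^-1) * b.
have mE : m = (a + b) / 2 by rewrite /m; field.
have fm : f m < (f a + f b) / 2.
  have := chord 2^-1; rewrite -/m => h.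
  apply: lt_le_trans (h _) _; first by lra.
  by rewrite le_eqVlt; apply/orP; left; apply/eqP; field.
have am : a < m by rewrite mE; lra.
have mb : m < b by rewrite mE; lra.
have aI : I a by rewrite /= in_itv/=; lra.
have bI : I b by rewrite /= in_itv/=; lra.
have mI : I m by rewrite /= in_itv/=; lra.
have lt_neq (u v : R) : u < v -> u != v by move=> uv; rewrite lt_eqF.
have r01 (r : R) : 0 < r -> r <= 1 / 2 -> 0 < 1 - r < 1 by lra.
have r01' (r : R) : 0 < r -> r <= 1 / 2 -> 0 < r < 1 by lra.
have left_le : derive_within `[0, 1] f a <= (f m - f a) / (m - a).
  apply/ler_addgt0Pr => e e0.
  have [del del0 hdel] := ha e e0.
  (* The point z = a + r (m - a) is then within del of a, and 1 - r is an admissible weight in the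
     convexity inequality. *)
  pose r := Num.min (del / (2 * (b - a))) (1 / 2).
  have r0 : 0 < r by rewrite lt_min divr_gt0 ?mulr_gt0//= divr_gt0.
  have rd : r * (b - a) <= del / 2.
    rewrite -ler_pdivlMr// (_ : del / 2 / (b - a) = del / (2 * (b - a))); first by rewrite ge_min lexx.
    by field; rewrite gt_eqF.
  have r2 : r <= 1 / 2 by rewrite ge_min lexx orbT.
  pose z := a + r * (m - a).
  have ma : m - a = (b - a) / 2 by rewrite mE; field.
  have zE : z - a = r * (m - a) by rewrite /z; ring.
  have rm0 : 0 < r * (m - a) by rewrite ma mulr_gt0// divr_gt0.
  have rm : r * (m - a) <= 1 / 2 * (m - a) by rewrite ler_wpM2r// ma divr_ge0// ltW.
  have hz : `|(f z - f a) / (z - a) - derive_within `[0, 1] f a| < e.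
    apply: hdel.
    - by move: zE rm rm0; rewrite ma; lra.
    - by rewrite -subr_eq0 zE gt_eqF.
    - by rewrite zE gtr0_norm// ma; lra.
  have fz : f z - f a <= r * (f m - f a).
    have := hconv a m (1 - r) aI mI (lt_neq _ _ am) (r01 r r0 r2).
    have -> : (1 - r) * a + (1 - (1 - r)) * m = z by rewrite /z; ring.
    by move: (f z) (f a) (f m) => ? ? ?; lra.
  have q : (f z - f a) / (z - a) <= (f m - f a) / (m - a).
    rewrite ler_pdivrMr ?zE// mulrCA divfK// ma gt_eqF// divr_gt0//.
  by move: hz; rewrite ltr_norml => /andP[h1 _]; lra.
have right_ge : (f b - f m) / (b - m) <= derive_within `[0, 1] f b.
  apply/ler_addgt0Pr => e e0.
  have [del del0 hdel] := hb e e0.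
  pose r := Num.min (del / (2 * (b - a))) (1 / 2).
  have r0 : 0 < r by rewrite lt_min divr_gt0 ?mulr_gt0//= divr_gt0.
  have rd : r * (b - a) <= del / 2.
    rewrite -ler_pdivlMr// (_ : del / 2 / (b - a) = del / (2 * (b - a))); first by rewrite ge_min lexx.
    by field; rewrite gt_eqF.
  have r2 : r <= 1 / 2 by rewrite ge_min lexx orbT.
  pose z := b - r * (b - m).
  have bm : b - m = (b - a) / 2 by rewrite mE; field.
  have zE : z - b = - (r * (b - m)) by rewrite /z; ring.
  have rm0 : 0 < r * (b - m) by rewrite bm mulr_gt0// divr_gt0.
  have rm : r * (b - m) <= 1 / 2 * (b - m) by rewrite ler_wpM2r// bm divr_ge0// ltW.
  have hz : `|(f z - f b) / (z - b) - derive_within `[0, 1] f b| < e.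
    apply: hdel.
    - by move: zE rm rm0; rewrite bm; lra.
    - by rewrite -subr_eq0 zE oppr_eq0 gt_eqF.
    - by rewrite zE normrN gtr0_norm// bm; lra.
  have fz : f z - f b <= - (r * (f b - f m)).
    have := hconv m b r mI bI (lt_neq _ _ mb) (r01' r r0 r2).
    have -> : r * m + (1 - r) * b = z by rewrite /z; ring.
    by move: (f z) (f b) (f m) => ? ? ?; lra.
  have q : (f b - f m) / (b - m) <= (f z - f b) / (z - b).
    rewrite zE invrN mulrN -mulNr ler_pdivlMr// mulrCA divfK; last by rewrite bm gt_eqF// divr_gt0.
    lra.
  by move: hz; rewrite ltr_norml => /andP[_ h1]; lra.
apply: le_lt_trans left_le _; apply: lt_le_trans right_ge.
have -> : m - a = (b - a) / 2 by rewrite mE; field.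
have -> : b - m = (b - a) / 2 by rewrite mE; field.
rewrite ltr_pM2r ?invr_gt0 ?divr_gt0//; lra.
Qed.

Lemma continuous_on_stripI (F : R -> R -> R) :
  (forall x0 y0, 0 <= y0 <= 1 -> forall e, 0 < e -> exists2 del, 0 < del &
     forall x y, 0 <= y <= 1 -> `|x - x0| < del -> `|y - y0| < del -> `|F x y - F x0 y0| < e) ->
  continuous_on_strip F.
Proof.
move=> h; apply/subspace_continuousP => -[x0 y0] /=; rewrite /strip /= in_itv/= => y01.
have FF : Filter (within (@strip R) (nbhs (x0, y0))) by exact: within_filter.
apply/(@cvgrPdist_lt _ _ _ _ FF) => e e0.
have [del del0 hdel] := h x0 y0 y01 e e0.
apply/nbhs_ballP; exists del => // -[x y] [/= hx hy]; rewrite /strip /= in_itv/= => hy01.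
by rewrite distrC; apply: hdel => //; rewrite distrC.
Qed.

End derive_within01.

Lemma is_derive_quot {R : realType} (f : R -> R) (x l : R) :
  (f (x + h) - f x) / h @[h --> 0^'] --> l -> is_derive x 1 f l.
Proof.
move=> h.
have h' : (fun h : R => h^-1 *: (f (h *: (1 : R) + x) - f x)) @ 0^' --> l.
  rewrite (_ : (fun _ => _) = fun h => (f (x + h) - f x) / h)//.
  by apply/funext => r; rewrite /GRing.scale/= mulr1 mulrC (addrC r).
apply: DeriveDef; first by apply/cvg_ex; exists l.
exact: cvg_lim h'.
Qed.

Lemma is_derive_quot_cvg {R : realType} (f : R -> R) (x l : R) :
  is_derive x 1 f l -> (f (x + h) - f x) / h @[h --> 0^'] --> l.
Proof.
move=> hf; have hq : (fun h : R => h^-1 *: (f (h *: (1 : R) + x) - f x)) @ 0^' --> l.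
  by have := @ex_derive _ _ _ _ _ _ _ hf; rewrite -(@derive_val _ _ _ _ _ _ _ hf).
rewrite (_ : (fun _ => _) = fun h : R => h^-1 *: (f (h *: (1 : R) + x) - f x))//.
by apply/funext => r; rewrite /GRing.scale/= mulr1 mulrC (addrC r).
Qed.

Lemma derive1_is_derive {R : realType} (f : R -> R) (x l : R) :
  is_derive x 1 f l -> derive1 f x = l.
Proof. by move=> hf; rewrite derive1E; exact: (@derive_val _ _ _ _ _ _ _ hf). Qed.

(** * Differentiation and continuity under the integral *)

Section parametric_integral.
Context {R : realType}.
Variables (TH : R -> R) (B : R).
Hypotheses (cTH : continuous TH) (bTH : forall z, `|TH z| <= B).

Let mTH x : measurable_fun setT (fun z => x - TH z).
Proof.
by apply: measurable_funB; [exact: measurable_cst|exact: continuous_measurable_fun].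
Qed.

Lemma J_quot (phi psi : R -> R) (y h K : R) : measurable_fun setT phi -> measurable_fun setT psi ->
  (forall z, `|phi z| <= K) -> (forall z, `|psi z| <= K) ->
  (J phi y - J psi y) / h = J (fun z => (phi z - psi z) / h) y.
Proof.
move=> mphi mpsi hphi hpsi.
have mI : measurable (`[0, y]%classic : set R) by exact: measurable_itv.
have i1 := @bounded_integrable_itv R true false 0 y K phi mphi hphi.
have i2 := @bounded_integrable_itv R true false 0 y K psi mpsi hpsi.
have b3 z : `|phi z - psi z| <= K + K by rewrite (le_trans (ler_normB _ _))// lerD.
have i3 := @bounded_integrable_itv R true false 0 y (K + K) (fun z => phi z - psi z)
  (measurable_funB mphi mpsi) b3.
rewrite /J -RintegralB// mulrC -RintegralZl//.
by apply: eq_Rintegral => z _; rewrite mulrC.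
Qed.

Lemma lipschitz_bound (v : R -> R) (K x z : R) : 0 <= K ->
  (forall s t, `|v s - v t| <= K * `|s - t|) -> `|v (x - TH z)| <= `|v 0| + K * (`|x| + B).
Proof.
move=> K0 hv; rewrite (_ : v (x - TH z) = v 0 + (v (x - TH z) - v 0)); last by ring.
apply: le_trans (ler_normD _ _) _; rewrite lerD2l; apply: le_trans (hv _ _) _.
by rewrite subr0 ler_wpM2l// (le_trans (ler_normB _ _))// lerD2l.
Qed.

Lemma lipschitz_measurable (v : R -> R) (K x : R) :
  (forall s t, `|v s - v t| <= K * `|s - t|) -> measurable_fun setT (fun z => v (x - TH z)).
Proof.
move=> hv; apply: (measurableT_comp _ (mTH x)).
by apply: continuous_measurable_fun; exact: (@dist_le_continuous R K).
Qed.

(** The difference quotients are bounded by the Lipschitz constant, so dominated convergence along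
    every sequence gives the derivative even if v is not differentiable at one point met by the
    integrand. *)
Lemma J_derive (v dv : R -> R) (K x y zs : R) : 0 <= K -> measurable_fun setT dv ->
  (forall s t, `|v s - v t| <= K * `|s - t|) ->
  (forall z, 0 <= z <= y -> z != zs -> is_derive (x - TH z) 1 v (dv (x - TH z))) ->
  is_derive x 1 (fun x => J (fun z => v (x - TH z)) y) (J (fun z => dv (x - TH z)) y).
Proof.
move=> K0 mdv hv hd; apply: is_derive_quot.
apply/cvgr_dnbhsP => s [s0 cs].
have mv x' := lipschitz_measurable x' hv.
pose M n := `|v 0| + K * (`|x + s n| + `|x| + B).
have e n : (J (fun z => v (x + s n - TH z)) y - J (fun z => v (x - TH z)) y) / s n =
    J (fun z => (v (x + s n - TH z) - v (x - TH z)) / s n) y.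
  apply: (@J_quot _ _ _ _ (M n)) => // z; apply: le_trans (lipschitz_bound _ _ K0 hv) _;
    by rewrite lerD2l ler_wpM2l// lerD2r ?lerDl ?lerDr.
under eq_cvg do rewrite e.
apply: (@J_cvg _ _ _ y K zs).
- move=> n; apply: measurable_funM; last exact: measurable_cst.
  by apply: measurable_funB.
- exact: (measurableT_comp mdv (mTH x)).
- move=> n z; rewrite normrM normfV ler_pdivrMr ?normr_gt0//.
  apply: le_trans (hv _ _) _; rewrite (_ : x + s n - TH z - (x - TH z) = s n)//; ring.
- move=> z hz zzs; have := is_derive_quot_cvg (hd z hz zzs).
  move=> /cvgr_dnbhsP /(_ s (conj s0 cs)).
  rewrite (_ : (fun n => _) = fun n => (v (x + s n - TH z) - v (x - TH z)) / s n)//.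
  by apply/funext => n; rewrite addrAC.
Qed.

Lemma J_continuous_param (v : R -> R) (K x0 y zs : R) : measurable_fun setT v ->
  (forall s, `|v s| <= K) ->
  (forall z, 0 <= z <= y -> z != zs -> {for (x0 - TH z), continuous v}) ->
  forall e, 0 < e -> exists2 del, 0 < del & forall x, `|x - x0| < del ->
    `|J (fun z => v (x - TH z)) y - J (fun z => v (x0 - TH z)) y| < e.
Proof.
move=> mv hv hc e e0.
have h : J (fun z => v (x - TH z)) y @[x --> x0^'] --> J (fun z => v (x0 - TH z)) y.
  apply/cvgr_dnbhsP => s [s0 cs].
  apply: (@J_cvg _ (fun n z => v (s n - TH z)) _ y K zs) => //.
  - by move=> n; exact: (measurableT_comp mv (mTH _)).
  - exact: (measurableT_comp mv (mTH _)).
  - move=> z hz zzs.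
    apply: (@cvg_comp _ _ _ (fun n => s n - TH z) v _ (nbhs (x0 - TH z))); last exact: hc.
    by apply: (@cvgB _ _ _ _ _ s (cst (TH z))) => //; exact: cvg_cst.
have FF : Filter x0^' by exact: within_filter.
have hn := (@cvgrPdist_lt _ _ _ _ FF _ _).1 h e e0.
have [del del0 hdel] := (nbhs_ballP _ _).1 hn.
exists del => // x hx; have [->|xx0] := eqVneq x x0; first by rewrite subrr normr0.
by rewrite distrC; apply: hdel => //; rewrite /ball/= distrC.
Qed.

End parametric_integral.

Lemma norm_between {R : realType} (p q r : R) : p <= r -> r <= q -> `|r| <= `|p| + `|q|.
Proof.
move=> pr rq; have := ler_norm q; have := ler_norm (- p); rewrite normrN ler_norml.
by have := normr_ge0 p; have := normr_ge0 q; lra.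
Qed.

Lemma sub_subr {R : realType} (p q r s : R) : p - q - (r - s) = (p - r) - (q - s).
Proof. by ring. Qed.

(** * Regularity and growth of the integrated value *)

Section regularity_of_F.
Context {R : realType}.
Variables (u du d2u : R -> R) (a L rho c : R) (f : R -> R).
Hypotheses (hu : slope01 u) (hdu : forall x : R, is_derive x 1 u (du x)).
Hypotheses (hdu01 : forall x, 0 <= du x <= 1) (L0 : 0 < L).
Hypothesis (hduL : forall x y, `|du x - du y| <= L * `|x - y|).
Hypothesis (hd2 : forall x : R, x != a -> is_derive x 1 du (d2u x)).
Hypotheses (hd2L : forall x, `|d2u x| <= L) (md2 : measurable_fun setT d2u).
Hypothesis (cd2 : forall x, x != a -> {for x, continuous d2u}).
Hypotheses (rho0 : 0 < rho) (hf : case_I f).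

Local Notation df := (derive_within `[0, 1] f).
Local Notation th := (theta rho c f).

(** Projection to [0, 1]. Composing theta with it gives a bounded continuous function on the whole
    line, as the integrals with a parameter require. *)
Let clamp (z : R) : R := Num.max 0 (Num.min 1 z).

Let clamp01 z : 0 <= clamp z <= 1.
Proof. by rewrite /clamp le_max lexx /= ge_max ler01 ge_min lexx. Qed.

Let clampE z : 0 <= z <= 1 -> clamp z = z.
Proof. by move=> /andP[z0 z1]; rewrite /clamp min_r// max_r. Qed.

Let clamp_dist x y : `|clamp x - clamp y| <= `|x - y|.
Proof.
have := ler_norm (x - y); have := ler_norm (y - x); rewrite distrC ler_norml.
by rewrite /clamp; case: (leP 1 x) => hx; case: (leP 1 y) => hy; rewrite ?(max_r ler01);
  try (case: (leP 0 x) => hx'); try (case: (leP 0 y) => hy'); lra.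
Qed.

Let derivable_f y : 0 <= y <= 1 -> derivable_within `[0, 1] f y.
Proof. by case: hf => _ _ _ _ [h _] y01; apply: h; rewrite /= in_itv. Qed.

Let df_near y e : 0 <= y <= 1 -> 0 < e -> exists2 del, 0 < del &
  forall z, 0 <= z <= 1 -> `|z - y| < del -> `|df z - df y| < e.
Proof.
move=> y01 e0; have [_ _ _ _ [_ hc]] := hf.
have yI : (`[0, 1]%classic : set R) y by rewrite /= in_itv.
have FF : Filter (within (`[0, 1]%classic : set R) (nbhs y)) by exact: within_filter.
have h : df @ within (`[0, 1]%classic : set R) (nbhs y) --> df y.
  by have /subspace_continuousP := hc; exact.
have hn := (@cvgrPdist_lt _ _ _ _ FF _ _).1 h e e0.
have [del del0 hdel] := (nbhs_ballP _ _).1 hn.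
exists del => // z z01 hz; rewrite distrC; apply: hdel; first by rewrite /ball/= distrC.
by rewrite /= in_itv.
Qed.

Let df_lt x y : 0 <= x -> x < y -> y <= 1 -> df x < df y.
Proof.
have [_ _ _ hconv _] := hf => x0 xy y1.
by apply: derive_within_lt => //; apply: derivable_f; lra.
Qed.

Let Bf := `|df 0| + `|df 1|.

Let df_bound y : 0 <= y <= 1 -> `|df y| <= Bf.
Proof.
move=> /andP[y0 y1].
have le0 : df 0 <= df y.
  by move: y0; rewrite le_eqVlt => /predU1P[<-//|y0]; apply/ltW/df_lt.
have le1 : df y <= df 1.
  by move: y1; rewrite le_eqVlt => /predU1P[->//|y1]; apply/ltW/df_lt.
exact: norm_between.
Qed.

Let TH z := th (clamp z).

Let THE z : 0 <= z <= 1 -> TH z = th z. Proof. by move=> z01; rewrite /TH clampE. Qed.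

Let th_near y e : 0 <= y <= 1 -> 0 < e -> exists2 del, 0 < del &
  forall z, 0 <= z <= 1 -> `|z - y| < del -> `|th z - th y| < e.
Proof.
move=> y01 e0; have [del del0 h] := df_near y01 (mulr_gt0 rho0 e0).
exists del => // z z01 zd; have := h z z01 zd.
rewrite /theta (_ : c - df z / rho - (c - df y / rho) = - ((df z - df y) / rho)); last by ring.
by rewrite normrN normrM normfV (gtr0_norm rho0) ltr_pdivrMr// mulrC.
Qed.

Let cTH : continuous TH.
Proof.
move=> y; apply/cvgrPdist_lt => e e0.
have [del del0 h] := th_near (clamp01 y) e0.
apply/nbhs_ballP; exists del => // z; rewrite /ball/= => hz; rewrite distrC; apply: h => //.
by apply: le_lt_trans (clamp_dist _ _) _; rewrite distrC.
Qed.

Let B := `|c| + Bf / rho.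

Let bTH z : `|TH z| <= B.
Proof.
apply: le_trans (ler_normB _ _) _; rewrite lerD2l normrM normfV (gtr0_norm rho0).
by rewrite ler_wpM2r ?invr_ge0 ?(ltW rho0)// df_bound.
Qed.

(** Equal values of theta mean equal values of f', which is strictly increasing. If no point is
    exceptional, any [zs] will do. *)
Let TH_inj x : exists zs, forall z, 0 <= z <= 1 -> z != zs -> x - TH z != a.
Proof.
have [[z0 [z01 h0]]|h] := pselect (exists z0, 0 <= z0 <= 1 /\ x - TH z0 = a); last first.
  by exists 0 => z z01 _; apply/eqP => e; apply: h; exists z.
exists z0 => z zI zz0; apply/eqP => e.
have : TH z = TH z0 by move: e; rewrite -h0 => /addrI /oppr_inj.
rewrite !THE// /theta => /addrI /oppr_inj /(mulIf (invr_neq0 (lt0r_neq0 rho0))) E.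
case/andP: zI => a0 a1; case/andP: z01 => b0 b1.
move: zz0; rewrite neq_lt => /orP[] lt; first by have := df_lt a0 lt b1; rewrite E ltxx.
by have := df_lt b0 lt a1; rewrite E ltxx.
Qed.

Let u_dist s t : `|u s - u t| <= 1 * `|s - t|.
Proof. by rewrite mul1r; exact: slope01_dist. Qed.

Let G0 x y := J (fun z => u (x - TH z)) y.
Let G1 x y := J (fun z => du (x - TH z)) y.
Let G2 x y := J (fun z => d2u (x - TH z)) y.

Let mdu : measurable_fun setT du.
Proof. by apply: continuous_measurable_fun; exact: (@dist_le_continuous R L). Qed.

Let mu0 x : measurable_fun setT (fun z => u (x - TH z)).
Proof. exact: (lipschitz_measurable cTH x u_dist). Qed.
Let mu1 x : measurable_fun setT (fun z => du (x - TH z)).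
Proof. exact: (lipschitz_measurable cTH x hduL). Qed.
Let mu2 x : measurable_fun setT (fun z => d2u (x - TH z)).
Proof.
apply: (measurableT_comp md2); apply: measurable_funB; first exact: measurable_cst.
exact: continuous_measurable_fun.
Qed.

Let bu x z : `|u (x - TH z)| <= `|u 0| + (`|x| + B).
Proof. by have := lipschitz_bound bTH x z ler01 u_dist; rewrite mul1r. Qed.

Let bdu x : `|du x| <= 1.
Proof. by have /andP[d0 d1] := hdu01 x; rewrite ger0_norm. Qed.

Let G0_derive (x : R) y : is_derive x 1 (G0^~ y) (G1 x y).
Proof.
by apply: (J_derive cTH bTH (zs := 0) ler01 mdu u_dist) => z _ _; exact: hdu.
Qed.

Let G1_derive (x : R) y : 0 <= y <= 1 -> is_derive x 1 (G1^~ y) (G2 x y).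
Proof.
move=> /andP[y0 y1]; have [zs hzs] := TH_inj x.
apply: (J_derive cTH bTH (zs := zs) (ltW L0) md2 hduL) => z /andP[z0 zy] zzs.
by apply: hd2; apply: hzs => //; rewrite z0 (le_trans zy).
Qed.

Lemma value_integral x y : 0 <= y <= 1 ->
  (\int[lebesgue_measure]_(z in `[0%R, y]) (u (x - th z))%:E = (G0 x y)%:E)%E.
Proof.
move=> /andP[y0 y1].
have mI : measurable (`[0, y]%classic : set R) by exact: measurable_itv.
have i0 := @bounded_integrable_itv R true false 0 y _ (fun z => u (x - TH z)) (mu0 x) (bu x).
have E := @EFin_Rintegral _ _ _ (@lebesgue_measure R) _ _ mI i0.
transitivity (\int[@lebesgue_measure R]_(z in `[0%R, y]) (EFin \o (fun z => u (x - TH z))) z)%E.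
  apply: eq_integral => z; rewrite inE/= in_itv/= => /andP[z0 zy].
  by rewrite THE// z0 (le_trans zy).
by rewrite -E.
Qed.

Variable F : R -> R -> R.
Hypothesis hF : forall x y, 0 <= y <= 1 -> F x y = G0 x y - f y / rho.

Let F_derive (x : R) y : 0 <= y <= 1 -> is_derive x 1 (F^~ y) (G1 x y).
Proof.
move=> y01; rewrite (_ : F^~ y = fun x => G0 x y - f y / rho); last first.
  by apply/funext => x'; exact: hF.
rewrite -[G1 x y]subr0; apply: is_deriveB; exact: G0_derive.
Qed.

Let dxE x y : 0 <= y <= 1 -> dx F x y = G1 x y.
Proof. by move=> y01; apply: derive1_is_derive; exact: F_derive. Qed.

Let dxF_derive (x : R) y : 0 <= y <= 1 -> is_derive x 1 (dx F ^~ y) (G2 x y).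
Proof.
move=> y01; rewrite (_ : dx F ^~ y = G1 ^~ y); first exact: G1_derive.
by apply/funext => x'; exact: dxE.
Qed.

Let dxxE x y : 0 <= y <= 1 -> dxx F x y = G2 x y.
Proof. by move=> y01; apply: derive1_is_derive; exact: dxF_derive. Qed.

Let phi_near x y e : 0 <= y <= 1 -> 0 < e -> exists2 del, 0 < del &
  forall z, 0 <= z <= 1 -> `|z - y| < del -> `|u (x - TH z) - u (x - TH y)| < e.
Proof.
move=> y01 e0; have [del del0 h] := th_near y01 e0.
exists del => // z z01 zd; apply: le_lt_trans (u_dist _ _) _.
rewrite mul1r (_ : x - TH z - (x - TH y) = - (TH z - TH y)); last by ring.
by rewrite normrN !THE//; exact: h.
Qed.

(** Near y the integrand differs little from its value at y, so the quotient of the integral tends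
    to that value, on either side of y; the quotient of f is handled by its own derivative. *)
Let F_quot x y : 0 <= y <= 1 -> quot_within `[0, 1] (F x) y --> u (x - th y) - df y / rho.
Proof.
move=> y01; apply/quot_withinP => e e0.
have e2 : 0 < e / 2 by rewrite divr_gt0.
have [d1 d10 h1] := phi_near x y01 e2.
have [d2 d20 h2] := (quot_withinP _ _ _).1 (derivable_f y01) _ (mulr_gt0 rho0 e2).
exists (Num.min d1 d2); first by rewrite lt_min d10.
move=> z z01 zy; rewrite lt_min => /andP[zd1 zd2].
have hq : `|(f z - f y) / (z - y) - df y| < rho * (e / 2) by exact: h2.
have zy0 : z - y != 0 by rewrite subr_eq0.
have Jq : `|(G0 x z - G0 x y) / (z - y) - u (x - TH y)| <= e / 2.
  rewrite (_ : _ - _ = (G0 x z - G0 x y - u (x - TH y) * (z - y)) / (z - y)); last by field.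
  rewrite normrM normfV ler_pdivrMr ?normr_gt0//.
  have bd : exists C, forall s, `|u (x - TH s)| <= C by eexists; exact: bu.
  case/andP: y01 => y0 y1; case/andP: z01 => z0 z1.
  case: (leP y z) => yz.
    rewrite (ger0_norm (_ : 0 <= z - y)) ?subr_ge0//.
    apply: J_increment => // s /andP[ys sz]; apply/ltW/h1.
      by rewrite (le_trans sz)// (le_trans y0)// ltW.
    move: zd1; rewrite !gtr0_norm ?subr_gt0 ?(lt_le_trans ys)//; lra.
  have zy' := ltW yz.
  have zyn : z - y <= 0 by rewrite subr_le0.
  rewrite (ler0_norm zyn) (opprB z y).
  rewrite (_ : G0 x z - G0 x y - _ = - (G0 x y - G0 x z - u (x - TH y) * (y - z))); last by ring.
  rewrite normrN; apply: J_increment => // s /andP[zs sy]; apply/ltW/h1.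
    by rewrite (le_trans sy)// (le_trans z0)// ltW.
  have sy0 : s - y <= 0 by rewrite subr_le0.
  by move: zd1; rewrite (ler0_norm zyn) (ler0_norm sy0); lra.
rewrite !hF// -(THE y01).
rewrite (_ : _ - _ = ((G0 x z - G0 x y) / (z - y) - u (x - TH y)) -
   ((f z - f y) / (z - y) - df y) / rho); last first.
  by field; rewrite zy0 gt_eqF.
apply: le_lt_trans (ler_normB _ _) _.
have : `|((f z - f y) / (z - y) - df y) / rho| < e / 2.
  by rewrite normrM normfV (gtr0_norm rho0) ltr_pdivrMr// (mulrC (e / 2)).
lra.
Qed.

Let dyF x y : 0 <= y <= 1 ->
  derivable_within `[0, 1] (F x) y /\ dy F x y = u (x - th y) - df y / rho.
Proof. by move=> y01; apply: derive_withinE => //; exact: F_quot. Qed.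

Let F_dist_x x x0 y : 0 <= y <= 1 -> `|G0 x y - G0 x0 y| <= `|x - x0|.
Proof.
move=> /andP[y0 y1]; apply: J_diff => //; [by eexists; exact: bu|by eexists; exact: bu|].
by move=> z; apply: le_trans (u_dist _ _) _; rewrite mul1r sub_subr subrr subr0.
Qed.

Let G1_dist_x x x0 y : 0 <= y <= 1 -> `|G1 x y - G1 x0 y| <= L * `|x - x0|.
Proof.
move=> /andP[y0 y1]; apply: J_diff => //; [by eexists => z; exact: bdu|by eexists => z; exact: bdu|].
by move=> z; apply: le_trans (hduL _ _) _; rewrite sub_subr subrr subr0.
Qed.

(** Joint continuity of F, dx F and dxx F is reduced to one variable at a time: the integrands are
    bounded near the point, hence the integrals are Lipschitz in y. *)
Lemma F_C21 : C21 F.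
Proof.
split=> [x y|].
  rewrite in_itv/= => y01; split.
  - exact: (@ex_derive _ _ _ _ _ _ _ (F_derive x y01)).
  - exact: (@ex_derive _ _ _ _ _ _ _ (dxF_derive x y01)).
  - by case: (dyF x y01).
split; apply: continuous_on_stripI => x0 y0 y001 e e0.
- have e3 : 0 < e / 3 by rewrite divr_gt0.
  have [d1 d10 h1] := derivable_within_continuous01 (derivable_f y001) (mulr_gt0 rho0 e3).
  pose K := `|u 0| + (`|x0| + B).
  have K1 : 0 < K + 1 by rewrite ltr_wpDl// (le_trans _ (bu x0 0)).
  exists (Num.min d1 (Num.min (e / 3) (e / 3 / (K + 1)))).
    by rewrite !lt_min d10 e3 divr_gt0.
  move=> x y y01 hx; rewrite !lt_min => /andP[hy1 /andP[_ hy2]].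
  move: hx; rewrite !lt_min => /andP[_ /andP[hx _]].
  rewrite !hF//.
  rewrite (_ : _ - _ = (G0 x y - G0 x0 y) + (G0 x0 y - G0 x0 y0) - (f y - f y0) / rho); last by ring.
  have t1 := F_dist_x x x0 y01.
  have t2 : `|G0 x0 y - G0 x0 y0| < e / 3.
    case/andP: y01 => a1 _; case/andP: y001 => b1 _.
    apply: le_lt_trans (J_dist b1 a1 (mu0 x0) (bu x0)) _.
    apply: (@le_lt_trans _ _ ((K + 1) * `|y - y0|)); first by rewrite ler_wpM2r// lerDl.
    by rewrite mulrC -ltr_pdivlMr.
  have t3 : `|(f y - f y0) / rho| < e / 3.
    by rewrite normrM normfV (gtr0_norm rho0) ltr_pdivrMr// mulrC; exact: h1.
  apply: le_lt_trans (ler_normB _ _) _.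
  have := ler_normD (G0 x y - G0 x0 y) (G0 x0 y - G0 x0 y0); lra.
- have e2 : 0 < e / 2 by rewrite divr_gt0.
  exists (Num.min (e / 2) (e / 2 / L)); first by rewrite lt_min e2 divr_gt0.
  move=> x y y01; rewrite !lt_min => /andP[_ hx] /andP[hy _].
  rewrite !dxE// (_ : _ - _ = (G1 x y - G1 x0 y) + (G1 x0 y - G1 x0 y0)); last by ring.
  have t1 : `|G1 x y - G1 x0 y| < e / 2.
    by apply: le_lt_trans (G1_dist_x _ _ y01) _; rewrite mulrC -ltr_pdivlMr.
  have t2 : `|G1 x0 y - G1 x0 y0| < e / 2.
    case/andP: y01 => a1 _; case/andP: y001 => b1 _.
    by apply: le_lt_trans (J_dist b1 a1 (mu1 x0) (fun z => bdu _)) _; rewrite mul1r.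
  by apply: le_lt_trans (ler_normD _ _) _; lra.
- have e2 : 0 < e / 2 by rewrite divr_gt0.
  have [zs hzs] := TH_inj x0.
  have le_y0 z : 0 <= z <= y0 -> 0 <= z <= 1 by case/andP: y001; lra.
  have [d1 d10 h1] := J_continuous_param cTH md2 hd2L (x0 := x0) (y := y0) (zs := zs)
    (fun z hz zz => cd2 (hzs z (le_y0 z hz) zz)) e2.
  exists (Num.min d1 (e / 2 / L)); first by rewrite lt_min d10 divr_gt0.
  move=> x y y01; rewrite !lt_min => /andP[hx _] /andP[_ hy].
  (* In x, continuity of G2 is obtained only for the fixed y0. The variation in y is therefore
     removed first, at the moving x, which works because the bound L on the integrand does not
     depend on x. *)
  rewrite !dxxE// (_ : _ - _ = (G2 x y - G2 x y0) + (G2 x y0 - G2 x0 y0)); last by ring.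
  have t1 : `|G2 x y - G2 x y0| < e / 2.
    case/andP: y01 => a1 _; case/andP: y001 => b1 _.
    apply: le_lt_trans (J_dist b1 a1 (mu2 x) (fun z => hd2L _)) _.
    by rewrite mulrC -ltr_pdivlMr.
  by apply: le_lt_trans (ler_normD _ _) _; have := h1 x hx; rewrite /G2 in t1 *; lra.
- have e3 : 0 < e / 3 by rewrite divr_gt0.
  have [d1 d10 h1] := df_near y001 (mulr_gt0 rho0 e3).
  have [d2 d20 h2] := th_near y001 e3.
  exists (Num.min (Num.min d1 d2) (e / 3)); first by rewrite !lt_min d10 d20.
  move=> x y y01; rewrite !lt_min => /andP[_ hx] /andP[/andP[hy1 hy2] _].
  have [_ ->] := dyF x y01; have [_ ->] := dyF x0 y001.
  rewrite sub_subr -mulrBl.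
  have t1 : `|u (x - th y) - u (x0 - th y0)| <= `|x - x0| + `|th y - th y0|.
    apply: le_trans (u_dist _ _) _; rewrite mul1r.
    rewrite sub_subr; exact: ler_normB.
  have t2 := h2 y y01 hy2.
  have t3 : `|(df y - df y0) / rho| < e / 3.
    by rewrite normrM normfV (gtr0_norm rho0) ltr_pdivrMr// mulrC; exact: h1.
  by apply: le_lt_trans (ler_normB _ _) _; lra.
Qed.

Lemma F_bounds : exists C kappa : R, [/\ 0 < C, 0 < kappa &
  forall x y, 0 <= y <= 1 ->
    `|F x y| + `|dy F x y| <= C * (1 + `|x|) /\ `|dx F x y| + `|dxx F x y| <= kappa].
Proof.
have [f0 fmono _ _ _] := hf.
have B0 : 0 <= B by rewrite (le_trans _ (bTH 0)).
have Bf0 : 0 <= Bf by rewrite addr_ge0.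
(* |F| and |dy F| are each at most |u 0| + |x| + B plus a term of f; the summand 2 pays for 2 |x|,
   and the rest bounds the constants. *)
pose C := 2 * (`|u 0| + B) + 2 + (f 1 / rho + Bf / rho).
have q1 : 0 <= f 1 / rho by rewrite divr_ge0// ltW.
have q2 : 0 <= Bf / rho by rewrite divr_ge0// ltW.
have u00 := normr_ge0 (u 0).
exists C, (1 + L); split; [by rewrite /C; lra|by rewrite addr_gt0|].
move=> x y y01; case/andP: (y01) => y0 y1; split; last first.
  rewrite dxE// dxxE//; apply: lerD; first exact: (J_bound y0 y1 (mu1 x) (fun z => bdu _)).
  exact: (J_bound y0 y1 (mu2 x) (fun z => hd2L _)).
have [_ ->] := dyF x y01; rewrite hF//.
have t1 := J_bound y0 y1 (mu0 x) (bu x); rewrite -/(G0 x y) in t1.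
have t2 : `|f y / rho| <= f 1 / rho.
  rewrite normrM normfV (gtr0_norm rho0) (ger0_norm (f0 y)) ler_wpM2r ?invr_ge0 ?(ltW rho0)//.
  exact: fmono.
have t3 := bu x y; rewrite (THE y01) in t3.
have t4 : `|df y / rho| <= Bf / rho.
  by rewrite normrM normfV (gtr0_norm rho0) ler_wpM2r ?invr_ge0 ?(ltW rho0)// df_bound.
have := ler_normB (G0 x y) (f y / rho); have := ler_normB (u (x - th y)) (df y / rho).
have x0 := normr_ge0 x.
have : 0 <= (C - 2) * `|x| by rewrite mulr_ge0// /C; lra.
by rewrite mulrDr mulr1 mulrBl /C; lra.
Qed.

End regularity_of_F.

Lemma is_derive_lipschitz {R : realType} (v : R -> R) (x l K : R) :
  (forall s t, `|v s - v t| <= K * `|s - t|) -> is_derive x 1 v l -> `|l| <= K.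
Proof.
move=> hv hd; apply/ler_addgt0Pr => e e0.
have FF : Filter (0 : R)^' by exact: within_filter.
have hn := (@cvgrPdist_lt _ _ _ _ FF _ _).1 (is_derive_quot_cvg hd) e e0.
have [del del0 hdel] := (nbhs_ballP _ _).1 hn.
have d2 : 0 < del / 2 by rewrite divr_gt0.
have := hdel (del / 2); rewrite /ball/= sub0r normrN (gtr0_norm d2) (gt_eqF d2).
have dd : del / 2 < del by rewrite ltr_pdivrMr// ltr_pMr// ltr1n.
move=> /(_ dd isT); set q := _ / (del / 2) => hq.
have qK : `|q| <= K.
  rewrite normrM normfV (gtr0_norm d2) ler_pdivrMr//.
  by apply: le_trans (hv _ _) _; rewrite addrC addKr gtr0_norm.
rewrite (_ : l = (l - q) + q); last by rewrite subrK.
apply: le_trans (ler_normD _ _) _; rewrite addrC; exact: lerD (ltW hq).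
Qed.

(** * The second derivative of the value functions *)

Section value_second_derivative.
Context {R : realType}.
Variables (lam sg : 'I_2 -> R) (rho : R) (U dU : 'I_2 -> R -> R) (thr : 'I_2 -> R).
Hypotheses (lam0 : forall i, 0 < lam i) (sg0 : forall i, 0 < sg i) (rho0 : 0 < rho).
Hypothesis VS : value_system lam sg rho U dU thr.
Variables i j : 'I_2.
Hypothesis ij : i != j.

(** A version of U_i'' defined everywhere. At the threshold, where U_i'' may not exist, the value 0
    is a convention. *)
Definition vs_d2U (z : R) : R :=
  if z < thr i then 2 / sg i ^+ 2 * vs_gen lam rho U i j z else 0.

Let gen_continuous : continuous (fun z => 2 / sg i ^+ 2 * vs_gen lam rho U i j z).
Proof.
apply: (@dist_le_continuous R (2 / sg i ^+ 2 * (rho + lam i + lam i))) => x y.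
have s0 : 0 < 2 / sg i ^+ 2 by rewrite divr_gt0// exprn_gt0.
rewrite -mulrBr normrM (gtr0_norm s0) -(mulrA _ (rho + lam i + lam i)) ler_pM2l//.
exact: (vs_gen_lip lam0 rho0 VS).
Qed.

Lemma vs_d2U_measurable : measurable_fun setT vs_d2U.
Proof.
rewrite (_ : vs_d2U = fun z => 2 / sg i ^+ 2 * vs_gen lam rho U i j z * \1_(`]-oo, thr i[%classic : set R) z).
  apply: measurable_funM; first exact: continuous_measurable_fun.
  by apply: measurable_indic; exact: measurable_itv.
apply/funext => z; rewrite /vs_d2U indicE mem_setE in_itv/=.
by case: ifP; rewrite ?mulr1 ?mulr0.
Qed.

Lemma vs_d2U_continuous x : x != thr i -> {for x, continuous vs_d2U}.
Proof.
rewrite neq_lt => xt; suff h : vs_d2U z @[z --> x] --> vs_d2U x by exact: h.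
case/orP: xt => xt.
  have -> : vs_d2U x = 2 / sg i ^+ 2 * vs_gen lam rho U i j x by rewrite /vs_d2U xt.
  apply: cvg_trans (@gen_continuous x); apply: near_eq_cvg.
  by near=> z; rewrite /vs_d2U ifT//; near: z; exact: lt_nbhsl.
have -> : vs_d2U x = 0 by rewrite /vs_d2U ltNge (ltW xt).
have c0 : (cst 0 : R -> R) @ x --> (0 : R) by exact: cvg_cst.
apply: cvg_trans c0; apply: near_eq_cvg; near=> z.
have tz : thr i < z by near: z; exact: lt_nbhsr.
by rewrite /vs_d2U ltNge (ltW tz).
Unshelve. all: by end_near. Qed.

Lemma vs_d2U_bound L : (forall x y, `|dU i x - dU i y| <= L * `|x - y|) -> 0 <= L ->
  forall x, `|vs_d2U x| <= L.
Proof.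
move=> hL L0 x; rewrite /vs_d2U; case: ifPn => xt; last by rewrite normr0.
exact: is_derive_lipschitz hL (vs_ode VS ij xt).
Qed.

End value_second_derivative.

Theorem proposition4p1 (R : realType) (d : measure_display)
  (T : measurableType d) (P : probability T R)
  (lambda1 lambda2 sigma1 sigma2 rho c : R)
  (W : R -> T -> R) (eps : R -> T -> 'I_2) (X : R -> R -> T -> R)
  (f : R -> R)
  (hlambda1 : 0 < lambda1) (hlambda2 : 0 < lambda2)
  (hsigma1 : 0 < sigma1) (hsigma12 : sigma1 <= sigma2)
  (hrho : 0 < rho) (hc : 0 < c)
  (hmodel : regime_model P lambda1 lambda2 sigma1 sigma2 W eps X)
  (hf : case_I f)
  (i : 'I_2) (hi : (0 < P [set w | eps 0%R w = i])%E) :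
  (forall x y, y \in `[0, 1] -> bigF P rho c f W eps X x y i \is a fin_num) /\
  let F := fun x y => fine (bigF P rho c f W eps X x y i) in
  C21 F /\
  exists C kappa : R, [/\ 0 < C, 0 < kappa &
    forall x y, y \in `[0, 1] ->
      `|F x y| + `|dy F x y| <= C * (1 + `|x|) /\
      `|dx F x y| + `|dxx F x y| <= kappa].
Proof.
have hsigma2 : 0 < sigma2 by exact: lt_le_trans hsigma12.
have lam0 k : 0 < by_regime lambda1 lambda2 k by exact: by_regime_gt0.
have sg0 k : 0 < by_regime sigma1 sigma2 k by exact: by_regime_gt0.
have [U [dU [thr VS]]] := value_system_exists lam0 sg0 hrho.
have valE x y := value_eq c f x y hlambda1 hlambda2 hsigma1 hsigma2 hrho hmodel VS hi.
have [j ij] : exists j, i != j.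
  by have [->|->] := I2_cases i; [exists ord_max|exists ord0].
have [L L0 hL] := vs_lip VS.
have hdu x : 0 <= dU i x <= 1 by exact: vs_derive01 VS i x.
have hd2 (x : R) : x != thr i ->
    is_derive x 1 (dU i) (vs_d2U (by_regime lambda1 lambda2) (by_regime sigma1 sigma2) rho U thr i j x).
  by move=> xt; case: (vs_second VS ij xt).
have d2L := vs_d2U_bound VS ij (hL i) (ltW L0).
have md2 := vs_d2U_measurable lam0 sg0 hrho VS i j.
have cd2 x := @vs_d2U_continuous _ _ _ _ _ _ _ lam0 sg0 hrho VS i j x.
(* The minimum and maximum are the projection to [0, 1] used in [F_C21]; for y in [0, 1] the
   integral only sees theta itself. *)
have intE x y : 0 <= y <= 1 -> bigF P rho c f W eps X x y i =
    (J (fun z => U i (x - theta rho c f (Num.max 0 (Num.min 1 z)))) y - f y / rho)%:E.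
  move=> y01; rewrite EFinB /bigF; congr (_ - _)%E.
  rewrite -(value_integral c (vs_slope VS i) hrho hf x y01).
  by apply: eq_integral => z _; exact: valE.
have FE x y : 0 <= y <= 1 -> fine (bigF P rho c f W eps X x y i) =
    J (fun z => U i (x - theta rho c f (Num.max 0 (Num.min 1 z)))) y - f y / rho.
  by move=> /(intE x) ->.
split=> [x y|F]; first by rewrite in_itv/= => /(intE x) ->.
have cF := F_C21 (vs_slope VS i) (vs_derive VS i) hdu L0 (hL i) hd2 d2L md2 cd2 hrho hf FE.
split; first exact: cF.
have [C [kappa [C0 k0 hb]]] :=
  F_bounds (vs_slope VS i) (vs_derive VS i) hdu L0 (hL i) hd2 d2L md2 hrho hf FE.
by exists C, kappa; split => // x y; rewrite in_itv/= => y01; exact: hb.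
Qed.
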